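(* Let $H$, $\ell$, $\rho^0$ satisfy the standing assumptions listed in the context, and assume in addition that there are $\kappa>0$, $L_0>0$ with $|\dot\ell(t)|\le L_0e^{-\kappa t}$ for all $t\ge0$. Let $\rho$ be a solution of the constrained Fokker-Planck equation $$\partial_t\rho=\partial_x\big(\partial_x\rho+(H'-\sigma(t))\rho\big),\quad \rho(0,\cdot)=\rho^0,\quad \int_{\mathbb{R}} x\,\rho(t,x)\,dx=\ell(t),\quad \sigma(t)=\int_{\mathbb{R}} H'(x)\rho(t,x)\,dx+\dot\ell(t).$$ Set $\sigma^*:=\lambda(\ell^* )$, $\tau:=C_{\mathrm{LSI},M}^{-1}$ with $M=\|\sigma\|_{L^\infty(\mathbb{R}_+)}$ and $C_{\ell,\sigma}:=\|\lambda(\ell(\cdot))\|_{L^\infty(\mathbb{R}_+)}+\|\sigma\|_{L^\infty(\mathbb{R}_+)}$. Then for all $t\ge0$ $$\mathcal{H}(\rho(t)|\gamma_{\sigma^*})\le e^{-\tau t}\mathcal{F}(\rho^0)+L_0\,C_{\ell,\sigma}\,\frac{e^{-\tau t}-e^{-\kappa t}}{\kappa-\tau}+\frac{C_{\mathrm{Var}}L_0^2}{2c_{\mathrm{Var}}^2\kappa^2}\,e^{-2\kappa t}$$ (the quotient being read as $te^{-\kappa t}$ if $\kappa=\tau$), as well as $$\big|\mathcal{F}(\rho(t))-\mathcal{F}(\gamma_{\sigma^*})-\mathcal{H}(\rho(t)|\gamma_{\sigma^*})\big|\le\frac{|\sigma^*|L_0}{\kappa}\,e^{-\kappa t}.$$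
   Context: Standing assumptions. (a) $H\in C^3(\mathbb{R};[0,\infty))$, there are constants $c_{H,\pm}>0$ with $\liminf_{x\to\pm\infty}H''(x)=c_{H,\pm}$ and $\lim_{x\to\pm\infty}H'''(x)=0$, and for some $C<\infty$ and all $x$: $H(x)\le C(1+x^2)$, $|H'(x)|\le C(1+|x|)$, $|H''(x)|\le C$, $|H'''(x)|\le C/(1+|x|)$. (b) $\ell\in W^{1,\infty}(\mathbb{R}_+;\mathbb{R})$, $\lim_{t\to\infty}\ell(t)=\ell^*\in\mathbb{R}$, $\dot\ell\in L^1(\mathbb{R}_+)$. (c) $\rho^0\in\mathcal{P}_2(\mathbb{R})$, $\int x\rho^0dx=\ell(0)$, and $\mathcal{F}(\rho^0)<\infty$. $\mathcal{P}_2(\mathbb{R})$: absolutely continuous probability measures on $\mathbb{R}$ (identified with densities) with finite second moment. $\mathcal{M}^{\ell}=\{\rho\in\mathcal{P}_2(\mathbb{R}):\int x\rho\,dx=\ell\}$. $M_1(\rho)=\int x\rho\,dx$. Free energy $\mathcal{F}(\rho)=\int\rho\log\rho\,dx+\int H\rho\,dx+\log Z_0$, $Z_0=\int e^{-H}dx$. For $\sigma\in\mathbb{R}$, $\gamma_\sigma(x)=Z_\sigma^{-1}e^{-H(x)+\sigma x}$ with $Z_\sigma=\int e^{-H(x)+\sigma x}dx$. The map $\lambda:\mathbb{R}\to\mathbb{R}$ is defined by letting $\lambda(\ell)$ be the unique real number with $M_1(\gamma_{\lambda(\ell)})=\ell$. With $\mathrm{Var}(\gamma)=\int x^2\gamma\,dx-(\int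 x\gamma\,dx)^2$, set $c_{\mathrm{Var}}=\inf_{\eta\in\mathbb{R}}\mathrm{Var}(\gamma_\eta)$ and $C_{\mathrm{Var}}=\sup_{\eta\in\mathbb{R}}\mathrm{Var}(\gamma_\eta)$; under (a), $0<c_{\mathrm{Var}}\le C_{\mathrm{Var}}<\infty$. Relative entropy: $\mathcal{H}(\rho|\gamma)=\int\rho\log(\rho/\gamma)\,dx$. Dissipation: $\mathcal{D}(\rho,\sigma)=\int_{\{\rho>0\}}\big|\partial_x\log\rho+H'-\sigma\big|^2\rho\,dx$ for weakly differentiable densities $\rho$, and $+\infty$ otherwise. $C_{\mathrm{LSI},M}\in(0,\infty)$ is a constant such that $\mathcal{H}(\rho|\gamma_\sigma)\le C_{\mathrm{LSI},M}\,\mathcal{D}(\rho,\sigma)$ for all $|\sigma|\le M$ and all $\rho\in\mathcal{P}_2(\mathbb{R})$ with $\mathcal{D}(\rho,\sigma)<\infty$. Solution: $\rho(0)=\rho^0$, $\rho(t)\in\mathcal{M}^{\ell(t)}$, and for every $T>0$ and $\zeta\in C_c^\infty([0,T)\times\mathbb{R})$ one has $0=-\int\zeta(0,x)\rho^0dx-\int_0^T\!\int\rho\,\partial_t\zeta\,dx\,dt+\int_0^T\!\int\rho\big((H'-\sigma)\partial_x\zeta-\partial_{xx}\zeta\big)dx\,dt$ with $\sigma(t)=\int H'\rho(t)\,dx+\dot\ell(t)$. As recorded in the paper, such solutions are understood with the regularity $\rho\in L^2_{\mathrm{loc}}(\mathbb{R}_+;H^2_{\mathrm{loc}}(\mathbb{R}))\cap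 H^1_{\mathrm{loc}}(\mathbb{R}_+;L^2_{\mathrm{loc}}(\mathbb{R}))$, with the time-continuous representative; conditions involving $\dot\ell$ or $\sigma$ are understood for a.e. $t$. For such solutions $\|\sigma\|_{L^\infty(\mathbb{R}_+)}<\infty$. *)

(* Defs.v *)
From HB Require Import structures.
From mathcomp Require Import all_boot all_order all_algebra.
From mathcomp Require Import all_classical all_reals all_analysis.

Set Implicit Arguments.
Unset Strict Implicit.
Unset Printing Implicit Defensive.

Import Order.TTheory GRing.Theory Num.Theory.
Import numFieldNormedType.Exports.

Local Open Scope ring_scope.
Local Open Scope classical_set_scope.

Section FokkerPlanck.
Context {R : realType}.
Implicit Types (H f g phi rho l dl : R -> R) (u z : R -> R -> R).

Local Notation mu := (@lebesgue_measure R).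

Definition Cn (n : nat) f : Prop :=
  (forall k x, (k < n)%N -> derivable (derive1n k f) x 1) /\ continuous (derive1n n f).

Definition smooth f : Prop := forall k x, derivable (derive1n k f) x 1.

Definition test_function (U : set R) phi : Prop :=
  smooth phi /\
  exists K, [/\ compact K, K `<=` U & forall x, ~ K x -> phi x = 0].

Definition weak_derivative (U : set R) f g : Prop :=
  [/\ locally_integrable U f, locally_integrable U g &
    forall phi, test_function U phi ->
      \int[mu]_(x in U) (f x * derive1 phi x) = - \int[mu]_(x in U) (g x * phi x)].

(* The norm of L^oo(R_+); the null set {0} and negative arguments do not
   contribute. *)
Definition Linfty_norm f : \bar R :=
  'N[mu]_+oo[EFin \o (f \_ `]0, +oo[)].

(* A function of time and space is written u t x. *)
Definition pdt u : R -> R -> R := fun t x => derive1 (u ^~ x) t.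
Definition pdx u : R -> R -> R := fun t x => derive1 (u t) x.

Fixpoint Cn2 (n : nat) u : Prop :=
  continuous (fun p : R * R => u p.1 p.2) /\
  match n with
  | 0 => True
  | m.+1 => [/\ forall t x, derivable (u ^~ x) t 1,
                forall t x, derivable (u t) x 1,
                Cn2 m (pdt u) & Cn2 m (pdx u)]
  end.

(* Elements of C_c^oo([0, T) x R) are taken as restrictions of elements of
   C_c^oo((-oo, T) x R). *)
Definition spacetime_test_function (T : R) z : Prop :=
  (forall n, Cn2 n z) /\
  exists K : set (R * R), [/\ compact K, K `<=` [set p | p.1 < T] &
    forall t x, ~ K (t, x) -> z t x = 0].

Definition potential H : Prop :=
  [/\ Cn 3 H, forall x, 0 <= H x,
   (exists c, 0 < c /\ limf_einf (fun x => (derive1n 2 H x)%:E) +oo = c%:E) /\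
   (exists c, 0 < c /\ limf_einf (fun x => (derive1n 2 H x)%:E) -oo = c%:E),
   (derive1n 3 H x @[x --> +oo] --> 0) /\ (derive1n 3 H x @[x --> -oo] --> 0) &
   exists C, forall x,
     [/\ H x <= C * (1 + x ^+ 2), `|derive1 H x| <= C * (1 + `|x|),
         `|derive1n 2 H x| <= C & `|derive1n 3 H x| <= C / (1 + `|x|)]].

(* dl is the weak derivative of l in W^{1,oo}(R_+), and l is the continuous
   representative. *)
Definition constraint l dl (lstar : R) : Prop :=
  [/\ {within `[0, +oo[, continuous l}, weak_derivative `]0, +oo[ l dl,
      (Linfty_norm l < +oo)%E /\ (Linfty_norm dl < +oo)%E,
      l t @[t --> +oo] --> lstar &
      mu.-integrable `]0, +oo[ (EFin \o dl)].

Definition P2 rho : Prop :=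
  [/\ measurable_fun setT rho, forall x, 0 <= rho x,
      (\int[mu]_x (rho x)%:E = 1)%E &
      (\int[mu]_x (x ^+ 2 * rho x)%:E < +oo)%E].

Definition M1 rho : R := \int[mu]_x (x * rho x).

Definition Var rho : R := \int[mu]_x (x ^+ 2 * rho x) - M1 rho ^+ 2.

Definition constrained_P2 (m : R) rho : Prop := P2 rho /\ M1 rho = m.

Definition Z H (s : R) : R := \int[mu]_x expR (- H x + s * x).

Definition gibbs H (s : R) : R -> R := fun x => expR (- H x + s * x) / Z H s.

Definition lambda H (m : R) : R := xget 0 [set s | M1 (gibbs H s) = m].

Definition c_Var H : \bar R := ereal_inf (range (fun s => (Var (gibbs H s))%:E)).
Definition C_Var H : \bar R := ereal_sup (range (fun s => (Var (gibbs H s))%:E)).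

Definition free_energy H rho : \bar R :=
  (\int[mu]_x (rho x * ln (rho x))%:E + \int[mu]_x (H x * rho x)%:E
   + (ln (Z H 0))%:E)%E.

Definition relative_entropy rho g : \bar R :=
  (\int[mu]_x (rho x * ln (rho x / g x))%:E)%E.

(* On {rho > 0}, the weak derivative of log rho is rho' / rho, with rho' the weak
   derivative, which is unique almost everywhere. *)
Definition dissipation H rho (s : R) : \bar R :=
  if `[< exists g, weak_derivative setT rho g >] then
    let drho := xget (cst 0) [set g | weak_derivative setT rho g] in
    (\int[mu]_(x in [set x | (0 < rho x)%R])
       (`|drho x / rho x + derive1 H x - s| ^+ 2 * rho x)%:E)%E
  else +oo%E.

Definition log_Sobolev H (M : \bar R) (C : R) : Prop :=
  forall s rho, (`|s|%:E <= M)%E -> P2 rho -> (dissipation H rho s < +oo)%E ->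
    (relative_entropy rho (gibbs H s) <= C%:E * dissipation H rho s)%E.

Definition multiplier H dl u : R -> R :=
  fun t => \int[mu]_x (derive1 H x * u t x) + dl t.

Definition L2_loc u : Prop :=
  measurable_fun (`]0%R, +oo[ `*` setT : set (R * R)) (fun p => u p.1 p.2) /\
  forall a b r : R, 0 < a ->
    (\int[mu \x mu]_(p in `[a, b] `*` `[(- r)%R, r]) ((u p.1 p.2) ^+ 2)%:E < +oo)%E.

(* u is in L^2_loc(R_+; H^2_loc(R)) and in H^1_loc(R_+; L^2_loc(R)), and is the
   representative which is continuous in time with values in L^2_loc(R). The
   localisation in time is in the open half-line: an initial density with
   finite free energy need not be locally square integrable. *)
Definition regular u : Prop :=
  [/\ L2_loc u,
   (exists ux uxx, [/\ L2_loc ux, L2_loc uxx &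
      {ae mu, forall t, 0 < t ->
        weak_derivative setT (u t) (ux t) /\
        weak_derivative setT (ux t) (uxx t)}]),
   (exists ut, L2_loc ut /\
      forall phi, test_function `]0, +oo[ phi ->
        {ae mu, forall x,
          \int[mu]_(t in `]0, +oo[) (u t x * derive1 phi t) =
          - \int[mu]_(t in `]0, +oo[) (ut t x * phi t)}) &
   forall s r : R, 0 < s ->
     (\int[mu]_(x in `[(- r)%R, r]) ((u t x - u s x) ^+ 2)%:E)%E @[t --> s]
       --> 0%E].

(* Local integrability of sigma is what makes the integrals of the weak
   formulation converge; nothing more is assumed on sigma. *)
Definition solution H l dl rho0 u : Prop :=
  let sigma := multiplier H dl u in
  [/\ {ae mu, forall x, u 0 x = rho0 x},
   (forall t, 0 <= t -> constrained_P2 (l t) (u t)),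
   regular u,
   (forall T, mu.-integrable `[0, T] (EFin \o sigma)) &
   forall T z, 0 < T -> spacetime_test_function T z ->
     0 = - (\int[mu]_x (z 0 x * rho0 x))
         - (\int[mu]_(t in `[0, T]) \int[mu]_x (u t x * pdt z t x))
         + (\int[mu]_(t in `[0, T]) \int[mu]_x
             (u t x * ((derive1 H x - sigma t) * pdx z t x - pdx (pdx z) t x)))].

(* (e^{-tau t} - e^{-kappa t}) / (kappa - tau), extended by continuity. *)
Definition exp_quotient (tau kappa t : R) : R :=
  if kappa == tau then t * expR (- (kappa * t))
  else (expR (- (tau * t)) - expR (- (kappa * t))) / (kappa - tau).

End FokkerPlanck.

(* Main.v *)
Require Import Defs.
From HB Require Import structures.
From mathcomp Require Import all_boot all_order all_algebra.
From mathcomp Require Import all_classical all_reals all_analysis.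
From mathcomp Require Import measurable_realfun ess_sup_inf.
From mathcomp Require Import ring lra.

Import Order.TTheory GRing.Theory Num.Theory.
Import numFieldNormedType.Exports.

Set Implicit Arguments.
Unset Strict Implicit.
Unset Printing Implicit Defensive.

Local Open Scope ring_scope.
Local Open Scope classical_set_scope.

(** The density is mollified in space, f = K * rho, with a smooth positive kernel
    K of width eps and exponential tails; no regularity of rho is used.  Testing
    the equation with K (x - .) gives d_t f = d_x J, where
    J = K' * rho + K * (H' rho) - sigma f.  Since |log f| grows at most linearly,
    d/dt F(f) = - int (d_x log f + H') J is justified, and up to the commutator
    H' f - K * (H' rho), which costs O(eps), the right-hand side is
    sigma l' - int J^2 / f.  The log-Sobolev inequality is applied to f and not
    to rho.  Let I m be the minimum of F over the densities of mean m, so that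
    I' = lambda.  Then E = F(f) - I(l) satisfies
    E' <= - tau E + (sigma - lambda(l)) l' + O(eps), and Gronwall's lemma gives
    the first two terms of the bound.  As eps tends to 0, F(rho) is controlled
    through its dual representation, a supremum over bounded Lipschitz
    functions.  Finally H(rho | gamma_{sigma_star}) - E is the Bregman distance
    of log Z between lambda(l) and sigma_star, at most
    (l - lstar)^2 / (2 c_Var) because (log Z)'' = Var. *)

(** The equation cannot be tested with log rho itself: the logarithm need not be bounded below and
    the dissipation of rho is not known to be finite. For f, all integrability comes from the bounds
    of K' and K'' by N K. The constant N blows up as the width e tends to 0, but the errors contain
    only the first two moments of the kernel, at most 16 e and 128 e^2. Young's inequality between
    flux and commutator costs a fraction d of the dissipation and a multiple of e^2 / d, so d = e
    makes both vanish. In time f is only Lipschitz, because sigma is merely bounded and measurable.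
    Instead of differentiating in time, one-sided inequalities with an error k (t - s)^2 are summed
    over partitions; convexity of x ln x gives them the right sign. The norms of sigma and lambda(l)
    live in the extended reals and may be infinite. Finiteness of F(rho(t)) is therefore obtained
    separately, from the decay estimate with rate 0 and a bound of sigma on [0, t] that comes from
    the second moment. *)

Notation intg mu D f := (integrable mu D (EFin \o f)).

(** * Limits and integrals of real functions *)

Section Limits.
Context {R : realType}.

Lemma cvg0_le T (F : set_system T) (f g : T -> R) : Filter F ->
  (\forall x \near F, `|f x| <= g x) -> g x @[x --> F] --> 0 ->
  f x @[x --> F] --> 0.
Proof.
move=> FF fg /cvgrPdist_lt g0; apply/cvgrPdist_lt => e e0.
apply: filterS2 fg (g0 e e0) => x fgx; rewrite !sub0r !normrN => h.
exact: le_lt_trans fgx (le_lt_trans (ler_norm _) h).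
Qed.

Lemma cvg_le T (F : set_system T) (f g : T -> R) (l : R) : Filter F ->
  (\forall x \near F, `|f x - l| <= g x) -> g x @[x --> F] --> 0 ->
  f x @[x --> F] --> l.
Proof.
move=> FF fg g0; have h := cvg0_le FF fg g0.
rewrite (_ : f = (fun x => (f x - l) + l)); last by apply/funext => x; rewrite subrK.
by rewrite -[X in _ --> X](add0r l); apply: cvgD => //; exact: cvg_cst.
Qed.

Lemma cvg_uniq (u : nat -> R) (a b : R) :
  u n @[n --> \oo] --> a -> u n @[n --> \oo] --> b -> a = b.
Proof.
by move=> ua ub; rewrite -(cvg_lim (@Rhausdorff R) ua) (cvg_lim (@Rhausdorff R) ub).
Qed.

Lemma cvg_harm (c : R) : c / n.+1%:R @[n --> \oo] --> 0.
Proof.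
rewrite -(mulr0 c); apply: cvgM; first exact: cvg_cst.
exact: cvg_harmonic.
Qed.

End Limits.

Section RealIntegrals.
Context d (T : measurableType d) (R : realType).
Variable mu : {measure set T -> \bar R}.
Implicit Types (D : set T) (f g : T -> R).

Lemma ae_mono (P Q : T -> Prop) : (forall x, P x -> Q x) ->
  {ae mu, forall x, P x} -> {ae mu, forall x, Q x}.
Proof. by move=> PQ; exact: filterS. Qed.

Lemma ae_mono2 (P Q S : T -> Prop) : (forall x, P x -> Q x -> S x) ->
  {ae mu, forall x, P x} -> {ae mu, forall x, Q x} -> {ae mu, forall x, S x}.
Proof. by move=> PQ; exact: filterS2. Qed.

Lemma intg_meas D f : intg mu D f -> measurable_fun D f.
Proof. by case/integrableP => /measurable_EFinP. Qed.

Lemma intg_le D f g : measurable D -> measurable_fun D f ->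
  (forall x, D x -> `|f x| <= g x) -> intg mu D g -> intg mu D f.
Proof.
move=> mD mf fg; apply: le_integrable => //; first exact/measurable_EFinP.
by move=> x Dx /=; rewrite lee_fin (le_trans (fg _ Dx)) ?ler_norm.
Qed.

Lemma intgD D f g : measurable D -> intg mu D f -> intg mu D g ->
  intg mu D (fun x => f x + g x).
Proof. by move=> mD fi gi; have := integrableD mD fi gi. Qed.

Lemma intgB D f g : measurable D -> intg mu D f -> intg mu D g ->
  intg mu D (fun x => f x - g x).
Proof. by move=> mD fi gi; have := integrableB mD fi gi. Qed.

Lemma intgZ D f (c : R) : measurable D -> intg mu D f ->
  intg mu D (fun x => c * f x).
Proof. by move=> mD fi; have := integrableZl mD c fi. Qed.

Lemma intgN D f : measurable D -> intg mu D f -> intg mu D (fun x => - f x).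
Proof. by move=> mD fi; exact: (integrableN fi). Qed.

Lemma intg_norm D f : measurable D -> intg mu D f -> intg mu D (fun x => `|f x|).
Proof. by move=> mD fi; exact: integrable_norm. Qed.

Lemma intg_eq D f g : measurable D -> (forall x, D x -> f x = g x) ->
  intg mu D f -> intg mu D g.
Proof.
move=> mD fg; apply: eq_integrable => // x; rewrite inE => Dx /=.
by rewrite fg.
Qed.

Lemma intg_patch D f : measurable D -> intg mu D f -> intg mu setT (f \_ D).
Proof. by move=> mD /(integrable_mkcond _ mD); rewrite restrict_EFin. Qed.

Lemma meas_patch D f : measurable D -> measurable_fun setT f ->
  measurable_fun setT (f \_ D).
Proof.
move=> mD mf; apply: (proj1 (measurable_restrictT _ mD)).
exact: measurable_funTS.
Qed.

Lemma Rint_EFin D f : intg mu D f -> measurable D ->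
  (\int[mu]_(x in D) (f x)%:E = (\int[mu]_(x in D) f x)%:E)%E.
Proof. by move=> fi mD; rewrite /Rintegral fineK// integrable_fin_num. Qed.

Lemma intg_ge0 D f : measurable D -> measurable_fun D f ->
  (forall x, D x -> 0 <= f x) ->
  (\int[mu]_(x in D) (f x)%:E < +oo)%E -> intg mu D f.
Proof.
move=> mD mf f0 foo; apply/integrableP; split; first exact/measurable_EFinP.
rewrite (eq_integral (fun x => (f x)%:E))// => x; rewrite inE => Dx /=.
by rewrite ger0_norm ?f0.
Qed.

Lemma Rint_le_norm D f g : measurable D -> intg mu D f -> intg mu D g ->
  (forall x, D x -> `|f x| <= g x) ->
  `|\int[mu]_(x in D) f x| <= \int[mu]_(x in D) g x.
Proof.
move=> mD fi gi fg; apply: (le_trans (le_normr_Rintegral mD fi)).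
by apply: le_Rintegral => //; exact: intg_norm.
Qed.

Lemma Rint_supp D E f : D `<=` E -> (forall x, E x -> ~ D x -> f x = 0) ->
  \int[mu]_(x in E) f x = \int[mu]_(x in D) f x.
Proof.
move=> DE f0; rewrite [LHS]Rintegral_mkcond [RHS]Rintegral_mkcond.
congr Rintegral; apply/funext => x; rewrite !patchE.
have [xD|xD] := pselect (D x); first by rewrite !mem_set//; exact: DE.
rewrite (memNset xD); case: ifPn => //; rewrite inE => Ex; exact: f0.
Qed.

Lemma Rint_N D f : measurable D -> intg mu D f ->
  \int[mu]_(x in D) (- f x) = - \int[mu]_(x in D) f x.
Proof.
move=> mD fi; rewrite -[RHS]mulN1r -RintegralZl//.
by apply: eq_Rintegral => x _; rewrite mulN1r.
Qed.

Lemma Rint_ae D f g : measurable D -> measurable_fun D f -> measurable_fun D g ->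
  {ae mu, forall x, D x -> f x = g x} ->
  \int[mu]_(x in D) f x = \int[mu]_(x in D) g x.
Proof.
move=> mD mf mg fg; congr fine; apply: ae_eq_integral => //.
- exact/measurable_EFinP.
- exact/measurable_EFinP.
- by apply: filterS fg => x /[apply] /= ->.
Qed.

(** Replacing [f] by [min f g] changes it on a null set only, and the minimum lies below [g]
    everywhere. *)
Lemma Rint_le_ae D f g : measurable D -> intg mu D f -> intg mu D g ->
  {ae mu, forall x, D x -> f x <= g x} ->
  \int[mu]_(x in D) f x <= \int[mu]_(x in D) g x.
Proof.
move=> mD fi gi fg; have mf := intg_meas fi; have mg := intg_meas gi.
have mm : measurable_fun D (fun x => Num.min (f x) (g x)) by exact: measurable_minr.
rewrite (@Rint_ae D f (fun x => Num.min (f x) (g x)))//; last first.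
  by apply: filterS fg => x /[apply] fgx; rewrite min_l.
apply: le_Rintegral => //; last by move=> x _; rewrite ge_min lexx orbT.
apply: (@intg_le _ _ (fun x => `|f x| + `|g x|)) => //; last first.
  by apply: intgD => //; exact: intg_norm.
move=> x _; rewrite /Num.min; case: ifP => _.
  by rewrite lerDl.
by rewrite lerDr.
Qed.

Lemma dct D (F : nat -> T -> R) f g : measurable D ->
  (forall n, measurable_fun D (F n)) -> measurable_fun D f ->
  {ae mu, forall x, D x -> F n x @[n --> \oo] --> f x} ->
  intg mu D g -> (forall n x, D x -> `|F n x| <= g x) ->
  intg mu D f /\ \int[mu]_(x in D) F n x @[n --> \oo] --> \int[mu]_(x in D) f x.
Proof.
move=> mD mF mf Ff gi Fg.
have [] := @dominated_convergence _ _ _ mu D mD (fun n => EFin \o F n)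
  (EFin \o f) (EFin \o g).
- by move=> n; exact/measurable_EFinP.
- exact/measurable_EFinP.
- apply: filterS Ff => x Ff Dx; apply: cvg_EFin; first exact: nearW.
  exact: Ff.
- by [].
- by apply/aeW => x n Dx /=; rewrite lee_fin; exact: Fg.
move=> fi _ Fc; split => //.
by apply: fine_cvg; rewrite -(Rint_EFin fi mD).
Qed.

End RealIntegrals.

Section RealFubini.
Context d1 d2 (T1 : measurableType d1) (T2 : measurableType d2) (R : realType).
Variables (m1 : {sigma_finite_measure set T1 -> \bar R})
  (m2 : {sigma_finite_measure set T2 -> \bar R}).
Implicit Type F : T1 * T2 -> R.

(** Tonelli gives the measurability of the integrals of the positive and the negative part; their
    difference in [\bar R] and [fine] preserve it, also at the points where the integral is
    infinite. *)
Lemma measurable_Rint F : measurable_fun setT F ->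
  measurable_fun setT (fun x => \int[m2]_y F (x, y)).
Proof.
move=> mF; rewrite /Rintegral.
apply: measurableT_comp => //.
rewrite (_ : (fun x => _) = (fun x => \int[m2]_y (EFin \o F)^\+ (x, y) -
   \int[m2]_y (EFin \o F)^\- (x, y))%E); last first.
  apply/funext => x; rewrite integralE.
  by congr (_ - _)%E; apply: eq_integral => y _; rewrite ?funeposE ?funenegE.
apply: emeasurable_funB.
- apply: (@measurable_fun_fubini_tonelli_F _ _ _ _ _ m2 ((EFin \o F)^\+)%E).
  + exact/measurable_funepos/measurable_EFinP.
  + by move=> z; exact: funepos_ge0.
- apply: (@measurable_fun_fubini_tonelli_F _ _ _ _ _ m2 ((EFin \o F)^\-)%E).
  + exact/measurable_funeneg/measurable_EFinP.
  + by move=> z; exact: funeneg_ge0.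
Qed.

Lemma measurable_Rint2 F : measurable_fun setT F ->
  measurable_fun setT (fun y => \int[m1]_x F (x, y)).
Proof.
move=> mF; rewrite /Rintegral.
apply: measurableT_comp => //.
rewrite (_ : (fun x => _) = (fun y => \int[m1]_x (EFin \o F)^\+ (x, y) -
   \int[m1]_x (EFin \o F)^\- (x, y))%E); last first.
  apply/funext => x; rewrite integralE.
  by congr (_ - _)%E; apply: eq_integral => y _; rewrite ?funeposE ?funenegE.
apply: emeasurable_funB.
- apply: (@measurable_fun_fubini_tonelli_G _ _ _ _ _ m1 ((EFin \o F)^\+)%E).
  + exact/measurable_funepos/measurable_EFinP.
  + by move=> z; exact: funepos_ge0.
- apply: (@measurable_fun_fubini_tonelli_G _ _ _ _ _ m1 ((EFin \o F)^\-)%E).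
  + exact/measurable_funeneg/measurable_EFinP.
  + by move=> z; exact: funeneg_ge0.
Qed.

Lemma tonelli_lt F (G : T1 -> R) : measurable_fun setT F ->
  (forall x, intg m2 setT (fun y => F (x, y))) ->
  (forall x, \int[m2]_y `|F (x, y)| <= G x) -> intg m1 setT G ->
  intg (m1 \x m2)%E setT F.
Proof.
move=> mF iF FG iG; apply/integrable12ltyP; first exact/measurable_EFinP.
case/integrableP: (iG) => mG; apply: le_lt_trans.
apply: ge0_le_integral => //.
- by move=> x _; exact: integral_ge0.
- apply: (@measurable_fun_fubini_tonelli_F _ _ _ _ _ m2 (fun z => `|(EFin \o F) z|%E)) => //.
  by apply: measurableT_comp => //; exact/measurable_EFinP.
- exact: measurableT_comp.
- move=> x _ /=; rewrite (Rint_EFin (intg_norm measurableT (iF x)))// lee_fin.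
  exact: le_trans (FG x) (ler_norm _).
Qed.

Lemma fubini_intg2 F : intg (m1 \x m2)%E setT F ->
  intg m2 setT (fun y => \int[m1]_x F (x, y)).
Proof.
move=> iF; have mF : measurable_fun setT F := intg_meas iF.
have iG : m2.-integrable setT (fubini_G m1 (EFin \o F)).
  apply/integrableP; split; first exact: (measurable_fubini_G iF).
  have /integrable21ltyP := iF; move=> /(_ (measurable_int _ iF)).
  apply: le_lt_trans; apply: ge0_le_integral => //.
  - by apply: measurableT_comp => //; exact: (measurable_fubini_G iF).
  - apply: (@measurable_fun_fubini_tonelli_G _ _ _ _ _ m1 (fun z => `|(EFin \o F) z|%E)) => //.
    by apply: measurableT_comp => //; exact/measurable_EFinP.
  - move=> y _; apply: le_abse_integral => //.
    apply/measurable_EFinP; exact: (measurableT_comp mF (measurable_pair2 _)).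
have /integrableP[_ oo] := iG.
apply/integrableP; split; first exact/measurable_EFinP/measurable_Rint2.
move: oo; apply: le_lt_trans; apply: ge0_le_integral => //.
- apply: measurableT_comp => //; exact/measurable_EFinP/measurable_Rint2.
- by apply: measurableT_comp => //; exact: (measurable_fubini_G iF).
- move=> x _ /=; rewrite /Rintegral /fubini_G /=.
  by case: (\int[m1]_y (F (y, x))%:E)%E => [r| |] //=; rewrite normr0 leey.
Qed.

Lemma fubini_ae2 F : intg (m1 \x m2)%E setT F ->
  {ae m2, forall y, intg m1 setT (fun x => F (x, y))}.
Proof. exact: ae_integrable2. Qed.

(** Iterated real integrals agree with those in [\bar R] where the sections are integrable, which
    holds almost everywhere and is enough for the outer integral. *)
Lemma fubiniR F : intg (m1 \x m2)%E setT F ->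
  \int[m1]_x \int[m2]_y F (x, y) = \int[m2]_y \int[m1]_x F (x, y).
Proof.
move=> iF; have mF : measurable_fun setT F := intg_meas iF.
have := Fubini iF => /(congr1 fine) E.
rewrite [LHS](_ : _ = fine (\int[m1]_x \int[m2]_y (EFin \o F) (x, y))%E); last first.
  congr fine; apply: ae_eq_integral => //.
  - exact/measurable_EFinP/measurable_Rint.
  - exact: (measurable_fubini_F iF).
  - by apply: filterS (ae_integrable1 iF) => x ix _ /=; rewrite Rint_EFin.
rewrite E; congr fine; apply: ae_eq_integral => //.
- exact: (measurable_fubini_G iF).
- exact/measurable_EFinP/measurable_Rint2.
- by apply: filterS (ae_integrable2 iF) => x ix _ /=; rewrite Rint_EFin.
Qed.

End RealFubini.

(** A plain predicate around the class [is_derive]: derivatives are composed as explicit proof terms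
    instead of being found by instance resolution. *)
Definition dv {R : realType} (f : R -> R) (x a : R) : Prop := is_derive x 1 f a.

(** * Derivatives on the line *)

Section Derivatives.
Context {R : realType}.
Implicit Types (f g : R -> R) (x a b c : R).

Lemma dv_ext f g x a : (forall y, f y = g y) -> dv f x a -> dv g x a.
Proof. by move=> /funext ->. Qed.

Lemma dv_eq f x a b : dv f x a -> a = b -> dv f x b.
Proof. by move=> ? <-. Qed.

Lemma dv_cst c x : dv (fun _ : R => c) x 0.
Proof. exact: is_derive_cst. Qed.

Lemma dv_id x : dv (fun y : R => y) x 1.
Proof. exact: is_derive_id. Qed.

Lemma dvD f g x a b : dv f x a -> dv g x b -> dv (fun y => f y + g y) x (a + b).
Proof. by move=> ? ?; exact: is_deriveD. Qed.

Lemma dvB f g x a b : dv f x a -> dv g x b -> dv (fun y => f y - g y) x (a - b).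
Proof. by move=> ? ?; exact: is_deriveB. Qed.

Lemma dvN f x a : dv f x a -> dv (fun y => - f y) x (- a).
Proof. by move=> ?; exact: is_deriveN. Qed.

Lemma dvM f g x a b : dv f x a -> dv g x b ->
  dv (fun y => f y * g y) x (a * g x + f x * b).
Proof.
move=> df dg; have df' : is_derive x 1 f a := df; have dg' : is_derive x 1 g b := dg.
have h := is_deriveM df' dg'; apply: (is_derive_eq h).
by rewrite /GRing.scale/= addrC (mulrC a).
Qed.

Lemma dvX f n x a : dv f x a ->
  dv (fun y => f y ^+ n) x (n%:R * f x ^+ n.-1 * a).
Proof.
move=> df; elim: n => [|n IH].
  rewrite !mul0r; apply: dv_ext (dv_cst 1 x) => y; by rewrite expr0.
apply: dv_ext (dv_eq (dvM df IH) _) => [y|]; first by rewrite exprS.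
case: n IH => [|n] _; first by rewrite !mul0r !mulr0 !expr0 mulr1 addr0 !mul1r.
by rewrite /= !exprS -[n.+2%:R]natr1; ring.
Qed.

Lemma dvZ f c x a : dv f x a -> dv (fun y => c * f y) x (c * a).
Proof. by move=> ?; exact: is_deriveZ. Qed.

Lemma dvV f x a : f x != 0 -> dv f x a ->
  dv (fun y => (f y)^-1) x (- a / (f x) ^+ 2).
Proof.
move=> fx0 [df <-]; split; first exact: derivableV.
by rewrite deriveV// /GRing.scale/= !mulNr mulrC.
Qed.

Lemma dv_comp f g x a b : dv g x b -> dv f (g x) a ->
  dv (fun y => f (g y)) x (a * b).
Proof.
by move=> dg df; exact: (@is_derive1_comp _ f g x a b df dg).
Qed.

Lemma dv_exp f x a : dv f x a -> dv (fun y => expR (f y)) x (expR (f x) * a).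
Proof. by move=> df; exact: (dv_comp df (is_derive_expR (f x))). Qed.

Lemma dv_ln f x a : 0 < f x -> dv f x a -> dv (fun y => ln (f y)) x (a / f x).
Proof.
by move=> fx df; apply: (dv_eq (dv_comp df (is_derive1_ln fx))); rewrite mulrC.
Qed.

Lemma dv_derive1 f x a : dv f x a -> derive1 f x = a.
Proof. by move=> [_ <-]; rewrite derive1E. Qed.

Lemma dv_of f x : derivable f x 1 -> dv f x (derive1 f x).
Proof. by move=> ?; rewrite derive1E; exact: DeriveDef. Qed.

Lemma dv_cont f x a : dv f x a -> {for x, continuous f}.
Proof. by move=> [/derivable1_diffP/differentiable_continuous]. Qed.

Lemma dv_continuous f (f' : R -> R) : (forall x, dv f x (f' x)) -> continuous f.
Proof. by move=> df x; exact: dv_cont (df x). Qed.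

Lemma mvt f (f' : R -> R) a b : (forall x, dv f x (f' x)) -> a <= b ->
  exists2 c, a <= c <= b & f b - f a = f' c * (b - a).
Proof.
move=> df ab; have cf := dv_continuous df.
by have [c /[!in_itv]/= cab e] := MVT_segment ab (fun x _ => df x)
  (continuous_subspaceT cf); exists c.
Qed.

Lemma mvt_le f (f' : R -> R) (K : R) a b : (forall x, dv f x (f' x)) ->
  (forall x, Num.min a b <= x <= Num.max a b -> `|f' x| <= K) ->
  `|f b - f a| <= K * `|b - a|.
Proof.
move=> df; wlog ab : a b / a <= b => [hw|] fK.
  case: (leP a b) => [/hw|/ltW ba]; first exact.
  by rewrite distrC (distrC b); apply: hw => // x; rewrite minC maxC; exact: fK.
have [c cab ->] := mvt df ab; rewrite normrM ler_wpM2r// fK//.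
by rewrite min_l// max_r.
Qed.

Lemma nondec_dv f (f' : R -> R) a b : (forall x, dv f x (f' x)) ->
  (forall x, a <= x <= b -> 0 <= f' x) -> a <= b -> f a <= f b.
Proof.
move=> df f0 ab; have [c cab e] := mvt df ab.
by rewrite -subr_ge0 e mulr_ge0 ?f0// subr_ge0.
Qed.

End Derivatives.

Section LineIntegrals.
Context {R : realType}.
Local Notation mu := (@lebesgue_measure R).
Implicit Types (f g : R -> R) (a b : R).

Lemma cont_meas f : continuous f -> measurable_fun setT f.
Proof. exact: continuous_measurable_fun. Qed.

Lemma intg_cont f a b : continuous f -> intg mu `[a, b] f.
Proof.
move=> cf; apply: continuous_compact_integrable; first exact: segment_compact.
exact: continuous_subspaceT.
Qed.

Lemma ftc_itv f (f' : R -> R) a b : (forall x, dv f x (f' x)) -> continuous f' ->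
  a <= b -> \int[mu]_(x in `[a, b]) f' x = f b - f a.
Proof.
move=> df cf'; rewrite le_eqVlt => /predU1P[->|ab].
  by rewrite set_itv1 Rintegral_set1 subrr.
have cf := dv_continuous df.
rewrite /Rintegral (@continuous_FTC2 _ f' f)//.
- exact: continuous_subspaceT.
- split; first by move=> x _; have [] := df x.
  + by apply: cvg_at_right_filter; exact: cf.
  + by apply: cvg_at_left_filter; exact: cf.
- by move=> x _; exact: dv_derive1.
Qed.

Lemma cvg_line_integral f : intg mu setT f ->
  \int[mu]_(x in `[- n%:R, n%:R]) f x @[n --> \oo] --> \int[mu]_x f x.
Proof.
move=> fi; under eq_fun do rewrite Rintegral_mkcond.
apply: (proj2 (@dct _ _ _ mu setT _ f (fun x => `|f x|) _ _ _ _ _ _)) => //.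
- by move=> n; apply: meas_patch => //; exact: intg_meas fi.
- exact: intg_meas fi.
- apply/aeW => x _; apply: cvg_near_cst.
  near=> n; rewrite patchE mem_set//= in_itv/= -ler_norml.
  by near: n; exact: nbhs_infty_ger.
- exact: intg_norm.
- by move=> n x _; rewrite patchE; case: ifP; rewrite ?normr0.
Unshelve. all: by end_near. Qed.

Lemma ftc_line f (f' : R -> R) a b : (forall x, dv f x (f' x)) -> continuous f' ->
  intg mu setT f' -> f n%:R @[n --> \oo] --> b -> f (- n%:R) @[n --> \oo] --> a ->
  \int[mu]_x f' x = b - a.
Proof.
move=> df cf' fi fb fa.
rewrite -(cvg_lim (@Rhausdorff R) (cvg_line_integral fi)); apply: cvg_lim => //.
rewrite (_ : (fun n => _) = (fun n => f n%:R - f (- n%:R))); first exact: cvgB.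
by apply/funext => n; rewrite (ftc_itv df)// ge0_cp.
Qed.

(** Monotone convergence along the intervals [[-n, n]]: a uniform bound of the partial integrals of
    a nonnegative function yields integrability on the line. *)
Lemma intg_line f (c : R) : measurable_fun setT f -> (forall x, 0 <= f x) ->
  (forall n, \int[mu]_(x in `[- n%:R, n%:R]) f x <= c) ->
  (forall n, intg mu `[- n%:R, n%:R] f) -> intg mu setT f.
Proof.
move=> mf f0 fc fi; apply: intg_ge0 => //.
have mfn n : measurable_fun setT (EFin \o (f \_ `[- n%:R, n%:R])).
  by apply/measurable_EFinP; apply: meas_patch.
have ge0n n x : (0 <= (EFin \o (f \_ `[(- n%:R)%R, n%:R%R])) x)%E.
  by rewrite /= patchE; case: ifP; rewrite lee_fin.
have e x : limn (fun n => (EFin \o (f \_ `[(- n%:R)%R, n%:R%R])) x) = (f x)%:E.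
  apply: cvg_lim => //; apply: cvg_near_cst; near=> n.
  rewrite /= patchE mem_set//= in_itv/= -ler_norml.
  by near: n; exact: nbhs_infty_ger.
have nd x : nondecreasing_seq (fun n => (EFin \o (f \_ `[- n%:R, n%:R])) x).
  move=> n m nm /=; rewrite lee_fin !patchE.
  case: ifPn; last by move=> _; case: ifP.
  rewrite inE/= in_itv/= -ler_norml => xn; rewrite mem_set//= in_itv/= -ler_norml.
  by rewrite (le_trans xn)// ler_nat.
under eq_integral do rewrite -e.
rewrite monotone_convergence//.
apply: (@le_lt_trans _ _ c%:E); last exact: ltry.
apply: lime_le.
  apply: ereal_nondecreasing_is_cvgn => n m nm.
  apply: (@ge0_le_integral _ _ _ mu setT measurableT) => //.
  - exact: mfn.
  - exact: mfn.
  - by move=> x _; exact: nd.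
apply: nearW => n.
rewrite (_ : (fun x => _) = ((EFin \o f) \_ `[- n%:R, n%:R])); last first.
  by rewrite restrict_EFin.
by rewrite -integral_mkcond /= (Rint_EFin (fi n))// lee_fin.
Unshelve. all: by end_near. Qed.

End LineIntegrals.

(** * Smooth cutoffs and test functions *)

Section SmoothFunctions.
Context {R : realType}.
Local Notation mu := (@lebesgue_measure R).
Implicit Types (f g : R -> R) (x : R).

(** The power of [x^-1] is a parameter because differentiating [e^(-1/x)] produces such factors; the
    family is closed under derivation by [dv_flat]. *)
Definition flat (n : nat) x : R :=
  if 0 < x then x^-1 ^+ n * expR (- x^-1) else 0.

(** The inequality [z <= e^z] at [z = y / (n + 1)], raised to the power [n + 1]. *)
Lemma expR_ge_pow (n : nat) (y : R) : 0 <= y -> (y / n.+1%:R) ^+ n.+1 <= expR y.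
Proof.
move=> y0; rewrite -{2}(@divfK _ n.+1%:R _ y)// expRM_natr lerXn2r//.
- by rewrite nnegrE divr_ge0.
- by rewrite nnegrE expR_ge0.
- by apply: le_trans (expR_ge1Dx _); rewrite lerDr.
Qed.

(** A quadratic bound makes the difference quotient at 0 vanish in the limit. The power [n + 2] in
    [expR_ge_pow] cancels [x^-1 ^+ n] and leaves [x ^+ 2]. *)
Lemma flat_le (n : nat) x : 0 <= x -> flat n x <= n.+2%:R ^+ n.+2 * x ^+ 2.
Proof.
move=> x0; rewrite /flat; case: ifP => [xp|_]; last first.
  by rewrite mulr_ge0 ?exprn_ge0.
have := @expR_ge_pow n.+1 x^-1; rewrite invr_ge0 x0 => /(_ isT) h.
rewrite expRN ler_pdivrMr ?expR_gt0//.
have e : x^-1 ^+ n = n.+2%:R ^+ n.+2 * x ^+ 2 * (x^-1 / n.+2%:R) ^+ n.+2.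
  have xn : x != 0 by rewrite gt_eqF.
  have n2 : (n.+2%:R ^+ n.+2 : R) != 0 by rewrite expf_neq0 ?pnatr_eq0.
  rewrite exprMn (exprVn n.+2%:R) -(addn2 n) (exprD x^-1) addn2.
  by rewrite (exprVn x 2); field; rewrite n2 xn.
by rewrite e ler_wpM2l// mulr_ge0 ?exprn_ge0.
Qed.

Lemma flat_ge0 (n : nat) x : 0 <= flat n x.
Proof.
rewrite /flat; case: ifP => // x0.
by rewrite mulr_ge0 ?expR_ge0// exprn_ge0// invr_ge0 ltW.
Qed.

Lemma flat_gt0 (n : nat) x : 0 < x -> 0 < flat n x.
Proof. by move=> x0; rewrite /flat x0 mulr_gt0 ?expR_gt0// exprn_gt0// invr_gt0. Qed.

Lemma flat_le0 (n : nat) x : x <= 0 -> flat n x = 0.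
Proof. by rewrite /flat leNgt; case: ifP. Qed.

Lemma dv_flat (n : nat) x : dv (flat n) x (flat n.+2 x - n%:R * flat n.+1 x).
Proof.
have [x0|x0|->] := ltgtP x 0.
- rewrite !flat_le0 ?ltW// mulr0 subr0.
  have h : is_derive x 1 (fun _ : R => 0 : R) 0 := dv_cst 0 x.
  apply: near_eq_is_derive h; near=> y; rewrite flat_le0// ltW//; near: y.
  exact: lt_nbhsl.
- have xn : x != 0 by rewrite gt_eqF.
  have di : dv (fun y : R => y^-1) x (- (1 / x ^+ 2)).
    by apply: dv_eq (dvV xn (dv_id x)) _; rewrite mulNr.
  have dp : dv (fun y : R => y^-1 ^+ n) x (n%:R * x^-1 ^+ n.-1 * (- (1 / x ^+ 2))).
    exact: dvX.
  have h : is_derive x 1 (fun y => y^-1 ^+ n * expR (- y^-1))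
      (flat n.+2 x - n%:R * flat n.+1 x).
    apply: dv_eq (dvM dp (dv_exp (dvN di))) _.
    rewrite /flat x0 opprK; case: n {dp} => [|n].
      by rewrite /= !exprS !expr0; field.
    by rewrite /= !exprS; field.
  apply: near_eq_is_derive h; near=> y; rewrite /flat ifT//; near: y.
  exact: lt_nbhsr.
- rewrite !(flat_le0 _ (lexx 0)) mulr0 subr0.
  have fl0 := flat_le0 n (lexx 0).
  (* The slope function of Caratheodory's criterion: its value at 0 is [flat n 0 / 0], that is 0,
     and this is also its limit by [flat_le]. *)
  apply/is_derive1_caratheodory; exists (fun z => flat n z / z); split => //.
  + move=> z; rewrite fl0 !subr0.
    have [->|z0] := eqVneq z 0; first by rewrite fl0 mulr0.
    by rewrite divfK.
  + suff h : flat n z / z @[z --> (0 : R)] --> flat n 0 / 0 by exact: h.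
    rewrite fl0 mul0r.
    set c := n.+2%:R ^+ n.+2 : R.
    have c0 : 0 <= c by rewrite exprn_ge0.
    apply: (@cvg0_le _ _ _ _ (fun z => c * `|z|)).
    * apply: nearW => z.
      have [z0|z0] := ltP 0 z; last by rewrite flat_le0// mul0r normr0 mulr_ge0.
      have q0 : 0 <= flat n z / z by rewrite divr_ge0 ?flat_ge0 ?ltW.
      rewrite (gtr0_norm z0) (ger0_norm q0) ler_pdivrMr//.
      by rewrite -mulrA -expr2; exact: flat_le (ltW z0).
    * rewrite -[X in _ --> X](_ : c * `|0 : R| = 0); last by rewrite normr0 mulr0.
      by apply: cvgM; [exact: cvg_cst|apply: cvg_norm; exact: cvg_id].
  + by rewrite fl0 mul0r.
Unshelve. all: by end_near. Qed.

(* Membership in this class, which is closed under differentiation, certifies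
   smoothness without computing iterated derivatives. *)
Inductive elem : (R -> R) -> Prop :=
| elem_cst c : elem (fun _ => c)
| elem_id : elem (fun x => x)
| elem_exp : elem expR
| elem_flat n : elem (flat n)
| elem_add f g : elem f -> elem g -> elem (fun x => f x + g x)
| elem_mul f g : elem f -> elem g -> elem (fun x => f x * g x)
| elem_inv f : (forall x, f x != 0) -> elem f -> elem (fun x => (f x)^-1)
| elem_comp f g : elem f -> elem g -> elem (fun x => f (g x)).

Lemma elem_scale c f : elem f -> elem (fun x => c * f x).
Proof. by move=> ef; apply: elem_mul => //; exact: elem_cst. Qed.

Lemma elem_opp f : elem f -> elem (fun x => - f x).
Proof.
move=> ef; rewrite (_ : (fun x => _) = (fun x => -1 * f x)); first exact: elem_scale.
by apply/funext => x; rewrite mulN1r.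
Qed.

Lemma elem_sub f g : elem f -> elem g -> elem (fun x => f x - g x).
Proof. by move=> ef eg; apply: elem_add => //; exact: elem_opp. Qed.

Lemma elem_derive f : elem f -> exists2 f', elem f' & forall x, dv f x (f' x).
Proof.
elim => {f} [c| | |n|f g _ [f' ef' df] _ [g' eg' dg]|f g ef [f' ef' df] eg [g' eg' dg]|f f0 ef [f' ef' df]|f g ef [f' ef' df] eg [g' eg' dg]].
- by exists (fun _ => 0); [exact: elem_cst|exact: dv_cst].
- by exists (fun _ => 1); [exact: elem_cst|exact: dv_id].
- by exists expR; [exact: elem_exp|exact: is_derive_expR].
- exists (fun x => flat n.+2 x - n%:R * flat n.+1 x); last exact: dv_flat.
  by apply: elem_sub; [exact: elem_flat|apply: elem_scale; exact: elem_flat].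
- exists (fun x => f' x + g' x); first exact: elem_add.
  by move=> x; exact: dvD.
- exists (fun x => f' x * g x + f x * g' x); last by move=> x; exact: dvM.
  by apply: elem_add; exact: elem_mul.
- exists (fun x => - f' x / (f x) ^+ 2); last by move=> x; exact: dvV.
  apply: elem_mul; first exact: elem_opp.
  apply: (@elem_inv (fun x => f x * f x)); last exact: elem_mul.
  by move=> x; rewrite mulf_neq0.
- exists (fun x => f' (g x) * g' x); last by move=> x; exact: (dv_comp (dg x)).
  by apply: elem_mul => //; exact: elem_comp.
Qed.

Lemma elem_derive1 f : elem f -> elem (derive1 f).
Proof.
move=> /elem_derive [f' ef' df]; rewrite (_ : derive1 f = f')//.
by apply/funext => x; exact: dv_derive1.
Qed.

Lemma elem_dv f x : elem f -> dv f x (derive1 f x).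
Proof. by move=> /elem_derive [f' _ df]; rewrite (dv_derive1 (df x)). Qed.

Lemma elem_derive1n k f : elem f -> elem (derive1n k f).
Proof. by elim: k => [|k IH] // ef; apply: elem_derive1; exact: IH. Qed.

Lemma elem_smooth f : elem f -> smooth f.
Proof.
by move=> ef k x; have [] := elem_dv x (elem_derive1n k ef).
Qed.

Lemma elem_cont f : elem f -> continuous f.
Proof. by move=> ef x; exact: dv_cont (elem_dv x ef). Qed.

End SmoothFunctions.

Section StepsAndCutoffs.
Context {R : realType}.
Local Notation mu := (@lebesgue_measure R).
Implicit Types (f g : R -> R) (x r : R).

Lemma dv_cst_right f c r x a : (forall y, r < y -> f y = c) -> r < x ->
  dv f x a -> a = 0.
Proof.
move=> fc rx df; rewrite -(dv_derive1 df); apply: dv_derive1.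
have h : is_derive x 1 (fun _ : R => c) 0 := dv_cst c x.
apply: near_eq_is_derive h; near=> y; rewrite fc//; near: y.
exact: lt_nbhsr.
Unshelve. all: by end_near. Qed.

Lemma dv_cst_left f c r x a : (forall y, y < r -> f y = c) -> x < r ->
  dv f x a -> a = 0.
Proof.
move=> fc rx df; rewrite -(dv_derive1 df); apply: dv_derive1.
have h : is_derive x 1 (fun _ : R => c) 0 := dv_cst c x.
apply: near_eq_is_derive h; near=> y; rewrite fc//; near: y.
exact: lt_nbhsl.
Unshelve. all: by end_near. Qed.

Lemma elem_support f r : elem f -> (forall x, r < `|x| -> f x = 0) ->
  forall x, r < `|x| -> derive1 f x = 0.
Proof.
move=> ef f0 x; rewrite lter_normr => /orP[rx|rx].
- apply: (@dv_cst_right f 0 r x) => //; last exact: elem_dv.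
  by move=> y ry; rewrite f0// (lt_le_trans ry)// ler_norm.
- apply: (@dv_cst_left f 0 (- r) x) => //; last exact: elem_dv.
    by move=> y ry; rewrite f0// lter_normr; apply/orP; right; rewrite ltrNr.
  by rewrite ltrNr.
Qed.

Lemma elem_bounded f r : elem f -> (forall x, r < `|x| -> f x = 0) ->
  exists2 C, 0 <= C & forall x, `|f x| <= C.
Proof.
move=> ef f0; have [r0|r0] := ltP r 0.
  by exists 0 => // x; rewrite f0 ?normr0// (lt_le_trans r0).
have cf : {within `[- r, r], continuous (fun x => `|f x|)}.
  apply: continuous_subspaceT => x; apply: continuous_comp; first exact: elem_cont.
  exact: norm_continuous.
have rr : - r <= r by rewrite (le_trans _ r0)// oppr_le0.
have [c _ fc] := EVT_max rr cf.
exists `|f c| => // x; have [xr|xr] := leP `|x| r; last by rewrite f0 ?normr0.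
by apply: fc; rewrite in_itv/= -ler_norml.
Qed.

(** A smooth transition from 1 on [x <= -1] to 0 on [x >= 1]. The two terms of the denominator never
    vanish together, and the quotient stays in [0, 1]. *)
Definition sstep : R -> R :=
  fun x => flat 0 (1 - x) * (flat 0 (1 - x) + flat 0 (1 + x))^-1.

Lemma sstep_den_gt0 x : 0 < flat 0 (1 - x) + flat 0 (1 + x).
Proof.
have [x0|x0] := leP x 0.
  by rewrite ltr_pwDl ?flat_ge0// flat_gt0// subr_gt0 (le_lt_trans x0).
by rewrite ltr_wpDl ?flat_ge0// flat_gt0// addr_gt0.
Qed.

Lemma elem_sstep : elem sstep.
Proof.
have h1 : elem (fun x : R => flat 0 (1 - x)).
  apply: (@elem_comp _ (flat 0) (fun x => 1 - x)); first exact: elem_flat.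
  by apply: elem_sub; [exact: elem_cst|exact: elem_id].
have h2 : elem (fun x : R => flat 0 (1 + x)).
  apply: (@elem_comp _ (flat 0) (fun x => 1 + x)); first exact: elem_flat.
  by apply: elem_add; [exact: elem_cst|exact: elem_id].
apply: elem_mul => //; apply: elem_inv; last exact: elem_add.
by move=> x; rewrite gt_eqF// sstep_den_gt0.
Qed.

Lemma sstep_ge0 x : 0 <= sstep x.
Proof. by rewrite mulr_ge0 ?flat_ge0// invr_ge0 ltW// sstep_den_gt0. Qed.

Lemma sstep_le1 x : sstep x <= 1.
Proof. by rewrite /sstep ler_pdivrMr ?sstep_den_gt0// mul1r lerDl flat_ge0. Qed.

Lemma sstep1 x : x <= -1 -> sstep x = 1.
Proof.
move=> x1; have := sstep_den_gt0 x; rewrite /sstep (@flat_le0 _ _ (1 + x)); last lra.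
by rewrite addr0 => /gt_eqF h; rewrite divff// h.
Qed.

Lemma sstep0 x : 1 <= x -> sstep x = 0.
Proof. by move=> x1; rewrite /sstep (@flat_le0 _ _ (1 - x)) ?mul0r//; lra. Qed.

Lemma sstep'0 x : 1 < `|x| -> derive1 sstep x = 0.
Proof.
rewrite lter_normr => /orP[x1|x1].
- apply: (@dv_cst_right sstep 0 1 x) => //; last exact/elem_dv/elem_sstep.
  by move=> y y1; rewrite sstep0// ltW.
- apply: (@dv_cst_left sstep 1 (-1) x) => //; last exact/elem_dv/elem_sstep.
    by move=> y y1; rewrite sstep1// ltW.
  by rewrite ltrNr.
Qed.

(** The shift by 2 makes both factors equal to 1 on [[-1, 1]], while one of them vanishes as soon as
    [|x| >= 3]. *)
Definition cutoff : R -> R := fun x => sstep (x - 2) * sstep (- x - 2).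

Lemma elem_cutoff : elem cutoff.
Proof.
apply: elem_mul; apply: (@elem_comp _ sstep); try exact: elem_sstep.
  by apply: elem_sub; [exact: elem_id|exact: elem_cst].
by apply: elem_sub; [apply: elem_opp; exact: elem_id|exact: elem_cst].
Qed.

Lemma cutoff1 x : `|x| <= 1 -> cutoff x = 1.
Proof.
by rewrite ler_norml => /andP[x1 x2]; rewrite /cutoff !sstep1 ?mulr1//; lra.
Qed.

Lemma cutoff0 x : 3 < `|x| -> cutoff x = 0.
Proof.
rewrite lter_normr => /orP[x1|x1]; rewrite /cutoff.
  by rewrite sstep0 ?mul0r//; lra.
by rewrite (@sstep0 (- x - 2)) ?mulr0//; lra.
Qed.

Lemma cutoff_ge0 x : 0 <= cutoff x.
Proof. by rewrite mulr_ge0 ?sstep_ge0. Qed.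

Lemma cutoff_le1 x : cutoff x <= 1.
Proof. by rewrite mulr_ile1 ?sstep_ge0 ?sstep_le1. Qed.

(** Because of this, truncation by a rescaled cutoff is eventually exact at each point, together
    with two derivatives; pointwise limits are then limits of eventually constant sequences. *)
Lemma cutoff_flat x : `|x| < 1 -> derive1 cutoff x = 0 /\ derive1n 2 cutoff x = 0.
Proof.
have h y : `|y| < 1 -> derive1 cutoff y = 0.
  move=> y1; apply: dv_derive1.
  have h : is_derive y 1 (fun _ : R => 1 : R) 0 := dv_cst 1 y.
  apply: near_eq_is_derive h; near=> z; rewrite cutoff1// ltW//; near: z.
  by move: y1; apply: cvgr_norm_lt; exact: cvg_id.
move=> x1; split; first exact: h.
rewrite /derive1n /=; apply: dv_derive1.
have h0 : is_derive x 1 (fun _ : R => 0 : R) 0 := dv_cst 0 x.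
apply: near_eq_is_derive h0; near=> z; rewrite h//; near: z.
by move: x1; apply: cvgr_norm_lt; exact: cvg_id.
Unshelve. all: by end_near. Qed.

Lemma cutoff_bounds : exists2 C, 0 <= C &
  forall x, `|derive1 cutoff x| <= C /\ `|derive1n 2 cutoff x| <= C.
Proof.
have s1 := elem_support elem_cutoff cutoff0.
have s2 := elem_support (elem_derive1 elem_cutoff) s1.
have [C1 C10 h1] := elem_bounded (elem_derive1 elem_cutoff) s1.
have [C2 C20 h2] := elem_bounded (elem_derive1 (elem_derive1 elem_cutoff)) s2.
exists (C1 + C2); first exact: addr_ge0.
by move=> x; rewrite (le_trans (h1 x)) ?lerDl// (le_trans (h2 x)) ?lerDr.
Qed.

(** The induction closes because both partial derivatives of a product of two [elem] functions are
    again such products. *)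
Lemma Cn2_tensor n a b : elem a -> elem b -> Cn2 n (fun t x : R => a t * b x).
Proof.
have cont f g : elem f -> elem g -> continuous (fun p : R * R => f p.1 * g p.2).
  move=> ef eg p; apply: cvgM.
    by apply: (@cvg_comp _ _ _ fst f); [exact: cvg_fst|exact: elem_cont].
  by apply: (@cvg_comp _ _ _ snd g); [exact: cvg_snd|exact: elem_cont].
elim: n a b => [|n IH] a b ea eb; first by split=> //; exact: cont.
split; first exact: cont.
have dt t x : dv (fun t => a t * b x) t (derive1 a t * b x).
  apply: dv_eq (dvM (elem_dv t ea) (dv_cst (b x) t)) _.
  by rewrite mulr0 addr0.
have dx t x : dv (fun x => a t * b x) x (a t * derive1 b x).
  exact: dvZ (elem_dv x eb).
split.
- by move=> t x; have [] := dt t x.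
- by move=> t x; have [] := dx t x.
- rewrite (_ : pdt _ = (fun t x => derive1 a t * b x)).
    by apply: IH => //; exact: elem_derive1.
  by apply/funext => t; apply/funext => x; exact: dv_derive1.
- rewrite (_ : pdx _ = (fun t x => a t * derive1 b x)).
    by apply: IH => //; exact: elem_derive1.
  by apply/funext => t; apply/funext => x; exact: dv_derive1.
Qed.

Lemma tensor_test (T A B r : R) a b : elem a -> elem b -> B < T ->
  (forall t, ~~ (A <= t <= B) -> a t = 0) -> (forall x, r < `|x| -> b x = 0) ->
  spacetime_test_function T (fun t x : R => a t * b x).
Proof.
move=> ea eb BT a0 b0; split; first by move=> n; exact: Cn2_tensor.
exists (`[A, B] `*` `[- r, r]); split.
- by apply: compact_setX; exact: segment_compact.
- by move=> [t x] [/= + _]; rewrite in_itv/= => /andP[_ /le_lt_trans]; exact.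
- move=> t x ntx; have [tAB|/a0 ->] := boolP (A <= t <= B); last by rewrite mul0r.
  rewrite b0 ?mulr0// ltNge; apply/negP => xr; apply: ntx; split => /=.
    by rewrite in_itv.
  by rewrite in_itv/= -ler_norml.
Qed.

End StepsAndCutoffs.

(** * Smoothed steps in time and weak derivatives *)

Section WeakTimeDerivative.
Context {R : realType}.
Local Notation mu := (@lebesgue_measure R).
Implicit Types (a b f g : R -> R) (s t d : R).

Lemma mu_itvcc (x y : R) : x <= y -> mu `[x, y] = (y - x)%:E.
Proof. by move=> xy; rewrite lebesgue_measure_itv/= lte_fin; case: ltgtP xy => // -> _; rewrite subrr. Qed.

Lemma Rint_cst_itv (x y c : R) : x <= y -> \int[mu]_(t in `[x, y]) c = c * (y - x).
Proof. by move=> xy; rewrite Rintegral_cst//= (mu_itvcc xy). Qed.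

Lemma intg_cst_itv (x y c : R) : intg mu `[x, y] (fun _ => c).
Proof. by apply: intg_cont => z; exact: cvg_cst. Qed.

Lemma ae_neq s : {ae mu, forall t : R, t != s}.
Proof.
exists [set s]; split => //; first exact: lebesgue_measure_set1.
by move=> x /= /negP; rewrite negbK => /eqP.
Qed.

(** The transition takes place within distance [d / (n + 1)] of [s], so [d] confines it to
    [[s - d, s + d]] for all [n] at once. *)
Definition tstep d s (n : nat) : R -> R := fun t => sstep (n.+1%:R / d * (t - s)).

Lemma elem_tstep d s n : elem (tstep d s n).
Proof.
apply: (@elem_comp _ sstep); first exact: elem_sstep.
by apply: elem_scale; apply: elem_sub; [exact: elem_id|exact: elem_cst].
Qed.

Lemma tstep'E d s n t : derive1 (tstep d s n) t =
  derive1 sstep (n.+1%:R / d * (t - s)) * (n.+1%:R / d).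
Proof.
apply: dv_derive1; apply: dv_comp; last exact/elem_dv/elem_sstep.
by apply: dv_eq (dvZ _ (dvB (dv_id t) (dv_cst s t))) _; rewrite subr0 mulr1.
Qed.

Lemma tstep1 d s n t : 0 < d -> t <= s - d / n.+1%:R -> tstep d s n t = 1.
Proof.
move=> d0 ts; apply: sstep1; rewrite -[X in X * _]invf_div mulrC ler_pdivrMr ?divr_gt0//.
by move: ts; set q := d / _ => ts; rewrite mulN1r; lra.
Qed.

Lemma tstep0 d s n t : 0 < d -> s + d / n.+1%:R <= t -> tstep d s n t = 0.
Proof.
move=> d0 ts; apply: sstep0; rewrite -[X in X * _]invf_div mulrC ler_pdivlMr ?divr_gt0//.
by move: ts; set q := d / _ => ts; rewrite mul1r; lra.
Qed.

Lemma tstep'0 d s n t : 0 < d -> d / n.+1%:R < `|t - s| ->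
  derive1 (tstep d s n) t = 0.
Proof.
move=> d0 ts; rewrite tstep'E sstep'0 ?mul0r//.
rewrite normrM gtr0_norm ?divr_gt0// -[X in X * _]invf_div mulrC.
by rewrite ltr_pdivlMr ?divr_gt0// mul1r.
Qed.

Lemma tstep_bound d s n t : `|tstep d s n t| <= 1.
Proof. by rewrite ger0_norm ?sstep_ge0 ?sstep_le1. Qed.

Lemma tstep_cvg d s t : 0 < d -> t != s ->
  tstep d s n t @[n --> \oo] --> (if t < s then 1 else 0 : R).
Proof.
move=> d0 ts; case: ifPn => [st|]; last rewrite -leNgt le_eqVlt eq_sym (negbTE ts)/= => st.
- have h : \forall n \near \oo, tstep d s n t = 1.
    have st0 : 0 < s - t by rewrite subr_gt0.
    have /cvgrPdist_lt/(_ _ st0) := cvg_harm d; apply: filterS => n.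
    rewrite sub0r normrN gtr0_norm ?divr_gt0// => hn; apply: tstep1 => //.
    by rewrite lerBrDr -lerBrDl ltW.
  exact: cvg_near_cst.
- have h : \forall n \near \oo, tstep d s n t = 0.
    have st0 : 0 < t - s by rewrite subr_gt0.
    have /cvgrPdist_lt/(_ _ st0) := cvg_harm d; apply: filterS => n.
    rewrite sub0r normrN gtr0_norm ?divr_gt0// => hn; apply: tstep0 => //.
    by rewrite -lerBrDl ltW.
  exact: cvg_near_cst.
Qed.

Lemma tstep'_bound : exists2 C, 0 <= C &
  forall d s n t, 0 < d -> `|derive1 (tstep d s n) t| <= C * (n.+1%:R / d).
Proof.
have [C C0 h] := elem_bounded (elem_derive1 (@elem_sstep R)) (@sstep'0 R).
exists C => // d s n t d0; rewrite tstep'E normrM.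
have q0 : 0 <= n.+1%:R / d by rewrite divr_ge0 ?ltW.
by rewrite (ger0_norm q0) ler_wpM2r.
Qed.

(** Minus the derivative of the step has mass one and concentrates at [s]. In place of a sign, the
    proof uses the bound [C (n + 1) / d] of the derivative on an interval of length [2 d / (n + 1)];
    their product is the constant [2 C] in the choice of [e']. *)
Lemma tstep'_cvg d s a : 0 < d -> intg mu `[s - d, s + d] a ->
  {for s, continuous a} ->
  \int[mu]_(t in `[s - d, s + d]) (a t * derive1 (tstep d s n) t) @[n --> \oo] --> - a s.
Proof.
move=> d0 ia ca; have [C C0 hC] := tstep'_bound.
pose J := `[s - d, s + d] : set R.
have mJ : measurable J by exact: measurable_itv.
have cphi n : continuous (derive1 (tstep d s n)) by exact/elem_cont/elem_derive1/elem_tstep.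
have iphi n : intg mu J (derive1 (tstep d s n)) by exact: intg_cont.
have dn0 n : 0 < d / n.+1%:R by rewrite divr_gt0.
have dnd n : d / n.+1%:R <= d.
  by rewrite ler_pdivrMr// ler_peMr ?(ltW d0)// ler1n.
have Iphi n : \int[mu]_(t in J) derive1 (tstep d s n) t = -1.
  rewrite (@ftc_itv _ (tstep d s n))//.
  - rewrite tstep0//; last by rewrite lerD2l.
    by rewrite tstep1// ?sub0r// lerB.
  - by move=> x; exact/elem_dv/elem_tstep.
  - lra.
have iaphi n : intg mu J (fun t => a t * derive1 (tstep d s n) t).
  apply: (@intg_le _ _ _ mu _ _ (fun t => C * (n.+1%:R / d) * `|a t|)) => //.
  - apply: measurable_funM; first exact: intg_meas ia.
    exact: intg_meas (iphi n).
  - by move=> t _; rewrite normrM mulrC ler_wpM2r// hC.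
  - by apply: intgZ => //; exact: intg_norm.
apply/cvgrPdist_le => e e0.
pose e' := e / (2 * C + 1).
have C1 : 0 < 2 * C + 1 by lra.
have e'0 : 0 < e' by rewrite divr_gt0.
have /cvgrPdist_le/(_ _ e'0) [r /= r0 hr] := ca.
have /cvgrPdist_lt/(_ _ r0) := cvg_harm d; apply: filterS => n.
rewrite sub0r normrN gtr0_norm// => dr.
have -> : - a s = \int[mu]_(t in J) (a s * derive1 (tstep d s n) t).
  by rewrite RintegralZl// Iphi mulrN1.
rewrite -RintegralB//; last exact: intgZ.
pose I := `[s - d / n.+1%:R, s + d / n.+1%:R] : set R.
have IJ : I `<=` J.
  move=> t; rewrite /I /J /= !in_itv/= => /andP[h1 h2].
  move: h1 h2 (dnd n); set q := d / _ => h1 h2 h3.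
  by apply/andP; split; lra.
have mI : measurable I by exact: measurable_itv.
rewrite (@Rint_supp _ _ _ mu I J)//; last first.
  move=> t Jt nIt; rewrite -mulrBl tstep'0 ?mulr0//.
  by rewrite ltNge ler_distl; apply/negP => h; apply: nIt; rewrite /I /= in_itv.
have igI : intg mu I (fun t => a s * derive1 (tstep d s n) t - a t * derive1 (tstep d s n) t).
  apply: (@integrableS _ _ _ mu J) => //.
  by apply: intgB => //; exact: intgZ.
have hI : forall t, I t -> `|a s * derive1 (tstep d s n) t - a t * derive1 (tstep d s n) t|
    <= e' * (C * (n.+1%:R / d)).
  move=> t It; rewrite -mulrBl normrM ler_pM// ?hC//.
  apply: hr => /=; apply: le_lt_trans dr.
  by move: It; rewrite /I /= in_itv/= -ler_distl distrC.
apply: (le_trans (@Rint_le_norm _ _ _ mu _ _ _ mI igI (intg_cst_itv _ _ _) hI)).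
rewrite Rint_cst_itv; last by move: (dn0 n); set q := d / _ => q0; lra.
have -> : e' * (C * (n.+1%:R / d)) * (s + d / n.+1%:R - (s - d / n.+1%:R)) = e' * (2 * C).
  have n0 : n.+1%:R != 0 :> R by rewrite pnatr_eq0.
  by move: n0; move: (n.+1%:R : R) => m n0; field; rewrite n0 gt_eqF.
by rewrite /e' mulrAC ler_pdivrMr// ler_wpM2l// ?ltW//; lra.
Qed.

Lemma tstep_int_cvg d s b (D : set R) : measurable D -> 0 < d -> intg mu D b ->
  \int[mu]_(t in D) (b t * tstep d s n t) @[n --> \oo] -->
  \int[mu]_(t in D `&` `]-oo, s]) b t.
Proof.
move=> mD d0 ib; rewrite Rintegral_mkcondr.
apply: (proj2 (@dct _ _ _ mu D _ _ (fun t => `|b t|) mD _ _ _ _ _)).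
- move=> n; apply: measurable_funM; first exact: intg_meas ib.
  by apply: measurable_funTS; apply: cont_meas; exact/elem_cont/elem_tstep.
- have mI : measurable (`]-oo, s] : set R) by exact: measurable_itv.
  have h := proj1 (measurable_restrict b mI mD).
  by apply: h; apply: measurable_funS (intg_meas ib) => //; exact: subIsetl.
- apply: ae_mono (ae_neq s) => t ts Dt; rewrite patchE.
  have := tstep_cvg d0 ts => /(cvgM (cvg_cst (b t))).
  congr (_ --> _); rewrite mem_setE in_itv/=.
  by have [st|st|e] := ltgtP t s; rewrite ?mulr1 ?mulr0//; rewrite e eqxx in ts.
- exact: intg_norm.
- by move=> n t Dt; rewrite normrM ler_piMr ?tstep_bound.
Qed.

(** This difference of steps is a smooth approximation of the indicator of []s, t]]; testing a weak
    derivative with it gives the fundamental theorem of calculus in the limit. *)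
Lemma bump_test d s t n (U : set R) : 0 < d -> s <= t -> `[s - d, t + d] `<=` U ->
  test_function U (fun x => tstep d t n x - tstep d s n x).
Proof.
move=> d0 st dU; have dnd : d / n.+1%:R <= d.
  by rewrite ler_pdivrMr// ler_peMr ?(ltW d0)// ler1n.
split; first by apply: elem_smooth; apply: elem_sub; exact: elem_tstep.
exists `[s - d, t + d]; split => //; first exact: segment_compact.
move=> x; rewrite /= in_itv/= => /negP; rewrite negb_and -!ltNge ; move: dnd; set q := d / _ => dnd /orP[h|h].
  by rewrite !tstep1 ?subrr//; rewrite -/q; lra.
by rewrite !tstep0 ?subrr//; rewrite -/q; lra.
Qed.

End WeakTimeDerivative.

Section WeakDerivatives.
Context {R : realType}.
Local Notation mu := (@lebesgue_measure R).
Implicit Types (f g l dl : R -> R) (s t : R).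

Lemma locally_intg (U : set R) f a b : locally_integrable U f ->
  `[a, b] `<=` U -> intg mu `[a, b] f.
Proof.
move=> [mf oU fK] abU; apply/integrableP; split.
  apply/measurable_EFinP; apply: measurable_funS mf => //.
  exact: open_measurable.
by apply: fK => //; exact: segment_compact.
Qed.

Lemma Rint_itv_diff f a b c : a <= b -> b <= c -> intg mu `[a, c] f ->
  \int[mu]_(x in `[a, c] `&` `]-oo, c]) f x -
  \int[mu]_(x in `[a, c] `&` `]-oo, b]) f x = \int[mu]_(x in `]b, c]) f x.
Proof.
move=> ab bc fi.
have e1 : `[a, c] `&` `]-oo, c] = `[a, c] :> set R.
  apply/seteqP; split=> x /=; rewrite !in_itv/=; first by case.
  by move=> h; split=> //; case/andP: h.
have e2 : `[a, c] `&` `]-oo, b] = `[a, b] :> set R.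
  apply/seteqP; split=> x /=; rewrite !in_itv/=.
    by move=> [/andP[-> _] ->].
  by move=> /andP[-> xb]; split=> //; exact: le_trans bc.
by rewrite e1 e2 Rintegral_itvB// bnd_simp.
Qed.

(** Test with [bump_test] and let [n] grow: by [tstep'_cvg], continuity at the two endpoints turns
    the side of [f] into point values, and [tstep_int_cvg] turns the side of [g] into an integral
    over the interval. *)
Lemma weak_derivative_itv (U : set R) f g s t d : weak_derivative U f g -> 0 < d ->
  s <= t -> `[s - d, t + d] `<=` U -> {for s, continuous f} ->
  {for t, continuous f} -> f t - f s = \int[mu]_(x in `]s, t]) g x.
Proof.
move=> [lf lg fg] d0 st dU cs ct.
pose J := `[s - d, t + d] : set R.
have mJ : measurable J by exact: measurable_itv.
have sub x : (s <= x <= t) -> `[x - d, x + d] `<=` J.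
  move=> /andP[sx xt] y; rewrite /J /= !in_itv/= => /andP[h1 h2].
  by apply/andP; split; lra.
have iJf := locally_intg lf dU; have iJg := locally_intg lg dU.
have Us x : (s <= x <= t) -> `[x - d, x + d] `<=` U.
  by move=> xst; exact: subset_trans (sub x xst) dU.
have sst : s <= s <= t by rewrite lexx.
have tst : s <= t <= t by rewrite st lexx.
pose p n x := tstep d t n x - tstep d s n x.
have ep n : elem (p n) by apply: elem_sub; exact: elem_tstep.
have p0 n x : U x -> ~ J x -> p n x = 0.
  move=> _; rewrite /J /= in_itv/= => /negP; rewrite negb_and -!ltNge /p.
  have dnd : d / n.+1%:R <= d by rewrite ler_pdivrMr// ler_peMr ?(ltW d0)// ler1n.
  move: dnd; set q := d / _ => dnd /orP[h|h].
    by rewrite !tstep1 ?subrr//; rewrite -/q; lra.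
  by rewrite !tstep0 ?subrr//; rewrite -/q; lra.
have p'E n x : derive1 (p n) x = derive1 (tstep d t n) x - derive1 (tstep d s n) x.
  by apply: dv_derive1; apply: dvB; exact/elem_dv/elem_tstep.
have t'0 n r x : s <= r <= t -> U x -> ~ `[r - d, r + d] x -> derive1 (tstep d r n) x = 0.
  move=> rst Ux nx; apply: tstep'0 => //.
  have dnd : d / n.+1%:R <= d by rewrite ler_pdivrMr// ler_peMr ?(ltW d0)// ler1n.
  apply: (le_lt_trans dnd); rewrite ltNge ler_distl; apply/negP => h.
  by apply: nx; rewrite /= in_itv.
have ift' n r : s <= r <= t -> intg mu J (fun x => f x * derive1 (tstep d r n) x).
  move=> rst; have [C C0 hC] := @tstep'_bound R.
  apply: (@intg_le _ _ _ mu _ _ (fun x => C * (n.+1%:R / d) * `|f x|)) => //.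
  - apply: measurable_funM; first exact: intg_meas iJf.
    by apply: measurable_funTS; apply: cont_meas; exact/elem_cont/elem_derive1/elem_tstep.
  - by move=> x _; rewrite normrM mulrC ler_wpM2r// hC.
  - by apply: intgZ => //; exact: intg_norm.
have igt n r : intg mu J (fun x => g x * tstep d r n x).
  apply: (@intg_le _ _ _ mu _ _ (fun x => `|g x|)) => //.
  - apply: measurable_funM; first exact: intg_meas iJg.
    by apply: measurable_funTS; apply: cont_meas; exact/elem_cont/elem_tstep.
  - by move=> x _; rewrite normrM ler_piMr// tstep_bound.
  - exact: intg_norm.
have E n : \int[mu]_(x in J) (f x * derive1 (tstep d t n) x) -
           \int[mu]_(x in J) (f x * derive1 (tstep d s n) x) =
         - (\int[mu]_(x in J) (g x * tstep d t n x) -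
            \int[mu]_(x in J) (g x * tstep d s n x)).
  have := fg _ (bump_test n d0 st dU).
  rewrite (@Rint_supp _ _ _ mu J U)//; last first.
    move=> x Ux nJ; rewrite p'E !t'0 ?subrr ?mulr0//.
      by move=> h; apply: nJ; exact: (sub s).
    by move=> h; apply: nJ; exact: (sub t).
  rewrite (@Rint_supp _ _ _ mu J U)//; last first.
    by move=> x Ux nJ; rewrite -/(p n x) p0 ?mulr0.
  rewrite -(@RintegralB _ _ _ mu)//; [|exact: ift'|exact: ift'].
  rewrite -(@RintegralB _ _ _ mu)// => h.
  have -> : \int[mu]_(x in J) (f x * derive1 (tstep d t n) x - f x * derive1 (tstep d s n) x)
     = \int[mu]_(x in J) (f x * derive1 (p n) x).
    by apply: eq_Rintegral => x _; rewrite p'E mulrBr.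
  rewrite h; congr (- _); apply: eq_Rintegral => x _.
  by rewrite mulrBr.
have L r : s <= r <= t -> {for r, continuous f} ->
    \int[mu]_(x in J) (f x * derive1 (tstep d r n) x) @[n --> \oo] --> - f r.
  move=> rst cr.
  under eq_fun do rewrite (@Rint_supp _ _ _ mu _ J _ (sub r rst) (fun x Jx nx =>
    etrans (congr1 (fun z => f x * z) (t'0 _ r x rst (dU x Jx) nx)) (mulr0 _))).
  by apply: tstep'_cvg => //; apply: (locally_intg lf); exact: Us.
have L1 : \int[mu]_(x in J) (f x * derive1 (tstep d t n) x) -
    \int[mu]_(x in J) (f x * derive1 (tstep d s n) x) @[n --> \oo] --> - f t - - f s.
  by apply: cvgB; exact: L.
have L2 : - (\int[mu]_(x in J) (g x * tstep d t n x) -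
    \int[mu]_(x in J) (g x * tstep d s n x)) @[n --> \oo] -->
    - (\int[mu]_(x in J `&` `]-oo, t]) g x - \int[mu]_(x in J `&` `]-oo, s]) g x).
  by apply: cvgN; apply: cvgB; exact: tstep_int_cvg.
have e : - f t - - f s = - (\int[mu]_(x in J `&` `]-oo, t]) g x -
    \int[mu]_(x in J `&` `]-oo, s]) g x).
  move: L1; under eq_fun do rewrite E; move=> L1.
  exact: (cvg_uniq L1 L2).
have {e} : f t - f s = \int[mu]_(x in J `&` `]-oo, t]) g x -
    \int[mu]_(x in J `&` `]-oo, s]) g x by lra.
move=> ->; have e1 r : r <= t -> J `&` `]-oo, r] = `[s - d, t] `&` `]-oo, r] :> set R.
  move=> rt; apply/seteqP; split=> x; rewrite /J /= !in_itv/=.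
    by move=> [/andP[-> _] xr]; split=> //; exact: le_trans rt.
  by move=> [/andP[-> xt] xr]; split=> //=; lra.
rewrite !e1//; apply: Rint_itv_diff => //; first lra.
apply: (@integrableS _ _ _ mu J) => //.
by move=> x; rewrite /J /= !in_itv/= => /andP[-> xt] /=; lra.
Qed.

(** On each half-line []-n, +oo[] the primitive vanishes, so Lebesgue's differentiation theorem
    gives [f = 0] almost everywhere there; a countable intersection concludes. *)
Lemma ae_eq0_of_itv f : locally_integrable setT f ->
  (forall a b, a <= b -> \int[mu]_(x in `]a, b]) f x = 0) -> {ae mu, forall x, f x = 0}.
Proof.
move=> lf f0.
have h (n : nat) : {ae mu, forall x, - n%:R < x -> f x = 0}.
  have fi y : intg mu [set` Interval (BRight (- n%:R)) (BRight y)] f.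
    apply: (@integrableS _ _ _ mu `[- n%:R, y]) => //.
      by move=> x /=; rewrite !in_itv/= => /andP[/ltW -> ->].
    exact: (locally_intg lf).
  apply: ae_mono (FTC1 fi lf) => x hx nx; have [_ <-] := hx nx.
  rewrite (_ : (fun _ => _) = cst 0) ?derive1_cst//.
  apply/funext => y; have [ny|/ltW yn] := leP (- n%:R) y; first exact: f0.
  by rewrite set_itv_ge ?Rintegral_set0// bnd_simp -leNgt.
have := ae_foralln h; apply: ae_mono => x hx.
apply: (hx (Num.truncn `|x|).+1).
rewrite ltrNl (le_lt_trans (ler_norm _))// normrN.
exact: truncnS_gt.
Qed.

(** The difference [g1 - g2] is a weak derivative of the zero function, hence has zero integral over
    every interval. Since [dissipation] picks some weak derivative by [xget], uniqueness is what
    allows computing with the classical one. *)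
Lemma weak_derivative_unique f g1 g2 : weak_derivative setT f g1 ->
  weak_derivative setT f g2 -> {ae mu, forall x, g1 x = g2 x}.
Proof.
move=> [lf lg1 fg1] [_ lg2 fg2].
have lg : locally_integrable setT (fun x => g1 x - g2 x) by exact: locally_integrableB.
suff h : {ae mu, forall x, g1 x - g2 x = 0}.
  by apply: ae_mono h => x /eqP; rewrite subr_eq0 => /eqP.
apply: ae_eq0_of_itv => // a b ab.
have w0 : weak_derivative setT (fun _ => 0) (fun x => g1 x - g2 x).
  split=> //.
    split; [exact: measurable_cst|exact: openT|].
    move=> K _ cK; under eq_integral do rewrite normr0.
    by rewrite integral0.
  move=> p tp; have [sp [K [cK _ pK]]] := tp.
  have e1 := fg1 p tp; have e2 := fg2 p tp.
  have mK : measurable K by exact: compact_measurable.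
  have sK (g : R -> R) : \int[mu]_x (g x * p x) = \int[mu]_(x in K) (g x * p x).
    by apply: (@Rint_supp _ _ _ mu K setT) => // x _ Kx; rewrite pK ?mulr0.
  have cp : continuous p.
    by move=> x; apply: dv_cont (dv_of (sp 0%N x)).
  have [C [_ hC]] : exists C, C \is Num.real /\ forall x, C < x -> forall y, K y -> `|p y| <= x.
    have := compact_bounded (continuous_compact (continuous_subspaceT cp) cK).
    move=> [C [rC hC]]; exists C; split => // x Cx y Ky.
    by apply: (hC x Cx); exists y.
  have iK g : locally_integrable setT g -> intg mu K (fun x => g x * p x).
    move=> [mg _ gK].
    have ig : intg mu K g.
      apply/integrableP; split; last exact: gK.
      by apply/measurable_EFinP; exact: measurable_funTS.
    apply: (@intg_le _ _ _ mu _ _ (fun x => (C + 1) * `|g x|)) => //.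
    - apply: measurable_funM; first exact: measurable_funTS.
      by apply: measurable_funTS; exact: cont_meas.
    - move=> x Kx; rewrite normrM mulrC ler_wpM2r//; apply: hC => //.
      by rewrite ltrDl.
    - by apply: intgZ => //; exact: intg_norm.
  rewrite [LHS](_ : _ = 0); last first.
    rewrite /Rintegral (eq_integral (cst 0%E)) ?integral0// => x _ /=.
    by rewrite mul0r.
  rewrite sK; under eq_Rintegral do rewrite mulrBl.
  rewrite RintegralB//; [|exact: iK|exact: iK].
  by rewrite -!sK -[X in X - _]opprK -e1 -[X in _ - X]opprK -e2; lra.
have := @weak_derivative_itv setT (fun _ => 0) _ a b 1 w0 ltr01 ab.
by rewrite subrr => <-//; exact: cvg_cst.
Qed.

End WeakDerivatives.

(** * Densities with finite second moment *)

Section SecondMoments.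
Context {R : realType}.
Local Notation mu := (@lebesgue_measure R).
Implicit Types (g rho : R -> R).

Lemma P2_meas rho : P2 rho -> measurable_fun setT rho.
Proof. by case. Qed.

Lemma P2_ge0 rho x : P2 rho -> 0 <= rho x.
Proof. by case=> _ /(_ x). Qed.

Lemma P2_intg1 rho : P2 rho -> intg mu setT rho.
Proof.
by move=> [m p e _]; apply: intg_ge0 => //; rewrite e ltry.
Qed.

Lemma P2_mass rho : P2 rho -> \int[mu]_x rho x = 1.
Proof. by move=> [_ _ e _]; rewrite /Rintegral e. Qed.

Lemma P2_intg2 rho : P2 rho -> intg mu setT (fun x => x ^+ 2 * rho x).
Proof.
move=> [m p _ e]; apply: intg_ge0 => //.
- by apply: measurable_funM => //; exact: measurable_funX.
- by move=> x _; rewrite mulr_ge0 ?sqr_ge0.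
Qed.

Definition mom2 rho : R := \int[mu]_x (x ^+ 2 * rho x).

Lemma mom2_ge0 rho : P2 rho -> 0 <= mom2 rho.
Proof. by move=> h; apply: Rintegral_ge0 => x _; rewrite mulr_ge0 ?sqr_ge0 ?P2_ge0. Qed.

Lemma P2_intg12 rho : P2 rho -> intg mu setT (fun x => (1 + x ^+ 2) * rho x).
Proof.
move=> h; apply: (@intg_eq _ _ _ mu _ (fun x => rho x + x ^+ 2 * rho x)) => //.
  by move=> x _; rewrite mulrDl mul1r.
by apply: intgD => //; [exact: P2_intg1|exact: P2_intg2].
Qed.

Lemma P2_intg rho g (C : R) : P2 rho -> measurable_fun setT g ->
  (forall x, `|g x| <= C * (1 + x ^+ 2)) -> intg mu setT (fun x => g x * rho x).
Proof.
move=> h mg gC; apply: (@intg_le _ _ _ mu _ _ (fun x => C * ((1 + x ^+ 2) * rho x))) => //.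
- by apply: measurable_funM => //; exact: P2_meas.
- move=> x _; rewrite normrM (ger0_norm (P2_ge0 x h)) mulrA ler_wpM2r//.
  exact: P2_ge0.
- by apply: intgZ => //; exact: P2_intg12.
Qed.

Lemma P2_le rho g (C : R) : P2 rho -> measurable_fun setT g ->
  (forall x, `|g x| <= C * (1 + x ^+ 2)) ->
  `|\int[mu]_x (g x * rho x)| <= C * (1 + mom2 rho).
Proof.
move=> h mg gC.
have -> : C * (1 + mom2 rho) = \int[mu]_x (C * ((1 + x ^+ 2) * rho x)).
  rewrite RintegralZl//; last exact: P2_intg12.
  congr (_ * _); under eq_Rintegral do rewrite mulrDl mul1r.
  by rewrite (RintegralD measurableT (P2_intg1 h) (P2_intg2 h)) P2_mass.
apply: (@Rint_le_norm _ _ _ mu) => //.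
- exact: P2_intg gC.
- by apply: intgZ => //; exact: P2_intg12.
move=> x _; rewrite normrM (ger0_norm (P2_ge0 x h)) mulrA ler_wpM2r//.
exact: P2_ge0.
Qed.

Lemma bdd_quad (C x y : R) : `|y| <= C -> `|y| <= C * (1 + x ^+ 2).
Proof.
move=> yC; apply: (le_trans yC); rewrite ler_peMr ?lerDl ?sqr_ge0//.
exact: le_trans yC.
Qed.

(** The weight [1 + x ^+ 2] serves as the common growth scale, being integrable against every
    density in [P2]; the factor 2 comes from [1 + z <= 2 (1 + z^2)]. *)
Lemma lin_quad (C x y : R) : `|y| <= C * (1 + `|x|) -> `|y| <= (2 * C) * (1 + x ^+ 2).
Proof.
move=> yC; apply: (le_trans yC).
have C0 : 0 <= C.
  have x1 : 0 < 1 + `|x| by apply: ltr_pwDl.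
  by have := le_trans (normr_ge0 _) yC; rewrite pmulr_lge0.
rewrite (mulrC 2) -mulrA ler_wpM2l// -(real_normK (num_real x)).
by have := sqr_ge0 (`|x| - 4^-1); move: (`|x|) => z h; lra.
Qed.

Lemma P2_bdd rho g (C : R) : P2 rho -> measurable_fun setT g ->
  (forall x, `|g x| <= C) -> `|\int[mu]_x (g x * rho x)| <= C.
Proof.
move=> h mg gC.
have -> : C = \int[mu]_x (C * rho x).
  by rewrite RintegralZl// ?P2_mass ?mulr1//; exact: P2_intg1.
apply: (@Rint_le_norm _ _ _ mu) => //.
- by apply: (P2_intg (C := C)) => // x; exact: bdd_quad.
- by apply: intgZ => //; exact: P2_intg1.
by move=> x _; rewrite normrM (ger0_norm (P2_ge0 x h)) ler_wpM2r// P2_ge0.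
Qed.

End SecondMoments.

(** * From compactly supported to slowly varying test functions *)

Section WeakIdentity.
Context {R : realType}.
Local Notation mu := (@lebesgue_measure R).
Implicit Types (g phi Hp sigma : R -> R) (w : R -> R -> R) (x r s t : R).

(** The weak equation for a test function that does not depend on time, integrated over [[0, t]]. *)
Definition weak_identity Hp sigma w phi : Prop := forall t, 0 <= t ->
  \int[mu]_x (phi x * w t x) - \int[mu]_x (phi x * w 0 x) =
  \int[mu]_(r in `[0, t]) (\int[mu]_x ((derive1n 2 phi x - Hp x * derive1 phi x) * w r x)
     + sigma r * \int[mu]_x (derive1 phi x * w r x)).

(** The decay of [phi'] like [1 / |x|] compensates the linear growth of the drift, so that all terms
    of [weak_identity] have bounded integrands in space. Two families matter: translates of the
    mollifier, and truncations of [x^2]. *)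
Definition moderate phi : Prop := elem phi /\
  exists C, forall x, [/\ `|phi x| <= C, (1 + `|x|) * `|derive1 phi x| <= C &
    `|derive1n 2 phi x| <= C].

Variables (Hp sigma : R -> R) (w : R -> R -> R) (CH : R).
Hypothesis cHp : continuous Hp.
Hypothesis bHp : forall x, `|Hp x| <= CH * (1 + `|x|).
Hypothesis mw : measurable_fun setT (fun p : R * R => w p.1 p.2).
Hypothesis Pw : forall t, P2 (w t).
Hypothesis isig : forall T, intg mu `[0, T] sigma.

Lemma meas_pairing g : measurable_fun setT g ->
  measurable_fun setT (fun t => \int[mu]_x (g x * w t x)).
Proof.
move=> mg; apply: (@measurable_Rint _ _ _ _ _ mu (fun p : R * R => g p.2 * w p.1 p.2)).
by apply: measurable_funM => //; exact: (measurableT_comp mg measurable_snd).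
Qed.

Lemma intg_weighted (T C : R) (b : R -> R) : measurable_fun setT b ->
  (forall r, `|b r| <= C) -> intg mu `[0, T] b /\ intg mu `[0, T] (fun r => sigma r * b r).
Proof.
move=> mb bC; split.
  apply: (@intg_le _ _ _ mu _ _ (fun _ => C)) => //; first exact: measurable_funTS.
  exact: intg_cst_itv.
apply: (@intg_le _ _ _ mu _ _ (fun r => C * `|sigma r|)) => //.
- by apply: measurable_funM; [exact: intg_meas (isig T)|exact: measurable_funTS].
- by move=> r _; rewrite normrM mulrC ler_wpM2r.
- by apply: intgZ => //; exact: intg_norm.
Qed.

Lemma CH_ge0 : 0 <= CH.
Proof.
by have := bHp 0; rewrite normr0 addr0 mulr1; apply: le_trans.
Qed.

Lemma moderate_drift phi C : elem phi ->
  (forall x, [/\ `|phi x| <= C, (1 + `|x|) * `|derive1 phi x| <= C &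
    `|derive1n 2 phi x| <= C]) ->
  [/\ measurable_fun setT (fun x => derive1n 2 phi x - Hp x * derive1 phi x),
      forall x, `|derive1n 2 phi x - Hp x * derive1 phi x| <= C + CH * C,
      measurable_fun setT (derive1 phi) & forall x, `|derive1 phi x| <= C].
Proof.
move=> ep hC; have c1 := elem_cont (elem_derive1 ep).
have c2 := elem_cont (elem_derive1n 2 ep).
split.
- apply: measurable_funB; first exact: cont_meas.
  by apply: measurable_funM; exact: cont_meas.
- move=> x; have [_ h1 h2] := hC x.
  apply: (le_trans (ler_normB _ _)); apply: lerD => //.
  rewrite normrM; apply: (le_trans (ler_wpM2r (normr_ge0 _) (bHp x))).
  by rewrite -mulrA ler_wpM2l// CH_ge0.
- exact: cont_meas.
- move=> x; have [_ h1 _] := hC x; apply: le_trans h1.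
  by rewrite ler_peMl// lerDl.
Qed.

Hypothesis weak_compact : forall phi r, elem phi ->
  (forall x, r < `|x| -> phi x = 0) -> weak_identity Hp sigma w phi.

(** Multiply [phi] by the cutoff at scale [n + 1] and let [n] grow. The products are moderate with a
    constant independent of [n], so dominated convergence applies in space, and then in time with a
    majorant of the form [a + b |sigma|]. *)
Lemma weak_moderate phi : moderate phi -> weak_identity Hp sigma w phi.
Proof.
move=> [ep [C hC]] t t0.
have [D D0 hD] := @cutoff_bounds R.
pose k (n : nat) (x : R) : R := cutoff (n.+1%:R^-1 * x).
have esc (n : nat) : elem (fun x : R => n.+1%:R^-1 * x).
  by apply: elem_scale; exact: elem_id.
have ek n : elem (k n) by apply: elem_comp; [exact: elem_cutoff|exact: esc].
have dsc (n : nat) x : dv (fun x : R => n.+1%:R^-1 * x) x n.+1%:R^-1.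
  by apply: dv_eq (dvZ _ (dv_id x)) _; rewrite mulr1.
have k'E n x : derive1 (k n) x = derive1 cutoff (n.+1%:R^-1 * x) / n.+1%:R.
  by apply: dv_derive1; apply: (dv_comp (dsc n x)); exact/elem_dv/elem_cutoff.
have k''E n x : derive1n 2 (k n) x = derive1n 2 cutoff (n.+1%:R^-1 * x) / n.+1%:R / n.+1%:R.
  rewrite [LHS](_ : _ = derive1 (fun x => derive1 cutoff (n.+1%:R^-1 * x) / n.+1%:R) x).
    apply: dv_derive1; rewrite mulrC.
    apply: dv_ext (dvZ n.+1%:R^-1 (dv_comp (dsc n x) _)); first by move=> y; rewrite mulrC.
    exact/elem_dv/elem_derive1/elem_cutoff.
  by rewrite /derive1n /=; congr derive1; apply/funext => y; exact: k'E.
have C0 : 0 <= C by have [h _ _] := hC 0; exact: le_trans h.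
pose p (n : nat) (x : R) : R := k n x * phi x.
have epn n : elem (p n) by exact: elem_mul.
have p'E n x : derive1 (p n) x = derive1 (k n) x * phi x + k n x * derive1 phi x.
  by apply: dv_derive1; apply: dvM; exact: elem_dv.
have p''E n x : derive1n 2 (p n) x = derive1n 2 (k n) x * phi x +
    2 * (derive1 (k n) x * derive1 phi x) + k n x * derive1n 2 phi x.
  rewrite [LHS](_ : _ = derive1 (fun x => derive1 (k n) x * phi x + k n x * derive1 phi x) x).
    have h := dvD (dvM (elem_dv x (elem_derive1 (ek n))) (elem_dv x ep))
      (dvM (elem_dv x (ek n)) (elem_dv x (elem_derive1 ep))).
    rewrite (dv_derive1 h) !derive1nS !derive1n0.
    move: (derive1 (derive1 (k n)) x) (derive1 (k n) x) (derive1 (derive1 phi) x).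
    by move: (derive1 phi x) (k n x) (phi x) => a b c a' b' c'; ring.
  by rewrite /derive1n /=; congr derive1; apply/funext => y; exact: p'E.
have psupp n x : 3 * n.+1%:R < `|x| -> p n x = 0.
  move=> nx; rewrite /p /k cutoff0 ?mul0r// normrM ger0_norm ?invr_ge0//.
  by rewrite mulrC ltr_pdivlMr.
have kle n x : `|k n x| <= 1 by rewrite ger0_norm ?cutoff_ge0 ?cutoff_le1.
have inv1 (n : nat) : n.+1%:R^-1 <= 1 :> R by rewrite invf_le1 ?ler1n.
(* On the support, [|x| <= 3 (n + 1)], so [(1 + |x|) / (n + 1)] is at most 4. *)
have k'le n x : (1 + `|x|) * `|derive1 (k n) x| <= 4 * D.
  rewrite k'E; set y := n.+1%:R^-1 * x.
  have [y3|y3] := ltP 3 `|y|.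
    by rewrite (elem_support elem_cutoff cutoff0 y3) mul0r normr0 mulr0 mulr_ge0.
  rewrite normrM (@ger0_norm _ n.+1%:R^-1)// mulrCA (mulrC 4).
  apply: ler_pM => //; first exact: (hD y).1.
  have e : n.+1%:R^-1 * `|x| = `|y| by rewrite /y normrM ger0_norm.
  rewrite mulrDl mul1r mulrC in e *; rewrite e.
  by move: (inv1 n) y3; move: (n.+1%:R^-1 : R) `|y| => z1 z2; lra.
have k''le n x : `|derive1n 2 (k n) x| <= D.
  rewrite k''E normrM (@ger0_norm _ n.+1%:R^-1)// normrM (@ger0_norm _ n.+1%:R^-1)//.
  rewrite -mulrA -[leRHS]mulr1; apply: ler_pM => //; first exact: (hD _).2.
  by rewrite mulr_ile1.
(* A sum large enough to dominate the three bounds given by the product rule, uniformly in [n]. *)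
pose E := D * C + 2 * (4 * D * C) + C + 4 * D * C + C.
have hE n x : [/\ `|p n x| <= E, (1 + `|x|) * `|derive1 (p n) x| <= E &
    `|derive1n 2 (p n) x| <= E].
  have [h0 h1 h2] := hC x.
  have x1 : 1 <= 1 + `|x| by rewrite lerDl.
  have h1' : `|derive1 phi x| <= C by apply: le_trans h1; rewrite ler_peMl.
  have k1' : `|derive1 (k n) x| <= 4 * D.
    by apply: le_trans (k'le n x); rewrite ler_peMl.
  have DC : 0 <= D * C by rewrite mulr_ge0.
  split.
  - rewrite /p normrM (@le_trans _ _ (1 * C)) ?ler_pM// /E; lra.
  - rewrite p'E (@le_trans _ _ (4 * D * C + C))//; last by rewrite /E; lra.
    apply: (@le_trans _ _ ((1 + `|x|) * (`|derive1 (k n) x| * `|phi x| +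
       `|k n x| * `|derive1 phi x|))).
      by rewrite ler_wpM2l ?addr_ge0// (le_trans (ler_normD _ _))// !normrM.
    rewrite (_ : _ * _ = ((1 + `|x|) * `|derive1 (k n) x|) * `|phi x| +
      `|k n x| * ((1 + `|x|) * `|derive1 phi x|)); last by ring.
    apply: lerD; first by apply: ler_pM => //; rewrite mulr_ge0 ?addr_ge0.
    by rewrite -[leRHS]mul1r; apply: ler_pM => //; rewrite mulr_ge0 ?addr_ge0.
  - rewrite p''E (@le_trans _ _ (D * C + 2 * (4 * D * C) + C))//; last by rewrite /E; lra.
    apply: (le_trans (ler_normD _ _)); apply: lerD; last first.
      by rewrite normrM -[leRHS]mul1r ler_pM.
    apply: (le_trans (ler_normD _ _)); apply: lerD; first by rewrite normrM ler_pM.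
    by rewrite normrM ger0_norm// ler_wpM2l// normrM ler_pM.
have W n : weak_identity Hp sigma w (p n) by exact: weak_compact (psupp n).
have bnd n := moderate_drift (epn n) (hE n).
have bphi := moderate_drift ep hC.
have kev x : \forall n \near \oo, `|n.+1%:R^-1 * x| < 1.
  have /cvgrPdist_lt/(_ _ ltr01) := cvg_harm x; apply: filterS => n.
  by rewrite sub0r normrN mulrC.
have kc x : \forall n \near \oo, [/\ p n x = phi x, derive1 (p n) x = derive1 phi x &
    derive1n 2 (p n) x = derive1n 2 phi x].
  apply: filterS (kev x) => n hn; have [z1 z2] := cutoff_flat hn.
  have k1 : k n x = 1 by rewrite /k cutoff1// ltW.
  split; first by rewrite /p k1 mul1r.
  - by rewrite p'E k'E z1 k1 !mul0r add0r mul1r.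
  - by rewrite p''E k'E k''E z1 z2 k1 !mul0r mulr0 !add0r mul1r.
have cv (gn : nat -> R -> R) (g : R -> R) (B : R) s :
    (forall n, measurable_fun setT (gn n)) -> measurable_fun setT g ->
    (forall n x, `|gn n x| <= B) ->
    (forall x, \forall n \near \oo, gn n x = g x) ->
    \int[mu]_x (gn n x * w s x) @[n --> \oo] --> \int[mu]_x (g x * w s x).
  move=> mgn mg gB gg.
  apply: (proj2 (@dct _ _ _ mu setT _ _ (fun x => B * w s x) _ _ _ _ _ _)) => //.
  - by move=> n; apply: measurable_funM; [exact: mgn|exact: (P2_meas (Pw s))].
  - by apply: measurable_funM; [exact: mg|exact: (P2_meas (Pw s))].
  - by apply/aeW => x _; apply: cvg_near_cst; apply: filterS (gg x) => n ->.
  - by apply: intgZ => //; exact: (P2_intg1 (Pw _)).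
  - by move=> n x _; rewrite normrM (ger0_norm (P2_ge0 x (Pw s))) ler_wpM2r// P2_ge0.
have mp n : measurable_fun setT (p n) := cont_meas (elem_cont (epn n)).
have mphi : measurable_fun setT phi := cont_meas (elem_cont ep).
have La s : \int[mu]_x (p n x * w s x) @[n --> \oo] --> \int[mu]_x (phi x * w s x).
  apply: (cv _ _ E) => //; first by move=> n x; have [] := hE n x.
  by move=> x; apply: filterS (kc x) => n [].
have Lb s : \int[mu]_x ((derive1n 2 (p n) x - Hp x * derive1 (p n) x) * w s x) @[n --> \oo]
    --> \int[mu]_x ((derive1n 2 phi x - Hp x * derive1 phi x) * w s x).
  apply: (cv _ _ (E + CH * E)) => //.
  - by move=> n; have [] := bnd n.
  - by have [] := bphi.
  - by move=> n; have [] := bnd n.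
  - by move=> x; apply: filterS (kc x) => n [_ -> ->].
have Lc s : \int[mu]_x (derive1 (p n) x * w s x) @[n --> \oo]
    --> \int[mu]_x (derive1 phi x * w s x).
  apply: (cv _ _ E) => //.
  - by move=> n; have [] := bnd n.
  - by have [] := bphi.
  - by move=> n; have [] := bnd n.
  - by move=> x; apply: filterS (kc x) => n [].
have mS : measurable_fun `[0, t] sigma by exact: intg_meas (isig t).
have L2 : \int[mu]_(r in `[0, t]) (\int[mu]_x ((derive1n 2 (p n) x - Hp x * derive1 (p n) x) * w r x)
     + sigma r * \int[mu]_x (derive1 (p n) x * w r x)) @[n --> \oo] -->
   \int[mu]_(r in `[0, t]) (\int[mu]_x ((derive1n 2 phi x - Hp x * derive1 phi x) * w r x)
     + sigma r * \int[mu]_x (derive1 phi x * w r x)).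
  apply: (proj2 (@dct _ _ _ mu `[0, t] _ _ (fun r => (E + CH * E) + E * `|sigma r|) _ _ _ _ _ _)) => //.
  - move=> n; have [h1 _ h2 _] := bnd n; apply: measurable_funD.
      by apply: measurable_funTS; exact: meas_pairing.
    by apply: measurable_funM => //; apply: measurable_funTS; exact: meas_pairing.
  - have [h1 _ h2 _] := bphi; apply: measurable_funD.
      by apply: measurable_funTS; exact: meas_pairing.
    by apply: measurable_funM => //; apply: measurable_funTS; exact: meas_pairing.
  - apply/aeW => r _; apply: cvgD; first exact: Lb.
    by apply: cvgM; [exact: cvg_cst|exact: Lc].
  - apply: intgD => //; first exact: intg_cst_itv.
    by apply: intgZ => //; exact: intg_norm.
  - move=> n r _; have [h1 h2 h3 h4] := bnd n.
    apply: (le_trans (ler_normD _ _)); apply: lerD; first exact: (P2_bdd (Pw _)).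
    by rewrite normrM mulrC ler_wpM2r//; exact: (P2_bdd (Pw _)).
have L1 : \int[mu]_x (p n x * w t x) - \int[mu]_x (p n x * w 0 x) @[n --> \oo] -->
    \int[mu]_x (phi x * w t x) - \int[mu]_x (phi x * w 0 x).
  by apply: cvgB; exact: La.
move: L1; under eq_fun do rewrite (W _ t t0); move=> L1.
exact: (cvg_uniq L1 L2).
Qed.

End WeakIdentity.

(** * Quantitative confinement by the potential *)

Section Confinement.
Context {R : realType}.
Implicit Types (H : R -> R) (x y C c : R).

(** The form in which the assumptions on the potential enter all later estimates: [conf_coer] makes
    the Gibbs weights integrable, [conf_mono] propagates second moments, and [conf_lip] controls the
    commutator with the mollifier. *)
Record confining H C c : Prop := Confining {
  conf_c : 0 < c;
  conf_C : 0 <= C;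
  conf_dv : forall x, dv H x (derive1 H x);
  conf_cont : continuous (derive1 H);
  conf_lip : forall x y, `|derive1 H x - derive1 H y| <= C * `|x - y|;
  conf_lin : forall x, `|derive1 H x| <= C * (1 + `|x|);
  conf_ge0 : forall x, 0 <= H x;
  conf_quad : forall x, H x <= C * (1 + x ^+ 2);
  conf_coer : forall x, c * x ^+ 2 - C <= H x;
  conf_mono : forall x, - C <= x * derive1 H x }.

Lemma limf_einf_gt (F : set_system R) (f : R -> R) c : Filter F -> 0 < c ->
  limf_einf (fun x => (f x)%:E) F = c%:E -> \forall x \near F, c / 2 <= f x.
Proof.
move=> FF c0; rewrite limf_einfE => e.
have : ((c / 2)%:E < ereal_sup [set ereal_inf ((fun x => (f x)%:E) @` V) | V in F])%E.
  by rewrite e lte_fin; lra.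
move=> /ereal_sup_gt[_ [V FV <-]] h; apply: filterS FV => x Vx.
rewrite -lee_fin; apply: (le_trans (ltW h)).
by apply: ereal_inf_lbound; exists x.
Qed.

(** Integrate [G'' >= c] twice. The slopes [c / 2] and [c / 4], half of what integration gives,
    leave room to absorb lower-order terms; for [G] the linear term [a x] goes into
    [c / 4 x^2 + a^2 / c]. *)
Lemma half_line_bounds (G G' G'' : R -> R) (c X : R) : 0 < c -> 0 <= X ->
  (forall x, dv G x (G' x)) -> (forall x, dv G' x (G'' x)) ->
  (forall x, X <= x -> c <= G'' x) ->
  exists2 K, 0 <= K & forall x, X <= x ->
    (c / 2) * x - K <= G' x /\ (c / 4) * x ^+ 2 - K <= G x.
Proof.
move=> c0 X0 dG dG' G''c.
pose a := c * X + `|G' X|.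
have a0 : 0 <= a by rewrite addr_ge0// mulr_ge0// ltW.
have h1 x : X <= x -> c * x - a <= G' x.
  move=> Xx; have [y /andP[Xy _] e] := mvt dG' Xx.
  have : c * (x - X) <= G' x - G' X by rewrite e ler_wpM2r ?subr_ge0// G''c.
  have := lerNnormlW (lexx `|G' X|); rewrite /a; lra.
pose b := a ^+ 2 / c + `|G X| + a * X + c * X ^+ 2.
have b0 : 0 <= b.
  rewrite !addr_ge0 ?mulr_ge0 ?sqr_ge0 ?invr_ge0 ?(ltW c0)//.
exists (a + b); first exact: addr_ge0.
move=> x Xx; have x0 := le_trans X0 Xx; split.
  by apply: le_trans (h1 x Xx); have : 0 <= c * x by [rewrite mulr_ge0// ltW]; lra.
have hm : G X - (c / 2 * X ^+ 2 - a * X) <= G x - (c / 2 * x ^+ 2 - a * x).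
  apply: (@nondec_dv _ (fun z => G z - (c / 2 * z ^+ 2 - a * z))
    (fun z => G' z - (c / 2 * (2 * z) - a))) => //.
    move=> z; apply: dvB => //; apply: dvB.
      by apply: dvZ; apply: dv_eq (dvX 2 (dv_id z)) _; rewrite mulr1 expr1.
    by apply: dv_eq (dvZ a (dv_id z)) _; rewrite mulr1.
  by move=> z /andP[Xz _]; have := h1 z Xz; lra.
have q : a * x <= c / 4 * x ^+ 2 + a ^+ 2 / c.
  have h : 0 <= (x - 2 * a / c) ^+ 2 * (c / 4) by rewrite mulr_ge0 ?sqr_ge0//; lra.
  have : (x - 2 * a / c) ^+ 2 * (c / 4) = c / 4 * x ^+ 2 + a ^+ 2 / c - a * x.
    by field; rewrite gt_eqF.
  lra.
have := lerNnormlW (lexx `|G X|).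
have : 0 <= c * X ^+ 2 by rewrite mulr_ge0 ?sqr_ge0 ?(ltW c0).
have : 0 <= a * X by rewrite mulr_ge0.
rewrite /b; lra.
Qed.

Lemma potential_confining H : potential H -> exists C c, confining H C c.
Proof.
move=> [[dH _] H0 [[c1 [c10 hc1]] [c2 [c20 hc2]]] _ [C0 hC]].
have d0 x : dv H x (derive1 H x) by apply: dv_of; exact: (dH 0%N x).
have d1 x : dv (derive1 H) x (derive1n 2 H x) by apply: dv_of; exact: (dH 1%N x).
have [X1 [_ h1]] := limf_einf_gt _ c10 hc1.
have [X2 [_ h2]] := limf_einf_gt _ c20 hc2.
pose X := `|X1| + `|X2| + 1.
have X0 : 0 <= X by rewrite !addr_ge0.
have [K1 K10 b1] : exists2 K, 0 <= K & forall x, X <= x ->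
    (c1 / 2 / 2) * x - K <= derive1 H x /\ (c1 / 2 / 4) * x ^+ 2 - K <= H x.
  apply: half_line_bounds d0 d1 _ => //; first lra.
  move=> x Xx; apply: h1; apply: lt_le_trans Xx; rewrite /X.
  by have := ler_norm X1; have := normr_ge0 X2; lra.
(* The left half-line is reduced to the right one by the reflection [x -> - x]. *)
have [K2 K20 b2] : exists2 K, 0 <= K & forall x, X <= x ->
    (c2 / 2 / 2) * x - K <= - derive1 H (- x) /\ (c2 / 2 / 4) * x ^+ 2 - K <= H (- x).
  have dn x : dv (fun y : R => - y) x (-1) by apply: dvN; exact: dv_id.
  apply: (@half_line_bounds (fun x => H (- x)) (fun x => - derive1 H (- x))
    (fun x => derive1n 2 H (- x))); [lra|exact: X0| | |].
  - by move=> x; apply: dv_eq (dv_comp (dn x) (d0 (- x))) _; rewrite mulrN1.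
  - move=> x; apply: dv_eq (dvN (dv_comp (dn x) (d1 (- x)))) _.
    by rewrite mulrN1 opprK.
  - move=> x Xx; apply: h2; rewrite ltrNl; apply: lt_le_trans Xx; rewrite /X.
    by have := lerNnormlW (lexx `|X2|); have := normr_ge0 X1; lra.
have C00 : 0 <= C0 by have [_ _ + _] := hC 0; exact: le_trans.
(* The lower bound of [H''] near infinity is [ci / 2], and [half_line_bounds] divides it by 4, which
   leaves [ci / 8]. *)
have [c [c0 cc1 cc2]] : exists c, [/\ 0 < c, c <= c1 / 8 & c <= c2 / 8].
  exists (Num.min c1 c2 / 8); split; first by rewrite divr_gt0// lt_min c10 c20.
    by rewrite ler_wpM2r ?invr_ge0// ge_min lexx.
  by rewrite ler_wpM2r ?invr_ge0// ge_min lexx orbT.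
pose C := C0 * (1 + X) * X + C0 + c * X ^+ 2 + K1 + K2 + K1 ^+ 2 / c + K2 ^+ 2 / c.
have t1 : 0 <= C0 * (1 + X) * X by rewrite !mulr_ge0 ?addr_ge0.
have t2 : 0 <= c * X ^+ 2 by rewrite mulr_ge0 ?sqr_ge0 ?ltW.
have t3 : 0 <= K1 ^+ 2 / c by rewrite divr_ge0 ?sqr_ge0 ?ltW.
have t4 : 0 <= K2 ^+ 2 / c by rewrite divr_ge0 ?sqr_ge0 ?ltW.
have CC0 : C0 <= C by rewrite /C; lra.
(* Absorbs the linear term of [x H'(x) >= ci / 4 x^2 - K x]; the quadratic term covers [2 c x^2]
   because [c <= ci / 8]. *)
have sq K x : 0 <= K -> 0 <= x -> x * K <= 2 * c * x ^+ 2 + K ^+ 2 / c.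
  move=> K0 x0.
  have h : 0 <= (x - K / (2 * c)) ^+ 2 * (2 * c) + K ^+ 2 / (2 * c).
    have cc0 : 0 <= 2 * c by lra.
    by apply: addr_ge0; [apply: mulr_ge0|apply: divr_ge0]; rewrite ?sqr_ge0.
  have : (x - K / (2 * c)) ^+ 2 * (2 * c) + K ^+ 2 / (2 * c) =
     2 * c * x ^+ 2 + K ^+ 2 / c - 2 * (x * K) by field; rewrite gt_eqF.
  have : 0 <= x * K by rewrite mulr_ge0.
  lra.
exists C, c; split => //.
- by apply: le_trans CC0.
- by move=> x; exact: dv_cont (d1 x).
- move=> x y; rewrite distrC (distrC x); apply: (@mvt_le _ _ (derive1n 2 H)) => //.
  by move=> z _; have [_ _ h _] := hC z; exact: le_trans CC0.
- move=> x; have [_ h _ _] := hC x; apply: (le_trans h).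
  by rewrite ler_wpM2r// addr_ge0.
- move=> x; have [h _ _ _] := hC x; apply: (le_trans h).
  by rewrite ler_wpM2r// addr_ge0// sqr_ge0.
- move=> x; have [xX|xX] := leP X x.
    have [_ h] := b1 x xX; apply: le_trans h.
    have : c * x ^+ 2 <= c1 / 8 * x ^+ 2 by rewrite ler_wpM2r ?sqr_ge0.
    by rewrite /C; lra.
  have [Xx|Xx] := leP X (- x).
    have [_] := b2 _ Xx; rewrite opprK sqrrN => h; apply: le_trans h.
    have : c * x ^+ 2 <= c2 / 8 * x ^+ 2 by rewrite ler_wpM2r ?sqr_ge0.
    by rewrite /C; lra.
  apply: le_trans (H0 x).
  have : c * x ^+ 2 <= c * X ^+ 2.
    rewrite ler_wpM2l ?(ltW c0)// -(real_normK (num_real x)) lerXn2r ?nnegrE//.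
    by rewrite ler_norml; apply/andP; split; lra.
  by rewrite /C; lra.
- move=> x; have [xX|xX] := leP X x.
    have [h _] := b1 x xX; have x0 := le_trans X0 xX.
    have := ler_wpM2l x0 h; have := sq _ _ K10 x0.
    rewrite (_ : x * (_ - _) = c1 / 4 * x ^+ 2 - x * K1); last by field.
    have : c * x ^+ 2 <= c1 / 8 * x ^+ 2 by rewrite ler_wpM2r ?sqr_ge0.
    rewrite /C; lra.
  have [Xx|Xx] := leP X (- x).
    have [h _] := b2 _ Xx; have x0 := le_trans X0 Xx; rewrite opprK in h.
    have := ler_wpM2l x0 h; have := sq _ _ K20 x0; rewrite sqrrN mulrNN.
    rewrite (_ : - x * (_ - _) = c2 / 4 * x ^+ 2 - - x * K2); last by field.
    have : c * x ^+ 2 <= c2 / 8 * x ^+ 2 by rewrite ler_wpM2r ?sqr_ge0.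
    rewrite /C; lra.
  have hx : `|x| <= X by rewrite ler_norml; apply/andP; split; lra.
  have : `|x * derive1 H x| <= C0 * (1 + X) * X.
    rewrite normrM mulrC; apply: ler_pM => //.
    have [_ h _ _] := hC x; apply: (le_trans h).
    by rewrite ler_wpM2l// lerD2l.
  by move=> /lerNnormlW; rewrite /C; lra.
Qed.

End Confinement.

(** * The equation against time-independent test functions *)

Section SolutionFacts.
Context {R : realType}.
Local Notation mu := (@lebesgue_measure R).
Implicit Types (phi : R -> R) (t s r x : R).

(** A solution equals [rho0] at time 0 only almost everywhere, and its joint measurability is given
    for positive times. Putting [rho0] at all times [t <= 0] yields a jointly measurable path that
    lies in [P2] at every real time. *)
Definition dpath (rho0 : R -> R) (u : R -> R -> R) : R -> R -> R := fun t => if 0 < t then u t else rho0.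

Variables (H l dl rho0 : R -> R) (u : R -> R -> R) (C c : R).
Hypothesis hH : confining H C c.
Hypothesis h0 : constrained_P2 (l 0) rho0.
Hypothesis hsol : solution H l dl rho0 u.
Let w := dpath rho0 u.
Let sigma := multiplier H dl u.

Lemma dpath_P2 t : P2 (w t).
Proof.
rewrite /w /dpath; case: ifP => [t0|_]; last by case: h0.
by case: hsol => _ /(_ t (ltW t0)) [].
Qed.

Lemma dpath_ae t : 0 <= t -> {ae mu, forall x, u t x = w t x}.
Proof.
rewrite le_eqVlt /w /dpath => /predU1P[<-|->]; last exact: aeW.
by rewrite ltxx; case: hsol.
Qed.

Lemma dpath_Rint t (g : R -> R) : 0 <= t -> measurable_fun setT g ->
  \int[mu]_x (u t x * g x) = \int[mu]_x (g x * w t x).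
Proof.
move=> t0 mg; apply: (@Rint_ae _ _ _ mu) => //.
- apply: measurable_funM => //; apply: P2_meas.
  by case: hsol => _ /(_ t t0) [].
- by apply: measurable_funM => //; apply: P2_meas; exact: dpath_P2.
- by apply: ae_mono (dpath_ae t0) => x -> _; rewrite mulrC.
Qed.

Lemma dpath_M1 t : 0 <= t -> M1 (w t) = l t.
Proof.
move=> t0; rewrite /M1 -dpath_Rint//.
case: hsol => _ /(_ t t0) [_ <-] _ _ _; rewrite /M1.
by apply: eq_Rintegral => x _; rewrite mulrC.
Qed.

Lemma dpath_joint : measurable_fun setT (fun p : R * R => w p.1 p.2).
Proof.
pose D : set (R * R) := `]0, +oo[ `*` setT.
have mD : measurable D by apply: measurableX => //; exact: measurable_itv.
have mu' : measurable_fun D (fun p => u p.1 p.2).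
  by case: hsol => _ _ [[]].
have m1 : measurable_fun setT ((fun p => u p.1 p.2) \_ D).
  exact: (proj1 (measurable_restrictT _ mD)).
have m2 : measurable_fun setT ((fun p : R * R => rho0 p.2) \_ (~` D)).
  apply: meas_patch; first exact: measurableC.
  by apply: (measurableT_comp _ measurable_snd); apply: P2_meas; case: h0.
rewrite (_ : (fun p => _) = (fun p => ((fun p => u p.1 p.2) \_ D) p +
    ((fun p : R * R => rho0 p.2) \_ (~` D)) p)); first exact: measurable_funD.
apply/funext => -[t x]; rewrite !patchE /w /dpath /=.
case: ifPn => t0.
  rewrite mem_set; last by split => //=; rewrite in_itv/= t0.
  rewrite memNset ?addr0//; apply; split => //=; by rewrite in_itv/= t0.
rewrite memNset; last by move=> [/=]; rewrite in_itv/= andbT (negbTE t0).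
rewrite mem_set ?add0r// => -[/=]; by rewrite in_itv/= andbT (negbTE t0).
Qed.

(** Continuity in time with values in [L^2([-r, r])] gives that of the pairing; the inequality
    [y <= e1 + y^2 / e1] plays the role of Cauchy-Schwarz. *)
Lemma pairing_cont phi r s : elem phi -> (forall x, r < `|x| -> phi x = 0) -> 0 < s ->
  {for s, continuous (fun t => \int[mu]_x (phi x * w t x))}.
Proof.
move=> ep; wlog r0 : r / 0 <= r => [hw|] phi0 s0.
  apply: (hw `|r|) => // x rx; apply: phi0; exact: le_lt_trans (ler_norm _) rx.
have [B B0 hB] := elem_bounded ep phi0.
have mphi : measurable_fun setT phi := cont_meas (elem_cont ep).
have iphi t : intg mu setT (fun x => phi x * w t x).
  by apply: (P2_intg (dpath_P2 t) mphi (C := B)) => x; exact: bdd_quad.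
case: hsol => _ _ [_ _ _ /(_ s r s0) hs] _ _.
apply/cvgrPdist_le => e e0.
(* With these choices the constant part contributes at most [e / 2] over the length [2 r], and the
   quadratic part at most [(B / e1) e2 <= e / 4]. *)
pose e1 := e / (4 * (B + 1) * (r + 1)).
have k0 : 0 < 4 * (B + 1) * (r + 1) by rewrite !mulr_gt0//; lra.
have e10 : 0 < e1 by rewrite divr_gt0.
pose e2 := e1 * (e / (4 * (B + 1))).
have k1 : 0 < 4 * (B + 1) by lra.
have e20 : 0 < e2 by rewrite mulr_gt0// divr_gt0.
have n1 : \forall t \near s,
    (\int[mu]_(x in `[(- r)%R, r]) ((u t x - u s x) ^+ 2)%:E < e2%:E)%E.
  have : nbhs (0%E : \bar R) [set z | (z < e2%:E)%E].
    by apply: open_ereal_lt'; rewrite lte_fin.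
  exact: hs.
apply: filterS2 n1 (lt_nbhsr s0) => t ht t0.
have uE y : 0 < y -> u y = w y by rewrite /w /dpath => ->.
rewrite (uE _ t0) (uE _ s0) in ht.
rewrite -RintegralB//.
pose J := `[- r, r] : set R.
have mJ : measurable J by exact: measurable_itv.
have md : measurable_fun setT (fun x => w t x - w s x).
  by apply: measurable_funB; apply: P2_meas; exact: dpath_P2.
have i2 : intg mu J (fun x => (w t x - w s x) ^+ 2).
  apply: intg_ge0 => //.
  - by apply: measurable_funX; exact: measurable_funTS.
  - by move=> x _; exact: sqr_ge0.
  - exact: lt_trans ht (ltry _).
have I2 : \int[mu]_(x in J) (w t x - w s x) ^+ 2 <= e2.
  by rewrite -lee_fin -Rint_EFin// ltW.
rewrite (@Rint_supp _ _ _ mu J setT)//; last first.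
  move=> x _ nJ; rewrite phi0 ?mul0r ?subrr//.
  by rewrite ltNge; apply/negP; rewrite ler_norml => h; apply: nJ; rewrite /J /= in_itv.
have iB : intg mu J (fun x => B * e1 + B / e1 * (w t x - w s x) ^+ 2).
  by apply: intgD => //; [exact: intg_cst_itv|exact: intgZ].
have hb : forall x, J x -> `|phi x * w s x - phi x * w t x| <=
    B * e1 + B / e1 * (w t x - w s x) ^+ 2.
  move=> x _; rewrite -mulrBr normrM distrC -mulrA -mulrDr ler_pM//.
  set z := w t x - w s x; rewrite -(real_normK (num_real z)).
  move: `|z| (normr_ge0 z) => y y0.
  have [ye|ey] := leP y e1.
    by apply: (le_trans ye); rewrite lerDl mulr_ge0 ?sqr_ge0 ?invr_ge0 ?(ltW e10).
  have : y <= e1^-1 * y ^+ 2.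
    by rewrite mulrC ler_pdivlMr// expr2 ler_wpM2l// ltW.
  lra.
have ib : intg mu J (fun x => phi x * w s x - phi x * w t x).
  apply: (@integrableS _ _ _ mu setT) => //.
  by apply: intgB => //; exact: iphi.
apply: (le_trans (@Rint_le_norm _ _ _ mu _ _ _ mJ ib iB hb)).
rewrite RintegralD//; [|exact: intg_cst_itv|exact: intgZ].
rewrite Rint_cst_itv; last lra.
rewrite RintegralZl//.
apply: (@le_trans _ _ (e / 2 + e / 4)); last lra.
apply: lerD.
  have -> : B * e1 * (r - - r) = e / 2 * (B / (B + 1)) * (r / (r + 1)).
    by rewrite /e1; field; apply/andP; split; apply: lt0r_neq0; lra.
  rewrite -[leRHS]mulr1 -[X in _ <= X * _]mulr1; apply: ler_pM => //.
  - by rewrite !mulr_ge0 ?invr_ge0//; lra.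
  - by rewrite mulr_ge0 ?invr_ge0//; lra.
  - by rewrite ler_wpM2l// ?ler_pdivrMr; lra.
  - by rewrite ler_pdivrMr; lra.
have : B / e1 * \int[mu]_(x in J) (w t x - w s x) ^+ 2 <= B / e1 * e2.
  by rewrite ler_wpM2l// divr_ge0// ltW.
move=> h; apply: (le_trans h).
have -> : B / e1 * e2 = e / 4 * (B / (B + 1)).
  have e1n : e1 != 0 by rewrite gt_eqF.
  have b1n : B + 1 != 0 by apply: lt0r_neq0; lra.
  rewrite /e2; move: e1 e1n {e10 e20 e2 ht I2 iB hb h} => e1 e1n.
  by field; rewrite ?e1n ?b1n.
rewrite -[leRHS]mulr1; apply: ler_wpM2l; first lra.
by rewrite ler_pdivrMr; lra.
Qed.

(** Test the equation with a smoothed indicator of the times before [s] multiplied by [phi]. The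
    derivative of the step extracts the pairing at time [s] by [pairing_cont], and the other terms
    converge to the integral over [[0, s]]. *)
Lemma solution_compact phi r : elem phi -> (forall x, r < `|x| -> phi x = 0) ->
  weak_identity (derive1 H) sigma w phi.
Proof.
move=> ep phi0 s; rewrite le_eqVlt => /predU1P[<-|s0].
  by rewrite subrr set_itv1 Rintegral_set1.
have e1p := elem_derive1 ep; have e2p := elem_derive1n 2 ep.
have [B0 B00 hB0] := elem_bounded ep phi0.
have s1 := elem_support ep phi0; have s2 := elem_support e1p s1.
have [B1 B10 hB1] := elem_bounded e1p s1.
have [B2 B20 hB2] := elem_bounded e2p s2.
have mphi : measurable_fun setT phi := cont_meas (elem_cont ep).
have m1 : measurable_fun setT (derive1 phi) := cont_meas (elem_cont e1p).
have m2 : measurable_fun setT (derive1n 2 phi) := cont_meas (elem_cont e2p).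
have mH : measurable_fun setT (derive1 H) := cont_meas (conf_cont hH).
pose g x := derive1n 2 phi x - derive1 H x * derive1 phi x.
have mg : measurable_fun setT g.
  by apply: measurable_funB => //; exact: measurable_funM.
pose Bg := B2 + C * (1 + `|r|) * B1.
have Cr : 0 <= C * (1 + `|r|) by rewrite mulr_ge0 ?addr_ge0// (conf_C hH).
have hg x : `|g x| <= Bg.
  apply: (le_trans (ler_normB _ _)); apply: lerD => //; rewrite normrM.
  have [rx|xr] := ltP r `|x|; first by rewrite s1// normr0 mulr0 mulr_ge0.
  apply: ler_pM => //; apply: (le_trans (conf_lin hH x)).
  rewrite ler_wpM2l// ?(conf_C hH)// lerD2l; exact: le_trans xr (ler_norm _).
pose a t := \int[mu]_x (phi x * w t x).
pose b t := \int[mu]_x (g x * w t x) + sigma t * \int[mu]_x (derive1 phi x * w t x).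
(* The transition interval [[s - d, s + d]] lies in the interior of [[0, T]], so the step is 1 at
   time 0 and vanishes before [T]. *)
pose d := s / 2; have d0 : 0 < d by rewrite /d; lra.
pose T := s + d + 1.
have isig T' : intg mu `[0, T'] sigma by case: hsol.
have ma : measurable_fun setT a := meas_pairing dpath_joint mphi.
have ba t : `|a t| <= B0 by apply: P2_bdd => //; exact: dpath_P2.
have ib : intg mu `[0, T] b.
  have [i1 _] := intg_weighted isig T (meas_pairing dpath_joint mg) (fun t => P2_bdd (dpath_P2 t) mg hg).
  have [_ i2] := intg_weighted isig T (meas_pairing dpath_joint m1) (fun t => P2_bdd (dpath_P2 t) m1 hB1).
  exact: intgD.
have E n : 0 = - a 0 - \int[mu]_(t in `[0, T]) (a t * derive1 (tstep d s n) t)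
    - \int[mu]_(t in `[0, T]) (b t * tstep d s n t).
  (* The second factor is 1 for [t >= -2] and 0 for [t <= -4]: it makes the support compact without
     changing anything on [[0, T]]. *)
  pose eta t := tstep d s n t * sstep (- t - 3).
  have eeta : elem eta.
    apply: elem_mul; first exact: elem_tstep.
    apply: (@elem_comp _ sstep); first exact: elem_sstep.
    by apply: elem_sub; [apply: elem_opp; exact: elem_id|exact: elem_cst].
  have dnd : d / n.+1%:R <= d by rewrite ler_pdivrMr// ler_peMr ?(ltW d0)// ler1n.
  have tt : spacetime_test_function T (fun t x => eta t * phi x).
    apply: (@tensor_test _ T (-4) (s + d) r) => //; first by rewrite /T; lra.
    move=> t; rewrite negb_and -!ltNge => /orP[h|h]; rewrite /eta.
      by rewrite (@sstep0 _ (- t - 3)) ?mulr0//; lra.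
    rewrite tstep0 ?mul0r//; apply: le_trans (ltW h); by rewrite lerD2l.
  have eta1 t : -2 < t -> eta t = tstep d s n t.
    by move=> t0; rewrite /eta sstep1 ?mulr1//; lra.
  have eta'1 t : 0 <= t -> derive1 eta t = derive1 (tstep d s n) t.
    move=> t0; apply: dv_derive1.
    have h : is_derive t 1 (tstep d s n) (derive1 (tstep d s n) t) := elem_dv t (elem_tstep d s n).
    apply: near_eq_is_derive h; near=> y; rewrite eta1//; near: y.
    by apply: lt_nbhsr; lra.
  have T0 : 0 < T by rewrite /T; lra.
  case: hsol => _ _ _ _ hw; apply: (etrans (hw T _ T0 tt)).
  congr (- _ - _ + _).
  - apply: eq_Rintegral => x _; rewrite eta1; last lra.
    have t01 : tstep d s n 0 = 1.
      apply: tstep1 => //; apply: (@le_trans _ _ (s - d)); last exact: lerB.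
      by rewrite /d; lra.
    rewrite t01 mul1r.
    by rewrite /w /dpath ltxx.
  - apply: eq_Rintegral => t; rewrite inE/= in_itv/= => /andP[t0 _].
    rewrite (_ : (fun x => u t x * _) = (fun x => u t x * (derive1 eta t * phi x))); last first.
      apply/funext => x; congr (_ * _); apply: dv_derive1.
      by apply: dv_eq (dvM (elem_dv t eeta) (dv_cst (phi x) t)) _; rewrite mulr0 addr0.
    rewrite dpath_Rint//; last by apply: measurable_funM => //; exact: measurable_cst.
    rewrite eta'1//; under eq_Rintegral do rewrite -mulrA.
    rewrite RintegralZl ?(mulrC (a t))//.
    by apply: (P2_intg (dpath_P2 t) mphi (C := B0)) => x; exact: bdd_quad.
  - rewrite -Rint_N//; last first.
      apply: (@intg_le _ _ _ mu _ _ (fun t => `|b t|)) => //.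
      + apply: measurable_funM; first exact: intg_meas ib.
        by apply: measurable_funTS; apply: cont_meas; exact/elem_cont/elem_tstep.
      + by move=> t _; rewrite normrM ler_piMr// tstep_bound.
      + exact: intg_norm.
    apply: eq_Rintegral => t; rewrite inE/= in_itv/= => /andP[t0 _].
    have e1 x : pdx (fun t x => eta t * phi x) t x = eta t * derive1 phi x.
      by apply: dv_derive1; apply: dvZ; exact: elem_dv.
    have e2 x : pdx (pdx (fun t x => eta t * phi x)) t x = eta t * derive1n 2 phi x.
      rewrite (_ : pdx (fun t x => eta t * phi x) = (fun t x => eta t * derive1 phi x)).
        by apply: dv_derive1; apply: dvZ; exact: elem_dv.
      apply/funext => t'; apply/funext => y; apply: dv_derive1; apply: dvZ; exact: elem_dv.
    rewrite (_ : (fun x => u t x * _) = (fun x => u t x * (- eta t * (g x + sigma t * derive1 phi x)))); last first.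
      by apply/funext => x; rewrite e1 e2 /g; congr (_ * _); rewrite -/sigma; ring.
    rewrite dpath_Rint//; last first.
      apply: measurable_funM; first exact: measurable_cst.
      by apply: measurable_funD => //; apply: measurable_funM => //; exact: measurable_cst.
    have ig : intg mu setT (fun x => g x * w t x).
      by apply: (P2_intg (dpath_P2 t) mg (C := Bg)) => x; exact: bdd_quad.
    have i1 : intg mu setT (fun x => derive1 phi x * w t x).
      by apply: (P2_intg (dpath_P2 t) m1 (C := B1)) => x; exact: bdd_quad.
    under eq_Rintegral do rewrite -mulrA mulrDl -mulrA.
    rewrite RintegralZl//; last by apply: intgD => //; exact: intgZ.
    rewrite RintegralD//; last exact: intgZ.
    by rewrite RintegralZl// eta1; [rewrite -/(b t) mulrC mulrN|lra].
have mT : measurable (`[0, T] : set R) by exact: measurable_itv.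
have sub : `[s - d, s + d] `<=` `[0, T].
  move=> t /=; rewrite !in_itv/= /T /d => /andP[h1 h2]; apply/andP; split; lra.
have ia : intg mu `[s - d, s + d] a.
  apply: (@intg_le _ _ _ mu _ _ (fun _ => B0)) => //; first exact: measurable_funTS.
  exact: intg_cst_itv.
have L1 : \int[mu]_(t in `[0, T]) (a t * derive1 (tstep d s n) t) @[n --> \oo] --> - a s.
  have hz n x : `[0, T] x -> ~ `[s - d, s + d] x -> a x * derive1 (tstep d s n) x = 0.
    move=> _ nx; rewrite tstep'0 ?mulr0//.
    have dnd : d / n.+1%:R <= d by rewrite ler_pdivrMr// ler_peMr ?(ltW d0)// ler1n.
    apply: (le_lt_trans dnd); rewrite ltNge ler_distl; apply/negP => hx.
    by apply: nx; rewrite /= in_itv.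
  under eq_fun do rewrite (@Rint_supp _ _ _ mu _ _ _ sub (hz _)).
  by apply: tstep'_cvg => //; exact: (pairing_cont ep phi0 s0).
have L2 := @tstep_int_cvg _ d s b _ mT d0 ib.
have L : - a 0 - \int[mu]_(t in `[0, T]) (a t * derive1 (tstep d s n) t)
    - \int[mu]_(t in `[0, T]) (b t * tstep d s n t) @[n --> \oo] -->
    - a 0 - - a s - \int[mu]_(t in `[0, T] `&` `]-oo, s]) b t.
  by apply: cvgB => //; apply: cvgB => //; exact: cvg_cst.
have h : 0 = - a 0 - - a s - \int[mu]_(t in `[0, T] `&` `]-oo, s]) b t.
  apply: cvg_uniq L; under eq_fun do rewrite -E; exact: cvg_cst.
have e : `[0, T] `&` `]-oo, s] = `[0, s] :> set R.
  apply/seteqP; split=> x /=; rewrite !in_itv/=.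
    by move=> [/andP[-> _] ->].
  move=> /andP[-> xs]; split=> //=; rewrite /T /d; lra.
rewrite e in h; rewrite -/(a s) -/(a 0); move: h.
rewrite -[X in _ -> _ = X]/(\int[mu]_(t in `[0, s]) b t).
move: (\int[mu]_(t in `[0, s]) b t) => z; lra.
Unshelve. all: by end_near. Qed.

End SolutionFacts.

Lemma Rint_subset d (T : measurableType d) (R : realType)
    (mu : {measure set T -> \bar R}) (D E : set T) (f : T -> R) :
  measurable D -> measurable E -> D `<=` E -> intg mu E f ->
  (forall x, E x -> 0 <= f x) ->
  \int[mu]_(x in D) f x <= \int[mu]_(x in E) f x.
Proof.
move=> mD mE DE fi f0; have fD : intg mu D f by exact: integrableS DE fi.
rewrite -lee_fin -!Rint_EFin//; apply: ge0_subset_integral => //.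
exact: measurable_int fi.
Qed.

Lemma cvg_le_ub (R : realType) (u : nat -> R) (L A : R) :
  u n @[n --> \oo] --> L -> (\forall n \near \oo, u n <= A) -> L <= A.
Proof.
move=> uL uA; rewrite -(cvg_lim (@Rhausdorff R) uL).
by apply: limr_le => //; exact: (cvgP L).
Qed.

Lemma cvg_ge_lb (R : realType) (u : nat -> R) (L A : R) :
  u n @[n --> \oo] --> L -> (\forall n \near \oo, A <= u n) -> A <= L.
Proof.
move=> uL uA; rewrite -(cvg_lim (@Rhausdorff R) uL).
by apply: limr_ge => //; exact: (cvgP L).
Qed.

(** * Propagation of the second moment *)

Section MomentBound.
Context {R : realType}.
Local Notation mu := (@lebesgue_measure R).
Implicit Types (x t s r d : R).

(** A bounded approximation from below of [x^2], whose derivative decays fast enough to be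
    [moderate]. *)
Definition trunc_sq d : R -> R := fun x => x ^+ 2 * (1 + d * x ^+ 2)^-1.

Lemma trunc_den_gt0 d x : 0 < d -> 0 < 1 + d * x ^+ 2.
Proof. by move=> d0; rewrite ltr_pwDl// mulr_ge0 ?sqr_ge0 ?ltW. Qed.

Lemma elem_sqr : elem (fun x : R => x ^+ 2).
Proof.
rewrite (_ : (fun x => _) = (fun x => x * x)); last by apply/funext => x; rewrite expr2.
by apply: elem_mul; exact: elem_id.
Qed.

Lemma elem_trunc_sq d : 0 < d -> elem (trunc_sq d).
Proof.
move=> d0; apply: elem_mul; first exact: elem_sqr.
apply: elem_inv; first by move=> x; rewrite gt_eqF// trunc_den_gt0.
by apply: elem_add; [exact: elem_cst|apply: elem_scale; exact: elem_sqr].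
Qed.

Lemma dv_sqr x : dv (fun x : R => x ^+ 2) x (2 * x).
Proof. by apply: dv_eq (dvX 2 (dv_id x)) _; rewrite mulr1 expr1. Qed.

Lemma dv_den d x : dv (fun x => 1 + d * x ^+ 2) x (d * (2 * x)).
Proof. by apply: dv_eq (dvD (dv_cst 1 x) (dvZ d (dv_sqr x))) _; rewrite add0r. Qed.

Lemma trunc_sq'E d x : 0 < d ->
  derive1 (trunc_sq d) x = 2 * x / (1 + d * x ^+ 2) ^+ 2.
Proof.
move=> d0; apply: dv_derive1; have q0 := trunc_den_gt0 x d0.
apply: dv_eq (dvM (dv_sqr x) (dvV _ (dv_den d x))) _; rewrite ?gt_eqF//.
by field; rewrite gt_eqF.
Qed.

Lemma trunc_sq''E d x : 0 < d ->
  derive1n 2 (trunc_sq d) x = (2 - 6 * (d * x ^+ 2)) / (1 + d * x ^+ 2) ^+ 3.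
Proof.
move=> d0; rewrite derive1nS derive1n1.
rewrite (_ : derive1 (trunc_sq d) = (fun x => 2 * x * ((1 + d * x ^+ 2) ^+ 2)^-1)); last first.
  by apply/funext => y; exact: trunc_sq'E.
apply: dv_derive1; have q0 := trunc_den_gt0 x d0.
apply: dv_eq (dvM (dvZ 2 (dv_id x)) (dvV _ (dvX 2 (dv_den d x)))) _.
  by rewrite expf_neq0// gt_eqF.
by rewrite /= expr1; field; rewrite gt_eqF.
Qed.

Lemma trunc_sq_bounds d x : 0 < d -> d <= 1 ->
  [/\ 0 <= trunc_sq d x <= x ^+ 2, trunc_sq d x <= d^-1,
      (1 + `|x|) * `|derive1 (trunc_sq d) x| <= 3 / d,
      `|derive1n 2 (trunc_sq d) x| <= 6 &
      forall a, 0 < a -> `|derive1 (trunc_sq d) x| <= a + a^-1 * trunc_sq d x].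
Proof.
move=> d0 d1; have q0 := trunc_den_gt0 x d0.
have x20 := sqr_ge0 x.
have q1 : 1 <= 1 + d * x ^+ 2 by rewrite lerDl mulr_ge0// ltW.
rewrite trunc_sq'E// trunc_sq''E// /trunc_sq.
move: q0 q1; set q := 1 + d * x ^+ 2 => q0 q1.
have dxq : d * x ^+ 2 = q - 1 by rewrite /q; lra.
have q2 : q <= q ^+ 2 by rewrite expr2 ler_peMl// ltW.
have q3 : q <= q ^+ 3.
  by apply: (le_trans q2); rewrite [leRHS]exprS ler_peMl// exprn_ge0// ltW.
have q20 : 0 < q ^+ 2 by rewrite exprn_gt0.
split.
- by rewrite mulr_ge0 ?invr_ge0 ?(ltW q0)//= ler_pdivrMr// ler_peMr.
- by rewrite ler_pdivrMr// mulrC ler_pdivlMr// mulrC dxq; lra.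
- rewrite normrM (@ger0_norm _ (_^-1)); last by rewrite invr_ge0 ltW.
  rewrite mulrA ler_pdivrMr// mulrAC ler_pdivlMr//.
  apply: (@le_trans _ _ (3 * q)); last by rewrite ler_wpM2l.
  rewrite normrM (@ger0_norm _ 2)//.
  have e : x ^+ 2 = `|x| ^+ 2 by rewrite real_normK// num_real.
  rewrite /q e; move: `|x| (normr_ge0 x) => y y0.
  have h : (1 + y) * (2 * y) <= 1 + 3 * y ^+ 2.
    have := sqr_ge0 (y - 1); rewrite sqrrB expr1n => h.
    have -> : (1 + y) * (2 * y) = 2 * y + 2 * y ^+ 2 by ring.
    move: h; rewrite mulr1 -mulr_natl; lra.
  apply: (@le_trans _ _ ((1 + 3 * y ^+ 2) * d)); first by rewrite ler_wpM2r// ltW.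
  by rewrite mulrDl mul1r mulrDr (mulrC d) mulrA; lra.
- rewrite normrM (@ger0_norm _ (_^-1)); last by rewrite invr_ge0 exprn_ge0// ltW.
  rewrite ler_pdivrMr ?exprn_gt0//; apply: (@le_trans _ _ (6 * q)); last by rewrite ler_wpM2l.
  by rewrite dxq ler_norml; apply/andP; split; lra.
- move=> a a0; rewrite normrM (@ger0_norm _ (_^-1)); last by rewrite invr_ge0 ltW.
  rewrite ler_pdivrMr// normrM (@ger0_norm _ 2)//.
  have e : x ^+ 2 = `|x| ^+ 2 by rewrite real_normK// num_real.
  rewrite e; move: `|x| (normr_ge0 x) => y y0.
  have h : 2 * y <= a + a^-1 * y ^+ 2.
    have : 0 <= (a - y) ^+ 2 / a by rewrite divr_ge0 ?sqr_ge0 ?ltW.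
    have -> : (a - y) ^+ 2 / a = a + a^-1 * y ^+ 2 - 2 * y by field; rewrite gt_eqF.
    lra.
  apply: (le_trans h); rewrite mulrDl; apply: lerD.
    by rewrite ler_peMr ?(ltW a0)//; exact: le_trans q2.
  have -> : a^-1 * (y ^+ 2 / q) * q ^+ 2 = a^-1 * y ^+ 2 * q by field; rewrite !gt_eqF.
  by rewrite ler_peMr// mulr_ge0 ?sqr_ge0// invr_ge0 ltW.
Qed.

Variables (Hp sigma : R -> R) (w : R -> R -> R) (CH : R).
Hypothesis cHp : continuous Hp.
Hypothesis bHp : forall x, `|Hp x| <= CH * (1 + `|x|).
Hypothesis monoHp : forall x, - CH <= x * Hp x.
Hypothesis mw : measurable_fun setT (fun p : R * R => w p.1 p.2).
Hypothesis Pw : forall t, P2 (w t).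
Hypothesis isig : forall T : R, intg mu `[0, T] sigma.
Hypothesis weak_mod : forall phi, moderate phi -> weak_identity Hp sigma w phi.

(** Since [sigma] is only integrable, the truncated moment is bounded by its supremum over [[0, T]]
    inside the time integral, and half of that supremum is absorbed. The bound does not depend on
    the truncation, which is then removed. *)
Lemma moment_bound (T : R) : 0 <= T -> exists2 A, 0 <= A &
  forall t, 0 <= t <= T -> mom2 (w t) <= A.
Proof.
move=> T0.
have CH0 : 0 <= CH by have := bHp 0; rewrite normr0 addr0 mulr1; apply: le_trans.
pose S := \int[mu]_(r in `[0, T]) `|sigma r|.
have S0 : 0 <= S by exact: Rintegral_ge0.
have iS : intg mu `[0, T] (fun r => `|sigma r|) by exact: intg_norm.
(* Bounds the drift term: 6 comes from the second derivative, and [2 CH] from [x Hp(x) >= - CH]. *)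
pose K := 6 + 2 * CH.
(* The supremum [Y] appears with the coefficient [S / a], which this choice keeps below 1/2;
   absorbing it produces the factor 2 of [A]. *)
pose a := 2 * S + 1; have a0 : 0 < a by rewrite /a; lra.
pose A := 2 * (mom2 (w 0) + K * T + S * a).
have K0 : 0 <= K by rewrite /K; lra.
have A0 : 0 <= A.
  by rewrite mulr_ge0// !addr_ge0 ?mulr_ge0 ?mom2_ge0// ltW.
exists A => //.
have trunc (n : nat) t : 0 <= t <= T ->
    \int[mu]_x (trunc_sq n.+1%:R^-1 x * w t x) <= A.
  pose d : R := n.+1%:R^-1; rewrite -/d.
  have d0 : 0 < d by rewrite invr_gt0.
  have d1 : d <= 1 by rewrite invf_le1 ?ler1n.
  have bd x := trunc_sq_bounds x d0 d1.
  have ed := elem_trunc_sq d0.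
  pose phi := trunc_sq d.
  have hC x : [/\ `|phi x| <= 3 / d + 6, (1 + `|x|) * `|derive1 phi x| <= 3 / d + 6 &
      `|derive1n 2 phi x| <= 3 / d + 6].
    have di0 : 0 < d^-1 by rewrite invr_gt0.
    have [/andP[h0 _] h1 h2 h3 _] := bd x; split.
    - by rewrite ger0_norm//; apply: (le_trans h1); lra.
    - by apply: (le_trans h2); lra.
    - by apply: (le_trans h3); rewrite lerDr mulr_ge0// ltW.
  have mphi : moderate phi by split=> //; exists (3 / d + 6).
  have [mg hg m1 h1] := moderate_drift cHp bHp ed hC.
  have mp : measurable_fun setT phi := cont_meas (elem_cont ed).
  have i0 t' : intg mu setT (fun x => phi x * w t' x).
    by apply: (P2_intg (Pw t') mp (C := 3 / d + 6)) => x; apply: bdd_quad; have [] := hC x.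
  have i1 t' : intg mu setT (fun x => derive1 phi x * w t' x).
    by apply: (P2_intg (Pw t') m1 (C := 3 / d + 6)) => x; apply: bdd_quad.
  pose y t := \int[mu]_x (phi x * w t x).
  have y0 t' : 0 <= y t'.
    apply: Rintegral_ge0 => x _; rewrite mulr_ge0 ?(P2_ge0 _ (Pw t'))//.
    by have [/andP[]] := bd x.
  have yd t' : y t' <= d^-1.
    rewrite -[leRHS]mulr1 -(P2_mass (Pw t')) -RintegralZl//; last exact: P2_intg1 (Pw t').
    apply: le_Rintegral => //; first by apply: intgZ => //; exact: P2_intg1 (Pw t').
    move=> x _; rewrite ler_wpM2r ?(P2_ge0 _ (Pw t'))//.
    by have [] := bd x.
  have drift r : \int[mu]_x ((derive1n 2 phi x - Hp x * derive1 phi x) * w r x) <= K.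
    rewrite -[leRHS]mulr1 -(P2_mass (Pw r)) -RintegralZl//; last exact: P2_intg1 (Pw r).
    apply: le_Rintegral => //.
    - by apply: (P2_intg (Pw r) mg (C := _)) => x; apply: bdd_quad; exact: hg.
    - by apply: intgZ => //; exact: P2_intg1 (Pw r).
    move=> x _; rewrite ler_wpM2r ?(P2_ge0 _ (Pw r))//.
    have [_ _ _ h3 _] := bd x; rewrite /K; apply: lerD.
      exact: le_trans (ler_norm _) h3.
    rewrite /phi trunc_sq'E//.
    have q0 := trunc_den_gt0 x d0.
    have e : - (Hp x * (2 * x / (1 + d * x ^+ 2) ^+ 2)) =
        2 * (- (x * Hp x)) / (1 + d * x ^+ 2) ^+ 2 by field; rewrite gt_eqF.
    rewrite e ler_pdivrMr ?exprn_gt0//.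
    apply: (@le_trans _ _ (2 * CH)); first by rewrite ler_wpM2l// lerNl.
    rewrite ler_peMr ?mulr_ge0// exprn_ege1// lerDl mulr_ge0 ?sqr_ge0 ?ltW//.
  (* The supremum is finite because the truncated square is at most [d^-1]; without truncation the
     absorption would be circular. *)
  pose Ys := [set y r | r in `[0, T]].
  have hs : has_sup Ys.
    split; first by exists (y 0), 0 => //=; rewrite in_itv/= lexx.
    by exists d^-1 => _ [r _ <-]; exact: yd.
  pose Y := sup Ys.
  have yY r : 0 <= r <= T -> y r <= Y.
    by move=> rT; apply: sup_upper_bound => //; exists r => //=; rewrite in_itv.
  have Y0 : 0 <= Y by apply: le_trans (y0 0) (yY 0 _); rewrite lexx.
  have sg r : 0 <= r <= T -> `|\int[mu]_x (derive1 phi x * w r x)| <= a + a^-1 * Y.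
    move=> rT; apply: (@le_trans _ _ (\int[mu]_x (a * w r x + a^-1 * (phi x * w r x)))).
      apply: (@Rint_le_norm _ _ _ mu) => //.
        by apply: intgD => //; apply: intgZ => //; exact: P2_intg1 (Pw r).
      move=> x _; rewrite normrM (ger0_norm (P2_ge0 x (Pw r))) mulrA -mulrDl.
      by rewrite ler_wpM2r ?(P2_ge0 _ (Pw r))//; have [_ _ _ _] := bd x; apply.
    rewrite RintegralD//; [|by apply: intgZ => //; exact: P2_intg1 (Pw r)|exact: intgZ].
    rewrite RintegralZl//; last exact: P2_intg1 (Pw r).
    rewrite (P2_mass (Pw r)) mulr1 RintegralZl// lerD2l ler_wpM2l ?invr_ge0 ?(ltW a0)//.
    exact: yY.
  have main t' : 0 <= t' <= T -> y t' <= y 0 + K * T + S * (a + a^-1 * Y).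
    move=> /andP[t0 tT]; have e := weak_mod mphi t0.
    have st : `[0, t'] `<=` `[0, T].
      by move=> r /=; rewrite !in_itv/= => /andP[-> /le_trans]; exact.
    have aY : 0 <= a + a^-1 * Y by rewrite addr_ge0 ?mulr_ge0 ?invr_ge0 ?(ltW a0).
    have iS' : intg mu `[0, t'] (fun r => `|sigma r|).
      exact: (@integrableS _ _ _ mu `[0, T]).
    suff h : \int[mu]_(r in `[0, t']) (\int[mu]_x ((derive1n 2 phi x - Hp x * derive1 phi x) * w r x)
       + sigma r * \int[mu]_x (derive1 phi x * w r x)) <= K * T + S * (a + a^-1 * Y).
      by rewrite -e in h; rewrite -/(y t') -/(y 0) in h; lra.
    apply: (@le_trans _ _ (\int[mu]_(r in `[0, t']) (K + (a + a^-1 * Y) * `|sigma r|))).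
      apply: le_Rintegral => //.
      - have mb : measurable_fun setT (fun r => \int[mu]_x ((derive1n 2 phi x - Hp x * derive1 phi x) * w r x)).
          exact: meas_pairing.
        have [j1 _] := intg_weighted isig t' mb (fun r => P2_bdd (Pw r) mg hg).
        have [_ j2] := intg_weighted isig t' (meas_pairing mw m1) (fun r => P2_bdd (Pw r) m1 h1).
        exact: intgD.
      - by apply: intgD => //; [exact: intg_cst_itv|exact: intgZ].
      - move=> r /st; rewrite /= in_itv/= => rT; apply: lerD; first exact: drift.
        apply: le_trans (ler_norm _) _; rewrite normrM mulrC ler_wpM2r//.
        exact: sg.
    rewrite RintegralD//; [|exact: intg_cst_itv|exact: intgZ].
    rewrite Rint_cst_itv// subr0 RintegralZl//; apply: lerD; first exact: ler_wpM2l.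
    rewrite mulrC ler_wpM2r//.
    by apply: (@Rint_subset _ _ _ mu) => // r _.
  have YA : Y <= A.
    have : Y <= y 0 + K * T + S * (a + a^-1 * Y).
      apply: ge_sup; first by case: hs.
      move=> _ [r rT <-]; apply: main; by move: rT; rewrite /= in_itv.
    have : y 0 <= mom2 (w 0).
      apply: le_Rintegral => //; first exact: P2_intg2 (Pw 0).
      move=> x _; rewrite ler_wpM2r ?(P2_ge0 _ (Pw 0))//.
      by have [/andP[]] := bd x.
    have : S * (a^-1 * Y) <= Y / 2.
      rewrite mulrA mulrC ler_wpM2l// ler_pdivrMr// /a; lra.
    by rewrite mulrDr /A; lra.
  by move=> tT; apply: le_trans (yY t tT) YA.
move=> t tT.
have L : \int[mu]_x (trunc_sq n.+1%:R^-1 x * w t x) @[n --> \oo] --> mom2 (w t).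
  have di (n : nat) : 0 < n.+1%:R^-1 :> R by rewrite invr_gt0.
  have d1 (n : nat) : n.+1%:R^-1 <= 1 :> R by rewrite invf_le1 ?ler1n.
  apply: (proj2 (@dct _ _ _ mu setT _ _ (fun x => x ^+ 2 * w t x) _ _ _ _ _ _)) => //.
  - move=> n; apply: measurable_funM; last exact: P2_meas (Pw t).
    exact: cont_meas (elem_cont (elem_trunc_sq (di n))).
  - by apply: measurable_funM; [exact: measurable_funX|exact: P2_meas (Pw t)].
  - apply/aeW => x _; apply: cvgM; last exact: cvg_cst.
    rewrite -[X in _ --> X]mulr1; apply: cvgM; first exact: cvg_cst.
    rewrite -[X in _ --> X]invr1; apply: cvgV; first exact: oner_neq0.
    rewrite -[X in _ --> X]addr0; apply: cvgD; first exact: cvg_cst.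
    rewrite -(mul0r (x ^+ 2)); apply: cvgM; last exact: cvg_cst.
    exact: cvg_harmonic.
  - exact: P2_intg2 (Pw t).
  - move=> n x _; have [/andP[h1 h2] _ _ _ _] := trunc_sq_bounds x (di n) (d1 n).
    rewrite normrM (ger0_norm (P2_ge0 x (Pw t))) ler_wpM2r ?(P2_ge0 _ (Pw t))//.
    by rewrite ger0_norm.
by apply: (cvg_le_ub L); apply: nearW => n; exact: trunc.
Qed.

End MomentBound.

(** * Mollification *)

Section LogisticKernel.
Context {R : realType}.
Local Notation mu := (@lebesgue_measure R).
Implicit Types (x y z e : R).

(** The bounds of the derivatives by the kernel itself make logarithmic derivatives of convolutions
    bounded, and the exponential lower bound makes their logarithm grow at most linearly. [N] may be
    huge; smallness is asked only of the moments [e1] and [e2]. *)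
Record mollifier (K : R -> R) (N e1 e2 : R) : Prop := Mollifier {
  mol_elem : elem K;
  mol_gt0 : forall z, 0 < K z;
  mol_even : forall z, K (- z) = K z;
  mol_N : 1 <= N;
  mol_d1 : forall z, `|derive1 K z| <= N * K z;
  mol_d2 : forall z, `|derive1n 2 K z| <= N * K z;
  mol_low : forall z, expR (- (N * (1 + `|z|))) <= K z;
  mol_dec : forall z, (1 + `|z|) * K z <= N;
  mol_intg : forall x, intg mu setT (fun y => K (x - y));
  mol_int1 : forall x, \int[mu]_y K (x - y) = 1;
  mol_intd : forall x, \int[mu]_y derive1 K (x - y) = 0;
  mol_mom1i : forall x, intg mu setT (fun y => `|x - y| * K (x - y));
  mol_mom1 : forall x, \int[mu]_y (`|x - y| * K (x - y)) <= e1;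
  mol_mom2i : forall x, intg mu setT (fun y => (x - y) ^+ 2 * K (x - y));
  mol_mom2 : forall x, \int[mu]_y ((x - y) ^+ 2 * K (x - y)) <= e2 }.

(** The kernel is the logistic density [logis']: it has an explicit antiderivative, exponential
    tails, and derivatives equal to itself times a polynomial in [logis], hence bounded by multiples
    of itself. *)
Definition logis z : R := (1 + expR (- z))^-1.
Definition logd z : R := logis z * (1 - logis z).

Lemma logis_den z : 0 < 1 + expR (- z).
Proof. by rewrite addr_gt0// expR_gt0. Qed.

Lemma logis_itv z : 0 < logis z < 1.
Proof.
rewrite invr_gt0 logis_den/= invf_lt1 ?logis_den// ltrDl; exact: expR_gt0.
Qed.

Lemma dv_logis z : dv logis z (logd z).
Proof.
have d0 := logis_den z.
apply: dv_eq (dvV _ (dvD (dv_cst 1 z) (dv_exp (dvN (dv_id z))))) _.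
  by rewrite gt_eqF.
by rewrite /logd /logis; field; rewrite gt_eqF.
Qed.

Lemma dv_logd z : dv logd z (logd z * (1 - 2 * logis z)).
Proof.
apply: dv_eq (dvM (dv_logis z) (dvB (dv_cst 1 z) (dv_logis z))) _.
by rewrite /logd; ring.
Qed.

Lemma dv_logd' z : dv (fun z => logd z * (1 - 2 * logis z)) z
  (logd z * (1 - 6 * logis z + 6 * logis z ^+ 2)).
Proof.
apply: dv_eq (dvM (dv_logd z) (dvB (dv_cst 1 z) (dvZ 2 (dv_logis z)))) _.
by rewrite /logd; ring.
Qed.

Lemma logis_opp z : logis (- z) = 1 - logis z.
Proof.
rewrite /logis opprK expRN; field; rewrite !gt_eqF ?addr_gt0 ?expR_gt0//.
Qed.

Lemma logd_even z : logd (- z) = logd z.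
Proof. by rewrite /logd logis_opp; ring. Qed.

Lemma logd_gt0 z : 0 < logd z.
Proof. by have /andP[h1 h2] := logis_itv z; rewrite mulr_gt0// subr_gt0. Qed.

Lemma logdE z : logd z = expR (- `|z|) / (1 + expR (- `|z|)) ^+ 2.
Proof.
have h y : logd y = expR (- y) / (1 + expR (- y)) ^+ 2.
  by rewrite /logd /logis; field; rewrite gt_eqF// logis_den.
have [z0|z0] := leP 0 z; first by rewrite (ger0_norm z0).
by rewrite (ltr0_norm z0) -logd_even.
Qed.

Lemma logd_bounds z : expR (- `|z|) / 4 <= logd z <= expR (- `|z|).
Proof.
rewrite logdE; have e0 := expR_gt0 (- `|z|).
have e1 : expR (- `|z|) <= 1 by rewrite -expR0 ler_expR oppr_le0.
move: (expR _) e0 e1 => e e0 e1.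
have ee : e * e <= 1 by rewrite mulr_ile1 ?(ltW e0).
have e3 : 0 < (1 + e) ^+ 2 by apply: exprn_gt0; lra.
have e4 : (1 + e) ^+ 2 <= 4 by lra.
have e5 : 1 <= (1 + e) ^+ 2 by apply: exprn_ege1; lra.
apply/andP; split; last by rewrite ler_pdivrMr// ler_peMr ?(ltW e0).
by rewrite ler_wpM2l ?(ltW e0)// lef_pV2 ?posrE.
Qed.

Lemma logis_lim z : 0 <= 1 - logis z <= expR (- z).
Proof.
have d0 := logis_den z; have e0 := expR_gt0 (- z).
have -> : 1 - logis z = expR (- z) / (1 + expR (- z)).
  by rewrite /logis; field; rewrite gt_eqF.
rewrite divr_ge0 ?(ltW d0) ?(ltW e0)//= ler_pdivrMr// ler_peMr ?(ltW e0)//.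
by rewrite lerDl ltW.
Qed.

Lemma elem_logd : elem logd.
Proof.
have el : elem logis.
  apply: elem_inv; first by move=> x; rewrite gt_eqF// logis_den.
  apply: elem_add; first exact: elem_cst.
  apply: (@elem_comp _ expR); first exact: elem_exp.
  by apply: elem_opp; exact: elem_id.
by apply: elem_mul => //; apply: elem_sub => //; exact: elem_cst.
Qed.

Variable e : R.
Hypothesis e0 : 0 < e.

Definition logk (a z : R) : R := a^-1 * logd (a^-1 * z).

Lemma dv_scale a z : dv (fun z : R => a^-1 * z) z a^-1.
Proof. by apply: dv_eq (dvZ _ (dv_id z)) _; rewrite mulr1. Qed.

Lemma logk'E a z : derive1 (logk a) z = a^-1 * (logk a z * (1 - 2 * logis (a^-1 * z))).
Proof.
apply: dv_derive1.
apply: dv_eq (dvZ _ (dv_comp (dv_scale a z) (dv_logd _))) _.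
by rewrite /logk; ring.
Qed.

Lemma logk''E a z : derive1n 2 (logk a) z = a^-1 * a^-1 *
  (logk a z * (1 - 6 * logis (a^-1 * z) + 6 * logis (a^-1 * z) ^+ 2)).
Proof.
rewrite derive1nS derive1n1.
rewrite (_ : derive1 (logk a) = (fun z => a^-1 * a^-1 *
    (logd (a^-1 * z) * (1 - 2 * logis (a^-1 * z))))); last first.
  by apply/funext => y; rewrite logk'E /logk; ring.
apply: dv_derive1; apply: dv_eq (dvZ _ (dv_comp (dv_scale a z) (dv_logd' _))) _.
by rewrite /logk; ring.
Qed.

Lemma elem_logk a : elem (logk a).
Proof.
apply: elem_scale; apply: elem_comp; first exact: elem_logd.
by apply: elem_scale; exact: elem_id.
Qed.

Lemma cvg_exp_lin (a b : R) : 0 < a -> expR (- (a * n%:R) + b) @[n --> \oo] --> 0.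
Proof.
move=> a0; under eq_fun do rewrite expRD -mulNr expRM_natr.
rewrite -(mul0r (expR b)); apply: cvgM; last exact: cvg_cst.
apply: cvg_expr; rewrite ger0_norm ?expR_ge0//.
by rewrite -expR0 ltr_expR oppr_lt0.
Qed.

Lemma dv_logprim a x y : dv (fun y => - logis (a^-1 * (x - y))) y (logk a (x - y)).
Proof.
have h : dv (fun y => a^-1 * (x - y)) y (- a^-1).
  by apply: dv_eq (dvZ _ (dvB (dv_cst x y) (dv_id y))) _; rewrite sub0r mulrN1.
apply: dv_eq (dvN (dv_comp h (dv_logis _))) _.
by rewrite /logk mulrN opprK mulrC.
Qed.

Lemma cvg_logis_y a x : 0 < a -> logis (a^-1 * (x - n%:R)) @[n --> \oo] --> 0.
Proof.
move=> a0; apply: (@cvg0_le _ _ _ _ (fun n : nat => expR (- (a^-1 * n%:R) + a^-1 * x))).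
  apply: nearW => n; set z := a^-1 * (x - n%:R).
  have /andP[h1 _] := logis_itv z; rewrite (ger0_norm (ltW h1)).
  have := logis_lim (- z); rewrite logis_opp opprB addrC subrK opprK => /andP[_].
  by rewrite /z mulrBr addrC.
by apply: cvg_exp_lin; rewrite invr_gt0.
Qed.

Lemma cvg_logis_Ny a x : 0 < a -> logis (a^-1 * (x + n%:R)) @[n --> \oo] --> (1 : R).
Proof.
move=> a0; apply: (@cvg_le _ _ _ _ (fun n : nat => expR (- (a^-1 * n%:R) - a^-1 * x))).
  apply: nearW => n; set z := a^-1 * (x + n%:R).
  have /andP[h1 h2] := logis_lim z; rewrite distrC (ger0_norm h1).
  by apply: (le_trans h2); rewrite ler_expR /z mulrDr opprD addrC.
by apply: cvg_exp_lin; rewrite invr_gt0.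
Qed.

Lemma logk_gt0 a z : 0 < a -> 0 < logk a z.
Proof. by move=> a0; rewrite mulr_gt0 ?invr_gt0// logd_gt0. Qed.

Lemma cont_logk a x : continuous (fun y => logk a (x - y)).
Proof.
apply: elem_cont; apply: (@elem_comp _ (logk a)); first exact: elem_logk.
by apply: elem_sub; [exact: elem_cst|exact: elem_id].
Qed.

Lemma logk_intg a x : 0 < a -> intg mu setT (fun y => logk a (x - y)).
Proof.
move=> a0; apply: (@intg_line _ _ 1).
- by apply: cont_meas; exact: cont_logk.
- by move=> y; rewrite ltW// logk_gt0.
- move=> n; rewrite (@ftc_itv _ (fun y => - logis (a^-1 * (x - y)))).
  + have /andP[h1 _] := logis_itv (a^-1 * (x - n%:R)).
    have /andP[_ h2] := logis_itv (a^-1 * (x - - n%:R)).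
    by rewrite opprK; lra.
  + by move=> y; exact: dv_logprim.
  + exact: cont_logk.
  + by rewrite ge0_cp.
- by move=> n; apply: intg_cont; exact: cont_logk.
Qed.

Lemma logk_int1 a x : 0 < a -> \int[mu]_y logk a (x - y) = 1.
Proof.
move=> a0; rewrite (@ftc_line _ (fun y => - logis (a^-1 * (x - y))) _ (-1) (-0)).
- by rewrite oppr0 sub0r opprK.
- by move=> y; exact: dv_logprim.
- exact: cont_logk.
- exact: logk_intg.
- by apply: cvgN; exact: cvg_logis_y.
- by under eq_fun do rewrite opprK; apply: cvgN; exact: cvg_logis_Ny.
Qed.

(** Half of the tail [e^(-|y|)] absorbs the polynomial weight and the other half is the tail of the
    kernel of double width, so moments reduce to the mass one of [logk (2 * e)]. In 16 and 128, the
    factors 2 and 16 bound [r e^(-r/2)] and [r^2 e^(-r/2)], 4 comes from [logd_bounds], and 2 from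
    the normalisation. *)
Lemma logk_double z : logk e z * (`|e^-1 * z|) <= 16 * logk (2 * e) z /\
  logk e z * (e^-1 * z) ^+ 2 <= 128 * logk (2 * e) z.
Proof.
have ei0 : 0 < e^-1 by rewrite invr_gt0.
rewrite /logk; have -> : (2 * e)^-1 * z = (e^-1 * z) / 2 by rewrite invfM; ring.
have -> : (2 * e)^-1 = e^-1 / 2 by rewrite invfM mulrC.
move: (e^-1) ei0 => b b0; move: (b * z) => y.
have /andP[_ h1] := logd_bounds y; have /andP[h2 _] := logd_bounds (y / 2).
rewrite normrM (@ger0_norm _ 2^-1) ?invr_ge0// in h2.
have hs : expR (- `|y|) = expR (- (`|y| / 2)) * expR (- (`|y| / 2)).
  by rewrite -expRD; congr expR; lra.
have n0 := normr_ge0 y; have y2 : y ^+ 2 = `|y| ^+ 2 by rewrite real_normK// num_real.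
rewrite y2; move: (`|y|) n0 h1 h2 hs => r r0 h1 h2 hs.
have p0 := expR_gt0 (- (r / 2)).
have q1 : r * expR (- (r / 2)) <= 2.
  rewrite expRN ler_pdivrMr ?expR_gt0//.
  by have := expR_ge1Dx (r / 2); lra.
have q2 : r ^+ 2 * expR (- (r / 2)) <= 16.
  rewrite expRN ler_pdivrMr ?expR_gt0//.
  have := @expR_ge_pow R 1 (r / 2); rewrite divr_ge0// => /(_ isT).
  by rewrite (_ : (r / 2 / 2%:R) ^+ 2 = r ^+ 2 / 16); [lra|field].
have [a1 a2] : r * logd y <= 8 * logd (y / 2) /\ r ^+ 2 * logd y <= 64 * logd (y / 2).
  have l0 := logd_gt0 y.
  have m1 : r * logd y <= 2 * expR (- (r / 2)).
    apply: (@le_trans _ _ (r * expR (- r))); first by rewrite ler_wpM2l.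
    by rewrite hs mulrA ler_wpM2r// ltW.
  have m2 : r ^+ 2 * logd y <= 16 * expR (- (r / 2)).
    apply: (@le_trans _ _ (r ^+ 2 * expR (- r))); first by rewrite ler_wpM2l// sqr_ge0.
    by rewrite hs mulrA ler_wpM2r// ltW.
  by split; lra.
split.
- have -> : b * logd y * r = b * (r * logd y) by ring.
  have -> : 16 * (b / 2 * logd (y / 2)) = b * (8 * logd (y / 2)) by field.
  exact: ler_wpM2l (ltW b0) _ _ a1.
- have -> : b * logd y * r ^+ 2 = b * (r ^+ 2 * logd y) by ring.
  have -> : 128 * (b / 2 * logd (y / 2)) = b * (64 * logd (y / 2)) by field.
  exact: ler_wpM2l (ltW b0) _ _ a2.
Qed.

Hypothesis e1 : e <= 1.

(** Two derivatives cost [e^-2]. The factor 2 in [N] makes [e^(-N)] small enough to absorb the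
    constant 1/4 of the lower bound in [logd_bounds]. *)
Lemma logk_mollifier : mollifier (logk e) (2 / e ^+ 2) (16 * e) (128 * e ^+ 2).
Proof.
have ei0 : 0 < e^-1 by rewrite invr_gt0.
have ei1 : 1 <= e^-1 by rewrite invr_ge1// ?unitfE ?gt_eqF.
have N1 : e^-1 <= 2 / e ^+ 2.
  by rewrite -exprVn expr2 mulrA ler_peMl ?(ltW ei0)//; lra.
have N2 : 2 <= 2 / e ^+ 2 by rewrite -exprVn ler_peMr// exprn_ege1.
have e20 : 0 < 2 * e by rewrite mulr_gt0.
have k0 z : 0 < logk e z by exact: logk_gt0.
have b1 p : 0 < p < 1 -> `|1 - 2 * p| <= 1 :> R.
  by move=> /andP[h1 h2]; rewrite ler_norml; apply/andP; split; lra.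
have b2 p : 0 < p < 1 -> `|1 - 6 * p + 6 * p ^+ 2| <= 1 :> R.
  move=> /andP[h1 h2]; have := sqr_ge0 (2 * p - 1).
  have : p ^+ 2 <= p by rewrite expr2 ler_piMr// ltW.
  have -> : (2 * p - 1) ^+ 2 = 4 * p ^+ 2 - 4 * p + 1 by ring.
  by move=> h3 h4; rewrite ler_norml; apply/andP; split; lra.
have dbl1 z : `|z| * logk e z <= 16 * e * logk (2 * e) z.
  have [h _] := logk_double z.
  have -> : `|z| * logk e z = e * (logk e z * `|e^-1 * z|).
    by rewrite normrM (gtr0_norm ei0); field; rewrite gt_eqF.
  rewrite [leRHS](_ : _ = e * (16 * logk (2 * e) z)); last by ring.
  by rewrite ler_wpM2l// ltW.
have dbl2 z : z ^+ 2 * logk e z <= 128 * e ^+ 2 * logk (2 * e) z.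
  have [_ h] := logk_double z.
  have -> : z ^+ 2 * logk e z = e ^+ 2 * (logk e z * (e^-1 * z) ^+ 2).
    by field; rewrite gt_eqF.
  rewrite [leRHS](_ : _ = e ^+ 2 * (128 * logk (2 * e) z)); last by ring.
  by rewrite ler_wpM2l// sqr_ge0.
have ms x : measurable_fun setT (fun y => x - y).
  by apply: measurable_funB => //; exact: measurable_cst.
have mk x : measurable_fun setT (fun y => logk e (x - y)).
  by apply: cont_meas; exact: cont_logk.
have i1 x : intg mu setT (fun y => `|x - y| * logk e (x - y)).
  apply: (@intg_le _ _ _ mu _ _ (fun y => 16 * e * logk (2 * e) (x - y))) => //.
  - apply: measurable_funM; last exact: mk.
    by apply: cont_meas => y; apply: cvg_norm; apply: cvgB; [exact: cvg_cst|exact: cvg_id].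
  - by move=> y _; rewrite normrM normr_id (gtr0_norm (k0 _)); exact: dbl1.
  - by apply: intgZ => //; exact: logk_intg.
have i2 x : intg mu setT (fun y => (x - y) ^+ 2 * logk e (x - y)).
  apply: (@intg_le _ _ _ mu _ _ (fun y => 128 * e ^+ 2 * logk (2 * e) (x - y))) => //.
  - by apply: measurable_funM; [apply: measurable_funX; exact: ms|exact: mk].
  - by move=> y _; rewrite normrM (gtr0_norm (k0 _)) ger0_norm ?sqr_ge0//; exact: dbl2.
  - by apply: intgZ => //; exact: logk_intg.
split.
- exact: elem_logk.
- exact: k0.
- by move=> z; rewrite /logk mulrN logd_even.
- by lra.
- move=> z; rewrite logk'E normrM (gtr0_norm ei0) normrM (gtr0_norm (k0 z)).
  apply: ler_pM; [exact: ltW|by rewrite mulr_ge0 ?(ltW (k0 z))|exact: N1|].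
  rewrite ler_piMr ?(ltW (k0 z))//; apply: b1; exact: logis_itv.
- move=> z; rewrite logk''E normrM (ger0_norm (mulr_ge0 (ltW ei0) (ltW ei0))).
  rewrite normrM (gtr0_norm (k0 z)).
  apply: ler_pM; [by rewrite mulr_ge0 ?(ltW ei0)|by rewrite mulr_ge0 ?(ltW (k0 z))| |].
    by rewrite -expr2 exprVn ler_peMl ?ler1n// invr_ge0 sqr_ge0.
  rewrite ler_piMr ?(ltW (k0 z))//; apply: b2; exact: logis_itv.
- move=> z; rewrite /logk; have /andP[h _] := logd_bounds (e^-1 * z).
  apply: (@le_trans _ _ (logd (e^-1 * z))); last by rewrite ler_peMl// ltW// logd_gt0.
  apply: le_trans h; rewrite normrM (gtr0_norm ei0) ler_pdivlMr//.
  (* From [e >= 2], squared; it absorbs the 1/4 since [2 / e ^+ 2 >= 2]. *)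
  have h4 : 4 <= expR (2 : R).
    have := @expR_ge_pow R 1 2 (ler0n _ _); rewrite divff ?pnatr_eq0// expr1n => _.
    have h1 := expR_ge1Dx (1 : R).
    have -> : expR (2 : R) = expR 1 * expR 1 by rewrite -expRD; congr expR; lra.
    nra.
  apply: (@le_trans _ _ (expR (- (2 / e ^+ 2 * (1 + `|z|))) * expR 2)).
    by rewrite ler_wpM2l// expR_ge0.
  rewrite -expRD ler_expR mulrDr mulr1.
  have : e^-1 * `|z| <= 2 / e ^+ 2 * `|z| by rewrite ler_wpM2r.
  by lra.
- move=> z; rewrite /logk; have /andP[_ h] := logd_bounds (e^-1 * z).
  apply: le_trans N1; rewrite mulrCA -[leRHS]mulr1 ler_wpM2l ?(ltW ei0)//.
  rewrite normrM (gtr0_norm ei0) in h.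
  have zz : 1 + `|z| <= 1 + e^-1 * `|z| by rewrite lerD2l ler_peMl.
  apply: (@le_trans _ _ ((1 + e^-1 * `|z|) * expR (- (e^-1 * `|z|)))).
    by apply: ler_pM => //; rewrite ?addr_ge0// ltW// logd_gt0.
  by rewrite expRN ler_pdivrMr ?expR_gt0// mul1r; exact: expR_ge1Dx.
- by move=> x; exact: logk_intg.
- by move=> x; exact: logk_int1.
- move=> x; have cd : continuous (fun y => derive1 (logk e) (x - y)).
    apply: elem_cont; apply: (@elem_comp _ (derive1 (logk e))).
      exact: elem_derive1 (elem_logk e).
    by apply: elem_sub; [exact: elem_cst|exact: elem_id].
  have bnd z : `|logk e z| <= e^-1 * expR (- (e^-1 * `|z|)).
    rewrite (gtr0_norm (k0 z)) ler_wpM2l ?(ltW ei0)//.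
    by have /andP[_] := logd_bounds (e^-1 * z); rewrite normrM (gtr0_norm ei0).
  rewrite (@ftc_line _ (fun y => - logk e (x - y)) _ (-0) (-0)) ?subrr//.
  + move=> y; have h : dv (fun y => x - y) y (-1).
      by apply: dv_eq (dvB (dv_cst x y) (dv_id y)) _; rewrite sub0r.
    apply: dv_eq (dvN (dv_comp h (elem_dv _ (elem_logk e)))) _.
    by rewrite mulrN1 opprK.
  + apply: (@intg_le _ _ _ mu _ _ (fun y => e^-1 * logk e (x - y))) => //.
    * exact: cont_meas.
    * move=> y _; rewrite logk'E normrM (gtr0_norm ei0) ler_wpM2l ?(ltW ei0)//.
      rewrite normrM (gtr0_norm (k0 _)) ler_piMr ?(ltW (k0 _))//.
      by apply: b1; exact: logis_itv.
    * by apply: intgZ => //; exact: logk_intg.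
  + apply: cvgN; apply: (@cvg0_le _ _ _ _ (fun n : nat => e^-1 * expR (- (e^-1 * n%:R) + e^-1 * x))).
      apply: nearW => n; apply: (le_trans (bnd _)); rewrite ler_wpM2l ?(ltW ei0)// ler_expR.
      have : e^-1 * (n%:R - x) <= e^-1 * `|x - n%:R|.
        by rewrite ler_wpM2l ?(ltW ei0)// distrC ler_norm.
      by rewrite mulrBr; lra.
    rewrite -(mulr0 e^-1); apply: cvgM; [exact: cvg_cst|exact: cvg_exp_lin].
  + apply: cvgN; apply: (@cvg0_le _ _ _ _ (fun n : nat => e^-1 * expR (- (e^-1 * n%:R) - e^-1 * x))).
      apply: nearW => n; apply: (le_trans (bnd _)); rewrite ler_wpM2l ?(ltW ei0)// ler_expR.
      have : e^-1 * (x + n%:R) <= e^-1 * `|x - - n%:R|.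
        by rewrite ler_wpM2l ?(ltW ei0)// opprK ler_norm.
      by rewrite mulrDr; lra.
    rewrite -(mulr0 e^-1); apply: cvgM; [exact: cvg_cst|exact: cvg_exp_lin].
- exact: i1.
- move=> x; apply: (@le_trans _ _ (\int[mu]_y (16 * e * logk (2 * e) (x - y)))).
    by apply: le_Rintegral => //; apply: intgZ => //; exact: logk_intg.
  by rewrite RintegralZl// ?logk_int1 ?mulr1//; exact: logk_intg.
- exact: i2.
- move=> x; apply: (@le_trans _ _ (\int[mu]_y (128 * e ^+ 2 * logk (2 * e) (x - y)))).
    by apply: le_Rintegral => //; apply: intgZ => //; exact: logk_intg.
  by rewrite RintegralZl// ?logk_int1 ?mulr1//; exact: logk_intg.
Qed.

End LogisticKernel.

(** * Convolutions: regularity and Fubini *)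

Section Convolution.
Context {R : realType}.
Local Notation mu := (@lebesgue_measure R).
Implicit Types (k h g : R -> R) (a : R -> R -> R) (x y : R).

Definition convol k h : R -> R := fun x => \int[mu]_y (k (x - y) * h y).

Lemma cont_shift k x : continuous k -> continuous (fun y => k (x - y)).
Proof.
move=> ck y; apply: (@cvg_comp _ _ _ (fun y => x - y) k); last exact: ck.
by apply: cvgB; [exact: cvg_cst|exact: cvg_id].
Qed.

Lemma cont_shiftl k y : continuous k -> continuous (fun x => k (x - y)).
Proof.
move=> ck x; apply: (@cvg_comp _ _ _ (fun x => x - y) k); last exact: ck.
by apply: cvgB; [exact: cvg_id|exact: cvg_cst].
Qed.

Lemma conv_intg k h (B : R) x : continuous k -> (forall z, `|k z| <= B) ->
  intg mu setT h -> intg mu setT (fun y => k (x - y) * h y).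
Proof.
move=> ck kB hi; apply: (@intg_le _ _ _ mu _ _ (fun y => B * `|h y|)) => //.
- by apply: measurable_funM; [by apply: cont_meas; exact: cont_shift|exact: intg_meas hi].
- by move=> y _; rewrite normrM ler_wpM2r.
- by apply: intgZ => //; exact: intg_norm.
Qed.

Lemma conv_cont k h (B : R) : continuous k -> (forall z, `|k z| <= B) ->
  intg mu setT h -> continuous (convol k h).
Proof.
move=> ck kB hi x.
have := @continuity_under_integral R _ _ mu (fun x y => k (x - y) * h y) setT
  measurableT (x - 1) (x + 1) _ _ (fun y => B * `|h y|) _ _ x.
apply.
- by move=> z _; exact: conv_intg kB hi.
- apply/aeW => y _ z _; apply: cvgM; last exact: cvg_cst.
  exact: cont_shiftl.
- by apply: intgZ => //; exact: intg_norm.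
- by move=> z _; apply/aeW => y _; rewrite normrM ler_wpM2r.
- by rewrite inE/= in_itv/=; apply/andP; split; lra.
Qed.

Lemma conv_dv k h (B : R) x : elem k -> (forall z, `|k z| <= B) ->
  (forall z, `|derive1 k z| <= B) -> intg mu setT h ->
  dv (convol k h) x (convol (derive1 k) h x).
Proof.
move=> ek kB k'B hi.
have B0 : 0 <= B by exact: le_trans (kB 0).
have dk z y : dv (fun x => k (x - y) * h y) z (derive1 k (z - y) * h y).
  have d1 : dv (fun x => x - y) z 1.
    by apply: dv_eq (dvB (dv_id z) (dv_cst y z)) _; rewrite subr0.
  apply: dv_eq (dvM (dv_comp d1 (elem_dv _ ek)) (dv_cst (h y) z)) _.
  by rewrite mulr1 mulr0 addr0.
have I x0 : (`]x - 1, x + 1[ : set R) x0 -> intg mu setT (fun y => k (x0 - y) * h y).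
  by move=> _; apply: (conv_intg _ (elem_cont ek) kB).
have Ix : (`]x - 1, x + 1[ : set R) x.
  by rewrite /= in_itv/=; apply/andP; split; lra.
have D1 x0 y : (`]x - 1, x + 1[ : set R) x0 -> [set: R] y ->
    derivable ((fun x y => k (x - y) * h y) ^~ y) x0 1.
  by move=> _ _; have [] := dk x0 y.
have G0 y : 0 <= B * `|h y| by rewrite mulr_ge0.
have iG : intg mu setT (fun y => B * `|h y|) by apply: intgZ => //; exact: intg_norm.
have GB x0 y : (`]x - 1, x + 1[ : set R) x0 -> [set: R] y ->
    `|partial1of2 (fun x y => k (x - y) * h y) x0 y| <= B * `|h y|.
  by move=> _ _; rewrite /partial1of2 (dv_derive1 (dk x0 y)) normrM ler_wpM2r.
have h1 := @derivable_under_integral R _ _ mu _ _ measurableT _ _ _ Ix I D1 _ G0 iG GB.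
have h2 := @differentiation_under_integral R _ _ mu _ _ measurableT _ _ _ Ix I D1 _ G0 iG GB.
apply: dv_eq (dv_of h1) _; rewrite h2; apply: eq_Rintegral => y _.
by rewrite /partial1of2 (dv_derive1 (dk x y)).
Qed.

Lemma conv_fubini a h (M : R -> R) :
  measurable_fun setT (fun p : R * R => a p.1 p.2) -> measurable_fun setT h ->
  (forall y, intg mu setT (a ^~ y)) ->
  (forall y, \int[mu]_x `|a x y| <= M y) -> intg mu setT (fun y => M y * `|h y|) ->
  [/\ intg mu setT (fun x => \int[mu]_y (a x y * h y)),
      \int[mu]_x \int[mu]_y (a x y * h y) = \int[mu]_y ((\int[mu]_x a x y) * h y) &
      {ae mu, forall x, intg mu setT (fun y => a x y * h y)}].
Proof.
move=> ma mh ia aM iM.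
pose F (p : R * R) := a p.2 p.1 * h p.1.
have mF : measurable_fun setT F.
  apply: measurable_funM; last exact: (measurableT_comp mh measurable_fst).
  apply: (@measurableT_comp _ _ _ _ _ _ (fun p : R * R => a p.1 p.2) _ (fun p => (p.2, p.1))) => //.
  by apply: measurable_fun_pair; [exact: measurable_snd|exact: measurable_fst].
have iF : intg (mu \x mu)%E setT F.
  apply: (@tonelli_lt _ _ _ _ _ mu mu F _ mF _ _ iM) => y.
    apply: (@intg_eq _ _ _ mu _ (fun x => h y * a x y)) => //.
      by move=> x _; rewrite mulrC.
    by apply: intgZ => //; exact: ia.
  rewrite [leLHS](_ : _ = \int[mu]_x (`|h y| * `|a x y|)); last first.
    by apply: eq_Rintegral => x _; rewrite normrM mulrC.
  rewrite RintegralZl//; last by apply: intg_norm => //; exact: ia.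
  by rewrite mulrC ler_wpM2r.
split.
- exact: (fubini_intg2 iF).
- rewrite -(fubiniR iF); apply: eq_Rintegral => y _ /=.
  rewrite -RintegralZr//; exact: ia.
- exact: (fubini_ae2 iF).
Qed.

Lemma meas_sub2 k : measurable_fun setT k ->
  measurable_fun setT (fun p : R * R => k (p.1 - p.2)).
Proof.
move=> mk; apply: (measurableT_comp mk).
by apply: measurable_funB; [exact: measurable_fst|exact: measurable_snd].
Qed.

Lemma meas_fst2 g : measurable_fun setT g ->
  measurable_fun setT (fun p : R * R => g p.1).
Proof. by move=> mg; exact: (measurableT_comp mg measurable_fst). Qed.

Lemma meas_snd2 g : measurable_fun setT g ->
  measurable_fun setT (fun p : R * R => g p.2).
Proof. by move=> mg; exact: (measurableT_comp mg measurable_snd). Qed.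

End Convolution.

Section MollifiedDensity.
Context {R : realType}.
Local Notation mu := (@lebesgue_measure R).
Implicit Types (x y z : R).
Variables (K : R -> R) (N e1 e2 : R).
Hypothesis hK : mollifier K N e1 e2.

Lemma mol_N0 : 0 <= N.
Proof. by apply: le_trans (mol_N hK). Qed.

Lemma mol_cont : continuous K.
Proof. exact: elem_cont (mol_elem hK). Qed.

Lemma mol_bd z : `|K z| <= N.
Proof.
rewrite (gtr0_norm (mol_gt0 hK z)); apply: le_trans (mol_dec hK z).
by rewrite ler_peMl ?(ltW (mol_gt0 hK z))// lerDl.
Qed.

Lemma mol_bd1 z : `|derive1 K z| <= N ^+ 2.
Proof.
apply: (le_trans (mol_d1 hK z)); rewrite expr2 ler_wpM2l ?mol_N0//.
exact: le_trans (ler_norm _) (mol_bd z).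
Qed.

Lemma mol_bd2 z : `|derive1n 2 K z| <= N ^+ 2.
Proof.
apply: (le_trans (mol_d2 hK z)); rewrite expr2 ler_wpM2l ?mol_N0//.
exact: le_trans (ler_norm _) (mol_bd z).
Qed.

Lemma mol_NN : N <= N ^+ 2.
Proof. by rewrite expr2 ler_peMl ?mol_N0//; exact: mol_N hK. Qed.

Lemma mol_sym x y : K (x - y) = K (y - x).
Proof. by rewrite -(mol_even hK) opprB. Qed.

Lemma mol_odd z : derive1 K (- z) = - derive1 K z.
Proof.
have dn : dv (fun y : R => - y) z (-1) by apply: dvN; exact: dv_id.
have h := dv_comp dn (elem_dv (- z) (mol_elem hK)).
have e : (fun y => K (- y)) = K by apply/funext => y; exact: mol_even hK y.
by rewrite e in h; have := dv_derive1 h; rewrite mulrN1 => ->; rewrite opprK.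
Qed.

Lemma mol_intgx y : intg mu setT (fun x => K (x - y)).
Proof. by apply: intg_eq (mol_intg hK y) => // x _; exact: mol_sym. Qed.

Lemma mol_int1x y : \int[mu]_x K (x - y) = 1.
Proof. by rewrite -(mol_int1 hK y); apply: eq_Rintegral => x _; exact: mol_sym. Qed.

Lemma mol_intgdx y : intg mu setT (fun x => derive1 K (x - y)).
Proof.
apply: (@intg_le _ _ _ mu _ _ (fun x => N * K (x - y))) => //.
- by apply: cont_meas; apply: cont_shiftl; exact: elem_cont (elem_derive1 (mol_elem hK)).
- by move=> x _; exact: mol_d1 hK _.
- by apply: intgZ => //; exact: mol_intgx.
Qed.

Lemma mol_intdx y : \int[mu]_x derive1 K (x - y) = 0.
Proof.
have e x : derive1 K (x - y) = - derive1 K (y - x) by rewrite -mol_odd opprB.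
have i : intg mu setT (fun x => derive1 K (y - x)).
  apply: (@intg_eq _ _ _ mu _ (fun x => - derive1 K (x - y))) => //.
    by move=> x _; rewrite e opprK.
  by apply: intgN => //; exact: mol_intgdx.
under eq_Rintegral do rewrite e.
by rewrite Rint_N// (mol_intd hK) oppr0.
Qed.

Lemma mol_mom1x y : intg mu setT (fun x => `|x - y| * K (x - y)) /\
  \int[mu]_x (`|x - y| * K (x - y)) <= e1.
Proof.
have e x : `|y - x| * K (y - x) = `|x - y| * K (x - y) by rewrite distrC mol_sym.
split; first by apply: intg_eq (mol_mom1i hK y) => // x _.
by under eq_Rintegral do rewrite -e; exact: mol_mom1 hK y.
Qed.

Lemma mol_mom2x y : intg mu setT (fun x => (x - y) ^+ 2 * K (x - y)) /\
  \int[mu]_x ((x - y) ^+ 2 * K (x - y)) <= e2.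
Proof.
have e x : (y - x) ^+ 2 * K (y - x) = (x - y) ^+ 2 * K (x - y).
  by rewrite mol_sym -sqrrN opprB.
split; first by apply: intg_eq (mol_mom2i hK y) => // x _.
by under eq_Rintegral do rewrite -e; exact: mol_mom2 hK y.
Qed.

Lemma mol_e1 : 0 <= e1.
Proof.
apply: le_trans (mol_mom1 hK 0); apply: Rintegral_ge0 => x _.
by rewrite mulr_ge0// ltW// (mol_gt0 hK).
Qed.

Lemma mol_e2 : 0 <= e2.
Proof.
apply: le_trans (mol_mom2 hK 0); apply: Rintegral_ge0 => x _.
by rewrite mulr_ge0 ?sqr_ge0// ltW// (mol_gt0 hK).
Qed.

(* A bound of [|a x y|] by [K (x - y)] times a quadratic weight in [y] and
   [x - y] is all that Fubini needs against densities of finite second moment. *)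
Lemma mol_fubini rho (a : R -> R -> R) (B : R) : P2 rho ->
  measurable_fun setT (fun p : R * R => a p.1 p.2) ->
  (forall x y, `|a x y| <= B * ((1 + y ^+ 2 + (x - y) ^+ 2) * K (x - y))) ->
  [/\ intg mu setT (fun x => \int[mu]_y (a x y * rho y)),
      \int[mu]_x \int[mu]_y (a x y * rho y) = \int[mu]_y ((\int[mu]_x a x y) * rho y) &
      {ae mu, forall x, intg mu setT (fun y => a x y * rho y)}].
Proof.
move=> hr ma aB.
have B0 : 0 <= B.
  have q0 : 0 < (1 + 0 ^+ 2 + (0 - 0) ^+ 2) * K (0 - 0).
    by rewrite subrr expr0n !addr0 mul1r (mol_gt0 hK).
  by have := le_trans (normr_ge0 _) (aB 0 0); rewrite pmulr_lge0.
have iw y : intg mu setT (fun x => (1 + y ^+ 2 + (x - y) ^+ 2) * K (x - y)).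
  apply: (@intg_eq _ _ _ mu _ (fun x => (1 + y ^+ 2) * K (x - y) + (x - y) ^+ 2 * K (x - y))) => //.
    by move=> x _; ring.
  by apply: intgD => //; [apply: intgZ => //; exact: mol_intgx|exact: (mol_mom2x y).1].
have ia y : intg mu setT (a ^~ y).
  apply: (@intg_le _ _ _ mu _ _ (fun x => B * ((1 + y ^+ 2 + (x - y) ^+ 2) * K (x - y)))) => //.
  - exact: (measurableT_comp ma (measurable_pair2 y)).
  - by apply: intgZ => //; exact: iw.
apply: (@conv_fubini _ a rho (fun y => B * (1 + y ^+ 2 + e2))) => //.
- exact: P2_meas.
- move=> y; apply: (@le_trans _ _ (\int[mu]_x (B * ((1 + y ^+ 2 + (x - y) ^+ 2) * K (x - y))))).
    apply: le_Rintegral => //; first by apply: intg_norm => //; exact: ia.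
    by apply: intgZ => //; exact: iw.
  rewrite RintegralZl//.
  rewrite ler_wpM2l//; under eq_Rintegral do rewrite mulrDl.
  rewrite RintegralD//; [|by apply: intgZ => //; exact: mol_intgx|exact: (mol_mom2x y).1].
  by rewrite RintegralZl ?mol_int1x ?mulr1 ?lerD2l//; [exact: (mol_mom2x y).2|exact: mol_intgx].
- apply: (@intg_eq _ _ _ mu _ (fun y => B * ((1 + y ^+ 2) * rho y + e2 * rho y))) => //.
    by move=> y _; rewrite (ger0_norm (P2_ge0 y hr)); ring.
  apply: intgZ => //; apply: intgD => //; first exact: P2_intg12.
  by apply: intgZ => //; exact: P2_intg1.
Qed.

Lemma quad_split x y : x ^+ 2 <= 2 * (y ^+ 2 + (x - y) ^+ 2).
Proof.
have := sqr_ge0 (x - 2 * y).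
have -> : (x - 2 * y) ^+ 2 = 2 * (y ^+ 2 + (x - y) ^+ 2) - x ^+ 2 by ring.
by lra.
Qed.

Variable rho : R -> R.
Hypothesis hr : P2 rho.

Definition mfl : R -> R := convol K rho.

(** Jensen's inequality by hand: in the lower bound of the kernel, the exponential in [|y|] is
    replaced by its tangent at [A]. As [A] is at least the first absolute moment of [rho], the
    integrated tangent factor is at least 1. *)
Lemma mfl_gt_low x : expR (- (N * (3 + mom2 rho + `|x|))) <= mfl x.
Proof.
set A := 1 + mom2 rho.
have i1 := P2_intg1 hr.
have ky : forall y, expR (- (N * (1 + A + `|x|))) * (1 - N * (`|y| - A)) <= K (x - y).
  move=> y; apply: le_trans (mol_low hK (x - y)).
  apply: (@le_trans _ _ (expR (- (N * (1 + A + `|x|))) * expR (- (N * (`|y| - A))))).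
    by rewrite ler_wpM2l ?expR_ge0//; exact: expR_ge1Dx.
  rewrite -expRD ler_expR; have := ler_wpM2l mol_N0 (ler_normB x y); lra.
have iy : intg mu setT (fun y => `|y| * rho y).
  apply: (P2_intg hr (C := 2)).
    by apply: cont_meas => z; apply: cvg_norm; exact: cvg_id.
  by move=> y; rewrite -[2]mulr1; apply: lin_quad; rewrite normr_id mul1r lerDr.
have yA : \int[mu]_y (`|y| * rho y) <= A.
  have -> : A = \int[mu]_y ((1 + y ^+ 2) * rho y).
    under eq_Rintegral do rewrite mulrDl mul1r.
    by rewrite (RintegralD measurableT i1 (P2_intg2 hr)) P2_mass.
  apply: le_Rintegral => //; first exact: P2_intg12.
  move=> y _; rewrite ler_wpM2r ?(P2_ge0 _ hr)//.
  have := sqr_ge0 (`|y| - 2^-1); rewrite -(real_normK (num_real y)).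
  have -> : (`|y| - 2^-1) ^+ 2 = `|y| ^+ 2 - `|y| + 4^-1 by field.
  by lra.
have iL : intg mu setT (fun y => (expR (- (N * (1 + A + `|x|))) * (1 - N * (`|y| - A))) * rho y).
  apply: (@intg_eq _ _ _ mu _ (fun y => expR (- (N * (1 + A + `|x|))) *
    ((1 + N * A) * rho y - N * (`|y| * rho y)))) => //; first by move=> y _; ring.
  by apply: intgZ => //; apply: intgB => //; exact: intgZ.
apply: (@le_trans _ _ (\int[mu]_y ((expR (- (N * (1 + A + `|x|))) * (1 - N * (`|y| - A))) * rho y))); last first.
  apply: le_Rintegral => //; first exact: (conv_intg _ mol_cont mol_bd i1).
  by move=> y _; rewrite ler_wpM2r ?(P2_ge0 _ hr).
rewrite (_ : \int[mu]_y _ = \int[mu]_y (expR (- (N * (1 + A + `|x|))) *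
    ((1 + N * A) * rho y - N * (`|y| * rho y)))); last first.
  by apply: eq_Rintegral => y _; ring.
rewrite RintegralZl//; last by apply: intgB => //; exact: intgZ.
rewrite RintegralB//; [|exact: intgZ|exact: intgZ].
rewrite RintegralZl// RintegralZl// (P2_mass hr) mulr1.
apply: (@le_trans _ _ (expR (- (N * (1 + A + `|x|))))).
  rewrite ler_expR lerN2 ler_wpM2l ?mol_N0// /A; lra.
rewrite ler_peMr ?expR_ge0//.
by rewrite -addrA lerDl subr_ge0 ler_wpM2l ?mol_N0.
Qed.

Lemma mfl_gt0 x : 0 < mfl x.
Proof. exact: lt_le_trans (expR_gt0 _) (mfl_gt_low x). Qed.

Lemma mfl_le x : mfl x <= N.
Proof.
rewrite -[leRHS]mulr1 -(P2_mass hr) -RintegralZl//; last exact: P2_intg1 hr.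
apply: le_Rintegral => //; first exact: (conv_intg _ mol_cont mol_bd (P2_intg1 hr)).
  by apply: intgZ => //; exact: P2_intg1 hr.
move=> y _; rewrite ler_wpM2r ?(P2_ge0 _ hr)//.
exact: le_trans (ler_norm _) (mol_bd _).
Qed.

Lemma mfl_ln x : `|ln (mfl x)| <= N * (3 + mom2 rho + `|x|).
Proof.
have f0 := mfl_gt0 x; have m0 := mom2_ge0 hr.
rewrite ler_norml; apply/andP; split.
  by rewrite -[leLHS]expRK ler_ln ?posrE ?expR_gt0//; exact: mfl_gt_low.
apply: (@le_trans _ _ (ln N)).
  by rewrite ler_ln ?posrE ?mfl_le// (lt_le_trans ltr01 (mol_N hK)).
apply: (@le_trans _ _ N).
  have := ln_sublinear (lt_le_trans ltr01 (mol_N hK)); exact: ltW.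
rewrite ler_peMr ?mol_N0//; have := normr_ge0 x; lra.
Qed.

Lemma mfl_cont : continuous mfl.
Proof. exact: (conv_cont mol_cont mol_bd (P2_intg1 hr)). Qed.

Lemma mfl_dv x : dv mfl x (convol (derive1 K) rho x).
Proof.
apply: (conv_dv (B := N ^+ 2)) => //; [exact: mol_elem hK| |exact: mol_bd1|exact: P2_intg1].
by move=> z; exact: le_trans (mol_bd z) mol_NN.
Qed.

Lemma mfl_quad : intg mu setT (fun x => (1 + x ^+ 2) * mfl x) /\
  \int[mu]_x (x ^+ 2 * mfl x) <= 2 * (mom2 rho + e2).
Proof.
have e x : x ^+ 2 * mfl x = \int[mu]_y (x ^+ 2 * K (x - y) * rho y).
  rewrite -RintegralZl//; last exact: (conv_intg _ mol_cont mol_bd (P2_intg1 hr)).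
  by apply: eq_Rintegral => y _; rewrite mulrA.
have mk : measurable_fun setT (fun p : R * R => K (p.1 - p.2)).
  exact: meas_sub2 (cont_meas mol_cont).
have m2 : measurable_fun setT (fun p : R * R => p.1 ^+ 2 * K (p.1 - p.2)).
  apply: measurable_funM => //.
  by apply: (@meas_fst2 _ (fun x => x ^+ 2)); exact: measurable_funX.
have b2 x y : `|x ^+ 2 * K (x - y)| <= 2 * ((1 + y ^+ 2 + (x - y) ^+ 2) * K (x - y)).
  rewrite normrM (gtr0_norm (mol_gt0 hK _)) mulrA ler_wpM2r ?(ltW (mol_gt0 hK _))//.
  rewrite ger0_norm ?sqr_ge0//; apply: (le_trans (quad_split x y)); lra.
have [i2 E2 _] := @mol_fubini rho (fun x y => x ^+ 2 * K (x - y)) 2 hr m2 b2.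
have b1 x y : `|K (x - y)| <= 1 * ((1 + y ^+ 2 + (x - y) ^+ 2) * K (x - y)).
  rewrite mul1r (gtr0_norm (mol_gt0 hK _)) ler_peMl ?(ltW (mol_gt0 hK _))//.
  by rewrite -addrA lerDl addr_ge0 ?sqr_ge0.
have [i1 _ _] := @mol_fubini rho (fun x y => K (x - y)) 1 hr mk b1.
split.
  apply: (@intg_eq _ _ _ mu _ (fun x => mfl x + x ^+ 2 * mfl x)) => //.
    by move=> x _; rewrite mulrDl mul1r.
  by apply: intgD => //; apply: intg_eq i2 => // x _; rewrite e.
under eq_Rintegral do rewrite e.
rewrite E2.
have -> : 2 * (mom2 rho + e2) = \int[mu]_y (2 * (y ^+ 2 * rho y + e2 * rho y)).
  rewrite RintegralZl//; last first.
    by apply: intgD => //; [exact: P2_intg2|apply: intgZ => //; exact: P2_intg1].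
  rewrite RintegralD//; [|exact: P2_intg2|by apply: intgZ => //; exact: P2_intg1].
  by rewrite RintegralZl// ?(P2_mass hr) ?mulr1//; exact: P2_intg1.
have iq y : intg mu setT (fun x => 2 * (y ^+ 2 * K (x - y) + (x - y) ^+ 2 * K (x - y))).
  apply: intgZ => //; apply: intgD => //; last exact: (mol_mom2x y).1.
  by apply: intgZ => //; exact: mol_intgx.
have ix y : intg mu setT (fun x => x ^+ 2 * K (x - y)).
  apply: (@intg_le _ _ _ mu _ _ (fun x => 2 * (y ^+ 2 * K (x - y) + (x - y) ^+ 2 * K (x - y)))) => //.
    exact: (measurableT_comp m2 (measurable_pair2 y)).
  move=> x _; rewrite normrM (gtr0_norm (mol_gt0 hK _)) -mulrDl mulrA.
  rewrite ler_wpM2r ?(ltW (mol_gt0 hK _))// ger0_norm ?sqr_ge0//; exact: quad_split.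
have bx y : 0 <= \int[mu]_x (x ^+ 2 * K (x - y)) <= 2 * (y ^+ 2 + e2).
  apply/andP; split.
    by apply: Rintegral_ge0 => x _; rewrite mulr_ge0 ?sqr_ge0 ?(ltW (mol_gt0 hK _)).
  apply: (@le_trans _ _ (\int[mu]_x (2 * (y ^+ 2 * K (x - y) + (x - y) ^+ 2 * K (x - y))))).
    apply: le_Rintegral => // x _.
    rewrite -mulrDl mulrA ler_wpM2r ?(ltW (mol_gt0 hK _))//; exact: quad_split.
  rewrite RintegralZl//; last first.
    apply: intgD => //; last exact: (mol_mom2x y).1.
    by apply: intgZ => //; exact: mol_intgx.
  rewrite RintegralD//; [|by apply: intgZ => //; exact: mol_intgx|exact: (mol_mom2x y).1].
  rewrite RintegralZl ?mol_int1x ?mulr1//; last exact: mol_intgx.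
  by rewrite ler_wpM2l// lerD2l; exact: (mol_mom2x y).2.
have ir : intg mu setT (fun y => 2 * (y ^+ 2 * rho y + e2 * rho y)).
  by apply: intgZ => //; apply: intgD => //; [exact: P2_intg2|apply: intgZ => //; exact: P2_intg1].
apply: le_Rintegral => //.
  apply: (@intg_le _ _ _ mu _ _ (fun y => 2 * (y ^+ 2 * rho y + e2 * rho y))) => //.
    apply: measurable_funM; last exact: P2_meas.
    exact: (@measurable_Rint2 _ _ _ _ _ mu (fun p : R * R => p.1 ^+ 2 * K (p.1 - p.2))).
  move=> y _; have /andP[h1 h2] := bx y; rewrite normrM (ger0_norm h1) (ger0_norm (P2_ge0 y hr)).
  by rewrite -mulrDl mulrA ler_wpM2r// (P2_ge0 _ hr).
move=> y _; have /andP[h1 h2] := bx y.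
by rewrite -mulrDl mulrA ler_wpM2r// (P2_ge0 _ hr).
Qed.

End MollifiedDensity.

(** * Gibbs measures *)

Section StrongConvexity.
Context {R : realType}.
Implicit Types (A M V : R -> R) (x y s a k : R).

Lemma dv_mono_mul (F F' : R -> R) s x k : (forall z, dv F z (F' z)) ->
  (forall z, k <= F' z) -> k * (x - s) ^+ 2 <= (F x - F s) * (x - s).
Proof.
move=> dF Fk; have [sx|xs] := leP s x.
  have [c _ ->] := mvt dF sx.
  by rewrite -mulrA -expr2 ler_wpM2r// sqr_ge0.
have [c _ e] := mvt dF (ltW xs).
have -> : (F x - F s) * (x - s) = F' c * (x - s) ^+ 2.
  by rewrite -opprB e expr2; ring.
by rewrite ler_wpM2r// sqr_ge0.
Qed.

Lemma strong_convex A M V k : (forall s, dv A s (M s)) -> (forall s, dv M s (V s)) ->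
  (forall s, k <= V s) ->
  forall s y, A s + M s * (y - s) + k / 2 * (y - s) ^+ 2 <= A y.
Proof.
move=> dA dM Vk s y.
pose g x := A x - (M s * (x - s) + k / 2 * (x - s) ^+ 2).
pose g' x := M x - (M s + k * (x - s)).
have dg x : dv g x (g' x).
  apply: dvB => //; have d1 : dv (fun x => x - s) x 1.
    by apply: dv_eq (dvB (dv_id x) (dv_cst s x)) _; rewrite subr0.
  apply: dv_eq (dvD (dvZ _ d1) (dvZ _ (dvX 2 d1))) _.
  by rewrite /= expr1; field.
have g'p x : 0 <= g' x * (x - s).
  have := dv_mono_mul s x dM Vk; rewrite /g'; move: (M x) (M s) => p q h.
  have -> : (p - (q + k * (x - s))) * (x - s) = (p - q) * (x - s) - k * (x - s) ^+ 2 by ring.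
  by rewrite subr_ge0.
suff : g s <= g y by rewrite /g subrr expr0n /= !mulr0 addr0 subr0; lra.
have [sy|ys] := leP s y.
  apply: (nondec_dv dg _ sy) => z /andP[sz _].
  have := g'p z; move: sz; rewrite le_eqVlt => /predU1P[<- _|sz].
    by rewrite /g' subrr mulr0 addr0 subrr.
  by rewrite pmulr_lge0// subr_gt0.
have h : - g y <= - g s.
  apply: (nondec_dv (fun z => dvN (dg z)) _ (ltW ys)) => z /andP[_ zs].
  have := g'p z; move: zs; rewrite le_eqVlt => /predU1P[-> _|zs].
    by rewrite /g' subrr mulr0 addr0 subrr oppr0.
  by rewrite nmulr_lge0 ?subr_lt0// oppr_ge0.
by lra.
Qed.

(** Strong convexity at [s], evaluated at [a], bounds the left side by
    [(a - s) (M a - M s) - k/2 (a - s)^2]; its maximum over [a - s] is the right side. The estimate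
    is thus in terms of the means and not of the parameters. *)
Lemma bregman_le A M V k : (forall s, dv A s (M s)) -> (forall s, dv M s (V s)) ->
  0 < k -> (forall s, k <= V s) ->
  forall s a, A s - A a - (s - a) * M a <= (M a - M s) ^+ 2 / (2 * k).
Proof.
move=> dA dM k0 Vk s a; have := strong_convex dA dM Vk s a.
have : 0 <= (k * (a - s) - (M a - M s)) ^+ 2 / (2 * k).
  by rewrite divr_ge0 ?sqr_ge0 ?mulr_ge0 ?(ltW k0).
have -> : (k * (a - s) - (M a - M s)) ^+ 2 / (2 * k) =
  k / 2 * (a - s) ^+ 2 - (a - s) * (M a - M s) + (M a - M s) ^+ 2 / (2 * k).
  by field; rewrite gt_eqF.
move: ((M a - M s) ^+ 2 / (2 * k)) => q; lra.
Qed.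

End StrongConvexity.

Section Gibbs.
Context {R : realType}.
Local Notation mu := (@lebesgue_measure R).
Implicit Types (x y s a m : R).
Variables (H : R -> R) (C c : R).
Hypothesis hH : confining H C c.

Definition expo s x : R := expR (- H x + s * x).

Lemma H_cont : continuous H.
Proof. exact: dv_continuous (conf_dv hH). Qed.

Lemma expo_cont s : continuous (expo s).
Proof.
move=> x; apply: (@cvg_comp _ _ _ (fun x => - H x + s * x) expR); last exact: continuous_expR.
apply: cvgD; first by apply: cvgN; exact: H_cont.
by apply: cvgM; [exact: cvg_cst|exact: cvg_id].
Qed.

Lemma sqr_exp_le x : (1 + x ^+ 2) * expR (- `|x|) <= 5.
Proof.
rewrite expRN ler_pdivrMr ?expR_gt0//.
rewrite -(real_normK (num_real x)); move: (`|x|) (normr_ge0 x) => r r0.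
have h1 := expR_ge1Dx r; have h2 := @expR_ge_pow R 1 r r0.
have : (r / 2%:R) ^+ 2 = r ^+ 2 / 4 by field.
by move=> e; rewrite e in h2; lra.
Qed.

(** A majorant uniform over [|s| <= S], as differentiation under the integral requires. It is a
    multiple of [logd] because the latter is already known to be integrable. *)
Lemma expo_dom (S : R) : 0 <= S -> exists2 B, 0 <= B & forall s x, `|s| <= S ->
  (1 + x ^+ 2) * expo s x <= B * logd x.
Proof.
move=> S0; have c0 := conf_c hH.
(* Completing the square in [C - c x^2 + (S + 2) |x|]. The spare factor [e^(-2 |x|)] is spent half
   on [1 + x^2] (constant 5) and half on the comparison with [logd] (constant 4), whence 20. *)
pose k := C + (S + 2) ^+ 2 / (4 * c).
exists (20 * expR k); first by rewrite mulr_ge0// expR_ge0.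
move=> s x sS.
have e : - H x + s * x <= k - `|x| - `|x|.
  have h1 := conf_coer hH x.
  have h2 : s * x <= S * `|x|.
    apply: (le_trans (ler_norm _)); rewrite normrM ler_wpM2r//.
  have h3 : 0 <= (c * `|x| - (S + 2) / 2) ^+ 2 / c by rewrite divr_ge0 ?sqr_ge0 ?ltW.
  have e3 : (c * `|x| - (S + 2) / 2) ^+ 2 / c = c * `|x| ^+ 2 - (S + 2) * `|x| + (S + 2) ^+ 2 / (4 * c).
    by field; rewrite gt_eqF.
  rewrite e3 real_normK ?num_real// in h3; rewrite /k; lra.
have h : expo s x <= expR k * expR (- `|x|) * expR (- `|x|).
  by rewrite -!expRD ler_expR.
have /andP[h4 _] := logd_bounds x.
apply: (@le_trans _ _ ((1 + x ^+ 2) * (expR k * expR (- `|x|) * expR (- `|x|)))).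
  by rewrite ler_wpM2l// addr_ge0// sqr_ge0.
have -> : (1 + x ^+ 2) * (expR k * expR (- `|x|) * expR (- `|x|)) =
  expR k * (((1 + x ^+ 2) * expR (- `|x|)) * expR (- `|x|)) by ring.
have -> : 20 * expR k * logd x = expR k * (20 * logd x) by ring.
rewrite ler_wpM2l ?expR_ge0//.
apply: (@le_trans _ _ (5 * expR (- `|x|))); last by lra.
by rewrite ler_wpM2r ?expR_ge0// sqr_exp_le.
Qed.

Lemma logd_intg : intg mu setT (@logd R).
Proof.
apply: (@intg_eq _ _ _ mu _ (fun y => logk 1 (0 - y))) => //.
  by move=> y _; rewrite /logk invr1 !mul1r sub0r logd_even.
exact: logk_intg.
Qed.

Lemma expo_intg (g : R -> R) (B s : R) : measurable_fun setT g ->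
  (forall x, `|g x| <= B * (1 + x ^+ 2)) -> intg mu setT (fun x => g x * expo s x).
Proof.
move=> mg gB; have [D D0 hD] := expo_dom (normr_ge0 s).
have B0 : 0 <= B.
  by have := le_trans (normr_ge0 _) (gB 0); rewrite expr0n /= addr0 mulr1.
apply: (@intg_le _ _ _ mu _ _ (fun x => B * (D * logd x))) => //.
- by apply: measurable_funM; [exact: mg|exact: (cont_meas (@expo_cont s))].
- move=> x _; rewrite normrM (ger0_norm (expR_ge0 _)).
  apply: (@le_trans _ _ (B * (1 + x ^+ 2) * expo s x)).
    by rewrite ler_wpM2r// expR_ge0.
  by rewrite -mulrA ler_wpM2l// hD.
- by do 2 apply: intgZ => //; exact: logd_intg.
Qed.

Lemma Rint_itv_gt0 (g : R -> R) a b : a < b -> continuous g -> (forall x, 0 < g x) ->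
  0 < \int[mu]_(x in `[a, b]) g x.
Proof.
move=> ab cg g0.
have [d _ hd] := EVT_min (ltW ab) (continuous_subspaceT cg).
apply: (@lt_le_trans _ _ (g d * (b - a))); first by rewrite mulr_gt0// subr_gt0.
rewrite -(Rint_cst_itv (g d) (ltW ab)); apply: le_Rintegral => //.
- exact: intg_cst_itv.
- exact: intg_cont.
Qed.

Definition zmom (n : nat) s : R := \int[mu]_x (x ^+ n * expo s x).

Lemma pow_bound (n : nat) x : (n <= 2)%N -> `|x ^+ n| <= 1 * (1 + x ^+ 2).
Proof.
rewrite mul1r -(real_normK (num_real x)) normrX; move: (`|x|) (normr_ge0 x) => r r0.
case: n => [|[|[|//]]] _; rewrite ?expr0 ?expr1.
- by rewrite lerDl sqr_ge0.
- have := sqr_ge0 (r - 2^-1).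
  have -> : (r - 2^-1) ^+ 2 = r ^+ 2 - r + 4^-1 by field.
  by lra.
- by rewrite lerDr.
Qed.

Lemma zmom_intg (n : nat) s : (n <= 2)%N -> intg mu setT (fun x => x ^+ n * expo s x).
Proof.
move=> n2; apply: (expo_intg s (B := 1)); first exact: measurable_funX.
by move=> x; exact: pow_bound.
Qed.

(** Two uses of this give the cumulants: the derivative of [logZ] is [mean], and that of [mean] is
    [variance]. *)
Lemma dv_zmom (n : nat) s : (n <= 1)%N -> dv (zmom n) s (zmom n.+1 s).
Proof.
move=> n1; have n2 : (n <= 2)%N by exact: leq_trans n1 _.
have dk z x : dv (fun s => x ^+ n * expo s x) z (x ^+ n.+1 * expo z x).
  have d1 : dv (fun s => - H x + s * x) z x.
    apply: dv_eq (dvD (dv_cst (- H x) z) (dvM (dv_id z) (dv_cst x z))) _.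
    by rewrite mulr0 addr0 add0r mul1r.
  by apply: dv_eq (dvZ _ (dv_exp d1)) _; rewrite exprSr /expo; ring.
have [B B0 hB] := expo_dom (addr_ge0 (normr_ge0 s) ler01).
have I x0 : (`]s - 1, s + 1[ : set R) x0 -> intg mu setT (fun x => x ^+ n * expo x0 x).
  by move=> _; exact: zmom_intg.
have Ix : (`]s - 1, s + 1[ : set R) s.
  by rewrite /= in_itv/=; apply/andP; split; lra.
have D1 x0 y : (`]s - 1, s + 1[ : set R) x0 -> [set: R] y ->
    derivable ((fun s x => x ^+ n * expo s x) ^~ y) x0 1.
  by move=> _ _; have [] := dk x0 y.
have G0 y : 0 <= B * logd y by rewrite mulr_ge0// ltW// logd_gt0.
have iG : intg mu setT (fun y => B * logd y) by apply: intgZ => //; exact: logd_intg.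
have GB x0 y : (`]s - 1, s + 1[ : set R) x0 -> [set: R] y ->
    `|partial1of2 (fun s x => x ^+ n * expo s x) x0 y| <= B * logd y.
  rewrite /= in_itv/= => /andP[h1 h2] _.
  rewrite /partial1of2 (dv_derive1 (dk x0 y)) normrM (ger0_norm (expR_ge0 _)).
  apply: (@le_trans _ _ ((1 + y ^+ 2) * expo x0 y)).
    by rewrite ler_wpM2r ?expR_ge0// -[leRHS]mul1r; apply: pow_bound.
  apply: hB; rewrite ler_norml; have := ler_norm s; have := lerNnormlW (lexx `|s|).
  by move=> h3 h4; apply/andP; split; lra.
have h1 := @derivable_under_integral R _ _ mu _ _ measurableT _ _ _ Ix I D1 _ G0 iG GB.
have h2 := @differentiation_under_integral R _ _ mu _ _ measurableT _ _ _ Ix I D1 _ G0 iG GB.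
apply: dv_eq (dv_of h1) _; rewrite h2; apply: eq_Rintegral => y _.
by rewrite /partial1of2 (dv_derive1 (dk s y)).
Qed.

Lemma ZE s : Z H s = zmom 0 s.
Proof. by apply: eq_Rintegral => x _; rewrite expr0 mul1r. Qed.

Lemma Z_gt0 s : 0 < Z H s.
Proof.
rewrite ZE; apply: lt_le_trans (Rint_itv_gt0 ltr01 (@expo_cont s) (fun x => expR_gt0 _)) _.
rewrite /zmom; under [leRHS]eq_Rintegral do rewrite expr0 mul1r.
apply: (@Rint_subset _ _ _ mu) => //; last by move=> x _; exact: expR_ge0.
by apply: intg_eq (zmom_intg s (leq0n 2)) => // x _; rewrite expr0 mul1r.
Qed.

Definition mean s : R := M1 (gibbs H s).
Definition variance s : R := Var (gibbs H s).
Definition logZ s : R := ln (Z H s).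

Lemma meanE s : mean s = zmom 1 s / Z H s.
Proof.
rewrite /mean /M1 /gibbs mulrC -RintegralZl//; last exact: zmom_intg.
by apply: eq_Rintegral => x _; rewrite expr1 /expo; ring.
Qed.

Lemma varE s : variance s = zmom 2 s / Z H s - mean s ^+ 2.
Proof.
rewrite /variance /Var; congr (_ - _).
rewrite mulrC -RintegralZl//; last exact: zmom_intg.
by apply: eq_Rintegral => x _; rewrite /gibbs /expo; ring.
Qed.

Lemma dv_Z s : dv (Z H) s (zmom 1 s).
Proof. by apply: dv_ext (dv_zmom s (leq0n 1)) => z; rewrite ZE. Qed.

Lemma dv_logZ s : dv logZ s (mean s).
Proof. by apply: dv_eq (dv_ln (Z_gt0 s) (dv_Z s)) _; rewrite meanE. Qed.

Lemma dv_mean s : dv mean s (variance s).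
Proof.
have z0 := Z_gt0 s.
apply: (@dv_ext _ (fun s => zmom 1 s * (Z H s)^-1)); first by move=> y; rewrite meanE.
apply: dv_eq (dvM (dv_zmom s (leqnn 1)) (dvV _ (dv_Z s))) _; first by rewrite gt_eqF.
by rewrite varE meanE; field; rewrite gt_eqF.
Qed.

Lemma varE' s : variance s = (\int[mu]_x ((x - mean s) ^+ 2 * expo s x)) / Z H s.
Proof.
have z0 := Z_gt0 s.
have e : \int[mu]_x ((x - mean s) ^+ 2 * expo s x) =
    zmom 2 s - 2 * mean s * zmom 1 s + mean s ^+ 2 * zmom 0 s.
  rewrite /zmom -RintegralZl//; last exact: zmom_intg.
  rewrite -RintegralB//; [|exact: zmom_intg|by apply: intgZ => //; exact: zmom_intg].
  rewrite -[X in _ + X]RintegralZl//; last exact: zmom_intg.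
  rewrite -RintegralD//; [|by apply: intgB => //; [exact: zmom_intg|apply: intgZ => //; exact: zmom_intg]|by apply: intgZ => //; exact: zmom_intg].
  by apply: eq_Rintegral => x _; ring.
have m1 : zmom 1 s = mean s * Z H s by rewrite meanE divfK// gt_eqF.
rewrite e varE -ZE m1; field; by rewrite gt_eqF.
Qed.

Lemma var_gt0 s : 0 < variance s.
Proof.
rewrite varE' divr_gt0 ?Z_gt0//; set m := mean s.
(* On [[m + 1, m + 2]] the factor [(x - m)^2] is at least 1, so the variance dominates the positive
   Gibbs mass of that interval. *)
have mm : m + 1 < m + 2 by lra.
apply: lt_le_trans (Rint_itv_gt0 mm (@expo_cont s) (fun x => expR_gt0 _)) _.
have ii : intg mu setT (fun x => (x - m) ^+ 2 * expo s x).
  apply: (expo_intg s (B := 2 * (1 + m ^+ 2))).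
    by apply: measurable_funX; apply: measurable_funB => //; exact: measurable_cst.
  move=> x; rewrite ger0_norm ?sqr_ge0//.
  have := sqr_ge0 (x + m); have := mulr_ge0 (sqr_ge0 m) (sqr_ge0 x).
  have -> : (x + m) ^+ 2 = 2 * x ^+ 2 + 2 * m ^+ 2 - (x - m) ^+ 2 by ring.
  by move=> h1 h2; rewrite -mulrA mulrDl !mulrDr; lra.
apply: (@le_trans _ _ (\int[mu]_(x in `[m + 1, m + 2]) ((x - m) ^+ 2 * expo s x))).
  apply: le_Rintegral => //.
  - exact: intg_cont (@expo_cont s).
  - exact: (@integrableS _ _ _ mu setT).
  - move=> x; rewrite /= in_itv/= => /andP[h _].
    by rewrite ler_peMl ?expR_ge0// exprn_ege1//; lra.
apply: (@Rint_subset _ _ _ mu) => // x _.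
by rewrite mulr_ge0 ?sqr_ge0 ?expR_ge0.
Qed.

Lemma logZ_convex s a : logZ s + mean s * (a - s) <= logZ a.
Proof.
have := strong_convex dv_logZ dv_mean (fun s => ltW (var_gt0 s)) s a.
by rewrite mul0r mul0r addr0.
Qed.

Lemma mean_incr s a : s < a -> mean s < mean a.
Proof.
move=> sa; have [d _ e] := mvt dv_mean (ltW sa).
by rewrite -subr_gt0 e mulr_gt0 ?var_gt0// subr_gt0.
Qed.

Lemma mean_cont : continuous mean.
Proof. exact: dv_continuous dv_mean. Qed.

(** Restricting [Z] to [[a, b]] bounds [logZ] from below by lines of slope [a] on the right and [b]
    on the left; as [a] and [b] are arbitrary, [logZ] grows faster than any line on both sides. *)
Lemma logZ_low a b : a < b -> exists k, (forall s, 0 <= s -> k + s * a <= logZ s) /\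
  (forall s, s <= 0 -> k + s * b <= logZ s).
Proof.
move=> ab; pose q := \int[mu]_(x in `[a, b]) expo 0 x.
have q0 : 0 < q by apply: Rint_itv_gt0 => //; [exact: expo_cont|move=> x; exact: expR_gt0].
have main s r : (forall x, a <= x <= b -> r <= s * x) -> ln q + r <= logZ s.
  move=> h; rewrite -[X in _ + X]expRK -lnM ?posrE ?expR_gt0// ler_ln ?posrE ?Z_gt0 ?mulr_gt0 ?expR_gt0//.
  rewrite ZE; apply: (@le_trans _ _ (\int[mu]_(x in `[a, b]) expo s x)).
    rewrite mulrC -RintegralZl//; last exact: intg_cont (@expo_cont 0).
    apply: le_Rintegral => //.
    - by apply: intgZ => //; exact: intg_cont (@expo_cont 0).
    - exact: intg_cont (@expo_cont s).
    - move=> x; rewrite /= in_itv/= => xab; rewrite -expRD ler_expR mul0r addr0.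
      by have := h x xab; lra.
  rewrite /zmom; under [leRHS]eq_Rintegral do rewrite expr0 mul1r.
  apply: (@Rint_subset _ _ _ mu) => //; last by move=> x _; exact: expR_ge0.
  by apply: intg_eq (zmom_intg s (leq0n 2)) => // x _; rewrite expr0 mul1r.
exists (ln q); split=> s s0; apply: main => x /andP[ax xb].
  by rewrite ler_wpM2l.
by rewrite ler_wnM2l.
Qed.

(** This excludes the default value of [xget]. Convexity bounds [mean s] below by the chord slope of
    [logZ] from 0, which exceeds [m] for large [s] by [logZ_low]; symmetrically on the left, and the
    intermediate value theorem concludes. *)
Lemma mean_lambda m : mean (lambda H m) = m.
Proof.
suff [s es] : exists s, mean s = m.
  exact: (@xgetPex _ 0 [set s | M1 (gibbs H s) = m] (ex_intro _ s es)).
have [k1 [h1 _]] : exists k, (forall s, 0 <= s -> k + s * (m + 1) <= logZ s) /\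
    (forall s, s <= 0 -> k + s * (m + 2) <= logZ s) by apply: logZ_low; lra.
have [k2 [_ h2]] : exists k, (forall s, 0 <= s -> k + s * (m - 2) <= logZ s) /\
    (forall s, s <= 0 -> k + s * (m - 1) <= logZ s) by apply: logZ_low; lra.
have [s [s0 hs1 hs2]] : exists s, [/\ 0 < s, logZ 0 - k1 <= s & logZ 0 - k2 <= s].
  move: (logZ 0 - k1) (logZ 0 - k2) => u v; exists (1 + `|u| + `|v|).
  by have := ler_norm u; have := ler_norm v; have := normr_ge0 u; have := normr_ge0 v; split; lra.
have hi : m <= mean s.
  have := logZ_convex s 0; rewrite sub0r mulrN => h.
  have h3 : k1 + s * m + s <= logZ s by have := h1 s (ltW s0); rewrite mulrDr mulr1 addrA.
  rewrite -(ler_pM2r s0) (mulrC m); move: h h3 hs1.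
  by move: (logZ s) (mean s * s) (s * m) (logZ 0) => u v w z; lra.
have lo : mean (- s) <= m.
  have := logZ_convex (- s) 0; rewrite sub0r opprK => h.
  have h3 : k2 - s * m + s <= logZ (- s).
    have := h2 (- s); rewrite oppr_le0 (ltW s0) => /(_ isT).
    by rewrite mulrBr mulr1 mulNr opprK addrA.
  rewrite -(ler_pM2r s0) (mulrC m); move: h h3 hs2.
  by move: (logZ (- s)) (mean (- s) * s) (s * m) (logZ 0) => u v w z; lra.
have ss : - s <= s by rewrite (le_trans _ (ltW s0))// oppr_le0 ltW.
have [||z _ hz] := @IVT R mean (- s) s m ss; last by exists z.
- exact: continuous_subspaceT mean_cont.
- have mm := le_trans lo hi.
  by rewrite min_l// max_r// lo hi.
Qed.

(** The function [I] of the overview: the Legendre transform of [logZ], shifted by [logZ 0]. By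
    [gibbs_energy] it is the free energy of the Gibbs density of mean [m]. *)
Definition rate m : R := lambda H m * m - logZ (lambda H m) + logZ 0.

Lemma rate_ge m s : s * m - logZ s + logZ 0 <= rate m.
Proof. by rewrite /rate; have := logZ_convex (lambda H m) s; rewrite mean_lambda;
  move: (logZ s) (logZ (lambda H m)) (logZ 0) (lambda H m) => *; lra. Qed.

Lemma rate_ge0 m : 0 <= rate m.
Proof. by have := rate_ge m 0; rewrite mul0r; lra. Qed.

(** The bracket is the affine function of [m] tangent to [rate] at [n], so the left side is a
    Bregman distance, estimated in dual variables by [bregman_le]. *)
Lemma rate_bregman m n k : 0 < k -> (forall s, k <= variance s) ->
  rate m - (lambda H n * m - logZ (lambda H n) + logZ 0) <= (m - n) ^+ 2 / (2 * k).
Proof.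
move=> k0 vk; have := bregman_le dv_logZ dv_mean k0 vk (lambda H n) (lambda H m).
have e1 := mean_lambda m; have e2 := mean_lambda n; rewrite e1 e2 /rate; clear e1 e2 vk.
move: (logZ (lambda H n)) (logZ (lambda H m)) (logZ 0) (lambda H n) (lambda H m) => a b z u v.
by move: (_ / (2 * k)) => r h; lra.
Qed.

(** A bound of [lambda] read as a closed condition on [m]: in this form it passes to limits in
    [m]. *)
Lemma lambda_bound m (b : R) : (`|lambda H m| <= b) = (mean (- b) <= m <= mean b).
Proof.
rewrite ler_norml; apply/andP/andP => -[h1 h2].
  rewrite -{1 2}(mean_lambda m); split.
    move: h1; rewrite le_eqVlt => /predU1P[->//|h]; exact: ltW (mean_incr h).
  move: h2; rewrite le_eqVlt => /predU1P[<-//|h]; exact: ltW (mean_incr h).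
split; rewrite leNgt; apply/negP => /mean_incr; rewrite mean_lambda ltNge.
  by rewrite h1.
by rewrite h2.
Qed.

End Gibbs.

Lemma le_eq2 (R : realType) (a b a' b' : R) : a <= b -> a' = a -> b = b' -> a' <= b'.
Proof. by move=> h -> <-. Qed.

(** The Fenchel-Young inequality for [r ln r], with conjugate [e^(b - 1)], obtained from
    [1 + z <= e^z]. It is the single source of the entropy's lower bound, of Jensen's inequality, of
    the tangent inequality and of the dual representation. *)
Lemma xlnx_ge (R : realType) (r b : R) : 0 <= r -> r * b - expR (b - 1) <= r * ln r.
Proof.
rewrite le_eqVlt => /predU1P[<-|r0]; first by rewrite !mul0r sub0r oppr_le0 expR_ge0.
have h : b - ln r <= expR (b - 1 - ln r).
  by have := expR_ge1Dx (b - 1 - ln r); lra.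
have e : r * expR (b - 1 - ln r) = expR (b - 1) by rewrite expRB lnK// mulrC divfK// gt_eqF.
have := ler_wpM2l (ltW r0) h; rewrite e mulrBr; move: (r * b) (r * ln r) => u v; lra.
Qed.

(** The weighted variance of [g], centred at its mean [a], is nonnegative. *)
Lemma cs_weight d (T : measurableType d) (R : realType) (mu : {measure set T -> \bar R})
    (k g : T -> R) : intg mu setT k -> (forall y, 0 <= k y) ->
  intg mu setT (fun y => g y * k y) -> intg mu setT (fun y => g y ^+ 2 * k y) ->
  0 < \int[mu]_y k y ->
  (\int[mu]_y (g y * k y)) ^+ 2 / \int[mu]_y k y <= \int[mu]_y (g y ^+ 2 * k y).
Proof.
move=> i0 k0 i1 i2 p0; set m0 := \int[mu]_y k y; set m1 := \int[mu]_y (g y * k y).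
set m2 := \int[mu]_y _; pose a := m1 / m0.
have e : \int[mu]_y ((g y - a) ^+ 2 * k y) = m2 - 2 * a * m1 + a ^+ 2 * m0.
  have i1' := intgZ (2 * a) measurableT i1; have i0' := intgZ (a ^+ 2) measurableT i0.
  rewrite /m2 /m1 /m0 -!RintegralZl// -RintegralB// -RintegralD//; last exact: intgB.
  by apply: eq_Rintegral => y _; ring.
have : 0 <= \int[mu]_y ((g y - a) ^+ 2 * k y).
  by apply: Rintegral_ge0 => y _; rewrite mulr_ge0 ?sqr_ge0.
rewrite e; have p1 : m0 != 0 by rewrite gt_eqF.
suff -> : m2 - 2 * a * m1 + a ^+ 2 * m0 = m2 - m1 ^+ 2 / m0 by rewrite subr_ge0.
by rewrite /a; field.
Qed.

(** * Free energy and dissipation of the mollified density *)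

Section FreeEnergy.
Context {R : realType}.
Local Notation mu := (@lebesgue_measure R).
Variables (H : R -> R) (C c : R).
Hypothesis hH : confining H C c.
Variable rho : R -> R.
Hypothesis hr : P2 rho.

Lemma meas_xlnx : measurable_fun setT (fun x => rho x * ln (rho x)).
Proof.
apply: measurable_funM; first exact: P2_meas hr.
by apply: (measurableT_comp (@measurable_ln R)); exact: P2_meas hr.
Qed.

Lemma H_bound x : `|H x| <= C * (1 + x ^+ 2).
Proof. by rewrite ger0_norm ?(conf_ge0 hH)//; exact: conf_quad hH x. Qed.

Lemma H_intg : intg mu setT (fun x => H x * rho x).
Proof. apply: (P2_intg hr (C := C)); [exact: cont_meas (H_cont hH)|exact: H_bound]. Qed.

Lemma id_intg : intg mu setT (fun x => x * rho x).
Proof.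
apply: (P2_intg hr (C := 2)) => [|x]; first exact: measurable_id.
by rewrite -[2]mulr1; apply: lin_quad; rewrite mul1r lerDr.
Qed.

Definition real_energy : R :=
  \int[mu]_x (rho x * ln (rho x)) + \int[mu]_x (H x * rho x) + logZ H 0.

(** [xlnx_ge] at [b = - H x]: the negative part of [rho ln rho] has an integrable majorant. *)
Lemma xlnx_low x : - (H x * rho x + expR (-1) * expo H 0 x) <= rho x * ln (rho x).
Proof.
have := xlnx_ge (- H x) (P2_ge0 x hr).
have -> : expR (- H x - 1) = expR (-1) * expo H 0 x.
  by rewrite /expo mul0r addr0 -expRD addrC.
by rewrite mulrN mulrC; move: (H x * rho x) => u; lra.
Qed.

Lemma low_intg : intg mu setT (fun x => H x * rho x + expR (-1) * expo H 0 x).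
Proof.
apply: intgD => //; first exact: H_intg.
apply: intgZ => //.
by apply: intg_eq (zmom_intg hH (n := 0) 0 isT) => // x _; rewrite expr0 mul1r.
Qed.

(** The negative part of the entropy is integrable, so an infinite positive part would force the
    free energy to be [+oo]. *)
Lemma free_energy_fin : (free_energy H rho < +oo)%E -> intg mu setT (fun x => rho x * ln (rho x)).
Proof.
set h := fun x => rho x * ln (rho x); rewrite /free_energy => hF.
have mh : measurable_fun setT (EFin \o h) by apply/measurable_EFinP; exact: meas_xlnx.
have hm : (\int[mu]_x ((EFin \o h)^\- x) < +oo)%E.
  have /integrableP[_ hlt] := low_intg.
  apply: le_lt_trans hlt; apply: ge0_le_integral => //.
  - exact: measurable_funeneg.
  - by apply: measurableT_comp => //; exact: measurable_int low_intg.
  - move=> x _; rewrite funenegE /= -EFin_max lee_fin ge_max normr_ge0 andbT.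
    have := xlnx_low x; rewrite -/(h x) lerNl => hx; exact: le_trans hx (ler_norm _).
have hp : (\int[mu]_x ((EFin \o h)^\+ x) < +oo)%E.
  rewrite ltey; apply/negP => /eqP e.
  move: hF; rewrite [X in (X + _ + _)%E]integralE e.
  rewrite (Rint_EFin H_intg)//.
  have : (0 <= \int[mu]_x ((EFin \o h)^\- x))%E by apply: integral_ge0.
  by move: hm; case: (integral _ _ _) => //= r.
apply/integrableP; split => //.
have -> : (fun x : R => `|(EFin \o h) x|)%E = ((EFin \o h)^\+ \+ (EFin \o h)^\-)%E by exact: fune_abse.
rewrite ge0_integralD//; [|exact: measurable_funepos|exact: measurable_funeneg].
exact: lte_add_pinfty.
Qed.

Hypothesis hi : intg mu setT (fun x => rho x * ln (rho x)).

Lemma free_energyE : free_energy H rho = real_energy%:E.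
Proof. by rewrite /free_energy (Rint_EFin hi)// (Rint_EFin H_intg)// -!EFinD. Qed.

Lemma relative_entropyE s :
  relative_entropy rho (gibbs H s) = (real_energy - s * M1 rho + logZ H s - logZ H 0)%:E.
Proof.
have i1 := intgZ s measurableT id_intg.
have i2 := intgZ (logZ H s) measurableT (P2_intg1 hr).
have i3 := intgD measurableT hi H_intg; have i4 := intgB measurableT i3 i1.
have e x : rho x * ln (rho x / gibbs H s x) =
    rho x * ln (rho x) + H x * rho x - s * (x * rho x) + logZ H s * rho x.
  have := P2_ge0 x hr; rewrite le_eqVlt => /predU1P[<-|r0]; first by ring.
  have g0 : 0 < gibbs H s x by rewrite divr_gt0 ?expR_gt0// (Z_gt0 hH).
  rewrite ln_div ?posrE// /gibbs ln_div ?posrE ?expR_gt0// ?(Z_gt0 hH)// expRK -/(logZ H s).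
  by move: (logZ H s) (ln (rho x)) => u v; ring.
rewrite /relative_entropy; under eq_integral do rewrite e.
rewrite Rint_EFin//; last exact: intgD.
rewrite (RintegralD _ i4 i2)// (RintegralB _ i3 i1)// (RintegralD _ hi H_intg)//.
rewrite (RintegralZl _ _ id_intg)// (RintegralZl _ _ (P2_intg1 hr))// (P2_mass hr) mulr1 /real_energy /M1.
congr (_%:E); move: (logZ H s) (logZ H 0) => u v.
by move: (\int[mu]_x (rho x * ln (rho x))) (\int[mu]_x (H x * rho x)) (s * _) => *; ring.
Qed.

End FreeEnergy.

Lemma lipschitz_cont (R : realType) (g : R -> R) (L : R) : (forall x y, `|g x - g y| <= L * `|x - y|) ->
  continuous g.
Proof.
move=> gL x; apply: (cvg_le (g := fun y => L * `|y - x|)); first by near=> y; exact: gL.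
rewrite -[X in _ --> X](_ : L * `|x - x| = 0); last by rewrite subrr normr0 mulr0.
apply: cvgM; first exact: cvg_cst.
by apply: cvg_norm; apply: cvgB; [exact: cvg_id|exact: cvg_cst].
Unshelve. all: by end_near. Qed.

Section MollifiedEnergy.
Context {R : realType}.
Local Notation mu := (@lebesgue_measure R).
Implicit Types (x y z s : R).
Variables (K : R -> R) (N e1 e2 : R).
Hypothesis hK : mollifier K N e1 e2.
Variables (H : R -> R) (C c : R).
Hypothesis hH : confining H C c.
Variable rho : R -> R.
Hypothesis hr : P2 rho.
Let f := mfl K rho.

Lemma meas_ker (k : R -> R) : continuous k -> measurable_fun setT (fun p : R * R => k (p.1 - p.2)).
Proof. by move=> ck; apply: meas_sub2; exact: cont_meas ck. Qed.

Lemma mfl_pairing (g : R -> R) (B : R) : measurable_fun setT g ->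
  (forall x, `|g x| <= B * (1 + x ^+ 2)) ->
  [/\ intg mu setT (fun x => g x * f x),
     \int[mu]_x (g x * f x) = \int[mu]_y ((\int[mu]_x (g x * K (x - y))) * rho y) &
     forall y, intg mu setT (fun x => g x * K (x - y))].
Proof.
move=> mg gB.
have B0 : 0 <= B by have := gB 0; rewrite expr0n addr0 mulr1; apply: le_trans.
have bd x y : `|g x * K (x - y)| <= (2 * B) * ((1 + y ^+ 2 + (x - y) ^+ 2) * K (x - y)).
  rewrite normrM (gtr0_norm (mol_gt0 hK _)) mulrA ler_wpM2r ?(ltW (mol_gt0 hK _))//.
  apply: (le_trans (gB x)); have h : 1 + x ^+ 2 <= 2 * (1 + y ^+ 2 + (x - y) ^+ 2).
    by have := quad_split x y; lra.
  by have := ler_wpM2l B0 h; rewrite mulrA [B * 2]mulrC.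
have m2 : measurable_fun setT (fun p : R * R => g p.1 * K (p.1 - p.2)).
  by apply: measurable_funM; [exact: meas_fst2|exact: meas_ker (mol_cont hK)].
have e x : g x * f x = \int[mu]_y (g x * K (x - y) * rho y).
  rewrite /f /mfl /convol -RintegralZl//; last exact: (conv_intg _ (mol_cont hK) (mol_bd hK) (P2_intg1 hr)).
  by apply: eq_Rintegral => y _; rewrite mulrA.
have [i1 i2 _] := mol_fubini hK hr m2 bd; split.
- by apply: intg_eq i1 => // x _; rewrite e.
- by rewrite -i2; under eq_Rintegral do rewrite e.
- move=> y; have [jq _] := mol_mom2x hK y.
  have j0 := intgZ (1 + y ^+ 2) measurableT (mol_intgx hK y).
  have jj := intgZ (2 * B) measurableT (intgD measurableT j0 jq).
  apply: (@intg_le _ _ _ mu _ _ _ _ _ _ jj) => //.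
    by apply: measurable_funM => //; apply: cont_meas; exact: cont_shiftl (mol_cont hK).
  by move=> x _; apply: le_trans (bd x y) _; rewrite [X in _ * X]mulrDl.
Qed.

Lemma mfl_P2 : P2 f.
Proof.
have [q _] := mfl_quad hK hr.
have [i1 i2 _] := mfl_pairing (measurable_cst (1 : R)) (fun x : R => bdd_quad x (lexx `|1 : R|)).
have j1 : intg mu setT f by apply: intg_eq i1 => // x _; rewrite mul1r.
have j2 : intg mu setT (fun x => x ^+ 2 * f x).
  by apply: intg_eq (intgB measurableT q j1) => // x _; rewrite /f; ring.
split.
- exact: cont_meas (mfl_cont hK hr).
- by move=> x; exact: ltW (mfl_gt0 hK hr x).
- rewrite Rint_EFin//; congr (_%:E); rewrite -[RHS](P2_mass hr).
  have -> : \int[mu]_x f x = \int[mu]_x (1 * f x) by under [RHS]eq_Rintegral do rewrite mul1r.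
  rewrite i2; apply: eq_Rintegral => y _; rewrite -[RHS]mul1r; congr (_ * _).
  by rewrite -[RHS](mol_int1x hK y); apply: eq_Rintegral => x _; rewrite mul1r.
- by rewrite Rint_EFin// ltry.
Qed.

(** Fubini moves the mollifier onto [g], and averaging [g] against the kernel displaces it by at
    most [L] times the first absolute moment. *)
Lemma mfl_lip (g : R -> R) (B L : R) :
  (forall x, `|g x| <= B * (1 + x ^+ 2)) -> (forall x y, `|g x - g y| <= L * `|x - y|) ->
  0 <= L -> `|\int[mu]_x (g x * f x) - \int[mu]_x (g x * rho x)| <= L * e1.
Proof.
move=> gB gL L0; have mg := cont_meas (lipschitz_cont gL).
have [i1 i2 i3] := mfl_pairing mg gB.
have j := P2_intg hr mg gB; have j1 := P2_intg1 hr.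
have h y : `|(\int[mu]_x (g x * K (x - y))) - g y| <= L * e1.
  have [k1 k2] := mol_mom1x hK y; apply: le_trans (ler_wpM2l L0 k2).
  have k3 := intgZ (g y) measurableT (mol_intgx hK y).
  rewrite -[X in _ - X]mulr1 -(mol_int1x hK y) -RintegralZl//; last exact: mol_intgx hK y.
  rewrite -(RintegralB _ (i3 y) k3)// -RintegralZl//; apply: (@Rint_le_norm _ _ _ mu) => //.
  - by apply: intgB => //; exact: i3.
  - exact: intgZ.
  - move=> x _; rewrite -mulrBl normrM (gtr0_norm (mol_gt0 hK _)) mulrA ler_wpM2r//.
    exact: ltW (mol_gt0 hK _).
pose G y := (\int[mu]_x (g x * K (x - y))) - g y.
have mG : measurable_fun setT G.
  apply: measurable_funB => //.
  apply: (@measurable_Rint2 _ _ _ _ _ mu (fun p : R * R => g p.1 * K (p.1 - p.2))).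
  by apply: measurable_funM; [exact: meas_fst2|exact: meas_ker (mol_cont hK)].
have gi := P2_intg hr mG (fun y => bdd_quad y (h y)).
rewrite i2 (_ : _ - _ = \int[mu]_y (G y * rho y)); first exact: P2_bdd hr mG h.
have ig : intg mu setT (fun y => (\int[mu]_x (g x * K (x - y))) * rho y).
  by apply: intg_eq (intgD measurableT gi j) => // y _; rewrite /G; ring.
by rewrite -(RintegralB _ ig j)//; apply: eq_Rintegral => y _; rewrite /G mulrBl.
Qed.

Lemma mfl_M1 : `|M1 f - M1 rho| <= e1.
Proof.
have b x : `|x : R| <= 2 * (1 + x ^+ 2).
  by rewrite -[2]mulr1; apply: lin_quad; rewrite mul1r lerDr.
have lip x y : `|(x : R) - y| <= 1 * `|x - y| by rewrite mul1r.
by rewrite -[leRHS]mul1r; exact: mfl_lip b lip ler01.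
Qed.

Lemma H_diff x y : `|H x - H y| <= 2 * C * ((1 + y ^+ 2) * `|x - y|) + C * (x - y) ^+ 2.
Proof.
have C0 := conf_C hH.
have h1 z : Num.min y x <= z <= Num.max y x -> `|derive1 H z| <= C * (1 + `|y| + `|x - y|).
  move=> hz; apply: (le_trans (conf_lin hH z)); rewrite ler_wpM2l// -addrA lerD2l.
  have : `|z - y| <= `|x - y|.
    move: hz; rewrite minElt maxElt; case: ltP => h /andP[a1 a2].
      by rewrite !ger0_norm ?subr_ge0//; lra.
    by rewrite !ler0_norm ?subr_le0//; lra.
  move=> h2; rewrite -{1}(subrK y z); apply: le_trans (ler_normD _ _) _; lra.
apply: le_trans (mvt_le (conf_dv hH) h1) _.
have a0 := normr_ge0 (x - y); have y0 := normr_ge0 y.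
have y1 : `|y| <= 1 + y ^+ 2 by rewrite -(real_normK (num_real y)); have := sqr_ge0 (`|y| - 1); nra.
rewrite -(real_normK (num_real (x - y))).
rewrite -subr_ge0.
have -> : 2 * C * ((1 + y ^+ 2) * `|x - y|) + C * `|x - y| ^+ 2 - C * (1 + `|y| + `|x - y|) * `|x - y| =
  C * `|x - y| * (2 * (1 + y ^+ 2) - 1 - `|y|) by ring.
rewrite mulr_ge0// ?mulr_ge0//; have := sqr_ge0 y; lra.
Qed.

(** [H] is not Lipschitz, so [mfl_lip] does not apply; the linear growth of [H'] makes the error
    depend on the second moment. With [mfl_jensen] this compares the initial mollified energy with
    that of [rho0]. *)
Lemma mfl_H_le : \int[mu]_x (H x * f x) <=
  \int[mu]_x (H x * rho x) + (2 * C * e1 * (1 + mom2 rho) + C * e2).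
Proof.
have mH := cont_meas (H_cont hH); have C0 := conf_C hH.
have [i1 i2 i3] := mfl_pairing mH (H_bound hH).
have j := H_intg hH hr; have j1 := P2_intg1 hr; have j2 := P2_intg12 hr.
have h y : \int[mu]_x (H x * K (x - y)) <= H y + (2 * C * e1 * (1 + y ^+ 2) + C * e2).
  have [k1 k2] := mol_mom1x hK y; have [l1 l2] := mol_mom2x hK y.
  have k0 := intgZ (H y) measurableT (mol_intgx hK y).
  have k1' := intgZ (2 * C * (1 + y ^+ 2)) measurableT k1; have l1' := intgZ C measurableT l1.
  have kk := intgD measurableT (intgD measurableT k0 k1') l1'.
  apply: (@le_trans _ _ (\int[mu]_x (H y * K (x - y) + 2 * C * (1 + y ^+ 2) * (`|x - y| * K (x - y))
      + C * ((x - y) ^+ 2 * K (x - y))))).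
    apply: le_Rintegral => // x _.
    have := H_diff x y => hd; have := le_trans (ler_norm _) hd; rewrite lerBlDl => hd'.
    by apply: (le_eq2 (ler_wpM2r (ltW (mol_gt0 hK (x - y))) hd')) => //; ring.
  rewrite (RintegralD _ (intgD measurableT k0 k1') l1')// (RintegralD _ k0 k1')//.
  rewrite !RintegralZl// ?(mol_int1x hK)//; last exact: mol_intgx hK y.
  rewrite mulr1 -addrA lerD2l lerD// ?ler_wpM2l//.
  by rewrite [leRHS]mulrAC; apply: ler_wpM2l => //; rewrite mulr_ge0 ?mulr_ge0// addr_ge0 ?sqr_ge0.
pose g y := H y * rho y + (2 * C * e1 * ((1 + y ^+ 2) * rho y) + C * e2 * rho y).
have j2' := intgZ (2 * C * e1) measurableT j2; have j1' := intgZ (C * e2) measurableT j1.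
have j3 := intgD measurableT j2' j1'; have j4 := intgD measurableT j j3.
have ig : intg mu setT (fun y => (\int[mu]_x (H x * K (x - y))) * rho y).
  apply: (@intg_le _ _ _ mu _ _ g) => //.
    apply: measurable_funM; last exact: P2_meas.
    apply: (@measurable_Rint2 _ _ _ _ _ mu (fun p : R * R => H p.1 * K (p.1 - p.2))).
    by apply: measurable_funM; [exact: meas_fst2|exact: meas_ker (mol_cont hK)].
  move=> y _; rewrite ger0_norm.
    by apply: (le_eq2 (ler_wpM2r (P2_ge0 y hr) (h y))) => //; rewrite /g; ring.
  rewrite mulr_ge0 ?(P2_ge0 _ hr)//; apply: Rintegral_ge0 => x _.
  by rewrite mulr_ge0 ?(conf_ge0 hH)// ltW ?(mol_gt0 hK).
rewrite i2; apply: (@le_trans _ _ (\int[mu]_y g y)).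
  apply: le_Rintegral => // y _.
  by apply: (le_eq2 (ler_wpM2r (P2_ge0 y hr) (h y))) => //; rewrite /g; ring.
rewrite (RintegralD _ j j3)// (RintegralD _ j2' j1')// !RintegralZl// (P2_mass hr) mulr1.
rewrite lerD2l lerD2r; have := P2_intg2 hr => j5.
have -> : \int[mu]_y ((1 + y ^+ 2) * rho y) = 1 + mom2 rho.
  rewrite -[X in _ = X + _](P2_mass hr) /mom2 -(RintegralD _ j1 j5)//.
  by apply: eq_Rintegral => y _; rewrite mulrDl mul1r.
by [].
Qed.

Lemma mfl_xlnx_intg : intg mu setT (fun x => f x * ln (f x)).
Proof.
have [q _] := mfl_quad hK hr; have A0 := mom2_ge0 hr; have N0 := mol_N0 hK.
have fp := mfl_P2.
apply: (@intg_le _ _ _ mu _ _ _ _ _ _ (intgZ (N * (4 + mom2 rho)) measurableT q)) => //.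
  exact: meas_xlnx fp.
move=> x _; have f0 := mfl_gt0 hK hr x.
rewrite normrM (gtr0_norm f0) mulrC mulrA ler_wpM2r ?(ltW f0)//.
apply: (le_trans (mfl_ln hK hr x)); rewrite -mulrA ler_wpM2l//.
have y1 : `|x| <= 1 + x ^+ 2.
  by rewrite -(real_normK (num_real x)); have := normr_ge0 x; have := sqr_ge0 (`|x| - 1); nra.
have := sqr_ge0 x; move: (mom2 rho) (x ^+ 2) (`|x|) A0 y1 => a u v; nra.
Qed.

(** The tangent of [r ln r] at [r = f x], evaluated at [rho y] and averaged with the weight
    [K (x - y)], integrates to [f x ln (f x)]. Integration in [x] then uses that the kernel has mass
    one. *)
Lemma mfl_jensen : intg mu setT (fun x => rho x * ln (rho x)) ->
  \int[mu]_x (f x * ln (f x)) <= \int[mu]_x (rho x * ln (rho x)).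
Proof.
move=> hi; have i0 := mol_intgx hK.
have K0 z := ltW (mol_gt0 hK z).
have [j1 j2 _] : [/\ intg mu setT (fun x => \int[mu]_y (K (x - y) * (rho y * ln (rho y)))),
   \int[mu]_x \int[mu]_y (K (x - y) * (rho y * ln (rho y))) =
   \int[mu]_y ((\int[mu]_x K (x - y)) * (rho y * ln (rho y))) &
   {ae mu, forall x, intg mu setT (fun y => K (x - y) * (rho y * ln (rho y)))}].
  apply: (@conv_fubini _ (fun x y => K (x - y)) _ (fun=> 1)).
  - exact: meas_ker (mol_cont hK).
  - exact: meas_xlnx hr.
  - exact: i0.
  - by move=> y; under eq_Rintegral do rewrite ger0_norm//; rewrite (mol_int1x hK).
  - by apply: intg_eq (intg_norm measurableT hi) => // y _; rewrite mul1r.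
have -> : \int[mu]_x (rho x * ln (rho x)) =
    \int[mu]_x \int[mu]_y (K (x - y) * (rho y * ln (rho y))).
  by rewrite j2; apply: eq_Rintegral => y _; rewrite (mol_int1x hK) mul1r.
apply: le_Rintegral => //; first exact: mfl_xlnx_intg.
move=> x _; have f0 := mfl_gt0 hK hr x.
have k1 := conv_intg x (mol_cont hK) (mol_bd hK) (P2_intg1 hr).
have k2 := conv_intg x (mol_cont hK) (mol_bd hK) hi.
have k3 := intgZ (1 + ln (f x)) measurableT k1.
have k4 := intgZ (f x) measurableT (mol_intg hK x).
have e : \int[mu]_y ((1 + ln (f x)) * (K (x - y) * rho y) - f x * K (x - y)) = f x * ln (f x).
  rewrite (RintegralB _ k3 k4)// !RintegralZl//; last exact: mol_intg hK x.
  rewrite (mol_int1 hK) (_ : \int[mu]_y (K (x - y) * rho y) = f x)//.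
  by move: (ln (f x)) => u; ring.
rewrite -e; apply: le_Rintegral => //; first exact: intgB.
move=> y _; have := xlnx_ge (1 + ln (f x)) (P2_ge0 y hr).
have -> : 1 + ln (f x) - 1 = ln (f x) by move: (ln (f x)) => u; ring.
rewrite lnK ?posrE// => h; apply: (le_eq2 (ler_wpM2l (K0 (x - y)) h)) => //.
by move: (ln (f x)) => u; ring.
Qed.

End MollifiedEnergy.

(** Brings the smooth density [f] into the scope of [dissipation], which is defined through weak
    derivatives. *)
Lemma weak_derivative_classical (R : realType) (f f' : R -> R) :
  (forall x, dv f x (f' x)) -> continuous f' ->
  intg (@lebesgue_measure R) setT f -> intg (@lebesgue_measure R) setT f' ->
  weak_derivative setT f f'.
Proof.
set mu := @lebesgue_measure R => ff cf' fi fi'.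
have cf := dv_continuous ff.
split; [exact: open_integrable_locally openT fi|exact: open_integrable_locally openT fi'|].
move=> p [sp [K [cK _ pK]]]; have dp x : dv p x (derive1 p x) := dv_of (sp 0%N x).
have cp := dv_continuous dp.
have cp' : continuous (derive1 p) by apply: dv_continuous => x; exact: dv_of (sp 1%N x).
have [m hm] : exists m : nat, forall x, K x -> `|x| <= m%:R.
  have [M [rM hM]] := compact_bounded cK; exists (Num.truncn `|M|).+2 => x Kx.
  have h := truncnS_gt `|M|; have Mx : M < (Num.truncn `|M|).+2%:R.
    by apply: le_lt_trans (ler_norm _) _; apply: (lt_trans h); rewrite ltr_nat.
  exact: hM _ Mx _ Kx.
have p0 x : m%:R < `|x| -> p x = 0.
  by move=> xm; apply: pK => Kx; move: (hm x Kx); rewrite leNgt xm.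
have p0' x : m%:R < `|x| -> derive1 p x = 0.
  rewrite lter_normr => /orP[rx|rx].
  - by apply: (@dv_cst_right _ p 0 m%:R x) => // y ry; rewrite p0// (lt_le_trans ry)// ler_norm.
  - apply: (@dv_cst_left _ p 0 (- m%:R) x) => //; last by rewrite ltrNr.
    by move=> y ry; rewrite p0// lter_normr; apply/orP; right; rewrite ltrNr.
have sub (x : R) : ~ `[- m.+1%:R, m.+1%:R] x -> m%:R < `|x|.
  move=> h; rewrite ltNge; apply/negP => h'; apply: h; rewrite /= in_itv/= -ler_norml.
  by apply: (le_trans h'); rewrite ler_nat.
rewrite (@Rint_supp _ _ _ mu `[- m.+1%:R, m.+1%:R] setT)//; last first.
  by move=> x _ /sub h; rewrite p0' ?mulr0.
rewrite [in RHS](@Rint_supp _ _ _ mu `[- m.+1%:R, m.+1%:R] setT)//; last first.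
  by move=> x _ /sub h; rewrite p0 ?mulr0.
have cA : continuous (fun x => f x * derive1 p x) by move=> x; apply: cvgM; [exact: cf|exact: cp'].
have cB : continuous (fun x => f' x * p x) by move=> x; apply: cvgM; [exact: cf'|exact: cp].
have iA := intg_cont (- m.+1%:R) m.+1%:R cA; have iB := intg_cont (- m.+1%:R) m.+1%:R cB.
apply/eqP; rewrite -addr_eq0 -(RintegralD _ iA iB)//; apply/eqP.
have dfp x : dv (fun x => f x * p x) x (f x * derive1 p x + f' x * p x).
  by apply: dv_eq (dvM (ff x) (dp x)) _; rewrite addrC.
have cAB : continuous (fun x => f x * derive1 p x + f' x * p x).
  by move=> x; apply: cvgD; [exact: cA|exact: cB].
rewrite (ftc_itv dfp cAB); last by rewrite (@le_trans _ _ 0)// oppr_le0.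
by rewrite !p0 ?mulr0 ?subrr// ?normrN ger0_norm// ltr_nat.
Qed.

(** * Flux, commutator and entropy production *)

Section Flux.
Context {R : realType}.
Local Notation mu := (@lebesgue_measure R).
Implicit Types (x y z : R).
Variables (K : R -> R) (N e1 e2 : R).
Hypothesis hK : mollifier K N e1 e2.
Variables (H : R -> R) (C c : R).
Hypothesis hH : confining H C c.
Variable rho : R -> R.
Hypothesis hr : P2 rho.
Variable s : R.
Let f := mfl K rho.

Definition flux x : R :=
  \int[mu]_y ((derive1 K (x - y) + (derive1 H y - s) * K (x - y)) * rho y).

Lemma drift_intg : intg mu setT (fun y => derive1 H y * rho y).
Proof.
apply: (P2_intg hr (C := 2 * C)) => [|y]; first exact: cont_meas (conf_cont hH).
by apply: lin_quad; exact: conf_lin hH y.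
Qed.

Lemma fluxE x : flux x =
  convol (derive1 K) rho x + convol K (fun y => derive1 H y * rho y) x - s * f x.
Proof.
have cK' := elem_cont (elem_derive1 (mol_elem hK)).
have i1 := conv_intg x cK' (mol_bd1 hK) (P2_intg1 hr).
have i2 := conv_intg x (mol_cont hK) (mol_bd hK) drift_intg.
have i3 := intgZ s measurableT (conv_intg x (mol_cont hK) (mol_bd hK) (P2_intg1 hr)).
rewrite /convol /f /mfl /convol -(RintegralD _ i1 i2)// -RintegralZl//; last first.
  exact: conv_intg (mol_cont hK) (mol_bd hK) (P2_intg1 hr).
rewrite -(RintegralB _ (intgD measurableT i1 i2) i3)//.
by apply: eq_Rintegral => y _; ring.
Qed.

Lemma flux_cont : continuous flux.
Proof.
move=> x; rewrite (_ : flux = fun x => convol (derive1 K) rho x +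
    convol K (fun y => derive1 H y * rho y) x - s * f x); last by apply/funext => z; exact: fluxE.
apply: cvgB; last by apply: cvgM; [exact: cvg_cst|exact: (mfl_cont hK hr)].
apply: cvgD; last exact: (conv_cont (mol_cont hK) (mol_bd hK) drift_intg).
exact: (conv_cont (elem_cont (elem_derive1 (mol_elem hK))) (mol_bd1 hK) (P2_intg1 hr)).
Qed.

Let A := N + C + `|s|.

Lemma A_ge0 : 0 <= A.
Proof. by rewrite !addr_ge0 ?(mol_N0 hK) ?(conf_C hH). Qed.

Lemma flux_ker_le x y : `|derive1 K (x - y) + (derive1 H y - s) * K (x - y)| <=
  2 * A * ((1 + y ^+ 2 + (x - y) ^+ 2) * K (x - y)).
Proof.
have K0 := ltW (mol_gt0 hK (x - y)); have N0 := mol_N0 hK; have C0 := conf_C hH.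
apply: (le_trans (ler_normD _ _)); rewrite normrM (ger0_norm K0).
apply: (@le_trans _ _ ((N + (`|derive1 H y| + `|s|)) * K (x - y))).
  by rewrite mulrDl lerD ?(mol_d1 hK)// ler_wpM2r// ler_normB.
rewrite mulrA ler_wpM2r//.
have h := lin_quad (conf_lin hH y); have q := sqr_ge0 y; have q' := sqr_ge0 (x - y).
have s0 := normr_ge0 s; have n1 : N <= 2 * N * (1 + y ^+ 2) by nra.
have n2 : `|s| <= 2 * `|s| * (1 + y ^+ 2) by nra.
have n3 : 0 <= 2 * A * (x - y) ^+ 2 by rewrite mulr_ge0// mulr_ge0// A_ge0.
rewrite mulrDr; move: n3; rewrite /A; lra.
Qed.

Lemma flux_ker_meas : measurable_fun setT
  (fun p : R * R => derive1 K (p.1 - p.2) + (derive1 H p.2 - s) * K (p.1 - p.2)).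
Proof.
apply: measurable_funD; first exact: meas_ker (elem_cont (elem_derive1 (mol_elem hK))).
apply: measurable_funM; last exact: meas_ker (mol_cont hK).
apply: (@meas_snd2 _ (fun y => derive1 H y - s)); apply: measurable_funB => //.
exact: cont_meas (conf_cont hH).
Qed.

(** For the true multiplier, [s = int H' rho + l'], the total flux is [- l']. This is the origin of
    the work term [sigma l'] in the energy balance. *)
Lemma flux_mass : intg mu setT flux /\
  \int[mu]_x flux x = \int[mu]_y (derive1 H y * rho y) - s.
Proof.
have [i1 i2 _] := mol_fubini hK hr flux_ker_meas flux_ker_le; split => //.
rewrite i2; transitivity (\int[mu]_y (derive1 H y * rho y - s * rho y)).
  apply: eq_Rintegral => y _.
  have k1 := mol_intgdx hK y; have k2 := intgZ (derive1 H y - s) measurableT (mol_intgx hK y).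
  rewrite (RintegralD _ k1 k2)// RintegralZl//; last exact: mol_intgx hK y.
  by rewrite (mol_intdx hK) (mol_int1x hK) add0r mulr1 mulrBl.
rewrite (RintegralB _ drift_intg (intgZ s measurableT (P2_intg1 hr)))//.
by rewrite RintegralZl ?(P2_mass hr) ?mulr1//; exact: P2_intg1.
Qed.

(** The flux is the average of this quantity for the weight [K (x - y) rho y]. It grows at most
    linearly in [y], uniformly in [x], because [K' / K] is bounded. *)
Definition score x y : R := derive1 K (x - y) / K (x - y) + derive1 H y - s.

Lemma score_le x y : score x y ^+ 2 <= 2 * (A ^+ 2) * (1 + y ^+ 2).
Proof.
have Kp := mol_gt0 hK (x - y); have C0 := conf_C hH; have N0 := mol_N0 hK.
have h : `|score x y| <= A + C * `|y|.
  apply: (le_trans (ler_normB _ _)); apply: (le_trans (lerD (ler_normD _ _) (lexx _))).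
  have h1 : `|derive1 K (x - y) / K (x - y)| <= N.
    by rewrite normrM normfV (gtr0_norm Kp) ler_pdivrMr// (mol_d1 hK).
  by have := conf_lin hH y; rewrite mulrDr mulr1 /A; lra.
have y0 := normr_ge0 y; have A0 := A_ge0.
have CA : C <= A by rewrite /A; have := normr_ge0 s; lra.
rewrite -(real_normK (num_real (score x y))) -(real_normK (num_real y)).
have h2 : `|score x y| <= A * (1 + `|y|).
  by apply: (le_trans h); rewrite mulrDr mulr1 lerD2l ler_wpM2r.
have h3 : `|score x y| ^+ 2 <= (A * (1 + `|y|)) ^+ 2.
  by rewrite !expr2; apply: ler_pM.
apply: (le_trans h3); rewrite exprMn [leRHS]mulrAC -[leRHS]mulrC; apply: ler_wpM2l.
  exact: sqr_ge0.
by have := sqr_ge0 (`|y| - 1); lra.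
Qed.

Lemma scoreK x y : score x y * (K (x - y) * rho y) =
  (derive1 K (x - y) + (derive1 H y - s) * K (x - y)) * rho y.
Proof.
have k0 : K (x - y) != 0 by rewrite gt_eqF// (mol_gt0 hK).
by rewrite /score; field.
Qed.

Lemma weight_intg x : intg mu setT (fun y => K (x - y) * rho y).
Proof. exact: (conv_intg _ (mol_cont hK) (mol_bd hK) (P2_intg1 hr)). Qed.

Lemma weight_ge0 x y : 0 <= K (x - y) * rho y.
Proof. by rewrite mulr_ge0 ?(P2_ge0 _ hr)// ltW// (mol_gt0 hK). Qed.

Lemma score_meas : measurable_fun setT (fun p : R * R => score p.1 p.2).
Proof.
have ck : continuous (fun z => derive1 K z / K z).
  move=> z; apply: cvgM; first exact: (elem_cont (elem_derive1 (mol_elem hK))).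
  by apply: cvgV; [rewrite gt_eqF// (mol_gt0 hK)|exact: mol_cont hK z].
apply: measurable_funB => //; apply: measurable_funD; first exact: meas_ker ck.
by apply: (@meas_snd2 _ (derive1 H)); exact: cont_meas (conf_cont hH).
Qed.

(* Cauchy-Schwarz for the probability [K (x - y) rho y / f x]. *)
Lemma weighted_cs (g : R -> R) (B : R) x : measurable_fun setT g ->
  (forall y, g y ^+ 2 <= B * (1 + y ^+ 2)) ->
  [/\ intg mu setT (fun y => g y * (K (x - y) * rho y)),
     intg mu setT (fun y => g y ^+ 2 * (K (x - y) * rho y)) &
     (\int[mu]_y (g y * (K (x - y) * rho y))) ^+ 2 / f x <=
     \int[mu]_y (g y ^+ 2 * (K (x - y) * rho y))].
Proof.
move=> mg gB; have N0 := mol_N0 hK.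
have mk : measurable_fun setT (fun y => K (x - y)).
  by apply: cont_meas; exact: cont_shift (mol_cont hK).
have bd (h : R -> R) D : measurable_fun setT h -> (forall y, `|h y| <= D * (1 + y ^+ 2)) ->
    intg mu setT (fun y => h y * (K (x - y) * rho y)).
  move=> mh hD.
  have hKD y : `|h y * K (x - y)| <= D * N * (1 + y ^+ 2).
    by rewrite normrM mulrAC; apply: ler_pM => //; exact: (mol_bd hK).
  apply: intg_eq (P2_intg hr (measurable_funM mh mk) hKD) => // y _.
  by rewrite mulrA.
have i1 : intg mu setT (fun y => g y * (K (x - y) * rho y)).
  apply: (bd _ (1 + B)) => // y; have := gB y; have := sqr_ge0 y.
  rewrite -(real_normK (num_real (g y))); have := sqr_ge0 (`|g y| - 1).
  by have := normr_ge0 (g y); move: (`|g y|) (y ^+ 2) => a b; nra.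
have i2 : intg mu setT (fun y => g y ^+ 2 * (K (x - y) * rho y)).
  apply: (bd _ B) => [|y]; first exact: measurable_funX.
  by rewrite ger0_norm ?sqr_ge0.
split => //; apply: (cs_weight (weight_intg x)) => //; first exact: weight_ge0.
by have := mfl_gt0 hK hr x.
Qed.

(** [weighted_cs] bounds [flux^2 / f] by the weighted integral of [score^2], which is integrable in
    [x] by Fubini. *)
Lemma flux_sq : intg mu setT (fun x => flux x ^+ 2 / f x).
Proof.
pose B := 2 * A ^+ 2.
have B0 : 0 <= B by rewrite mulr_ge0 ?sqr_ge0.
have m2 : measurable_fun setT (fun p : R * R => score p.1 p.2 ^+ 2 * K (p.1 - p.2)).
  apply: measurable_funM; last exact: meas_ker (mol_cont hK).
  by apply: measurable_funX; exact: score_meas.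
have bd x y : `|score x y ^+ 2 * K (x - y)| <= B * ((1 + y ^+ 2 + (x - y) ^+ 2) * K (x - y)).
  have K0 := ltW (mol_gt0 hK (x - y)).
  rewrite (ger0_norm (mulr_ge0 (sqr_ge0 _) K0)) mulrA ler_wpM2r//.
  apply: (le_trans (score_le x y)); rewrite ler_wpM2l// lerDl; exact: sqr_ge0.
have [i1 _ _] := mol_fubini hK hr m2 bd.
apply: (@intg_le _ _ _ mu _ _ _ _ _ _ i1) => // [|x _].
  apply: cont_meas => x; apply: cvgM; first by apply: cvgM; exact: flux_cont.
  by apply: cvgV; [rewrite gt_eqF// (mfl_gt0 hK hr)|exact: (mfl_cont hK hr)].
have f0 := mfl_gt0 hK hr x.
rewrite ger0_norm ?divr_ge0 ?sqr_ge0 ?(ltW f0)//.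
have ms : measurable_fun setT (score x).
  apply: measurable_funB => //; apply: measurable_funD; last exact: cont_meas (conf_cont hH).
  have c1 : continuous (fun y => derive1 K (x - y)).
    by apply: cont_shift; exact: elem_cont (elem_derive1 (mol_elem hK)).
  have c2 : continuous (fun y => K (x - y)) by apply: cont_shift; exact: mol_cont hK.
  apply: cont_meas => y; apply: cvgM; first exact: (c1 y).
  by apply: cvgV; [rewrite gt_eqF// (mol_gt0 hK)|exact: (c2 y)].
have [_ _] := weighted_cs x ms (score_le x).
under eq_Rintegral do rewrite scoreK.
by under [X in _ <= X -> _]eq_Rintegral do rewrite mulrA.
Qed.

Definition defect x : R := derive1 H x * f x - convol K (fun y => derive1 H y * rho y) x.

(** The commutator averages [H'(x) - H'(y)] against [K (x - y) rho y]. Cauchy-Schwarz cancels the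
    weight [f], and the Lipschitz bound of [H'] leaves the second moment of the kernel. *)
Lemma defect_sq : intg mu setT (fun x => defect x ^+ 2 / f x) /\
  \int[mu]_x (defect x ^+ 2 / f x) <= C ^+ 2 * e2.
Proof.
have m2 : measurable_fun setT (fun p : R * R => (p.1 - p.2) ^+ 2 * K (p.1 - p.2)).
  apply: measurable_funM; last exact: meas_ker (mol_cont hK).
  by apply: measurable_funX; apply: measurable_funB; [exact: measurable_fst|exact: measurable_snd].
have bd x y : `|(x - y) ^+ 2 * K (x - y)| <= 1 * ((1 + y ^+ 2 + (x - y) ^+ 2) * K (x - y)).
  have K0 := ltW (mol_gt0 hK (x - y)).
  by rewrite mul1r (ger0_norm (mulr_ge0 (sqr_ge0 _) K0)) ler_wpM2r// lerDr addr_ge0 ?sqr_ge0.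
have [i1 i2 i3] := mol_fubini hK hr m2 bd.
have C0 := conf_C hH; have i1' := intgZ (C ^+ 2) measurableT i1.
have e x : defect x = \int[mu]_y ((derive1 H x - derive1 H y) * (K (x - y) * rho y)).
  have k1 := intgZ (derive1 H x) measurableT (weight_intg x).
  have k2 := conv_intg x (mol_cont hK) (mol_bd hK) drift_intg.
  rewrite /defect /f /mfl /convol -RintegralZl//; last exact: weight_intg.
  by rewrite -(RintegralB _ k1 k2)//; apply: eq_Rintegral => y _; ring.
have le x : defect x ^+ 2 / f x <= C ^+ 2 * \int[mu]_y ((x - y) ^+ 2 * K (x - y) * rho y).
  have mg : measurable_fun setT (fun y => derive1 H x - derive1 H y).
    by apply: measurable_funB => //; exact: cont_meas (conf_cont hH).
  have sq y : (derive1 H x - derive1 H y) ^+ 2 <= C ^+ 2 * (x - y) ^+ 2.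
    rewrite -exprMn -(real_normK (num_real (_ - _))) -[leRHS]real_normK ?num_real//.
    by rewrite !expr2; apply: ler_pM => //; rewrite normrM (ger0_norm C0) (conf_lip hH).
  have gB y : (derive1 H x - derive1 H y) ^+ 2 <= (2 * C ^+ 2 * (1 + x ^+ 2)) * (1 + y ^+ 2).
    apply: (le_trans (sq y)).
    rewrite (_ : 2 * C ^+ 2 * (1 + x ^+ 2) * (1 + y ^+ 2) =
      C ^+ 2 * (2 * ((1 + x ^+ 2) * (1 + y ^+ 2)))); last by ring.
    apply: ler_wpM2l; first exact: sqr_ge0.
    have := sqr_ge0 (x + y); have := sqr_ge0 (x * y); rewrite exprMn.
    by move: (sqr_ge0 x) (sqr_ge0 y); lra.
  have [j1 j2 j3] := weighted_cs x mg gB.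
  rewrite e; apply: (le_trans j3).
  have mq : measurable_fun setT (fun y : R => x - y) by apply: measurable_funB.
  have qB y : (x - y) ^+ 2 <= (2 * (1 + x ^+ 2)) * (1 + y ^+ 2).
    have := sqr_ge0 (x + y); have := sqr_ge0 (x * y); rewrite exprMn.
    by move: (sqr_ge0 x) (sqr_ge0 y); lra.
  have [_ j4 _] := weighted_cs x mq qB.
  under [X in _ <= _ * X]eq_Rintegral do rewrite -mulrA.
  rewrite -RintegralZl//; apply: le_Rintegral => //; first exact: intgZ.
  by move=> y _; rewrite [leRHS]mulrA ler_wpM2r ?weight_ge0.
have ge x : 0 <= defect x ^+ 2 / f x.
  by rewrite divr_ge0 ?sqr_ge0// ltW// (mfl_gt0 hK hr).
have mD : measurable_fun setT (fun x => defect x ^+ 2 / f x).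
  apply: cont_meas => x; apply: cvgM.
    have cd : defect z @[z --> x] --> defect x.
      apply: cvgB; last exact: (conv_cont (mol_cont hK) (mol_bd hK) drift_intg).
      by apply: cvgM; [exact: conf_cont hH x|exact: (mfl_cont hK hr)].
    by apply: cvgM; exact: cd.
  by apply: cvgV; [rewrite gt_eqF// (mfl_gt0 hK hr)|exact: (mfl_cont hK hr)].
have iD : intg mu setT (fun x => defect x ^+ 2 / f x).
  by apply: (@intg_le _ _ _ mu _ _ _ _ _ _ i1') => // x _; rewrite ger0_norm.
split => //; apply: (@le_trans _ _ (\int[mu]_x (C ^+ 2 * \int[mu]_y ((x - y) ^+ 2 * K (x - y) * rho y)))).
  by apply: le_Rintegral.
rewrite RintegralZl// i2 ler_wpM2l ?sqr_ge0//.
have h y : `|\int[mu]_x ((x - y) ^+ 2 * K (x - y))| <= e2.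
  have [_ l] := mol_mom2x hK y; rewrite ger0_norm//; apply: Rintegral_ge0 => x _.
  by rewrite mulr_ge0 ?sqr_ge0// ltW// (mol_gt0 hK).
apply: (le_trans (ler_norm _)); apply: P2_bdd hr _ h.
exact: (@measurable_Rint2 _ _ _ _ _ mu (fun p : R * R => (p.1 - p.2) ^+ 2 * K (p.1 - p.2))).
Qed.

Lemma weighted_young (d J r g : R) : 0 < d -> 0 < g ->
  (J + r) ^+ 2 / g <= (1 + d) * (J ^+ 2 / g) + (1 + d^-1) * (r ^+ 2 / g) /\
  `|r * J / g| <= d * (J ^+ 2 / g) + (4 * d)^-1 * (r ^+ 2 / g).
Proof.
move=> d0 g0; have dn : d != 0 by rewrite gt_eqF.
have gi : 0 <= g^-1 by rewrite invr_ge0 ltW.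
split.
  rewrite -subr_ge0 (_ : _ - _ = (d * J - r) ^+ 2 * g^-1 * d^-1); last by field; rewrite dn gt_eqF.
  apply: mulr_ge0; [apply: mulr_ge0 => //; exact: sqr_ge0|by rewrite invr_ge0 ltW].
have d4 : 0 <= (4 * d)^-1 by rewrite invr_ge0 mulr_ge0// ltW.
rewrite !mulrA !normrM (ger0_norm gi) -!mulrDl ler_wpM2r//.
rewrite -normrM ler_norml; apply/andP; split.
  rewrite -subr_ge0 (_ : _ - _ = (2 * d * J + r) ^+ 2 * (4 * d)^-1); last by field.
  by rewrite mulr_ge0 ?sqr_ge0.
rewrite -subr_ge0 (_ : _ - _ = (2 * d * J - r) ^+ 2 * (4 * d)^-1); last by field.
by rewrite mulr_ge0 ?sqr_ge0.
Qed.

Lemma drift_split x :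
  convol (derive1 K) rho x + derive1 H x * f x = flux x + defect x + s * f x.
Proof. by rewrite fluxE /defect; ring. Qed.

(** The rate of decrease of the energy of [f]: the derivative of [ln f + H] tested against the
    flux. *)
Definition production : R :=
  \int[mu]_x ((convol (derive1 K) rho x / f x + derive1 H x) * flux x).

Lemma fluxM_meas (g : R -> R) : continuous g -> measurable_fun setT (fun x => g x * flux x / f x).
Proof.
move=> cg; apply: cont_meas => x; apply: cvgM.
  by apply: cvgM; [exact: cg|exact: flux_cont].
by apply: cvgV; [rewrite gt_eqF// (mfl_gt0 hK hr)|exact: (mfl_cont hK hr)].
Qed.

Lemma defect_cont : continuous defect.
Proof.
move=> x; apply: cvgB; last exact: (conv_cont (mol_cont hK) (mol_bd hK) drift_intg).
by apply: cvgM; [exact: conf_cont hH x|exact: (mfl_cont hK hr)].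
Qed.

(** By [drift_split], the integrand is [flux^2 / f + defect flux / f + s flux]. Young's inequality
    spends a fraction [d] of the first term on the second, and [flux_mass] evaluates the third. *)
Lemma production_ge d : 0 < d ->
  intg mu setT (fun x => (convol (derive1 K) rho x / f x + derive1 H x) * flux x) /\
  (1 - d) * (\int[mu]_x (flux x ^+ 2 / f x)) + s * (\int[mu]_y (derive1 H y * rho y) - s)
    - (4 * d)^-1 * (C ^+ 2 * e2) <= production.
Proof.
move=> d0; have [k1 k2] := defect_sq; have k3 := flux_sq; have [k4 k5] := flux_mass.
have fp x : 0 < f x := mfl_gt0 hK hr x.
have k3' := intgZ d measurableT k3; have k1' := intgZ (4 * d)^-1 measurableT k1.
have k6 : intg mu setT (fun x => defect x * flux x / f x).
  apply: (@intg_le _ _ _ mu _ _ _ _ _ _ (intgD measurableT k3' k1')) => //.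
    exact: fluxM_meas defect_cont.
  by move=> x _; have [_] := weighted_young (flux x) (defect x) d0 (fp x).
have k4' := intgZ s measurableT k4.
have e x : (convol (derive1 K) rho x / f x + derive1 H x) * flux x =
    flux x ^+ 2 / f x + defect x * flux x / f x + s * flux x.
  have -> : convol (derive1 K) rho x / f x + derive1 H x =
      (convol (derive1 K) rho x + derive1 H x * f x) / f x by field; rewrite gt_eqF.
  by rewrite drift_split; field; rewrite gt_eqF.
have k7 := intgD measurableT k3 k6; have k8 := intgD measurableT k7 k4'.
split; first by apply: intg_eq k8 => // x _; rewrite e.
have -> : production =
    \int[mu]_x (flux x ^+ 2 / f x + defect x * flux x / f x + s * flux x).
  by apply: eq_Rintegral => x _; exact: e.
rewrite (RintegralD _ k7 k4')// (RintegralD _ k3 k6)// (RintegralZl _ _ k4)// k5.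
have : `|\int[mu]_x (defect x * flux x / f x)| <=
    d * (\int[mu]_x (flux x ^+ 2 / f x)) + (4 * d)^-1 * (\int[mu]_x (defect x ^+ 2 / f x)).
  rewrite -(RintegralZl _ _ k3)// -(RintegralZl _ _ k1)// -(RintegralD _ k3' k1')//.
  apply: (@Rint_le_norm _ _ _ mu) => //; first exact: intgD.
  by move=> x _; have [_] := weighted_young (flux x) (defect x) d0 (fp x).
rewrite ler_norml => /andP[h _].
have d4 : 0 <= (4 * d)^-1 by rewrite invr_ge0 mulr_ge0// ltW.
have h' := ler_wpM2l d4 k2; move: h h'.
move: (4 * d)^-1 (\int[mu]_x (defect x * flux x / f x)) (\int[mu]_x (defect x ^+ 2 / f x)) => q u v.
by move: (\int[mu]_x (flux x ^+ 2 / f x)) (C ^+ 2 * e2) (s * _) => w z r; lra.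
Qed.

(** The dissipation of [f] is the integral of [(flux + defect)^2 / f], so the log-Sobolev inequality
    for [f] becomes a lower bound of the flux term of [production_ge], up to the commutator. *)
Lemma mfl_LSI d (M : \bar R) (CL : R) : 0 < d -> 0 < CL -> log_Sobolev H M CL ->
  (`|s|%:E <= M)%E ->
  real_energy H f - s * M1 f + logZ H s - logZ H 0 <=
  CL * ((1 + d) * (\int[mu]_x (flux x ^+ 2 / f x)) + (1 + d^-1) * (C ^+ 2 * e2)).
Proof.
move=> d0 CL0 lsi sM; have [k1 k2] := defect_sq; have k3 := flux_sq.
have fp x : 0 < f x := mfl_gt0 hK hr x.
have Pf : P2 f := mfl_P2 hK hr.
have cf' : continuous (convol (derive1 K) rho).
  exact: (conv_cont (elem_cont (elem_derive1 (mol_elem hK))) (mol_bd1 hK) (P2_intg1 hr)).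
have if' : intg mu setT (convol (derive1 K) rho).
  have m2 := meas_ker (elem_cont (elem_derive1 (mol_elem hK))).
  have bd x y : `|derive1 K (x - y)| <= N * ((1 + y ^+ 2 + (x - y) ^+ 2) * K (x - y)).
    apply: (le_trans (mol_d1 hK _)); rewrite ler_wpM2l ?(mol_N0 hK)// ler_peMl ?(ltW (mol_gt0 hK _))//.
    by rewrite -addrA lerDl addr_ge0 ?sqr_ge0.
  by have [] := mol_fubini hK hr m2 bd.
have wd : weak_derivative setT f (convol (derive1 K) rho).
  exact: (weak_derivative_classical (mfl_dv hK hr) cf' (P2_intg1 Pf) if').
have k3' := intgZ (1 + d) measurableT k3; have k1' := intgZ (1 + d^-1) measurableT k1.
have ub : (dissipation H f s <= ((1 + d) * (\int[mu]_x (flux x ^+ 2 / f x)) +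
    (1 + d^-1) * (C ^+ 2 * e2))%:E)%E.
  rewrite /dissipation asboolT; last by eexists; exact: wd.
  (* The chosen weak derivative agrees almost everywhere with the classical derivative of [f], so
     the two integrals coincide. *)
  set drho := xget _ _.
  have hd : weak_derivative setT f drho by exact: (xgetPex (cst 0) (ex_intro _ _ wd)).
  have sT : [set x | 0 < f x] = setT by apply/seteqP; split => // z _; exact: fp.
  rewrite sT.
  have [md _ _] : locally_integrable setT drho by case: hd.
  have mf : measurable_fun setT f := P2_meas Pf.
  have e x : `|convol (derive1 K) rho x / f x + derive1 H x - s| ^+ 2 * f x =
      (flux x + defect x) ^+ 2 / f x.
    rewrite real_normK ?num_real// (_ : _ - s = (flux x + defect x) / f x).
      by field; rewrite gt_eqF.
    have -> : flux x + defect x = convol (derive1 K) rho x + derive1 H x * f x - s * f x.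
      by rewrite drift_split; ring.
    by field; rewrite gt_eqF.
  rewrite (@ae_eq_integral _ _ _ mu setT (fun x => ((flux x + defect x) ^+ 2 / f x)%:E))//.
  - have i2 : intg mu setT (fun x => (flux x + defect x) ^+ 2 / f x).
      apply: (@intg_le _ _ _ mu _ _ _ _ _ _ (intgD measurableT k3' k1')) => //.
        apply: cont_meas => x; apply: cvgM.
          by apply: cvgM; apply: cvgD; [exact: flux_cont|exact: defect_cont|exact: flux_cont|exact: defect_cont].
        by apply: cvgV; [rewrite gt_eqF// (mfl_gt0 hK hr)|exact: (mfl_cont hK hr)].
      move=> x _; rewrite ger0_norm; last by rewrite divr_ge0 ?sqr_ge0// ltW.
      by have [] := weighted_young (flux x) (defect x) d0 (fp x).
    rewrite Rint_EFin// lee_fin.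
    apply: (@le_trans _ _ (\int[mu]_x ((1 + d) * (flux x ^+ 2 / f x) + (1 + d^-1) * (defect x ^+ 2 / f x)))).
      apply: le_Rintegral => //; first exact: intgD.
      by move=> x _; have [] := weighted_young (flux x) (defect x) d0 (fp x).
    rewrite (RintegralD _ k3' k1')// !RintegralZl// lerD2l ler_wpM2l//.
    by rewrite addr_ge0// invr_ge0 ltW.
  - apply/measurable_EFinP; apply: measurable_funM => //; apply: measurable_funX.
    apply: measurableT_comp => //; apply: measurable_funB => //; apply: measurable_funD.
      apply: measurable_funM => //; apply: cont_meas => x.
      by apply: cvgV; [rewrite gt_eqF// (mfl_gt0 hK hr)|exact: (mfl_cont hK hr)].
    exact: cont_meas (conf_cont hH).
  - apply/measurable_EFinP; apply: cont_meas => x; apply: cvgM.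
      by apply: cvgM; apply: cvgD; [exact: flux_cont|exact: defect_cont|exact: flux_cont|exact: defect_cont].
    by apply: cvgV; [rewrite gt_eqF// (mfl_gt0 hK hr)|exact: (mfl_cont hK hr)].
  - have ae := weak_derivative_unique hd wd.
    by apply: ae_mono ae => x ex _; rewrite ex e.
have fin : (dissipation H f s < +oo)%E by apply: le_lt_trans ub _; rewrite ltry.
have := lsi s f sM Pf fin.
rewrite (relative_entropyE hH Pf (mfl_xlnx_intg hK hr)) => h.
rewrite -lee_fin; apply: (le_trans h); rewrite EFinM lee_wpmul2l// lee_fin ltW//.
Qed.

End Flux.

Lemma partition_le (R : realType) (F : R -> R) (a b k : R) : a <= b ->
  (forall s t, a <= s -> s <= t -> t <= b -> F t - F s <= k * (t - s) ^+ 2) -> F b <= F a.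
Proof.
move=> ab h.
have sub n : F b - F a <= k * (b - a) ^+ 2 / n.+1%:R.
  pose d := (b - a) / n.+1%:R.
  have n0 : (0 : R) < n.+1%:R by rewrite ltr0n.
  have d0 : 0 <= d by rewrite divr_ge0// ?subr_ge0// ltW.
  have bE : b = a + n.+1%:R * d by rewrite /d mulrC divfK ?gt_eqF// addrC subrK.
  have step i : (i <= n.+1)%N -> F (a + i%:R * d) - F a <= i%:R * (k * d ^+ 2).
    elim: i => [|i IH] ile; first by rewrite !mul0r addr0 subrr.
    have ih := IH (ltnW ile); have i0 : 0 <= i%:R * d by rewrite mulr_ge0.
    have e : a + i.+1%:R * d - (a + i%:R * d) = d by rewrite -natr1; ring.
    have := h (a + i%:R * d) (a + i.+1%:R * d); rewrite e.
    have -> : a <= a + i%:R * d by rewrite lerDl.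
    have -> : a + i%:R * d <= a + i.+1%:R * d by rewrite lerD2l ler_wpM2r// ler_nat.
    have -> : a + i.+1%:R * d <= b by rewrite bE lerD2l ler_wpM2r// ler_nat.
    have -> : i.+1%:R * (k * d ^+ 2) = i%:R * (k * d ^+ 2) + k * d ^+ 2.
      by rewrite -natr1 mulrDl mul1r.
    move=> /(_ isT isT isT) hh; move: (lerD ih hh); clear.
    by move: (F _) (F _) (F _) => u v z; lra.
  have := step n.+1 (leqnn _); rewrite -bE => hs; apply: (le_trans hs).
  rewrite le_eqVlt; apply/orP; left; apply/eqP; rewrite /d expr_div_n; field.
  by rewrite gt_eqF.
rewrite -subr_le0; apply: cvg_ge_lb (cvg_harm (k * (b - a) ^+ 2)) _.
by near=> n; exact: sub.
Unshelve. all: by end_near. Qed.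

(** Convexity bounds the increment of [u ln u] by the slope at the later value [v]. *)
Lemma entropy_tangent (R : realType) (u v : R) : 0 < u -> 0 < v ->
  v * ln v - u * ln u <= (1 + ln v) * (v - u).
Proof.
move=> u0 v0; have := xlnx_ge (1 + ln v) (ltW u0).
rewrite (_ : 1 + ln v - 1 = ln v); last by move: (ln v) => z; ring.
by rewrite lnK ?posrE//; move: (ln u) (ln v) => x y; lra.
Qed.

Lemma ln_lip (R : realType) (a u v : R) : 0 < a -> a <= u -> a <= v -> `|ln u - ln v| <= `|u - v| / a.
Proof.
move=> a0; wlog uv : u v / v <= u.
  by move=> hw au av; have [h|h] := leP v u; [exact: hw|rewrite distrC [in leRHS]distrC hw// ltW].
move=> au av; have u0 := lt_le_trans a0 au; have v0 := lt_le_trans a0 av.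
rewrite !ger0_norm ?subr_ge0 ?ler_ln ?posrE//.
rewrite -ln_div ?posrE//; have h : u / v = 1 + (u - v) / v by field; rewrite gt_eqF.
rewrite h; have p : 0 <= (u - v) / v by rewrite divr_ge0 ?subr_ge0// ltW.
apply: (@le_trans _ _ ((u - v) / v)); last by rewrite ler_wpM2l ?subr_ge0// lef_pV2.
by rewrite -ler_expR lnK ?posrE ?expR_ge1Dx// ltr_wpDr.
Qed.

Lemma shift_tangent (R : realType) (a p q d i : R) : a <= (1 + p) * d ->
  a + q * d - i <= (1 + p + q) * d - i.
Proof. by lra. Qed.

Section LineAndTime.
Context {R : realType}.
Local Notation mu := (@lebesgue_measure R).
Implicit Types (x y s t : R).

(** Boundary values at infinity are avoided: [k_n g] has compact support for a rescaled cutoff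
    [k_n], and [k_n' g] is dominated by [D |g|] and tends to 0 pointwise. *)
Lemma integral_derivative0 (g g' : R -> R) : (forall x, dv g x (g' x)) -> continuous g' ->
  intg mu setT g -> intg mu setT g' -> \int[mu]_x g' x = 0.
Proof.
move=> dg cg' ig ig'; have [D D0 hD] := @cutoff_bounds R; have cg := dv_continuous dg.
pose k (n : nat) (x : R) : R := cutoff (n.+1%:R^-1 * x).
pose k' (n : nat) (x : R) : R := derive1 cutoff (n.+1%:R^-1 * x) * n.+1%:R^-1.
have dsc (n : nat) x : dv (fun x : R => n.+1%:R^-1 * x) x n.+1%:R^-1.
  by apply: dv_eq (dvZ _ (dv_id x)) _; rewrite mulr1.
have csc (n : nat) : continuous (fun x : R => n.+1%:R^-1 * x) := dv_continuous (dsc n).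
have dk n x : dv (k n) x (k' n x).
  by apply: (dv_comp (dsc n x)); exact: elem_dv (elem_cutoff).
have ck n := dv_continuous (dk n).
have ck' n : continuous (k' n).
  move=> x; apply: cvgM; last exact: cvg_cst.
  apply: (@cvg_comp _ _ _ (fun x => n.+1%:R^-1 * x) (derive1 cutoff)); first exact: csc.
  exact: (elem_cont (elem_derive1 elem_cutoff)).
have sup0 n x : 3 * n.+1%:R < `|x| -> 3 < `|n.+1%:R^-1 * x|.
  by move=> h; rewrite normrM gtr0_norm ?invr_gt0// mulrC ltr_pdivlMr.
pose F (n : nat) x := k' n x * g x + k n x * g' x.
have cF n : continuous (F n).
  by move=> x; apply: cvgD; apply: cvgM; [exact: ck'|exact: cg|exact: ck|exact: cg'].
have F0 n : \int[mu]_x F n x = 0.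
  pose M : R := 4 * n.+1%:R; have M0 : 0 <= M by rewrite mulr_ge0.
  have M3 : 3 * n.+1%:R < M by rewrite ltr_pM2r// ltr_nat.
  rewrite (@Rint_supp _ _ _ mu `[- M, M] setT)//; last first.
    move=> x _ h; have xM : 3 * n.+1%:R < `|x|.
      apply: (lt_trans M3); rewrite ltNge; apply/negP => h'; apply: h.
      by rewrite /= in_itv/= -ler_norml.
    have := sup0 n x xM => h3; rewrite /F /k /k' cutoff0//.
    by rewrite (elem_support elem_cutoff (@cutoff0 R))// !mul0r addr0.
  have dF x : dv (fun x => k n x * g x) x (F n x) by exact: dvM.
  rewrite (ftc_itv dF (cF n)); last by rewrite (@le_trans _ _ 0)// oppr_le0.
  have z x : `|x| = M -> k n x = 0 by move=> e; rewrite /k cutoff0// sup0// e.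
  by rewrite !z ?mul0r ?subrr// ?normrN ger0_norm.
have k'D n x : `|k' n x| <= D.
  have n1 : `|n.+1%:R^-1 : R| <= 1 by rewrite ger0_norm ?invr_ge0// invf_le1 ?ltr0n// ler1n.
  have [h _] := hD (n.+1%:R^-1 * x).
  rewrite /k' normrM -[leRHS]mulr1; apply: ler_pM; [exact: normr_ge0|exact: normr_ge0|exact: h|exact: n1].
have k1 n x : `|k n x| <= 1 by rewrite ger0_norm ?cutoff_ge0 ?cutoff_le1.
have dom n x : `|F n x| <= D * `|g x| + `|g' x|.
  apply: (le_trans (ler_normD _ _)); apply: lerD.
    by rewrite (normrM (k' n x) (g x)); apply: ler_wpM2r; [exact: normr_ge0|exact: k'D].
  rewrite (normrM (k n x) (g' x)) -[leRHS]mul1r.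
  by apply: ler_wpM2r; [exact: normr_ge0|exact: k1].
have ptw x : F n x @[n --> \oo] --> g' x.
  have : `|x| / n.+1%:R @[n --> \oo] --> (0 : R) by exact: cvg_harm.
  move=> /cvgrPdist_lt /(_ 1 ltr01) hn; apply: cvg_near_cst; near=> n.
  have : `|0 - `|x| / n.+1%:R| < 1 by near: n.
  rewrite sub0r normrN => h1; have h2 : `|n.+1%:R^-1 * x| < 1.
    by move: h1; rewrite !normrM normr_id (mulrC `|x|).
  have [h3 _] := cutoff_flat h2.
  by rewrite /F /k /k' h3 (cutoff1 (ltW h2)) !mul0r add0r mul1r.
have pae : {ae mu, forall x, setT x -> F n x @[n --> \oo] --> g' x}.
  by apply: aeW => x _; exact: ptw.
have [_ lim] := @dct _ _ _ mu setT F g' _ measurableT (fun n => cont_meas (cF n)) (cont_meas cg')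
  pae (intgD measurableT (intgZ D measurableT (intg_norm measurableT ig))
    (intg_norm measurableT ig')) (fun n x _ => dom n x).
apply: cvg_uniq lim _; under eq_fun do rewrite F0; exact: cvg_cst.
Unshelve. all: by end_near. Qed.

Lemma mu_itvoc x y : x <= y -> mu `]x, y] = (y - x)%:E.
Proof.
move=> xy; rewrite lebesgue_measure_itv /= lte_fin; case: ltP => // yx.
by rewrite (_ : y = x) ?subrr//; apply/le_anti; rewrite xy yx.
Qed.

Lemma Rint_cst_oc x y k : x <= y -> \int[mu]_(t in `]x, y]) k = k * (y - x).
Proof. by move=> xy; rewrite Rintegral_cst//= (mu_itvoc xy). Qed.

Lemma intg_bdd_oc x y (g : R -> R) (B : R) : measurable_fun setT g ->
  (forall t, `|g t| <= B) -> intg mu `]x, y] g.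
Proof.
move=> mg gB; apply: (@intg_le _ _ _ mu _ _ (fun=> B)) => //; first exact: measurable_funTS.
apply: (@integrableS _ _ _ mu `[x, y]) => //; first exact: subset_itv_oc_cc.
exact: intg_cst_itv.
Qed.

Lemma Rint_bdd_oc x y (g : R -> R) (B : R) : x <= y -> intg mu `]x, y] g ->
  (forall t, x < t <= y -> `|g t| <= B) -> `|\int[mu]_(t in `]x, y]) g t| <= B * (y - x).
Proof.
move=> xy ig gB; rewrite -Rint_cst_oc//; apply: (@Rint_le_norm _ _ _ mu) => //.
  by apply: (@intg_bdd_oc _ _ _ `|B|) => //; exact: measurable_cst.
Qed.

Lemma Rint_split_oc a x y (g : R -> R) : a <= x -> x <= y -> intg mu `]a, y] g ->
  \int[mu]_(t in `]a, y]) g t - \int[mu]_(t in `]a, x]) g t = \int[mu]_(t in `]x, y]) g t.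
Proof. by move=> ax xy ig; rewrite Rintegral_itvB// bnd_simp. Qed.

Lemma Rint_indic (D : set R) (g : R -> R) : \int[mu]_r (\1_D r * g r) = \int[mu]_(r in D) g r.
Proof.
rewrite (@Rint_supp _ _ _ mu D setT)//.
  by apply: eq_Rintegral => r rD; rewrite indicE rD mul1r.
by move=> r _ rD; rewrite indicE memNset ?mul0r.
Qed.

End LineAndTime.

(** * Evolution of the mollified energy *)

Section EnergyEvolution.
Context {R : realType}.
Local Notation mu := (@lebesgue_measure R).
Implicit Types (x y z r s t : R).
Variables (K : R -> R) (N e1 e2 : R).
Hypothesis hK : mollifier K N e1 e2.
Variables (H : R -> R) (C c : R).
Hypothesis hH : confining H C c.
Variables (w : R -> R -> R) (sg : R -> R) (A S T : R).
Hypothesis mw : measurable_fun setT (fun p : R * R => w p.1 p.2).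
Hypothesis Pw : forall r, P2 (w r).
Hypothesis mA : forall r, mom2 (w r) <= A.
Hypothesis msg : measurable_fun setT sg.
Hypothesis sgS : forall r, `|sg r| <= S.
Hypothesis weak : forall phi s t, moderate phi -> 0 <= s -> s <= t -> t <= T ->
  \int[mu]_x (phi x * w t x) - \int[mu]_x (phi x * w s x) =
  \int[mu]_(r in `]s, t])
    (\int[mu]_x ((derive1n 2 phi x - derive1 H x * derive1 phi x) * w r x)
     + sg r * \int[mu]_x (derive1 phi x * w r x)).

Let f r := mfl K (w r).
Let J r := flux K H (w r) (sg r).
Let K'' := derive1 (derive1 K).
(** [b] is the spatial derivative of [J]. Both are bounded by [G] times the moment [m] introduced
    next, whose product with [1 + |x|] is integrable uniformly in time: enough against weights like
    [ln f]. *)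
Let b r x := \int[mu]_y ((K'' (x - y) + (derive1 H y - sg r) * derive1 K (x - y)) * w r y).
Let m r x := \int[mu]_y ((1 + `|y|) * K (x - y) * w r y).
Let G := N * (N + C + S).

Let N1 : 1 <= N := mol_N hK.
Let C0 : 0 <= C := conf_C hH.
Let A0 : 0 <= A := le_trans (mom2_ge0 (Pw 0)) (mA 0).
Let S0 : 0 <= S := le_trans (normr_ge0 _) (sgS 0).
Let K0 z : 0 <= K z := ltW (mol_gt0 hK z).
Let eK' : elem (derive1 K) := elem_derive1 (mol_elem hK).

Lemma G_ge0 : 0 <= G.
Proof. by rewrite mulr_ge0 ?(mol_N0 hK)// !addr_ge0// (mol_N0 hK). Qed.

Lemma ker_flux_le r x y : `|derive1 K (x - y) + (derive1 H y - sg r) * K (x - y)| <=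
  G * ((1 + `|y|) * K (x - y)).
Proof.
have k0 := K0 (x - y); have y0 := normr_ge0 y.
apply: (le_trans (ler_normD _ _)); rewrite normrM (ger0_norm k0).
apply: (@le_trans _ _ ((N + (`|derive1 H y| + `|sg r|)) * K (x - y))).
  by rewrite mulrDl lerD ?(mol_d1 hK)// ler_wpM2r// ler_normB.
rewrite mulrA ler_wpM2r//.
apply: (@le_trans _ _ (1 * ((N + C + S) * (1 + `|y|)))).
  have := conf_lin hH y; have := sgS r; have := N1; have := S0; have := C0.
  by move: (`|derive1 H y|) (`|sg r|) (`|y|) y0 => a d e; nra.
rewrite /G -mulrA ler_wpM2r// mulr_ge0// !addr_ge0//; exact: mol_N0 hK.
Qed.

Lemma ker_b_le r x y : `|K'' (x - y) + (derive1 H y - sg r) * derive1 K (x - y)| <=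
  G * ((1 + `|y|) * K (x - y)).
Proof.
have k0 := K0 (x - y); have y0 := normr_ge0 y; have N0 := mol_N0 hK.
apply: (le_trans (ler_normD _ _)); rewrite normrM.
apply: (@le_trans _ _ ((N + (`|derive1 H y| + `|sg r|) * N) * K (x - y))).
  rewrite mulrDl lerD ?(mol_d2 hK)// -mulrA; apply: ler_pM => //; first exact: ler_normB.
  exact: mol_d1 hK _.
rewrite mulrA ler_wpM2r//.
apply: (@le_trans _ _ (N * ((1 + C + S) * (1 + `|y|)))).
  rewrite mulrC -[X in X + _]mulr1 -mulrDr ler_wpM2l//.
  have := conf_lin hH y; have := sgS r; have := S0; have := C0.
  by move: (`|derive1 H y|) (`|sg r|) (`|y|) y0 => a d e; nra.
by rewrite /G -mulrA ler_wpM2l// ler_wpM2r ?addr_ge0// !lerD2r.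
Qed.

Lemma m_ker_le x y : `|(1 + `|y|) * K (x - y)| <= 2 * N * (1 + y ^+ 2).
Proof.
rewrite normrM [`|1 + _|]ger0_norm ?addr_ge0// mulrAC; apply: ler_pM => //.
- have := @lin_quad R 1 y (1 + `|y|); rewrite mul1r mulr1 ger0_norm ?addr_ge0//; exact.
- exact: mol_bd hK _.
Qed.

Lemma m_ker_meas x : measurable_fun setT (fun y => (1 + `|y|) * K (x - y)).
Proof.
apply: measurable_funM; last by apply: cont_meas; exact: cont_shift (mol_cont hK).
by apply: cont_meas => y; apply: cvgD; [exact: cvg_cst|apply: cvg_norm; exact: cvg_id].
Qed.

Lemma m_intg r x : intg mu setT (fun y => (1 + `|y|) * K (x - y) * w r y).
Proof. exact: (P2_intg (Pw r) (m_ker_meas x) (m_ker_le x)). Qed.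

Lemma m_le r x : m r x <= 2 * N * (1 + A).
Proof.
apply: (le_trans (ler_norm _)); apply: (le_trans (P2_le (Pw r) (m_ker_meas x) (m_ker_le x))).
by rewrite ler_wpM2l ?lerD2l// mulr_ge0// (mol_N0 hK).
Qed.

Lemma ker_m_le (k : R -> R) r x : measurable_fun setT k ->
  (forall y, `|k y| <= G * ((1 + `|y|) * K (x - y))) ->
  intg mu setT (fun y => k y * w r y) /\ `|\int[mu]_y (k y * w r y)| <= G * m r x.
Proof.
move=> mk kG; have i1 := intgZ G measurableT (m_intg r x).
have le y : `|k y * w r y| <= G * ((1 + `|y|) * K (x - y) * w r y).
  by rewrite normrM (ger0_norm (P2_ge0 y (Pw r))) mulrA ler_wpM2r ?(P2_ge0 _ (Pw r)).
have i2 : intg mu setT (fun y => k y * w r y).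
  apply: (@intg_le _ _ _ mu _ _ _ _ _ _ i1) => //.
  by apply: measurable_funM => //; exact: P2_meas.
split => //; rewrite /m -RintegralZl//; last exact: m_intg.
exact: (@Rint_le_norm _ _ _ mu).
Qed.

Lemma ker_flux_meas1 r x :
  measurable_fun setT (fun y => derive1 K (x - y) + (derive1 H y - sg r) * K (x - y)).
Proof.
apply: measurable_funD; first by apply: cont_meas; exact: cont_shift (elem_cont eK').
apply: measurable_funM; last by apply: cont_meas; exact: cont_shift (mol_cont hK).
by apply: measurable_funB => //; exact: cont_meas (conf_cont hH).
Qed.

Lemma ker_b_meas1 r x :
  measurable_fun setT (fun y => K'' (x - y) + (derive1 H y - sg r) * derive1 K (x - y)).
Proof.
apply: measurable_funD.
  by apply: cont_meas; apply: cont_shift; exact: elem_cont (elem_derive1 eK').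
apply: measurable_funM; last by apply: cont_meas; exact: cont_shift (elem_cont eK').
by apply: measurable_funB => //; exact: cont_meas (conf_cont hH).
Qed.

Lemma J_le r x : `|J r x| <= G * m r x.
Proof. by have [_] := ker_m_le r (ker_flux_meas1 r x) (ker_flux_le r x). Qed.

Lemma b_le r x : `|b r x| <= G * m r x.
Proof. by have [_] := ker_m_le r (ker_b_meas1 r x) (ker_b_le r x). Qed.

Lemma bE r x : b r x = convol K'' (w r) x + convol (derive1 K) (fun y => derive1 H y * w r y) x
  - sg r * convol (derive1 K) (w r) x.
Proof.
have wi := P2_intg1 (Pw r); have di := drift_intg hH (Pw r).
have i1 := conv_intg x (elem_cont (elem_derive1 eK')) (mol_bd2 hK) wi.
have i2 := conv_intg x (elem_cont eK') (mol_bd1 hK) di.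
have i3 := conv_intg x (elem_cont eK') (mol_bd1 hK) wi.
have i3' := intgZ (sg r) measurableT i3.
rewrite /convol -(RintegralD _ i1 i2)// -(RintegralZl _ _ i3)//.
rewrite -(RintegralB _ (intgD measurableT i1 i2) i3')//.
by apply: eq_Rintegral => y _; rewrite /K''; ring.
Qed.

Lemma dv_J r x : dv (J r) x (b r x).
Proof.
have wi := P2_intg1 (Pw r); have di := drift_intg hH (Pw r).
have d1 : dv (convol (derive1 K) (w r)) x (convol K'' (w r) x).
  by apply: (conv_dv (B := N ^+ 2)) => //; [exact: (mol_bd1 hK)|exact: (mol_bd2 hK)].
have bd z : `|K z| <= N ^+ 2 by exact: le_trans (mol_bd hK z) (mol_NN hK).
have d2 : dv (convol K (fun y => derive1 H y * w r y)) x
    (convol (derive1 K) (fun y => derive1 H y * w r y) x).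
  by apply: (conv_dv (B := N ^+ 2)) => //; [exact: mol_elem hK|exact: (mol_bd1 hK)].
have d3 := mfl_dv hK (Pw r) x.
apply: (@dv_ext _ (fun x => convol (derive1 K) (w r) x +
  convol K (fun y => derive1 H y * w r y) x - sg r * f r x)).
  by move=> z; rewrite /J (fluxE hK hH).
by apply: dv_eq (dvB (dvD d1 d2) (dvZ (sg r) d3)) _; rewrite bE.
Qed.

Lemma b_cont r : continuous (b r).
Proof.
have wi := P2_intg1 (Pw r); have di := drift_intg hH (Pw r) => x.
rewrite (_ : b r = fun x => convol K'' (w r) x + convol (derive1 K) (fun y => derive1 H y * w r y) x
  - sg r * convol (derive1 K) (w r) x); last by apply/funext => z; exact: bE.
apply: cvgB; last first.
  apply: cvgM; [exact: cvg_cst|exact: (conv_cont (elem_cont eK') (mol_bd1 hK) wi)].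
apply: cvgD; last exact: (conv_cont (elem_cont eK') (mol_bd1 hK) di).
exact: (conv_cont (elem_cont (elem_derive1 eK')) (mol_bd2 hK) wi).
Qed.

Lemma meas_conv2 (k : R -> R) (g : R -> R -> R) : measurable_fun setT k ->
  measurable_fun setT (fun p : R * R => g p.1 p.2) ->
  measurable_fun setT (fun p : R * R => convol k (g p.1) p.2).
Proof.
move=> mk mg; apply: (@measurable_Rint _ _ _ _ _ mu
  (fun q : (R * R) * R => k (q.1.2 - q.2) * g q.1.1 q.2)).
have m1 : measurable_fun setT (fun q : (R * R) * R => q.1.1).
  exact: (measurableT_comp measurable_fst measurable_fst).
have m2 : measurable_fun setT (fun q : (R * R) * R => q.1.2).
  exact: (measurableT_comp measurable_snd measurable_fst).
apply: measurable_funM.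
  by apply: (measurableT_comp mk); apply: measurable_funB.
exact: (measurableT_comp mg (measurable_fun_pair m1 measurable_snd)).
Qed.

Lemma meas_drift2 : measurable_fun setT (fun p : R * R => derive1 H p.2 * w p.1 p.2).
Proof.
apply: measurable_funM => //; apply: (@meas_snd2 _ (derive1 H)).
exact: cont_meas (conf_cont hH).
Qed.

Lemma f_joint : measurable_fun setT (fun p : R * R => f p.1 p.2).
Proof. by apply: meas_conv2 => //; exact: cont_meas (mol_cont hK). Qed.

Lemma J_joint : measurable_fun setT (fun p : R * R => J p.1 p.2).
Proof.
rewrite (_ : (fun p => _) = fun p : R * R => convol (derive1 K) (w p.1) p.2 +
    convol K (fun y => derive1 H y * w p.1 y) p.2 - sg p.1 * f p.1 p.2); last first.
  by apply/funext => p; rewrite /J (fluxE hK hH).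
apply: measurable_funB; last by apply: measurable_funM; [exact: meas_fst2|exact: f_joint].
apply: measurable_funD; first by apply: meas_conv2 => //; exact: cont_meas (elem_cont eK').
apply: (meas_conv2 (g := fun r y => derive1 H y * w r y)); last exact: meas_drift2.
exact: cont_meas (mol_cont hK).
Qed.

Lemma b_joint : measurable_fun setT (fun p : R * R => b p.1 p.2).
Proof.
rewrite (_ : (fun p => _) = fun p : R * R => convol K'' (w p.1) p.2 +
    convol (derive1 K) (fun y => derive1 H y * w p.1 y) p.2 -
    sg p.1 * convol (derive1 K) (w p.1) p.2); last by apply/funext => p; rewrite bE.
have mk' : measurable_fun setT (derive1 K) := cont_meas (elem_cont eK').
apply: measurable_funB; last by apply: measurable_funM; [exact: meas_fst2|exact: meas_conv2].
apply: measurable_funD.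
  by apply: meas_conv2 => //; exact: cont_meas (elem_cont (elem_derive1 eK')).
by apply: (meas_conv2 (g := fun r y => derive1 H y * w r y)) => //; exact: meas_drift2.
Qed.

Let Q := 3 * (1 + e2) * (1 + A).

(** The constant 3 comes from [(1 + |x|) (1 + |y|) <= 3 (1 + y^2 + (x - y)^2)]; integrating in [x]
    and then against the density gives [Q]. *)
Lemma m_mom r : intg mu setT (fun x => (1 + `|x|) * m r x) /\
  \int[mu]_x ((1 + `|x|) * m r x) <= Q.
Proof.
pose a x y := (1 + `|x|) * ((1 + `|y|) * K (x - y)).
have mabs : measurable_fun setT (fun x : R => 1 + `|x|).
  by apply: cont_meas => y; apply: cvgD; [exact: cvg_cst|apply: cvg_norm; exact: cvg_id].
have ma : measurable_fun setT (fun p : R * R => a p.1 p.2).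
  apply: measurable_funM; first exact: meas_fst2 mabs.
  by apply: measurable_funM; [exact: meas_snd2 mabs|exact: meas_ker (mol_cont hK)].
have a0 x y : 0 <= a x y by rewrite !mulr_ge0// addr_ge0.
have le x y : a x y <= 3 * ((1 + y ^+ 2 + (x - y) ^+ 2) * K (x - y)).
  rewrite /a !mulrA ler_wpM2r//.
  have h : `|x| <= `|y| + `|x - y| by rewrite -{1}(subrK y x) addrC ler_normD.
  rewrite -(real_normK (num_real y)) -(real_normK (num_real (x - y))).
  have := normr_ge0 y; have := normr_ge0 (x - y); have := normr_ge0 x.
  have := sqr_ge0 (`|y| - 1); have := sqr_ge0 (`|x - y| - 1 - `|y|).
  by move: h; move: (`|y|) (`|x - y|) (`|x|) => u v z; nra.
have bd x y : `|a x y| <= 3 * ((1 + y ^+ 2 + (x - y) ^+ 2) * K (x - y)) by rewrite ger0_norm.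
have [i1 i2 _] := mol_fubini hK (Pw r) ma bd.
have e x : (1 + `|x|) * m r x = \int[mu]_y (a x y * w r y).
  rewrite /m -RintegralZl//; last exact: m_intg.
  by apply: eq_Rintegral => y _; rewrite /a; ring.
split; first by apply: intg_eq i1 => // x _; rewrite e.
under eq_Rintegral do rewrite e.
rewrite i2; have h y : `|\int[mu]_x a x y| <= 3 * (1 + e2) * (1 + y ^+ 2).
  rewrite ger0_norm; last by apply: Rintegral_ge0.
  have [k1 k2] := mol_mom2x hK y; have k0 := intgZ (1 + y ^+ 2) measurableT (mol_intgx hK y).
  have k3 := intgZ 3 measurableT (intgD measurableT k0 k1).
  have e3 x : 3 * ((1 + y ^+ 2) * K (x - y) + (x - y) ^+ 2 * K (x - y)) =
    3 * ((1 + y ^+ 2 + (x - y) ^+ 2) * K (x - y)) by rewrite -mulrDl.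
  apply: (@le_trans _ _ (\int[mu]_x (3 * ((1 + y ^+ 2) * K (x - y) + (x - y) ^+ 2 * K (x - y))))).
    apply: le_Rintegral => //; last by move=> x _; rewrite e3.
    apply: (@intg_le _ _ _ mu _ _ _ _ _ _ k3) => //; last by move=> x _; rewrite e3.
    apply: measurable_funM => //; apply: measurable_funM => //.
    by apply: cont_meas; exact: cont_shiftl (mol_cont hK).
  rewrite (RintegralZl _ _ (intgD measurableT k0 k1))// (RintegralD _ k0 k1)//.
  rewrite (RintegralZl _ _ (mol_intgx hK y))// (mol_int1x hK) mulr1 -mulrA ler_wpM2l//.
  have := mol_e2 hK; have := sqr_ge0 y; move: k2; move: (\int[mu]_x _) => q.
  by move: (y ^+ 2) => u *; nra.
apply: (le_trans (ler_norm _)); apply: (le_trans (P2_le (Pw r) _ h)).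
  exact: (@measurable_Rint2 _ _ _ _ _ mu (fun p : R * R => a p.1 p.2)).
by rewrite ler_wpM2l ?lerD2l// mulr_ge0// addr_ge0// (mol_e2 hK).
Qed.

Lemma b_pairing r x : \int[mu]_y ((K'' (x - y) - derive1 H y * - derive1 K (x - y)) * w r y)
  + sg r * \int[mu]_y (- derive1 K (x - y) * w r y) = b r x.
Proof.
have wi := P2_intg1 (Pw r); have di := drift_intg hH (Pw r).
have i1 := conv_intg x (elem_cont (elem_derive1 eK')) (mol_bd2 hK) wi.
have i2 := conv_intg x (elem_cont eK') (mol_bd1 hK) di.
have i3 := conv_intg x (elem_cont eK') (mol_bd1 hK) wi.
have i3n : intg mu setT (fun y => - derive1 K (x - y) * w r y).
  by apply: (intg_eq measurableT _ (intgN measurableT i3)) => y _; exact: esym (mulNr _ _).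
have i4 : intg mu setT (fun y => (K'' (x - y) - derive1 H y * - derive1 K (x - y)) * w r y).
  by apply: (intg_eq measurableT _ (intgD measurableT i1 i2)) => y _; rewrite /K''; ring.
rewrite bE /convol -(RintegralD measurableT i1 i2) -(RintegralZl (sg r) measurableT i3).
rewrite -(RintegralB measurableT (intgD measurableT i1 i2) (intgZ (sg r) measurableT i3)).
rewrite -(RintegralZl (sg r) measurableT i3n) -(RintegralD measurableT i4 (intgZ (sg r) measurableT i3n)).
by apply: eq_Rintegral => y _; rewrite /K''; ring.
Qed.

(** The equation tested with [y -> K (x - y)], which is moderate though not compactly supported. *)
Lemma f_diff s t x : 0 <= s -> s <= t -> t <= T ->
  f t x - f s x = \int[mu]_(r in `]s, t]) b r x.
Proof.
move=> s0 st tT; pose phi y := K (x - y).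
have dx y : dv (fun y : R => x - y) y (-1).
  by apply: dv_eq (dvB (dv_cst x y) (dv_id y)) _; rewrite sub0r.
have ephi : elem phi.
  by apply: elem_comp (mol_elem hK) _; apply: elem_sub; [exact: elem_cst|exact: elem_id].
have p1 : derive1 phi = fun y => - derive1 K (x - y).
  apply/funext => y; apply: dv_derive1.
  by apply: dv_eq (dv_comp (dx y) (elem_dv (x - y) (mol_elem hK))) _; rewrite mulrN1.
have p2 : derive1n 2 phi = fun y => K'' (x - y).
  apply/funext => y; rewrite [LHS](_ : _ = derive1 (fun y => - derive1 K (x - y)) y); last first.
    by rewrite /derive1n /= p1.
  apply: dv_derive1.
  by apply: dv_eq (dvN (dv_comp (dx y) (elem_dv (x - y) eK'))) _; rewrite mulrN1 opprK.
have mod : moderate phi.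
  split; first exact: ephi.
  (* From [1 + |y| <= (1 + |x|) (1 + |x - y|)] and the decay [(1 + |z|) K z <= N]. *)
  exists (N ^+ 2 * (1 + `|x|)) => y.
  have x1 : 1 <= 1 + `|x| by rewrite lerDl.
  have NN : N ^+ 2 <= N ^+ 2 * (1 + `|x|) by rewrite ler_peMr ?sqr_ge0.
  rewrite p1 p2; split.
  - by apply: (le_trans (mol_bd hK _)); exact: le_trans (mol_NN hK) NN.
  - rewrite normrN; apply: (@le_trans _ _ (((1 + `|x|) * (1 + `|x - y|)) * (N * K (x - y)))).
      apply: ler_pM; [by rewrite addr_ge0|exact: normr_ge0| |exact: mol_d1 hK _].
      have h : `|y| <= `|x| + `|x - y|.
        by rewrite -{1}(subKr x y); apply: le_trans (ler_normB _ _) _.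
      by have := mulr_ge0 (normr_ge0 x) (normr_ge0 (x - y)); lra.
    have h := mol_dec hK (x - y); rewrite mulrC mulrACA mulrC expr2 -!mulrA.
    have h2 := ler_wpM2l (mol_N0 hK) h; have h3 := ler_wpM2r (le_trans ler01 x1) h2.
    apply: (le_eq2 h3); ring.
  - by apply: (le_trans (mol_bd2 hK _)).
have e := weak mod s0 st tT; rewrite p1 p2 in e.
rewrite /f /mfl /convol e; apply: eq_Rintegral => r _; exact: b_pairing.
Qed.

Lemma lnf_le r x : `|ln (f r x)| <= N * (3 + A + `|x|).
Proof.
apply: (le_trans (mfl_ln hK (Pw r) x)); rewrite ler_wpM2l ?(mol_N0 hK)//.
by rewrite lerD2r lerD2l.
Qed.

Lemma f_low r x : expR (- (N * (3 + A + `|x|))) <= f r x.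
Proof.
apply: le_trans (mfl_gt_low hK (Pw r) x); rewrite ler_expR lerN2 ler_wpM2l ?(mol_N0 hK)//.
by rewrite lerD2r lerD2l.
Qed.

Let fp r x : 0 < f r x := mfl_gt0 hK (Pw r) x.
Let B := G * (2 * N * (1 + A)).

Lemma b_bdd r x : `|b r x| <= B.
Proof. by apply: (le_trans (b_le r x)); rewrite ler_wpM2l ?G_ge0 ?m_le. Qed.

Lemma meas_time (g : R -> R -> R) x : measurable_fun setT (fun p : R * R => g p.1 p.2) ->
  measurable_fun setT (g ^~ x).
Proof.
move=> mg; apply: (measurableT_comp mg (g := fun r : R => (r, x))).
by apply: measurable_fun_pair => //; exact: measurable_cst.
Qed.

Lemma b_time s t x : intg mu `]s, t] (b ^~ x).
Proof. by apply: (intg_bdd_oc _ _ (meas_time x b_joint)) => r; exact: b_bdd. Qed.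

Lemma f_time_lip s t x : 0 <= s -> s <= t -> t <= T -> `|f t x - f s x| <= B * (t - s).
Proof.
move=> s0 st tT; rewrite f_diff//; apply: Rint_bdd_oc => //; first exact: b_time.
by move=> r _; exact: b_bdd.
Qed.

Lemma rate_meas q x : measurable_fun setT (fun r => (1 + ln (f r x) + q) * b r x).
Proof.
apply: measurable_funM; last exact: meas_time b_joint.
apply: measurable_funD => //; apply: measurable_funD => //.
by apply: (measurableT_comp (@measurable_ln R)); exact: meas_time f_joint.
Qed.

Lemma rate_le q r x : `|1 + ln (f r x) + q| <= 1 + N * (3 + A + `|x|) + `|q|.
Proof.
apply: (le_trans (ler_normD _ _)); rewrite lerD2r; apply: (le_trans (ler_normD _ _)).
by rewrite normr1 lerD2l lnf_le.
Qed.

(** At fixed [x], the tangent inequality at the later time replaces the chain rule on each short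
    interval. The error, the variation of [ln f] times [b], is quadratic in the length, so
    [partition_le] applies. *)
Lemma entropy_pointwise q s t x : 0 <= s -> s <= t -> t <= T ->
  (f t x * ln (f t x) + q * f t x) - (f s x * ln (f s x) + q * f s x) <=
  \int[mu]_(r in `]s, t]) ((1 + ln (f r x) + q) * b r x).
Proof.
move=> s0 st tT; pose g r := (1 + ln (f r x) + q) * b r x.
have ig a d : intg mu `]a, d] g.
  apply: (intg_bdd_oc _ _ (rate_meas q x)) => r; rewrite normrM.
  by apply: ler_pM; [exact: normr_ge0|exact: normr_ge0|exact: rate_le|exact: b_bdd].
pose F r := f r x * ln (f r x) + q * f r x - \int[mu]_(z in `]s, r]) g z.
(* A lower bound of [f] at [x] uniform in time: [ln f] is then [B / a]-Lipschitz in time, and the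
   bound [B] of [b] supplies the other factor of [B * B / a]. *)
pose a := expR (- (N * (3 + A + `|x|))); have a0 : 0 < a := expR_gt0 _.
have B0 : 0 <= B := le_trans (normr_ge0 _) (b_bdd 0 0).
suff h : F t <= F s.
  move: h; rewrite /F set_itvxx Rintegral_set0 -/(g _).
  by move: (\int[mu]_(z in _) _) (ln (f t x)) (ln (f s x)) => u v z; lra.
apply: (@partition_le _ F s t (B * B / a)) => // s' t' ss' st' tt'.
have s'0 := le_trans s0 ss'; have t'T := le_trans tt' tT.
have e : F t' - F s' = (f t' x * ln (f t' x) - f s' x * ln (f s' x)) +
    q * (f t' x - f s' x) - \int[mu]_(z in `]s', t']) g z.
  rewrite -(Rint_split_oc ss' st' (ig s t')) /F.
  move: (\int[mu]_(z in `]s, t']) g z) (\int[mu]_(z in `]s, s']) g z) => u v.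
  by move: (ln (f t' x)) (ln (f s' x)) => z y; ring.
rewrite e; have tan := entropy_tangent (fp s' x) (fp t' x).
have ib := b_time s' t' x.
pose k := 1 + ln (f t' x) + q.
have i1 : intg mu `]s', t'] (fun z => k * b z x) by exact: intgZ.
have k1 : \int[mu]_(z in `]s', t']) (k * b z x) = k * (f t' x - f s' x).
  by rewrite RintegralZl// f_diff.
have e4 z : k * b z x - g z = (ln (f t' x) - ln (f z x)) * b z x.
  by rewrite /g /k; move: (ln (f t' x)) (ln (f z x)) => u v; ring.
have e3 : k * (f t' x - f s' x) - \int[mu]_(z in `]s', t']) g z =
    \int[mu]_(z in `]s', t']) ((ln (f t' x) - ln (f z x)) * b z x).
  rewrite -k1 -(RintegralB _ i1 (ig s' t'))//.
  by apply: eq_Rintegral => z _; exact: e4.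
have i2 : intg mu `]s', t'] (fun z => (ln (f t' x) - ln (f z x)) * b z x).
  apply: (@intg_eq _ _ _ mu _ (fun z => k * b z x - g z)); [exact: measurable_itv|by move=> z _; exact: e4|].
  by apply: intgB; [exact: measurable_itv|exact: i1|exact: ig].
apply: (@le_trans _ _ (\int[mu]_(z in `]s', t']) ((ln (f t' x) - ln (f z x)) * b z x))).
  by rewrite -e3; exact: shift_tangent tan.
apply: (le_trans (ler_norm _)).
have -> : B * B / a * (t' - s') ^+ 2 = (B * (t' - s') / a * B) * (t' - s') by field; rewrite gt_eqF.
apply: Rint_bdd_oc => // z /andP[z1 z2]; rewrite normrM; apply: ler_pM; [exact: normr_ge0|exact: normr_ge0| |exact: b_bdd].
apply: (le_trans (ln_lip a0 (f_low t' x) (f_low z x))).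
apply: ler_wpM2r; first by rewrite invr_ge0 ltW.
apply: (le_trans (f_time_lip x (le_trans s'0 (ltW z1)) z2 t'T)).
by apply: ler_wpM2l => //; rewrite lerD2l lerN2 ltW.
Qed.

Lemma weight_bound (phi h : R -> R) r L : measurable_fun setT phi -> measurable_fun setT h ->
  (forall x, `|phi x| <= L * (1 + `|x|)) -> (forall x, `|h x| <= G * m r x) ->
  [/\ intg mu setT (fun x => phi x * h x), \int[mu]_x `|phi x * h x| <= L * G * Q &
     `|\int[mu]_x (phi x * h x)| <= L * G * Q].
Proof.
move=> mp mh pL hG; have [i1 i2] := m_mom r.
have L0 : 0 <= L by have := pL 0; rewrite normr0 addr0 mulr1; apply: le_trans.
have i3 := intgZ (L * G) measurableT i1.
have le x : `|phi x * h x| <= L * G * ((1 + `|x|) * m r x).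
  rewrite normrM mulrACA; apply: ler_pM; [exact: normr_ge0|exact: normr_ge0|exact: pL|exact: hG].
have i4 : intg mu setT (fun x => phi x * h x).
  by apply: (@intg_le _ _ _ mu _ _ _ _ _ _ i3) => //; exact: measurable_funM.
have b1 : \int[mu]_x `|phi x * h x| <= L * G * Q.
  apply: (@le_trans _ _ (\int[mu]_x (L * G * ((1 + `|x|) * m r x)))).
    by apply: le_Rintegral => //; exact: intg_norm.
  by rewrite RintegralZl//; apply: ler_wpM2l => //; exact: mulr_ge0 L0 G_ge0.
split => //; apply: le_trans b1; apply: (@Rint_le_norm _ _ _ mu) => //; exact: intg_norm.
Qed.

Let f' r := convol (derive1 K) (w r).

Lemma f'_le r x : `|f' r x| <= N * f r x.
Proof.
have i1 := conv_intg x (elem_cont eK') (mol_bd1 hK) (P2_intg1 (Pw r)).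
have i2 := weight_intg hK (Pw r) x; have i3 := intgZ N measurableT i2.
rewrite /f /mfl /convol -(RintegralZl N measurableT i2).
apply: (@Rint_le_norm _ _ _ mu) => // y _.
by rewrite normrM (ger0_norm (P2_ge0 y (Pw r))) mulrA ler_wpM2r ?(P2_ge0 _ (Pw r))// (mol_d1 hK).
Qed.

Lemma score_bound r x : `|f' r x / f r x| <= N.
Proof. by rewrite normrM normfV (gtr0_norm (fp r x)) ler_pdivrMr ?f'_le. Qed.

Lemma f'_cont r : continuous (f' r).
Proof. exact: (conv_cont (elem_cont eK') (mol_bd1 hK) (P2_intg1 (Pw r))). Qed.

Lemma score_cont r : continuous (fun x => f' r x / f r x).
Proof.
move=> x; apply: cvgM; first exact: f'_cont.
by apply: cvgV; [rewrite gt_eqF|exact: (mfl_cont hK (Pw r))].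
Qed.

Lemma J_cont r : continuous (J r). Proof. exact: dv_continuous (dv_J r). Qed.

Section Potential.
Variables (q q' : R -> R) (Qb D : R).
Hypothesis dq : forall x, dv q x (q' x).
Hypothesis cq' : continuous q'.
Hypothesis qQ : forall x, `|q x| <= Qb.
Hypothesis q'D : forall x, `|q' x| <= D * (1 + `|x|).

Let L := 1 + N * (4 + A) + Qb.
Let P r := \int[mu]_x ((f' r x / f r x + q' x) * J r x).
Let cq : continuous q := dv_continuous dq.

(** The first-moment bound [m_mom] admits weights of at most linear growth. This is why the
    potential is replaced here by a bounded [q]; the quadratic [H] is reached afterwards by
    approximation. *)
Lemma log_weight_le r x : `|1 + ln (f r x) + q x| <= L * (1 + `|x|).
Proof.
apply: (le_trans (rate_le (q x) r x)); have := qQ x; have := normr_ge0 (q x).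
have := mulr_ge0 (mol_N0 hK) A0; have := mulr_ge0 (mol_N0 hK) (normr_ge0 x).
have := mulr_ge0 (mulr_ge0 (mol_N0 hK) A0) (normr_ge0 x); have := normr_ge0 x; have := mol_N0 hK.
rewrite /L; move: (`|q x|) (`|x|) => u v *; have : 0 <= Qb * v by apply: mulr_ge0; lra.
lra.
Qed.

Lemma log_weight_cont r : continuous (fun x => 1 + ln (f r x) + q x).
Proof.
have d x : dv (fun x => 1 + ln (f r x) + q x) x (0 + f' r x / f r x + q' x).
  by apply: dvD (dq x); apply: dvD (dv_cst 1 x) _; apply: dv_ln (fp r x) _; exact: (mfl_dv hK (Pw r)).
exact: dv_continuous d.
Qed.

(** The product of the weight with the flux and its derivative are both integrable, so
    [integral_derivative0] leaves no boundary term. *)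
Lemma log_weight_by_parts r :
  \int[mu]_x ((1 + ln (f r x) + q x) * b r x) = - P r.
Proof.
have mlw := cont_meas (log_weight_cont (r := r)).
have mJ := cont_meas (J_cont (r := r)); have mb := cont_meas (b_cont (r := r)).
have [i1 _ _] := weight_bound mlw mb (log_weight_le r) (b_le r).
have [i2 _ _] := weight_bound mlw mJ (log_weight_le r) (J_le r).
have csq : continuous (fun x => f' r x / f r x + q' x).
  by move=> x; apply: cvgD; [exact: score_cont|exact: cq'].
have sq x : `|f' r x / f r x + q' x| <= (N + D) * (1 + `|x|).
  apply: (le_trans (ler_normD _ _)); rewrite mulrDl lerD// -[leLHS]mulr1.
  apply: ler_pM => //; [exact: score_bound|by rewrite lerDl].
have [i3 _ _] := weight_bound (cont_meas csq) mJ sq (J_le r).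
have dg x : dv (fun x => (1 + ln (f r x) + q x) * J r x) x
    ((f' r x / f r x + q' x) * J r x + (1 + ln (f r x) + q x) * b r x).
  apply: dvM (dv_J r x).
  apply: dvD (dq x); apply: dv_eq (dvD (dv_cst 1 x) (dv_ln (fp r x) (mfl_dv hK (Pw r) x))) _.
  by rewrite add0r.
have cg : continuous (fun x => (f' r x / f r x + q' x) * J r x + (1 + ln (f r x) + q x) * b r x).
  move=> x; apply: cvgD; apply: cvgM; [exact: csq|exact: J_cont|exact: log_weight_cont|exact: b_cont].
have := integral_derivative0 dg cg i2 (intgD measurableT i3 i1).
rewrite (RintegralD measurableT i3 i1) => /eqP; rewrite addrC addr_eq0 => /eqP; exact.
Qed.

Lemma score_joint : measurable_fun setT (fun p : R * R => f' p.1 p.2 / f p.1 p.2).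
Proof.
rewrite (_ : (fun p => _) = fun p : R * R => f' p.1 p.2 * expR (- ln (f p.1 p.2))); last first.
  by apply/funext => p; rewrite expRN lnK ?posrE.
apply: measurable_funM; first by apply: meas_conv2 => //; exact: cont_meas (elem_cont eK').
apply: (measurableT_comp (@measurable_expR R)); apply: measurable_funN.
exact: (measurableT_comp (@measurable_ln R) f_joint).
Qed.

Lemma P_facts : measurable_fun setT P /\ forall r, `|P r| <= (N + D) * G * Q.
Proof.
split.
  apply: (@measurable_Rint _ _ _ _ _ mu (fun p : R * R => (f' p.1 p.2 / f p.1 p.2 + q' p.2) * J p.1 p.2)).
  apply: measurable_funM; last exact: J_joint.
  apply: measurable_funD; first exact: score_joint.
  by apply: (@meas_snd2 _ q'); exact: cont_meas.
move=> r; have csq : continuous (fun x => f' r x / f r x + q' x).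
  by move=> x; apply: cvgD; [exact: score_cont|exact: cq'].
have sq x : `|f' r x / f r x + q' x| <= (N + D) * (1 + `|x|).
  apply: (le_trans (ler_normD _ _)); rewrite mulrDl lerD// -[leLHS]mulr1.
  apply: ler_pM => //; [exact: score_bound|by rewrite lerDl].
by have [] := weight_bound (cont_meas csq) (cont_meas (J_cont (r := r))) sq (J_le r).
Qed.

Lemma qf_intg r : intg mu setT (fun x => q x * f r x).
Proof.
apply: (@P2_intg _ _ q Qb (mfl_P2 hK (Pw r))); first exact: cont_meas.
by move=> x; apply: bdd_quad.
Qed.

(** Integrate [entropy_pointwise] in space and exchange the integrals; the inner spatial integral is
    then [- P r] by parts. *)
Lemma energy_step s t : 0 <= s -> s <= t -> t <= T ->
  (\int[mu]_x (f t x * ln (f t x)) + \int[mu]_x (q x * f t x)) -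
  (\int[mu]_x (f s x * ln (f s x)) + \int[mu]_x (q x * f s x)) <=
  - \int[mu]_(r in `]s, t]) P r.
Proof.
move=> s0 st tT; pose I : set R := `]s, t]%classic.
have mI : measurable I by exact: measurable_itv.
(* The indicator of the time interval turns the double integral into one over the whole plane, where
   Fubini is available. *)
pose Y (p : R * R) : R := \1_I p.1 * ((1 + ln (f p.1 p.2) + q p.2) * b p.1 p.2).
have m1 : measurable_fun setT (fun r : R => \1_I r : R) by exact: measurable_indic.
have mY : measurable_fun setT Y.
  apply: measurable_funM; first exact: (@meas_fst2 _ (\1_I)).
  apply: measurable_funM; last exact: b_joint.
  apply: measurable_funD; last by apply: (@meas_snd2 _ q); exact: cont_meas.
  by apply: measurable_funD => //; exact: (measurableT_comp (@measurable_ln R) f_joint).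
have wb r := weight_bound (cont_meas (log_weight_cont (r := r))) (cont_meas (b_cont (r := r)))
  (log_weight_le r) (b_le r).
have Yr r : intg mu setT (fun x => Y (r, x)).
  by have [i _ _] := wb r; exact: (intgZ (\1_I r) measurableT i).
have Y1 r : \int[mu]_x `|Y (r, x)| <= L * G * Q * \1_I r.
  have [i le _] := wb r; rewrite /Y /=; under eq_Rintegral do rewrite normrM.
  rewrite RintegralZl//; last exact: intg_norm.
  by rewrite mulrC ger0_norm ?indicE ?ler0n// ler_wpM2r.
have i0 : intg mu setT (fun r : R => \1_I r : R).
  rewrite (_ : (fun r => _) = ((fun _ : R => 1 : R) \_ I)); last first.
    by apply/funext => r; rewrite patchE indicE; case: (r \in I).
  apply: intg_patch => //; apply: (@intg_bdd_oc _ _ _ (fun=> 1) 1); first exact: measurable_cst.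
  by move=> r; rewrite normr1.
have i1 := intgZ (L * G * Q) measurableT i0.
have iY := tonelli_lt (m1 := mu) (m2 := mu) mY Yr Y1 i1.
have j2 := fubini_intg2 iY; have fub := fubiniR iY.
have eI x : \int[mu]_r Y (r, x) = \int[mu]_(r in I) ((1 + ln (f r x) + q x) * b r x).
  exact: Rint_indic.
have eP : \int[mu]_r \int[mu]_x Y (r, x) = - \int[mu]_(r in I) P r.
  have [mP bP] := P_facts.
  have iP : intg mu I P by exact: (intg_bdd_oc _ _ mP bP).
  have -> : - (\int[mu]_(r in I) P r) = \int[mu]_(r in I) (- P r).
    by apply: esym; apply: Rint_N.
  rewrite -(Rint_indic I); apply: eq_Rintegral => r _.
  have [i _ _] := wb r; rewrite -log_weight_by_parts; exact: (RintegralZl (\1_I r) measurableT i).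
have k1 r := mfl_xlnx_intg hK (Pw r); have k2 := qf_intg.
have k3 r := intgD measurableT (k1 r) (k2 r).
have e r := RintegralD measurableT (k1 r) (k2 r).
have k4 := intgB measurableT (k3 t) (k3 s).
have pw x : (f t x * ln (f t x) + q x * f t x) - (f s x * ln (f s x) + q x * f s x) <=
    \int[mu]_r Y (r, x) by rewrite eI; exact: entropy_pointwise.
have := le_Rintegral measurableT k4 j2 (fun x _ => pw x).
by rewrite -fub eP (RintegralB measurableT (k3 t) (k3 s)) (e t) (e s).
Qed.

End Potential.

(** Apply [energy_step] to bounded approximations [q n] of [H]. These increase no faster than [H],
    and their derivatives have linear growth uniformly in [n], so every term converges by
    domination. *)
Lemma energy_production s t : 0 <= s -> s <= t -> t <= T ->
  [/\ intg mu `]s, t] (fun r => production K H (w r) (sg r)),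
     forall r, `|production K H (w r) (sg r)| <= (N + 3 * C) * G * Q &
     real_energy H (f t) - real_energy H (f s) <=
     - \int[mu]_(r in `]s, t]) production K H (w r) (sg r)].
Proof.
move=> s0 st tT.
pose d (n : nat) : R := n.+1%:R^-1.
have d0 n : 0 < d n by rewrite invr_gt0.
have d1 n : d n <= 1 by rewrite invf_le1 ?ltr0n// ler1n.
pose X n x := 1 + d n * x ^+ 2.
have X0 n x : 0 < X n x := trunc_den_gt0 x (d0 n).
have X1 n x : 1 <= X n x by rewrite lerDl mulr_ge0 ?sqr_ge0// ltW.
have dX n x : d n * (1 + x ^+ 2) <= X n x by rewrite mulrDr mulr1 lerD2r.
pose q n x := H x * (X n x)^-1.
pose q' n x := derive1 H x * (X n x)^-1 + H x * (- (d n * (2 * x)) / X n x ^+ 2).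
have dq n x : dv (q n) x (q' n x).
  by apply: dvM (conf_dv hH x) _; apply: dvV; [rewrite gt_eqF|exact: dv_den].
have cX n : continuous (X n) := dv_continuous (dv_den (d n)).
have cXi n : continuous (fun x => (X n x)^-1).
  by move=> x; apply: cvgV; [rewrite gt_eqF|exact: cX].
have cq' n : continuous (q' n).
  move=> x; apply: cvgD; apply: cvgM; [exact: conf_cont hH x|exact: cXi|exact: H_cont hH x|].
  apply: cvgM; last first.
    by apply: cvgV; [rewrite gt_eqF// exprn_gt0|apply: cvgM; exact: cX].
  by apply: cvgN; apply: cvgM; [exact: cvg_cst|apply: cvgM; [exact: cvg_cst|exact: cvg_id]].
have Hge := conf_ge0 hH.
have Xi1 n x : (X n x)^-1 <= 1 by rewrite invf_le1.
have Xi0 n x : 0 <= (X n x)^-1 by rewrite invr_ge0 ltW.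
have qH n x : `|q n x| <= H x.
  by rewrite ger0_norm ?mulr_ge0// -[leRHS]mulr1 ler_wpM2l.
have qQ n x : `|q n x| <= C / d n.
  rewrite ger0_norm ?mulr_ge0// ler_pdivrMr// mulrAC ler_pdivlMr//.
  apply: (@le_trans _ _ (C * (1 + x ^+ 2) * d n)).
    by rewrite ler_wpM2r ?(ltW (d0 n))//; exact: conf_quad hH x.
  by rewrite -mulrA ler_wpM2l// mulrC.
(* A part [C] comes from [H' / X], and [2 C] from differentiating the denominator, since
   [H d / X <= C]. *)
have q'D n x : `|q' n x| <= 3 * C * (1 + `|x|).
  apply: (le_trans (ler_normD _ _)).
  have h1 : `|derive1 H x * (X n x)^-1| <= C * (1 + `|x|).
    rewrite normrM (ger0_norm (Xi0 n x)) -[leRHS]mulr1.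
    by apply: ler_pM => //; exact: conf_lin hH x.
  have h2 : `|H x * (- (d n * (2 * x)) / X n x ^+ 2)| <= 2 * C * (1 + `|x|).
    have -> : H x * (- (d n * (2 * x)) / X n x ^+ 2) = - (2 * x * (H x * d n / X n x / X n x)).
      by field; rewrite gt_eqF.
    have h3 : H x * d n / X n x / X n x <= C.
      rewrite ler_pdivrMr// ler_pdivrMr//; apply: (@le_trans _ _ (C * X n x)).
        apply: (@le_trans _ _ (C * (1 + x ^+ 2) * d n)).
          by rewrite ler_wpM2r ?(ltW (d0 n))//; exact: conf_quad hH x.
        by rewrite -mulrA ler_wpM2l// mulrC.
      by rewrite ler_peMr// mulr_ge0// ltW.
    have h4 : 0 <= H x * d n / X n x / X n x.
      by rewrite !mulr_ge0// ltW.
    rewrite normrN normrM (ger0_norm h4) normrM ger0_norm//.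
    apply: (@le_trans _ _ (2 * `|x| * C)); first by rewrite ler_wpM2l// mulr_ge0.
    by have := mulr_ge0 C0 (normr_ge0 x); lra.
  by lra.
have dlim : d n @[n --> \oo] --> (0 : R).
  by have := @cvg_harm R 1; apply: cvg_trans; apply: near_eq_cvg; near=> n; rewrite mul1r.
have Xlim x : (X n x)^-1 @[n --> \oo] --> (1 : R).
  rewrite -[X in _ --> X]invr1; apply: cvgV; first exact: oner_neq0.
  rewrite -[X in _ --> X]addr0 -(mul0r (x ^+ 2)).
  by apply: cvgD; [exact: cvg_cst|apply: cvgM; [exact: dlim|exact: cvg_cst]].
have qlim x : q n x @[n --> \oo] --> H x.
  rewrite -[X in _ --> X]mulr1; apply: cvgM; [exact: cvg_cst|exact: Xlim].
have q'lim x : q' n x @[n --> \oo] --> derive1 H x.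
  rewrite -[X in _ --> X]addr0; apply: cvgD.
    by rewrite -[X in _ --> X]mulr1; apply: cvgM; [exact: cvg_cst|exact: Xlim].
  rewrite (_ : (fun n => _) = fun n => d n * (- H x * (2 * x)) * ((X n x)^-1 * (X n x)^-1)); last first.
    by apply/funext => n; field; rewrite gt_eqF.
  rewrite -[X in _ --> X](_ : 0 * (- H x * (2 * x)) * (1 * 1) = 0); last by rewrite !mul0r.
  by apply: cvgM; apply: cvgM; [exact: dlim|exact: cvg_cst|exact: Xlim|exact: Xlim].
pose P n r := \int[mu]_x ((f' r x / f r x + q' n x) * J r x).
have mJ r := cont_meas (J_cont (r := r)).
have sq (g : R -> R) r x : `|g x| <= 3 * C * (1 + `|x|) ->
    `|f' r x / f r x + g x| <= (N + 3 * C) * (1 + `|x|).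
  move=> h; apply: (le_trans (ler_normD _ _)); rewrite mulrDl lerD// -[leLHS]mulr1.
  by apply: ler_pM => //; [exact: score_bound|rewrite lerDl].
have Plim r : P n r @[n --> \oo] --> production K H (w r) (sg r).
  have mP n : measurable_fun setT (fun x => (f' r x / f r x + q' n x) * J r x).
    apply: measurable_funM => //; apply: cont_meas => x.
    by apply: cvgD; [exact: score_cont|exact: cq'].
  have mP' : measurable_fun setT (fun x => (f' r x / f r x + derive1 H x) * J r x).
    apply: measurable_funM => //; apply: cont_meas => x.
    by apply: cvgD; [exact: score_cont|exact: conf_cont hH x].
  have pae : {ae mu, forall x, setT x -> (f' r x / f r x + q' n x) * J r x @[n --> \oo] -->
      (f' r x / f r x + derive1 H x) * J r x}.
    apply: aeW => x _; apply: cvgM; last exact: cvg_cst.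
    by apply: cvgD; [exact: cvg_cst|exact: q'lim].
  have [i1 _] := m_mom r; have i2 := intgZ ((N + 3 * C) * G) measurableT i1.
  have dom n x : setT x -> `|(f' r x / f r x + q' n x) * J r x| <=
      (N + 3 * C) * G * ((1 + `|x|) * m r x).
    move=> _; rewrite normrM mulrACA.
    by apply: ler_pM; [exact: normr_ge0|exact: normr_ge0|exact: sq|exact: J_le].
  by have [] := @dct _ _ _ mu setT _ _ _ measurableT mP mP' pae i2 dom.
have F n := P_facts (cq' n) (q'D n).
have mprod : measurable_fun setT (fun r => production K H (w r) (sg r)).
  apply: (@measurable_Rint _ _ _ _ _ mu (fun p : R * R =>
    (f' p.1 p.2 / f p.1 p.2 + derive1 H p.2) * J p.1 p.2)).
  apply: measurable_funM; last exact: J_joint.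
  apply: measurable_funD; first exact: score_joint.
  by apply: (@meas_snd2 _ (derive1 H)); exact: cont_meas (conf_cont hH).
have bprod r : `|production K H (w r) (sg r)| <= (N + 3 * C) * G * Q.
  apply: cvg_le_ub (cvg_norm (Plim r)) _; near=> n; have [_ h] := F n; exact: h.
split => //; first exact: (intg_bdd_oc _ _ mprod bprod).
have R1 : \int[mu]_(r in `]s, t]) P n r @[n --> \oo] -->
    \int[mu]_(r in `]s, t]) production K H (w r) (sg r).
  have i3 : intg mu `]s, t] (fun _ : R => (N + 3 * C) * G * Q : R).
    apply: (@intg_bdd_oc _ _ _ _ `|(N + 3 * C) * G * Q|); [exact: measurable_cst|by []].
  have mPn n : measurable_fun `]s, t]%classic (P n).
    by apply: measurable_funTS; have [] := F n.
  have pae : {ae mu, forall r, `]s, t]%classic r -> P n r @[n --> \oo] --> production K H (w r) (sg r)}.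
    by apply: aeW => r _; exact: Plim.
  have dom n r : `]s, t]%classic r -> `|P n r| <= (N + 3 * C) * G * Q.
    by move=> _; have [_ h] := F n; exact: h.
  by have [] := @dct _ _ _ mu `]s, t]%classic _ _ _ (measurable_itv _) mPn (measurable_funTS mprod) pae i3 dom.
have fm r : P2 (f r) := mfl_P2 hK (Pw r).
have L1 r : \int[mu]_x (q n x * f r x) @[n --> \oo] --> \int[mu]_x (H x * f r x).
  have i4 := H_intg hH (fm r).
  have mq n : measurable_fun setT (fun x => q n x * f r x).
    apply: measurable_funM; last exact: P2_meas.
    exact: cont_meas (dv_continuous (dq n)).
  have pae : {ae mu, forall x, setT x -> q n x * f r x @[n --> \oo] --> H x * f r x}.
    by apply: aeW => x _; apply: cvgM; [exact: qlim|exact: cvg_cst].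
  have dom n x : setT x -> `|q n x * f r x| <= H x * f r x.
    by move=> _; rewrite normrM (gtr0_norm (fp r x)) ler_wpM2r// ltW.
  by have [] := @dct _ _ _ mu setT _ _ _ measurableT mq (intg_meas i4) pae i4 dom.
have canc (a h z b0 k i : R) : a + h + z - (b0 + k + z) + i = a + h - (b0 + k) + i by ring.
rewrite -subr_le0 /real_energy opprK canc.
apply: cvg_le_ub (cvgD (cvgB (cvgD (cvg_cst (\int[mu]_x (f t x * ln (f t x)))) (L1 t))
  (cvgD (cvg_cst (\int[mu]_x (f s x * ln (f s x)))) (L1 s))) R1) _.
near=> n.
by rewrite -lerBrDr sub0r; exact: (energy_step (dq n) (cq' n) (qQ n) (q'D n) s0 st tT).
Unshelve. all: try exact: 0%N. all: by end_near. Qed.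

End EnergyEvolution.

(** * Exponential decay of the mollified energy *)

Section Gronwall.
Context {R : realType}.
Implicit Types (s t : R).

Lemma expR_quad (y : R) : 0 <= y -> expR y <= 1 + y + y ^+ 2 * expR y.
Proof.
move=> y0; have e0 := expR_gt0 y.
have h : expR y - 1 <= y * expR y.
  have := ler_wpM2r (ltW e0) (expR_ge1Dx (- y)); rewrite -expRD addNr expR0 mulrDl mul1r mulNr.
  by move: (expR y) (y * expR y) => u v; lra.
have := ler_wpM2l y0 h; rewrite mulrBr mulr1 mulrA -expr2.
by move: h; move: (expR y) (y * expR y) (y ^+ 2 * expR y) => u v w; lra.
Qed.

(** With the integrating factor included, the derivative is [e^((tau - kappa) t)] whether or not
    [kappa = tau], so the confluent case needs no separate treatment later. *)
Definition growth (tau kappa t : R) : R := expR (tau * t) * exp_quotient tau kappa t.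

Lemma dv_growth tau kappa t : dv (growth tau kappa) t (expR ((tau - kappa) * t)).
Proof.
have dl (a : R) : dv (fun t => expR (a * t)) t (expR (a * t) * a).
  by apply: dv_exp; apply: dv_eq (dvZ a (dv_id t)) _; rewrite mulr1.
rewrite /growth /exp_quotient; case: eqP => [<-|ne].
  rewrite subrr mul0r expR0; apply: dv_ext (dv_id t) => y.
  by rewrite mulrCA -expRD subrr expR0 mulr1.
have kt : kappa - tau != 0 by rewrite subr_eq0; apply/eqP.
apply: (@dv_ext _ (fun y => (1 - expR ((tau - kappa) * y)) / (kappa - tau))).
  move=> y; rewrite mulrA mulrBr -!expRD subrr expR0; congr ((1 - expR _) / _); ring.
apply: (@dv_ext _ (fun y => (kappa - tau)^-1 * (1 - expR ((tau - kappa) * y)))).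
  by move=> y; rewrite mulrC.
apply: dv_eq (dvZ _ (dvB (dv_cst 1 t) (dl (tau - kappa)))) _.
by field.
Qed.

Lemma growth0 tau kappa : growth tau kappa 0 = 0.
Proof.
rewrite /growth /exp_quotient; case: eqP => _; first by rewrite mul0r mulr0.
by rewrite !mulr0 subrr mul0r mulr0.
Qed.

(** A left-endpoint Riemann sum for [growth], up to a quadratic error: the form in which the source
    term enters [gronwall]. *)
Lemma growth_low tau kappa T : exists2 k, 0 <= k & forall s t, 0 <= s -> s <= t -> t <= T ->
  expR ((tau - kappa) * s) * (t - s) - k * (t - s) ^+ 2 <= growth tau kappa t - growth tau kappa s.
Proof.
set a := tau - kappa; exists (`|a| * expR (`|a| * T)); first by rewrite mulr_ge0 ?expR_ge0.
move=> s t s0 st tT; have [z /andP[sz zt] ->] := mvt (dv_growth tau kappa) st.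
have de (y : R) : dv (fun t => expR (a * t)) y (expR (a * y) * a).
  by apply: dv_exp; apply: dv_eq (dvZ a (dv_id y)) _; rewrite mulr1.
have bd y : Num.min s z <= y <= Num.max s z -> `|expR (a * y) * a| <= `|a| * expR (`|a| * T).
  rewrite min_l// max_r// => /andP[y1 y2]; rewrite normrM ger0_norm ?expR_ge0// mulrC.
  rewrite ler_wpM2l// ler_expR; apply: (le_trans (ler_norm _)); rewrite normrM ler_wpM2l//.
  by rewrite ger0_norm; [exact: le_trans y2 (le_trans zt tT)|exact: le_trans y1].
have h1 := mvt_le de bd.
have h : expR (a * s) - expR (a * z) <= `|a| * expR (`|a| * T) * (t - s).
  apply: (le_trans (ler_norm _)); rewrite distrC; apply: (le_trans h1).
  have zs : 0 <= z - s by rewrite subr_ge0.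
  by rewrite (ger0_norm zs); apply: ler_wpM2l; [rewrite mulr_ge0 ?expR_ge0|rewrite lerD2r].
have h0 : 0 <= t - s by rewrite subr_ge0.
have := ler_wpM2r h0 h; rewrite mulrBl expr2 !mulrA.
move: (expR (a * s) * (t - s)) (expR (a * z) * (t - s)) (`|a| * expR (`|a| * T) * (t - s) * (t - s)).
by move=> u v w; lra.
Qed.

(** Gronwall's lemma for increments, with the damping taken at the right endpoint. [p] is the rate
    degraded by mollification and [tau] its limit: bounding [e^(p t)] by [e^(tau t)] in the sources
    keeps [growth tau kappa] independent of the degradation. *)
Lemma gronwall (E : R -> R) (p tau kappa A err k T : R) :
  0 <= p -> p <= tau -> 0 < kappa -> 0 <= A -> 0 <= err -> 0 <= k ->
  (forall s t, 0 <= s -> s <= t -> t <= T ->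
    E t - E s <= - (p * E t * (t - s)) + (A * expR (- (kappa * s)) + err) * (t - s)
      + k * (t - s) ^+ 2) ->
  forall t, 0 <= t -> t <= T -> expR (p * t) * E t <=
    E 0 + A * growth tau kappa t + err * expR (tau * T) * t.
Proof.
move=> p0 pt kap A0 err0 k0 hE t t0 tT; have T0 := le_trans t0 tT.
have tau0 := le_trans p0 pt.
(* An upper bound of [E] on [[0, T]], obtained by dropping the damping where [E] is positive; it
   controls the second-order remainder below. *)
pose M := `|E 0| + (A + err) * T + k * T ^+ 2.
have M0 : 0 <= M by rewrite !addr_ge0 ?mulr_ge0 ?addr_ge0 ?sqr_ge0.
have EM r : 0 <= r -> r <= T -> E r <= M.
  move=> r0 rT; have [Er|Er] := leP (E r) 0; first exact: le_trans Er M0.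
  have := hE 0 r (lexx 0) r0 rT; rewrite !subr0 mulr0 oppr0 expR0 mulr1 => h.
  have h1 : 0 <= p * E r * r by rewrite !mulr_ge0// ltW.
  have h2 : (A + err) * r <= (A + err) * T by rewrite ler_wpM2l ?addr_ge0.
  have h3 : k * r ^+ 2 <= k * T ^+ 2 by rewrite ler_wpM2l// ler_sqr ?nnegrE.
  by have := ler_norm (E 0); rewrite /M; lra.
have [k2 k20 hk2] := growth_low tau kappa T.
pose F r := expR (p * r) * E r - A * growth tau kappa r - err * expR (tau * T) * r.
suff : F t <= F 0.
  rewrite /F growth0 !mulr0 expR0 mul1r !subr0.
  by move: (expR (p * t) * E t) (A * growth _ _ _) (err * _ * t) => u v w; lra.
pose X := expR (tau * T).
have X1 : 1 <= X by rewrite -expR0 ler_expR mulr_ge0.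
have X0 : 0 <= X := le_trans ler01 X1.
apply: (@partition_le _ F 0 t (X * (k + p ^+ 2 * X * M) + A * k2)) => // s r s0 sr rt.
have rT := le_trans rt tT; have r0 := le_trans s0 sr; have sT := le_trans sr rT.
set h := r - s; have h0 : 0 <= h by rewrite subr_ge0.
have eX y : 0 <= y -> y <= T -> expR (p * y) <= X.
  by move=> y0 yT; rewrite ler_expR; apply: ler_pM.
have ph : 0 <= p * h by rewrite mulr_ge0.
have hT : h <= T by rewrite /h; lra.
(* [E] may be negative: then [1 + y <= e^y] suffices, whereas for positive values [expR_quad] is
   used. *)
have up : expR (p * h) * E r <= (1 + p * h) * E r + p ^+ 2 * X * M * h ^+ 2.
  have [Er|Er] := leP (E r) 0.
    have e1 := expR_ge1Dx (p * h).
    have : expR (p * h) * E r <= (1 + p * h) * E r by apply: ler_wnM2r.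
    move=> /le_trans; apply; rewrite lerDl !mulr_ge0 ?sqr_ge0//.
  have e1 := ler_wpM2r (ltW Er) (expR_quad ph).
  apply: (le_trans e1); rewrite mulrDl lerD2l exprMn.
  apply: (@le_trans _ _ (p ^+ 2 * h ^+ 2 * X * M)); last by rewrite le_eqVlt; apply/orP; left; apply/eqP; ring.
  apply: ler_pM => //; [by rewrite mulr_ge0 ?expR_ge0// mulr_ge0 ?sqr_ge0|exact: ltW| |exact: EM].
  by rewrite ler_wpM2l ?mulr_ge0 ?sqr_ge0// eX.
have st := hE s r s0 sr rT; rewrite -/h in st.
have up2 : expR (p * h) * E r <= E s + (A * expR (- (kappa * s)) + err) * h + (k + p ^+ 2 * X * M) * h ^+ 2.
  apply: (le_trans up); move: st; rewrite !mulrDl mul1r.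
  by move: (E r) (E s) (A * _ * h) (err * h) (k * _) (p ^+ 2 * X * M * h ^+ 2) => *; nra.
have es0 := expR_ge0 (p * s); have up3 := ler_wpM2l es0 up2.
have eqr : expR (p * s) * (expR (p * h) * E r) = expR (p * r) * E r.
  by rewrite mulrA -expRD; congr (expR _ * _); rewrite /h; ring.
have c1 : expR (p * s) * (A * expR (- (kappa * s)) * h) <= A * (expR ((tau - kappa) * s) * h).
  rewrite (_ : (tau - kappa) * s = tau * s + - (kappa * s)); last by ring.
  rewrite expRD (_ : expR (p * s) * _ = A * (expR (p * s) * expR (- (kappa * s)) * h)); last by ring.
  rewrite ler_wpM2l// ler_wpM2r// ler_wpM2r ?expR_ge0// ler_expR ler_wpM2r//.
have c2 : expR (p * s) * (err * h) <= err * X * h.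
  by rewrite mulrA mulrC [err * X]mulrC mulrC -mulrA -[leRHS]mulrA ler_wpM2r ?mulr_ge0// eX.
have c3 : expR (p * s) * ((k + p ^+ 2 * X * M) * h ^+ 2) <= X * (k + p ^+ 2 * X * M) * h ^+ 2.
  rewrite -[leRHS]mulrA ler_wpM2r ?eX// mulr_ge0 ?sqr_ge0// addr_ge0// !mulr_ge0 ?sqr_ge0//.
have c4 := ler_wpM2l A0 (hk2 s r s0 sr rT); rewrite -/h in c4.
move: up3 c1 c2 c3 c4; rewrite eqr /F -/X.
have -> : err * X * r = err * X * s + err * X * h by rewrite /h; ring.
move: (expR (p * r) * E r) (expR (p * s)) (E s) (expR (- (kappa * s))) => a b0 d e.
move: (X * (k + p ^+ 2 * X * M)) (k + p ^+ 2 * X * M) (err * X * h) (err * X * s) => q q' u v.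
move: (growth tau kappa r) (growth tau kappa s) (expR ((tau - kappa) * s)) (h ^+ 2) => x y z h2.
by clear; lra.
Qed.

End Gronwall.

Definition sobolev_rate (R : realType) (H : R -> R) (M : \bar R) (tau0 : R) : Prop :=
  tau0 = 0 \/ exists CL, [/\ 0 < CL, tau0 = CL^-1 & log_Sobolev H M CL].

Lemma sobolev_rate_ge0 (R : realType) (H : R -> R) (M : \bar R) (tau0 : R) :
  sobolev_rate H M tau0 -> 0 <= tau0.
Proof. by case=> [->//|[CL [CL0 -> _]]]; rewrite invr_ge0 ltW. Qed.

Section ProductionBound.
Context {R : realType}.
Local Notation mu := (@lebesgue_measure R).
Variables (K : R -> R) (N e1 e2 : R).
Hypothesis hK : mollifier K N e1 e2.
Variables (H : R -> R) (C c : R).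
Hypothesis hH : confining H C c.

(** Feed [mfl_LSI] into the term [(1 - d) D] of [production_ge]; dividing by [1 + d] explains the
    degraded rate. The term [|s| e1] accounts for the means of [f] and [rho] being only close. *)
Lemma production_low rho s d tau0 M : P2 rho -> 0 < d -> d < 1 ->
  sobolev_rate H M tau0 -> (`|s|%:E <= M)%E ->
  s * (\int[mu]_y (derive1 H y * rho y) - s)
    + (1 - d) / (1 + d) * tau0 * (real_energy H (mfl K rho) - rate H (M1 rho) - `|s| * e1)
    - (1 + d^-1 + (4 * d)^-1) * (C ^+ 2 * e2) <= production K H rho s.
Proof.
move=> hr d0 d1 st sM; have [_ pge] := production_ge hK hH hr s d0.
apply: le_trans pge; set D := \int[mu]_x (flux K H rho s x ^+ 2 / mfl K rho x).
have D0 : 0 <= D.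
  by apply: Rintegral_ge0 => x _; rewrite divr_ge0 ?sqr_ge0// ltW// (mfl_gt0 hK hr).
have C2 : 0 <= C ^+ 2 * e2 by rewrite mulr_ge0 ?sqr_ge0// (mol_e2 hK).
have di : 0 <= d^-1 by rewrite invr_ge0 ltW.
set X := real_energy H (mfl K rho) - rate H (M1 rho) - `|s| * e1.
have lsi : tau0 * X <= (1 + d) * D + (1 + d^-1) * (C ^+ 2 * e2).
  case: st => [->|[CL [CL0 -> lsi]]].
    by rewrite mul0r addr_ge0// mulr_ge0// addr_ge0// ltW.
  have h := mfl_LSI hK hH hr d0 CL0 lsi sM; rewrite -/D in h.
  rewrite mulrC ler_pdivrMr// mulrC; apply: le_trans h; rewrite /X.
  have rg := rate_ge hH (M1 rho) s; have m1 := mfl_M1 hK hr.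
  have : s * (M1 (mfl K rho) - M1 rho) <= `|s| * e1.
    by apply: (le_trans (ler_norm _)); rewrite normrM ler_wpM2l.
  move: rg; rewrite mulrBr.
  move: (s * M1 _) (s * M1 _) (logZ H s) (logZ H 0) (rate H _) (`|s| * e1) => u v w z y a.
  by move: (real_energy H _) => b; lra.
have p : 0 < 1 + d by rewrite addr_gt0.
have q0 : 0 <= (1 - d) / (1 + d) by rewrite divr_ge0 ?(ltW p)// subr_ge0 ltW.
have h := ler_wpM2l q0 lsi; rewrite (mulrDr _ ((1 + d) * D)) in h.
have e : (1 - d) / (1 + d) * ((1 + d) * D) = (1 - d) * D.
  by field; rewrite gt_eqF// ltr_wpDr// ltW.
have h2 : (1 - d) / (1 + d) * ((1 + d^-1) * (C ^+ 2 * e2)) <= (1 + d^-1) * (C ^+ 2 * e2).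
  rewrite -[leRHS]mul1r; apply: ler_wpM2r.
    by apply: mulr_ge0 => //; rewrite addr_ge0.
  by rewrite ler_pdivrMr// mul1r; lra.
move: h h2; rewrite e mulrA !(mulrDl _ _ (C ^+ 2 * e2)).
move: ((1 - d) * D) ((1 - d) / (1 + d) * tau0 * X) (1 * (C ^+ 2 * e2)) (d^-1 * (C ^+ 2 * e2)) => u v w z.
by move: ((4 * d)^-1 * (C ^+ 2 * e2)) (s * _) ((1 - d) / (1 + d) * _) => y a b; lra.
Qed.

End ProductionBound.

Section MollifiedDecay.
Context {R : realType}.
Local Notation mu := (@lebesgue_measure R).
Implicit Types (x y z r s t : R).
Variables (K : R -> R) (N e1 e2 : R).
Hypothesis hK : mollifier K N e1 e2.
Variables (H : R -> R) (C c : R).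
Hypothesis hH : confining H C c.
Variables (w : R -> R -> R) (sg l dl : R -> R) (A S T L0 kappa Lam tau0 d : R).
Hypothesis mw : measurable_fun setT (fun p : R * R => w p.1 p.2).
Hypothesis Pw : forall r, P2 (w r).
Hypothesis mA : forall r, mom2 (w r) <= A.
Hypothesis msg : measurable_fun setT sg.
Hypothesis sgS : forall r, `|sg r| <= S.
Hypothesis weak : forall phi s t, moderate phi -> 0 <= s -> s <= t -> t <= T ->
  \int[mu]_x (phi x * w t x) - \int[mu]_x (phi x * w s x) =
  \int[mu]_(r in `]s, t])
    (\int[mu]_x ((derive1n 2 phi x - derive1 H x * derive1 phi x) * w r x)
     + sg r * \int[mu]_x (derive1 phi x * w r x)).
Hypothesis wM1 : forall r, 0 <= r -> r <= T -> M1 (w r) = l r.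
Hypothesis sgE : {ae mu, forall r, 0 <= r <= T ->
  sg r = \int[mu]_x (derive1 H x * w r x) + dl r}.
Hypothesis dlL : {ae mu, forall r, 0 <= r -> `|dl r| <= L0 * expR (- (kappa * r))}.
Hypothesis lL : forall s t, 0 <= s -> s <= t -> `|l t - l s| <= L0 * expR (- (kappa * s)) * (t - s).
Hypothesis lamL : forall r, 0 <= r -> `|lambda H (l r)| <= Lam.
Hypothesis T0 : 0 <= T.
Hypothesis hL0 : 0 < L0.
Hypothesis hkappa : 0 < kappa.
Hypothesis hsob : sobolev_rate H S%:E tau0.
Hypothesis d0 : 0 < d.
Hypothesis d1 : d < 1.

Let q := (1 - d) / (1 + d).
Let E r := real_energy H (mfl K (w r)) - rate H (l r).
Let err := q * tau0 * (S * e1) + (1 + d^-1 + (4 * d)^-1) * (C ^+ 2 * e2).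

(** Convexity: [rate] lies above its tangent at [l s], whose slope is [lambda (l s)]. *)
Lemma rate_diff s t : 0 <= s -> s <= t ->
  - (Lam * (L0 * expR (- (kappa * s)) * (t - s))) <= rate H (l t) - rate H (l s).
Proof.
move=> s0 st; have h := rate_ge hH (l t) (lambda H (l s)).
have h2 : - (Lam * (L0 * expR (- (kappa * s)) * (t - s))) <= lambda H (l s) * (l t - l s).
  rewrite lerNl -mulrN; apply: (le_trans (ler_norm _)); rewrite normrM normrN.
  by apply: ler_pM; [exact: normr_ge0|exact: normr_ge0|exact: lamL|exact: lL].
apply: (le_trans h2); move: h; rewrite /rate mulrBr.
move: (lambda H (l s) * l t) (lambda H (l s) * l s) (logZ H (lambda H (l s))) (logZ H 0) => a b e z.
by move: (lambda H (l t) * l t) (logZ H (lambda H (l t))) => u v; lra.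
Qed.

Lemma q_bounds : 0 <= q <= 1.
Proof.
have p : 0 < 1 + d by rewrite addr_gt0.
apply/andP; split; first by rewrite divr_ge0 ?(ltW p)// subr_ge0 ltW.
by rewrite ler_pdivrMr// mul1r; have := d0; lra.
Qed.

(** The production bound involves [E r] for all intermediate times; replacing it by [E t] costs a
    quadratic error, which yields the hypothesis of [gronwall]. *)
Lemma energy_increment : exists2 k, 0 <= k & forall s t, 0 <= s -> s <= t -> t <= T ->
  E t - E s <= - (q * tau0 * E t * (t - s)) +
    (L0 * (S + Lam) * expR (- (kappa * s)) + err) * (t - s) + k * (t - s) ^+ 2.
Proof.
have Lam0 : 0 <= Lam := le_trans (normr_ge0 _) (lamL (lexx 0)).
have S0 : 0 <= S := le_trans (normr_ge0 _) (sgS 0).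
have /andP[q0 q1] := q_bounds; have tau00 := sobolev_rate_ge0 hsob.
have [B B0 hB] : exists2 B, 0 <= B & forall r, `|production K H (w r) (sg r)| <= B.
  have [_ h _] := energy_production hK hH mw Pw mA msg sgS weak (lexx 0) (lexx 0) T0.
  by eexists; last exact: h; exact: le_trans (normr_ge0 _) (h 0).
have ek s : 0 <= s -> expR (- (kappa * s)) <= 1.
  by move=> s0; rewrite -expR0 ler_expR oppr_le0 mulr_ge0// ltW.
pose k1 := B + Lam * L0.
have k10 : 0 <= k1 by rewrite addr_ge0// mulr_ge0// ltW.
exists (q * tau0 * k1) => [|s t s0 st tT]; first exact: mulr_ge0 (mulr_ge0 q0 tau00) k10.
have t0 := le_trans s0 st; have h0 : 0 <= t - s by rewrite subr_ge0.
(* A crude one-sided Lipschitz bound of [E], from the bounds of the production and of the slope of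
   [rate]. *)
have crude r : s <= r -> r <= t -> E t - k1 * (t - s) <= E r.
  move=> sr rt; have r0 := le_trans s0 sr; have rt0 : 0 <= t - r by rewrite subr_ge0.
  have [i1 _ i2] := energy_production hK hH mw Pw mA msg sgS weak r0 rt tT.
  have i3 := Rint_bdd_oc rt i1 (fun z _ => hB z); rewrite ler_norml in i3.
  have /andP[i4 _] := i3; have i5 := rate_diff r0 rt.
  have i6 : Lam * (L0 * expR (- (kappa * r)) * (t - r)) <= Lam * L0 * (t - r).
    rewrite !mulrA; apply: ler_wpM2r => //.
    by rewrite -[leRHS]mulr1; apply: ler_wpM2l; [rewrite mulr_ge0// ltW|exact: ek].
  have i7 : k1 * (t - r) <= k1 * (t - s) by apply: ler_wpM2l => //; rewrite lerD2l lerN2.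
  move: i2 i4 i5 i6 i7; rewrite /E /k1 !(mulrDl B).
  move: (real_energy H _) (real_energy H _) (rate H _) (rate H _) (\int[mu]_(z in _) _) => a b u v z.
  move: (B * (t - r)) (Lam * L0 * (t - r)) (Lam * (L0 * _ * _)) (B * (t - s)) (Lam * L0 * (t - s)).
  by move=> *; lra.
have [i1 _ i2] := energy_production hK hH mw Pw mA msg sgS weak s0 st tT.
pose es := expR (- (kappa * s)); have es0 : 0 <= es := expR_ge0 _.
(* A lower bound, constant in time, of the production on []s, t]]: the work term, the damping with
   [E t] in place of [E r], and the commutator error. *)
pose low := - (S * (L0 * es)) + q * tau0 * (E t - k1 * (t - s) - S * e1)
  - (1 + d^-1 + (4 * d)^-1) * (C ^+ 2 * e2).
have lowP : low * (t - s) <= \int[mu]_(r in `]s, t]) production K H (w r) (sg r).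
  rewrite -(Rint_cst_oc low st); apply: Rint_le_ae => //.
    by apply: (@intg_bdd_oc _ _ _ _ `|low|); [exact: measurable_cst|by []].
  apply: (ae_mono2 _ sgE dlL) => r hs hd; rewrite /= in_itv/= => /andP[sr rt].
  have r0 := le_trans s0 (ltW sr); have rT := le_trans rt tT.
  have r0T : 0 <= r <= T by rewrite r0 rT.
  have sSr : (`|sg r|%:E <= S%:E)%E by rewrite lee_fin.
  apply: le_trans (production_low hK hH (Pw r) d0 d1 hsob sSr).
  rewrite (wM1 r0 rT) -/(E r).
  have cr := crude r (ltW sr) rt.
  have p1 : `|sg r| * e1 <= S * e1 by rewrite ler_wpM2r// (mol_e1 hK).
  have p2 : - (S * (L0 * es)) <= sg r * (\int[mu]_y (derive1 H y * w r y) - sg r).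
    rewrite (_ : _ - sg r = - dl r); last by rewrite (hs r0T) opprD addrA subrr sub0r.
    rewrite mulrN lerN2; apply: (le_trans (ler_norm _)); rewrite normrM.
    apply: ler_pM => //; apply: (le_trans (hd r0)); rewrite ler_wpM2l ?(ltW hL0)//.
    by rewrite ler_expR lerN2 ler_wpM2l ?ltW.
  have p3 : q * tau0 * (E t - k1 * (t - s) - S * e1) <= q * tau0 * (E r - `|sg r| * e1).
    by apply: ler_wpM2l; [exact: mulr_ge0 q0 tau00|exact: lerB cr p1].
  by rewrite /low lerB// lerD.
have i5 := rate_diff s0 st.
move: i2 i5 lowP; rewrite /low /err /E -/es.
move: (real_energy H (mfl K (w t))) (real_energy H _) (rate H (l t)) (rate H (l s)) => a b u v.
clear es0 crude ek low.
move: (\int[mu]_(z in _) _) ((1 + d^-1 + (4 * d)^-1) * (C ^+ 2 * e2)) (q * tau0) (t - s) es => z g p h e.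
by move=> *; lra.
Qed.

Lemma mollified_decay t : 0 <= t -> t <= T ->
  expR (q * tau0 * t) * E t <=
  E 0 + L0 * (S + Lam) * growth tau0 kappa t + err * expR (tau0 * T) * t.
Proof.
have Lam0 : 0 <= Lam := le_trans (normr_ge0 _) (lamL (lexx 0)).
have S0 : 0 <= S := le_trans (normr_ge0 _) (sgS 0).
have /andP[q0 q1] := q_bounds; have tau00 := sobolev_rate_ge0 hsob.
have [k k0 hk] := energy_increment.
have err0 : 0 <= err.
  apply: addr_ge0; first exact: mulr_ge0 (mulr_ge0 q0 tau00) (mulr_ge0 S0 (mol_e1 hK)).
  apply: mulr_ge0; last exact: mulr_ge0 (sqr_ge0 C) (mol_e2 hK).
  by rewrite !addr_ge0// invr_ge0 ?mulr_ge0// ltW.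
apply: (gronwall (mulr_ge0 q0 tau00) (ler_piMl tau00 q1) hkappa _ err0 k0 hk).
exact: mulr_ge0 (ltW hL0) (addr_ge0 S0 Lam0).
Qed.

End MollifiedDecay.

Lemma fatou_bound d (T : measurableType d) (R : realType) (mu : {measure set T -> \bar R})
    (F : nat -> T -> R) (f : T -> R) (c : R) :
  (forall n, intg mu setT (F n)) -> (forall n x, 0 <= F n x) -> measurable_fun setT f ->
  (forall x, F n x @[n --> \oo] --> f x) -> (forall n, \int[mu]_x F n x <= c) ->
  intg mu setT f /\ \int[mu]_x f x <= c.
Proof.
move=> iF F0 mf cF Fc.
have f0 x : 0 <= f x by apply: cvg_ge_lb (cF x) _; near=> n; exact: F0.
have e x : limn_einf (fun n => (F n x)%:E) = (f x)%:E.
  have lim : (F n x)%:E @[n --> \oo] --> (f x)%:E.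
    by apply/fine_cvgP; split; [exact: nearW|exact: cF].
  by have [-> _] := cvg_limn_einf_sup lim.
have h : (\int[mu]_x (f x)%:E <= c%:E)%E.
  have := @fatou _ _ _ mu setT measurableT (fun n x => (F n x)%:E).
  move=> /(_ (fun n => measurable_int mu (iF n))) /(_ (fun n x _ => F0 n x)).
  under eq_integral do rewrite e.
  move=> /le_trans; apply; rewrite limn_einf_lim.
  apply: lime_le; first exact: is_cvg_einfs.
  near=> n; apply: (@le_trans _ _ (\int[mu]_x (F n x)%:E)%E).
    by apply: ereal_inf_lbound; exists n => //=.
  by rewrite Rint_EFin// lee_fin.
have i : intg mu setT f by apply: intg_ge0 => //; apply: le_lt_trans h (ltry _).
by split => //; rewrite -lee_fin -Rint_EFin.
Unshelve. all: by end_near. Qed.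

(** * Removing the mollification *)

Section DifferenceQuotients.
Context {R : realType}.
Local Notation mu := (@lebesgue_measure R).

(* Difference quotients of the primitive converge almost everywhere by
   Lebesgue's differentiation theorem. *)
Lemma lipschitz_approx (g : R -> R) (M : R) : intg mu setT g -> (forall x, `|g x| <= M) ->
  exists h : nat -> R -> R, [/\ forall n x, `|h n x| <= M,
    forall n, exists L, 0 <= L /\ forall x y, `|h n x - h n y| <= L * `|x - y| &
    {ae mu, forall x, h n x @[n --> \oo] --> g x}].
Proof.
move=> ig gM; have M0 : 0 <= M := le_trans (normr_ge0 _) (gM 0).
pose G x := \int[mu]_(t in `]-oo, x]) g t.
have igy y : intg mu `]-oo, y] g by apply: (@integrableS _ _ _ mu setT).
have inc x y : x <= y -> G y - G x = \int[mu]_(t in `]x, y]) g t.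
  by move=> xy; rewrite /G Rintegral_itvB// bnd_simp.
have lip x y : x <= y -> `|G y - G x| <= M * (y - x).
  move=> xy; rewrite inc//; apply: Rint_bdd_oc => //.
  by apply: (@integrableS _ _ _ mu setT).
have lip2 x y : `|G x - G y| <= M * `|x - y|.
  have [xy|yx] := leP x y.
    by rewrite distrC [X in _ <= _ * X]distrC [X in _ <= _ * X]ger0_norm ?subr_ge0 ?lip.
  by rewrite [X in _ <= _ * X]ger0_norm ?subr_ge0 ?lip// ltW.
pose e (n : nat) : R := n.+1%:R^-1; have e0 n : 0 < e n by rewrite invr_gt0.
pose h n x := (e n)^-1 * (G (e n + x) - G x).
exists h; split.
- move=> n x; rewrite /h normrM gtr0_norm ?invr_gt0// mulrC ler_pdivrMr//.
  by apply: le_trans (lip2 _ _) _; rewrite addrK gtr0_norm.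
- move=> n; exists ((e n)^-1 * (2 * M)); split; first by rewrite mulr_ge0 ?invr_ge0 ?mulr_ge0// ltW.
  move=> x y; rewrite /h -mulrBr normrM gtr0_norm ?invr_gt0// -mulrA ler_wpM2l ?invr_ge0 ?(ltW (e0 n))//.
  rewrite (_ : _ - _ = (G (e n + x) - G (e n + y)) - (G x - G y)); last by ring.
  apply: (le_trans (ler_normB _ _)); have := lip2 x y; have := lip2 (e n + x) (e n + y).
  rewrite (_ : e n + x - (e n + y) = x - y); last by ring.
  by move=> h1 h2; apply: (le_trans (lerD h1 h2)); rewrite -mulrDl; lra.
- have := FTC1Ny igy (open_integrable_locally openT ig).
  apply: ae_mono => x [dG eG].
  have /cvgr_dnbhsP /(_ e) := dG.
  have -> : lim (r^-1 *: ((G \o shift x) r%:A - G x) @[r --> 0^']) = g x by rewrite -eG derive1E.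
  have en0 n : e n != 0 by rewrite gt_eqF.
  have elim : e n @[n --> \oo] --> (0 : R).
    by have := @cvg_harm R 1; apply: cvg_trans; apply: near_eq_cvg; near=> n; rewrite mul1r.
  move=> /(_ (conj en0 elim)); apply: cvg_trans; apply: near_eq_cvg; near=> n.
  by rewrite /h /= /shift /= [_%:A]mulr1.
Unshelve. all: by end_near. Qed.

End DifferenceQuotients.

Section LowerSemicontinuity.
Context {R : realType}.
Local Notation mu := (@lebesgue_measure R).
Implicit Types (x y z : R) (g : R -> R).
Variables (H : R -> R) (C c : R).
Hypothesis hH : confining H C c.
Variable rho : R -> R.
Hypothesis hr : P2 rho.

(** The conjugate of the entropy shifted by [H]: by [xlnx_ge] at [b = g - H], the entropy plus
    potential energy of any density dominates its pairing with [g] minus the integral of [low g]. *)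
Let low g x := expR (g x - H x - 1).

Lemma low_int g (M : R) : measurable_fun setT g -> (forall x, `|g x| <= M) ->
  intg mu setT (low g) /\ forall x, `|low g x| <= expR (M - 1) * expo H 0 x.
Proof.
move=> mg gM.
have le x : `|low g x| <= expR (M - 1) * expo H 0 x.
  rewrite ger0_norm ?expR_ge0// /expo -expRD ler_expR mul0r addr0.
  by have := le_trans (ler_norm _) (gM x); lra.
split => //; have i0 : intg mu setT (expo H 0).
  by apply: intg_eq (zmom_intg hH (n := 0) 0 isT) => // x _; rewrite expr0 mul1r.
apply: (@intg_le _ _ _ mu _ _ _ _ _ _ (intgZ (expR (M - 1)) measurableT i0)) => //.
apply: (measurableT_comp (@measurable_expR R)); apply: measurable_funB => //.
by apply: measurable_funB => //; exact: cont_meas (H_cont hH).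
Qed.

Variable b : R.
Hypothesis approx : forall eta, 0 < eta -> exists K N e1 e2,
  [/\ mollifier K N e1 e2, e1 <= eta & real_energy H (mfl K rho) <= b + eta].

(** The dual inequality holds for each mollified density, and a Lipschitz [g] barely sees the
    mollification, so the bound passes to [rho] itself. *)
Lemma dual_lipschitz g (M L : R) : 0 <= L -> (forall x, `|g x| <= M) ->
  (forall x y, `|g x - g y| <= L * `|x - y|) ->
  \int[mu]_x (g x * rho x) - \int[mu]_x low g x <= b - logZ H 0.
Proof.
move=> L0 gM gL; have mg := cont_meas (lipschitz_cont gL).
have M0 : 0 <= M := le_trans (normr_ge0 _) (gM 0).
have gB x : `|g x| <= M * (1 + x ^+ 2) by exact: bdd_quad.
have [il _] := low_int mg gM.
apply/ler_addgt0Pr => eta eta0.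
have L1 : 0 < 1 + L by rewrite ltr_pwDl.
(* With [eta / (1 + L)] as tolerance, the two errors [L e1] and [eta / (1 + L)] add up to at most
   [eta]. *)
have [K [N [e1 [e2 [hK e1e Ee]]]]] := approx (divr_gt0 eta0 L1).
have Pu := mfl_P2 hK hr; have iu := mfl_xlnx_intg hK hr.
have [ig _ _] := mfl_pairing hK hr mg gB.
have hl := mfl_lip hK hr gB gL L0.
have du : \int[mu]_x (g x * mfl K rho x) - \int[mu]_x low g x <=
    \int[mu]_x (mfl K rho x * ln (mfl K rho x)) + \int[mu]_x (H x * mfl K rho x).
  have iH := H_intg hH Pu.
  rewrite -(RintegralB _ ig il)// -(RintegralD _ iu iH)//.
  apply: le_Rintegral => //; [exact: intgB|exact: intgD|move=> x _].
  have := xlnx_ge (g x - H x) (P2_ge0 x Pu); rewrite -/(low g x) mulrBr.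
  by rewrite (mulrC (g x)) (mulrC (H x)); move: (_ * ln _) (low g x) (_ * g x) (_ * H x) => *; lra.
have : L * e1 + eta / (1 + L) <= eta.
  rewrite [leRHS](_ : _ = L * (eta / (1 + L)) + eta / (1 + L)); last by field; rewrite gt_eqF.
  by rewrite lerD2r ler_wpM2l.
move: hl; rewrite ler_norml => /andP[hl _]; move: hl du Ee; rewrite /real_energy.
move: (\int[mu]_x (g x * mfl K rho x)) (\int[mu]_x (g x * rho x)) (\int[mu]_x low g x) => u v z.
move: (\int[mu]_x (mfl K rho x * ln (mfl K rho x))) (\int[mu]_x (H x * mfl K rho x)) (logZ H 0) => i j k.
by move: (L * e1) (eta / (1 + L)) => p q *; lra.
Qed.

(** Dominated convergence along the Lipschitz approximations of [g], which share its bound. *)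
Lemma dual_bounded g (M : R) : intg mu setT g -> (forall x, `|g x| <= M) ->
  \int[mu]_x (g x * rho x) - \int[mu]_x low g x <= b - logZ H 0.
Proof.
move=> ig gM; have [h [hM hL hg]] := lipschitz_approx ig gM.
have mg := intg_meas ig.
have mh n : measurable_fun setT (h n).
  by have [L [_ l]] := hL n; exact: cont_meas (lipschitz_cont l).
have j1 := P2_intg1 hr.
have [_ l1] : intg mu setT (fun x => g x * rho x) /\
    \int[mu]_x (h n x * rho x) @[n --> \oo] --> \int[mu]_x (g x * rho x).
  apply: (@dct _ _ _ mu setT _ _ (fun x => M * rho x)) => //.
  - by move=> n; apply: measurable_funM; [exact: mh|exact: P2_meas hr].
  - by apply: measurable_funM; [exact: mg|exact: P2_meas hr].
  - by apply: ae_mono hg => x hx _; apply: cvgM; [exact: hx|exact: cvg_cst].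
  - exact: intgZ.
  - by move=> n x _; rewrite normrM (ger0_norm (P2_ge0 x hr)) ler_wpM2r ?(P2_ge0 _ hr).
have [_ l2] : intg mu setT (low g) /\ \int[mu]_x low (h n) x @[n --> \oo] --> \int[mu]_x low g x.
  have i0 : intg mu setT (expo H 0).
    by apply: intg_eq (zmom_intg hH (n := 0) 0 isT) => // x _; rewrite expr0 mul1r.
  apply: (@dct _ _ _ mu setT _ _ (fun x => expR (M - 1) * expo H 0 x)) => //.
  - by move=> n; have [i _] := low_int (mh n) (hM n); exact: intg_meas i.
  - by have [i _] := low_int mg gM; exact: intg_meas i.
  - apply: ae_mono hg => x hx _; apply: continuous_cvg; first exact: continuous_expR.
    by apply: cvgB; [apply: cvgB; [exact: hx|exact: cvg_cst]|exact: cvg_cst].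
  - exact: intgZ.
  - by move=> n x _; have [_ h1] := low_int (mh n) (hM n).
apply: cvg_le_ub (cvgB l1 l2) _; near=> n; have [L [L0 l]] := hL n.
exact: dual_lipschitz L0 (hM n) l.
Unshelve. all: by end_near. Qed.

(** The supremum in the dual formula is attained formally at [g = 1 + ln rho + H]. Bounded,
    compactly supported truncations of it are inserted and Fatou recovers the entropy, including its
    integrability, which is not known beforehand. *)
Lemma energy_lsc : intg mu setT (fun x => rho x * ln (rho x)) /\ real_energy H rho <= b.
Proof.
pose phi x := 1 + ln (rho x) + H x; have mrho := P2_meas hr; have mH := cont_meas (H_cont hH).
have mln : measurable_fun setT (fun x => ln (rho x)).
  exact: (measurableT_comp (@measurable_ln R) mrho).
have mphi : measurable_fun setT phi.
  by apply: measurable_funD => //; apply: measurable_funD.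
pose I (n : nat) : set R := `[- n%:R, n%:R]%classic.
pose A n := (rho @^-1` `]0, +oo[) `&` (phi @^-1` (I n)) `&` I n.
pose B n := (rho @^-1` [set 0]) `&` I n.
have pre (f : R -> R) (Y : set R) : measurable_fun setT f -> measurable Y -> measurable (f @^-1` Y).
  by move=> mf mY; rewrite -[X in measurable X]setTI; exact: mf.
have mI n : measurable (I n) by exact: measurable_itv.
have mA n : measurable (A n).
  by apply: measurableI => //; apply: measurableI; apply: pre => //; exact: measurable_itv.
have mB n : measurable (B n) by apply: measurableI => //; apply: pre.
pose g n x : R := \1_(A n) x * phi x - n%:R * \1_(B n) x.
have gA n x : A n x -> g n x = phi x.
  move=> Ax; rewrite /g !indicE mem_set// memNset ?mul1r ?mulr0 ?subr0//.
  by case: Ax => -[/=]; rewrite in_itv/= andbT => r0 _ _ [/= r00]; move: r0; rewrite r00 ltxx.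
have gB n x : B n x -> g n x = - n%:R.
  move=> Bx; rewrite /g !indicE (mem_set Bx) memNset ?mul0r ?mulr1 ?sub0r//.
  by case: Bx => /= r00 _ [[/=]]; rewrite in_itv/= r00 ltxx.
have g0 n x : ~ A n x -> ~ B n x -> g n x = 0.
  by move=> Ax Bx; rewrite /g !indicE !memNset// mul0r mulr0 subrr.
have mg n : measurable_fun setT (g n).
  apply: measurable_funB; apply: measurable_funM => //; exact: measurable_indic.
have gM n x : `|g n x| <= n%:R * \1_(I n) x.
  have [Ax|nA] := pselect (A n x).
    rewrite gA// indicE mem_set ?mulr1; last by case: Ax.
    by case: Ax => -[_]; rewrite /preimage /I /= in_itv/= -ler_norml.
  have [Bx|nB] := pselect (B n x); last by rewrite g0// normr0 mulr_ge0.
  by rewrite gB// indicE mem_set ?mulr1 ?normrN ?ger0_norm//; case: Bx.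
have iI n : intg mu setT (fun x : R => \1_(I n) x : R).
  rewrite (_ : (fun x => _) = ((fun _ : R => 1 : R) \_ (I n))); last first.
    by apply/funext => r; rewrite patchE indicE; case: (r \in I n).
  by apply: intg_patch; [exact: mI|exact: (intg_cst_itv (- n%:R) n%:R 1)].
have ig n : intg mu setT (g n).
  apply: (@intg_le _ _ _ mu _ _ _ _ _ _ (intgZ n%:R measurableT (iI n)));
    [exact: measurableT|exact: mg|by move=> y _; exact: gM].
have gn n x : `|g n x| <= n%:R.
  by apply: (le_trans (gM n x)); rewrite -[leRHS]mulr1 ler_wpM2l// indicE lern1 leq_b1.
pose z x := low (fun=> 0) x.
have [iz _] : intg mu setT z /\ forall x, `|z x| <= expR (0 - 1) * expo H 0 x.
  by apply: low_int => [|x]; [exact: measurable_cst|rewrite normr0].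
(* Adding [z], the value of [low] at [g = 0], makes the integrands nonnegative, as Fatou
   requires. *)
pose ent x := rho x * ln (rho x) + H x * rho x + z x.
pose th n x := g n x * rho x - low (g n) x + z x.
have il n := (low_int (mg n) (gn n)).1.
have igr n : intg mu setT (fun x => g n x * rho x).
  by apply: (P2_intg hr (mg n)) => x; apply: bdd_quad; exact: gn.
have ith n : intg mu setT (th n) by apply: intgD => //; exact: intgB.
have rpos x : 0 < rho x -> phi x * rho x - low phi x = rho x * ln (rho x) + H x * rho x.
  move=> r0; rewrite /low (_ : phi x - H x - 1 = ln (rho x)); last first.
    by rewrite /phi; move: (ln _) => u; ring.
  by rewrite lnK ?posrE// /phi; move: (ln _) => u; ring.
have thA n x : A n x -> th n x = ent x.
  move=> Ax; rewrite /th /ent /low gA//; congr (_ + _).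
  by apply: rpos; case: Ax => -[/=]; rewrite in_itv/= andbT.
have zE x : z x = expR (-1) * expo H 0 x.
  by rewrite /z /low /expo mul0r addr0 -expRD; congr expR; ring.
have ent0 x : 0 <= ent x.
  by have := xlnx_low H hr x; rewrite /ent zE; move: (rho x * _) => u; lra.
have thB n x : B n x -> th n x = z x - expR (- (1 * n%:R) + (- H x - 1)).
  move=> Bx; have [/= r0 _] := Bx; rewrite /th r0 mulr0 sub0r addrC; congr (_ - expR _).
  by rewrite gB//; ring.
have th0 n x : 0 <= th n x.
  have [Ax|nA] := pselect (A n x); first by rewrite thA.
  have [Bx|nB] := pselect (B n x).
    rewrite thB// subr_ge0 /z /low ler_expR; have : 0 <= n%:R :> R by [].
    by lra.
  by rewrite /th /z /low g0// mul0r sub0r addNr.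
have lim x : th n x @[n --> \oo] --> ent x.
  have [K hK] : exists K : nat, `|x| <= K%:R /\ `|phi x| <= K%:R.
    exists (Num.truncn `|x| + Num.truncn `|phi x|).+1; split.
      by apply/ltW/(lt_le_trans (truncnS_gt _)); rewrite ler_nat ltnS leq_addr.
    by apply/ltW/(lt_le_trans (truncnS_gt _)); rewrite ler_nat ltnS leq_addl.
  have [h1 h2] := hK.
  have big n : (K <= n)%N -> I n x /\ I n (phi x).
    move=> Kn; have Knr : K%:R <= n%:R :> R by rewrite ler_nat.
    by split; rewrite /I /= in_itv/= -ler_norml; [exact: le_trans h1 Knr|exact: le_trans h2 Knr].
  have := P2_ge0 x hr; rewrite le_eqVlt => /predU1P[r0|r0].
    have -> : ent x = z x - 0 by rewrite /ent -r0 mul0r mulr0 !add0r subr0.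
    apply: cvg_trans (cvgB (cvg_cst (z x)) (cvg_exp_lin (- H x - 1) ltr01)).
    apply: near_eq_cvg; near=> n; rewrite /= thB//.
    by split => //; have [] : I n x /\ I n (phi x) by apply: big; near: n; exact: nbhs_infty_ge.
  apply: cvg_near_cst; near=> n; apply/thA.
  have [i1 i2] : I n x /\ I n (phi x) by apply: big; near: n; exact: nbhs_infty_ge.
  by split => //; split => //=; rewrite in_itv/= r0.
have ub n : \int[mu]_x th n x <= b - logZ H 0 + \int[mu]_x z x.
  have i3 := intgB measurableT (igr n) (il n).
  rewrite /th (RintegralD _ i3 iz)// lerD2r (RintegralB _ (igr n) (il n))//.
  exact: dual_bounded (ig n) (gn n).
have iH := H_intg hH hr.
have ment : measurable_fun setT ent.
  apply: measurable_funD; last exact: intg_meas iz.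
  by apply: measurable_funD; [exact: meas_xlnx hr|exact: intg_meas iH].
have [ient ent_le] := fatou_bound ith th0 ment lim ub.
have i5 : intg mu setT (fun x => rho x * ln (rho x) + H x * rho x).
  by apply: intg_eq (intgB measurableT ient iz) => // x _; rewrite /ent addrK.
have i6 : intg mu setT (fun x => rho x * ln (rho x)).
  by apply: intg_eq (intgB measurableT i5 iH) => // x _; rewrite addrK.
split => //; move: ent_le; rewrite /ent (RintegralD _ i5 iz)// (RintegralD _ i6 iH)// lerD2r /real_energy.
by rewrite lerBrDr.
Unshelve. all: by end_near. Qed.

End LowerSemicontinuity.

(** * Decay of the constraint towards its limit *)

Section Constraint.
Context {R : realType}.
Local Notation mu := (@lebesgue_measure R).
Implicit Types (r s t : R).
Variables (l dl : R -> R) (lstar kappa L0 : R).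
Hypothesis hl : constraint l dl lstar.
Hypothesis hkappa : 0 < kappa.
Hypothesis hL0 : 0 < L0.
Hypothesis hdl : {ae mu, forall t : R, 0 <= t -> `|dl t| <= L0 * expR (- (kappa * t))}.

Lemma constraint_cont t : 0 < t -> {for t, continuous l}.
Proof.
move=> t0; case: hl => cl _ _ _ _; have /continuous_within_itvcyP[h _] := cl.
by apply: h; rewrite in_itv/= t0.
Qed.

(** For [s > 0] this is the fundamental theorem for the weak derivative [dl]. The weak derivative
    lives on the open half-line, so [s = 0] is reached by right continuity of [l]. *)
Lemma constraint_lip s t : 0 <= s -> s <= t ->
  `|l t - l s| <= L0 * expR (- (kappa * s)) * (t - s).
Proof.
have pos s' t' : 0 < s' -> s' <= t' -> `|l t' - l s'| <= L0 * expR (- (kappa * s')) * (t' - s').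
  move=> s0 st; have t0 := lt_le_trans s0 st.
  case: (hl) => _ wd _ _ idl; have s2 : 0 < s' / 2 by rewrite divr_gt0.
  have sub : `[s' - s' / 2, t' + s' / 2] `<=` `]0, +oo[.
    by move=> x /=; rewrite !in_itv/= andbT => /andP[h _]; apply: lt_le_trans h; lra.
  rewrite (weak_derivative_itv wd s2 st sub (constraint_cont s0) (constraint_cont t0)).
  have i1 : intg mu `]s', t'] dl.
    apply: (@integrableS _ _ _ mu `]0, +oo[) => // x /=; rewrite !in_itv/= andbT => /andP[h _].
    exact: lt_trans s0 h.
  have i2 : intg mu `]s', t'] (fun _ : R => L0 * expR (- (kappa * s')) : R).
    by apply: (@intg_bdd_oc _ _ _ _ `|L0 * expR (- (kappa * s'))|); [exact: measurable_cst|by []].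
  apply: (@le_trans _ _ (\int[mu]_(r in `]s', t']) `|dl r|)).
    by apply: (@Rint_le_norm _ _ _ mu) => //; exact: intg_norm.
  rewrite -Rint_cst_oc//; apply: Rint_le_ae => //; first exact: intg_norm.
  apply: ae_mono hdl => r hr; rewrite /= in_itv/= => /andP[sr _].
  apply: (le_trans (hr (ltW (lt_trans s0 sr)))); rewrite ler_wpM2l ?(ltW hL0)//.
  by rewrite ler_expR lerN2 ler_wpM2l ?ltW.
rewrite le_eqVlt => /predU1P[<- t0|s0 st]; last exact: pos.
have := t0; rewrite le_eqVlt => /predU1P[<-|t1]; first by rewrite !subrr normr0 mulr0.
(* Positive times tending to 0 and staying below [t]. *)
pose e (n : nat) : R := t / n.+2%:R.
have e0 n : 0 < e n by rewrite divr_gt0.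
have et n : e n <= t by rewrite ler_pdivrMr// ler_peMr// ler1n.
have elim : e n @[n --> \oo] --> (0 : R).
  have := @cvg_harm R t; rewrite -(@cvg_shiftS _ _ _ ) => h.
  by apply: cvg_trans h; apply: near_eq_cvg; near=> n.
case: hl => cl _ _ _ _; have /continuous_within_itvcyP[_ h0] := cl.
have /cvg_at_rightP /(_ e (conj e0 elim)) l0 := h0.
have lim : `|l t - l (e n)| @[n --> \oo] --> `|l t - l 0|.
  by apply: cvg_norm; apply: cvgB; [exact: cvg_cst|exact: l0].
apply: cvg_le_ub lim _; near=> n; apply: (le_trans (pos _ _ (e0 n) (et n))).
rewrite mulr0 oppr0 expR0 mulr1 addr0; apply: ler_pM.
- by rewrite mulr_ge0 ?expR_ge0// ltW.
- by rewrite subr_ge0.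
- rewrite -[leRHS]mulr1 ler_wpM2l ?(ltW hL0)// -expR0 ler_expR oppr_le0.
  by rewrite mulr_ge0// ltW.
- by rewrite gerBl ltW.
Unshelve. all: by end_near. Qed.

(** [growth 0 kappa] is a primitive of [e^(-kappa r)]. Summing [constraint_lip] over partitions, for
    both signs [sg], bounds [l t - l n] by the tail of this integral; then [n] tends to infinity. *)
Lemma constraint_limit t : 0 <= t -> `|l t - lstar| <= L0 / kappa * expR (- (kappa * t)).
Proof.
move=> t0; have gE r : growth 0 kappa r = (1 - expR (- (kappa * r))) / kappa.
  by rewrite /growth /exp_quotient gt_eqF// !mul0r oppr0 expR0 mul1r addr0.
have inc (sg : R) T : `|sg| = 1 -> t <= T -> sg * (l T - l t) <= L0 * (growth 0 kappa T - growth 0 kappa t).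
  move=> s1 tT; have [k k0 hk] := growth_low 0 kappa T.
  suff : sg * l T - L0 * growth 0 kappa T <= sg * l t - L0 * growth 0 kappa t by lra.
  apply: (@partition_le _ (fun r => sg * l r - L0 * growth 0 kappa r) t T (L0 * k)) => // s r ts sr rT.
  have s0 := le_trans t0 ts; have := ler_wpM2l (ltW hL0) (hk s r s0 sr rT).
  have : sg * (l r - l s) <= L0 * expR (- (kappa * s)) * (r - s).
    by apply: (le_trans (ler_norm _)); rewrite normrM s1 mul1r constraint_lip.
  rewrite sub0r mulNr; move: (expR _) (growth _ _ _) (growth _ _ _) ((r - s) ^+ 2) (l r) (l s) => *; lra.
have bd n : t <= n%:R -> `|l t - l n%:R| <= L0 / kappa * expR (- (kappa * t)).
  move=> tn; have h1 := inc 1 n%:R (normr1 _) tn.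
  have h2 := inc (-1) n%:R (normrN1 _) tn.
  have h3 : L0 * (growth 0 kappa n%:R - growth 0 kappa t) <= L0 / kappa * expR (- (kappa * t)).
    rewrite -mulrA ler_wpM2l ?(ltW hL0)// !gE -mulrBl mulrC ler_wpM2l ?invr_ge0 ?(ltW hkappa)//.
    by have := expR_ge0 (- (kappa * n%:R)); lra.
  by rewrite ler_norml; apply/andP; split; move: h1 h2 h3; lra.
have lim : l n%:R @[n --> \oo] --> lstar.
  case: hl => _ _ _ h _; apply: cvg_comp h; exact: cvgr_idn.
apply: cvg_le_ub (cvg_norm (cvgB (cvg_cst (l t)) lim)) _; near=> n; apply: bd.
by near: n; exact: nbhs_infty_ger.
Unshelve. all: by end_near. Qed.

End Constraint.

(** * Restriction to a bounded time interval *)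

Section Localisation.
Context {R : realType}.
Local Notation mu := (@lebesgue_measure R).
Implicit Types (phi : R -> R) (x r s t : R).
Variables (H l dl rho0 : R -> R) (u : R -> R -> R) (C c : R).
Hypothesis hH : confining H C c.
Hypothesis h0 : constrained_P2 (l 0) rho0.
Hypothesis hsol : solution H l dl rho0 u.
Let w := dpath rho0 u.
Let sigma := multiplier H dl u.

Lemma path_weak phi : moderate phi -> weak_identity (derive1 H) sigma w phi.
Proof.
have [_ _ _ isig _] := hsol.
apply: (weak_moderate (conf_cont hH) (conf_lin hH) (dpath_joint h0 hsol) (dpath_P2 h0 hsol) isig).
by move=> psi r ep sp; exact (solution_compact hH h0 hsol ep sp).
Qed.

Lemma path_moment T : 0 <= T -> exists2 A, 0 <= A & forall t, 0 <= t <= T -> mom2 (w t) <= A.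
Proof.
have [_ _ _ isig _] := hsol.
exact: (moment_bound (conf_cont hH) (conf_lin hH) (conf_mono hH) (dpath_joint h0 hsol)
  (dpath_P2 h0 hsol) isig path_weak).
Qed.

Variables (T S : R).
Hypothesis T0 : 0 <= T.
Hypothesis S0 : 0 <= S.
Hypothesis hS : {ae mu, forall r, 0 <= r <= T -> `|sigma r| <= S}.

(** Frozen at its initial value outside [[0, T]], so that the moment bound holds at every real
    time. *)
Definition wT r : R -> R := if 0 <= r <= T then w r else w 0.
Let sgp := sigma \_ `[0, T].
(** Set to 0 outside [[0, T]] and wherever it exceeds [S]: the essential bound becomes a pointwise
    one, at the price of a null set of [[0, T]]. *)
Definition sgT r : R := sgp r * \1_(sgp @^-1` `[- S, S]) r.

Lemma wT_P2 r : P2 (wT r).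
Proof. by rewrite /wT; case: ifP => _; exact: dpath_P2 h0 hsol _. Qed.

Lemma wT_joint : measurable_fun setT (fun p : R * R => wT p.1 p.2).
Proof.
have mw := dpath_joint h0 hsol; rewrite -/w in mw.
have mc : measurable_fun setT (fun p : R * R => w 0 p.2).
  by apply: (@meas_snd2 _ (w 0)); exact: P2_meas (dpath_P2 h0 hsol 0).
have m1 : measurable_fun setT (fun r : R => \1_(`[0, T]%classic) r : R) by exact: measurable_indic.
rewrite (_ : (fun p => _) = fun p : R * R => \1_(`[0, T]%classic) p.1 * (w p.1 p.2 - w 0 p.2) + w 0 p.2).
  apply: measurable_funD => //; apply: measurable_funM; last exact: measurable_funB.
  exact: (@meas_fst2 _ (\1_(`[0, T]%classic))).
apply/funext => p; rewrite /wT indicE; case: ifP => h.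
  by rewrite mem_set/= ?in_itv//= mul1r subrK.
by rewrite memNset/= ?in_itv/= ?h// mul0r add0r.
Qed.

Lemma sgp_meas : measurable_fun setT sgp.
Proof.
have [_ _ _ isig _] := hsol.
by apply: (@intg_meas _ _ _ mu); apply: intg_patch; [exact: measurable_itv|exact: isig].
Qed.

Lemma sgT_meas : measurable_fun setT sgT.
Proof.
apply: measurable_funM; first exact: sgp_meas.
apply: measurable_indic; rewrite -[X in measurable X]setTI.
by apply: sgp_meas => //; exact: measurable_itv.
Qed.

Lemma sgT_le r : `|sgT r| <= S.
Proof.
rewrite /sgT indicE; case: (boolP (r \in _)); rewrite ?mulr0 ?normr0// mulr1 inE /=.
by rewrite in_itv/= -ler_norml.
Qed.

Lemma sgT_ae : {ae mu, forall r, 0 <= r <= T -> sgT r = sigma r}.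
Proof.
apply: ae_mono hS => r hr rT; have e : sgp r = sigma r.
  by rewrite /sgp patchE mem_set//= in_itv.
by rewrite /sgT indicE mem_set ?mulr1 ?e//= in_itv/= e -ler_norml hr.
Qed.

Lemma localised_weak phi s t : moderate phi -> 0 <= s -> s <= t -> t <= T ->
  \int[mu]_x (phi x * wT t x) - \int[mu]_x (phi x * wT s x) =
  \int[mu]_(r in `]s, t])
    (\int[mu]_x ((derive1n 2 phi x - derive1 H x * derive1 phi x) * wT r x)
     + sgT r * \int[mu]_x (derive1 phi x * wT r x)).
Proof.
move=> mp s0 st tT; have t0 := le_trans s0 st; have sT := le_trans st tT.
have wk := path_weak mp; have ht := wk t t0; have hs := wk s s0.
rewrite /wT t0 tT s0 sT /= -/(wT _).
have Pw := dpath_P2 h0 hsol; have mw := dpath_joint h0 hsol.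
have [_ _ _ isig _] := hsol; have [ep [D hD]] := mp.
have [m1 b1 m2 b2] := moderate_drift (conf_cont hH) (conf_lin hH) ep hD.
pose a r := \int[mu]_x ((derive1n 2 phi x - derive1 H x * derive1 phi x) * w r x).
pose b r := \int[mu]_x (derive1 phi x * w r x).
have ma : measurable_fun setT a := meas_pairing mw m1.
have mb : measurable_fun setT b := meas_pairing mw m2.
have aD r : `|a r| <= D + C * D by exact: P2_bdd (Pw r) m1 b1.
have bD r : `|b r| <= D by exact: P2_bdd (Pw r) m2 b2.
have [i1 _] := intg_weighted isig t ma aD; have [_ i2] := intg_weighted isig t mb bD.
have i3 : intg mu `[0, t] (fun r => a r + sigma r * b r) by exact: intgD.
have e1 : \int[mu]_x (phi x * w t x) - \int[mu]_x (phi x * w s x) =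
    \int[mu]_(r in `]s, t]) (a r + sigma r * b r).
  have := @Rintegral_itvB R (fun r => a r + sigma r * b r) (BLeft 0) (BRight t) s i3.
  rewrite !bnd_simp => /(_ s0 st) <-; move: ht hs; rewrite -/w /a /b.
  by move=> <- <-; ring.
rewrite e1; have i4 : intg mu `]s, t] (fun r => a r + sigma r * b r).
  apply: (@integrableS _ _ _ mu `[0, t]) => // x /=; rewrite !in_itv/= => /andP[h1 ->].
  by rewrite (le_trans s0 (ltW h1)).
have mab : measurable_fun setT (fun r =>
    \int[mu]_x ((derive1n 2 phi x - derive1 H x * derive1 phi x) * wT r x)
     + sgT r * \int[mu]_x (derive1 phi x * wT r x)).
  apply: measurable_funD; first exact (meas_pairing wT_joint m1).
  by apply: measurable_funM; [exact: sgT_meas|exact (meas_pairing wT_joint m2)].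
apply: Rint_ae => //; [exact: intg_meas i4|exact: measurable_funTS mab|].
apply: ae_mono sgT_ae => r hr; rewrite /= in_itv/= => /andP[sr rt].
have r0T : 0 <= r <= T by rewrite (le_trans s0 (ltW sr)) (le_trans rt tT).
by rewrite (hr r0T) /wT r0T.
Qed.

End Localisation.

Lemma sum_le (R : realType) (a b a' b' z d : R) : b <= b' + d -> a <= a' ->
  a + b + z <= a' + b' + z + d.
Proof. by lra. Qed.

Lemma decay_algebra (R : realType) (v0 v1 v3 v4 v5 v6 v8 C m e t p : R) :
  v1 <= v3 + (2 * C * (16 * e) * (1 + m) + v8) -> v8 <= 128 * C * e ->
  v6 * (v4 * t) <= (p * e + 288 * C ^+ 2 * e) * (v4 * t) -> 0 <= v0 ->
  v1 - v0 + v5 + v6 * v4 * t <=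
  v3 + v5 + (32 * C * (1 + m) + 128 * C + (p + 288 * C ^+ 2) * (v4 * t)) * e.
Proof. by lra. Qed.

(** With [d = e], first moment [16 e] and second moment [128 e^2], the factor [1 / d] still leaves
    an error of order [e]: the coefficient is [128 e^2 + 160 e], at most [288 e]. *)
Lemma error_bounds (R : realType) (e tau0 S C : R) : 0 < e -> e <= 1 -> 0 <= tau0 -> 0 <= S -> 0 <= C ->
  [/\ (1 - e) / (1 + e) * tau0 * (S * (16 * e)) <= 16 * tau0 * S * e,
     (1 + e^-1 + (4 * e)^-1) * (C ^+ 2 * (128 * e ^+ 2)) <= 288 * C ^+ 2 * e &
     C * (128 * e ^+ 2) <= 128 * C * e].
Proof.
move=> e0 e1 t0 S0 C0; have ee : e ^+ 2 <= e by rewrite expr2 ler_piMr// ltW.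
have q1 : (1 - e) / (1 + e) <= 1 by rewrite ler_pdivrMr ?addr_gt0// mul1r; lra.
split.
- have p := mulr_ge0 (mulr_ge0 t0 S0) (ltW e0); have := ler_wpM2r p q1.
  by move: (_ / _) => q; rewrite mul1r; lra.
- have -> : (1 + e^-1 + (4 * e)^-1) * (C ^+ 2 * (128 * e ^+ 2)) =
      C ^+ 2 * (128 * e ^+ 2 + 160 * e) by field; rewrite gt_eqF.
  by have := ler_wpM2l (sqr_ge0 C) ee; lra.
- by have := ler_wpM2l C0 ee; lra.
Qed.

Section Decay.
Context {R : realType}.
Local Notation mu := (@lebesgue_measure R).
Implicit Types (r s t : R).
Variables (H l dl rho0 : R -> R) (u : R -> R -> R) (C c lstar L0 kappa : R).
Hypothesis hH : confining H C c.
Hypothesis h0 : constrained_P2 (l 0) rho0.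
Hypothesis hsol : solution H l dl rho0 u.
Hypothesis hl : constraint l dl lstar.
Hypothesis hkappa : 0 < kappa.
Hypothesis hL0 : 0 < L0.
Hypothesis hdl : {ae mu, forall t : R, 0 <= t -> `|dl t| <= L0 * expR (- (kappa * t))}.
Hypothesis hi0 : intg mu setT (fun x => rho0 x * ln (rho0 x)).
Let w := dpath rho0 u.
Let sigma := multiplier H dl u.

Lemma multiplierE r : 0 <= r -> sigma r = \int[mu]_x (derive1 H x * w r x) + dl r.
Proof.
move=> r0; congr (_ + _); rewrite -(dpath_Rint h0 hsol r0 (cont_meas (conf_cont hH))).
by apply: eq_Rintegral => x _; rewrite mulrC.
Qed.

(** [mollified_decay] is applied on [[0, t]] with width and Young parameter both equal to [e]. As
    [e] tends to 0 the energies of the mollified densities satisfy the limiting bound, and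
    [energy_lsc] transfers it to the density itself. *)
Lemma energy_decay t S Lam tau0 : 0 <= t -> 0 <= S ->
  {ae mu, forall r, 0 <= r <= t -> `|sigma r| <= S} ->
  (forall r, 0 <= r -> `|lambda H (l r)| <= Lam) -> sobolev_rate H S%:E tau0 ->
  intg mu setT (fun x => w t x * ln (w t x)) /\
  real_energy H (w t) <= rate H (l t) +
    expR (- (tau0 * t)) * (real_energy H rho0 + L0 * (S + Lam) * growth tau0 kappa t).
Proof.
move=> t0 S0 hS hlam hsob; have [A A0 hA] := path_moment hH h0 hsol t0.
have Pw := dpath_P2 h0 hsol; rewrite -/w in hA Pw.
have tt : 0 <= t <= t by rewrite t0 lexx.
have z0 : 0 <= (0 : R) <= t by rewrite lexx t0.
pose w' := wT rho0 u t; pose sg' := sgT H dl u t S.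
have w't : w' t = w t by rewrite /w' /wT tt.
have w'0 : w' 0 = rho0 by rewrite /w' /wT z0 /dpath ltxx.
have Pr0 : P2 rho0 by case: h0.
have mA r : mom2 (w' r) <= A.
  by rewrite /w' /wT; case: ifP => h; apply: hA.
have wM1 r : 0 <= r -> r <= t -> M1 (w' r) = l r.
  by move=> r0 rt; rewrite /w' /wT r0 rt /=; exact: dpath_M1 h0 hsol r r0.
have sgE : {ae mu, forall r, 0 <= r <= t -> sg' r = \int[mu]_x (derive1 H x * w' r x) + dl r}.
  apply: ae_mono (sgT_ae hS) => r hr rt; rewrite /sg' (hr rt) -/(sigma r).
  by rewrite multiplierE; [rewrite /w' /wT rt|case/andP: rt].
have lL := constraint_lip hl hkappa hL0 hdl.
have j1 : measurable_fun setT (fun p : R * R => w' p.1 p.2) by apply: wT_joint h0 hsol _.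
have j2 r : P2 (w' r) by apply: wT_P2 h0 hsol _ _.
have j3 : measurable_fun setT sg' by apply: sgT_meas hsol _ _.
have j4 r : `|sg' r| <= S by apply: sgT_le.
have j5 phi s r : moderate phi -> 0 <= s -> s <= r -> r <= t ->
  \int[mu]_x (phi x * w' r x) - \int[mu]_x (phi x * w' s x) =
  \int[mu]_(z in `]s, r])
    (\int[mu]_x ((derive1n 2 phi x - derive1 H x * derive1 phi x) * w' z x)
     + sg' z * \int[mu]_x (derive1 phi x * w' z x)).
  by move=> mp s0 sr rt; apply: (localised_weak hH h0 hsol).
have tau00 := sobolev_rate_ge0 hsob; have C0 := conf_C hH.
have m0 := mom2_ge0 Pr0.
pose X := real_energy H rho0 + L0 * (S + Lam) * growth tau0 kappa t.
pose Y := expR (tau0 * t) * t; have Y0 : 0 <= Y by rewrite mulr_ge0 ?expR_ge0.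
pose k := 32 * C * (1 + mom2 rho0) + 128 * C + (16 * tau0 * S + 288 * C ^+ 2) * Y.
have step e : 0 < e -> e < 1 -> real_energy H (mfl (logk e) (w t)) <= rate H (l t) +
    expR (- ((1 - e) / (1 + e) * tau0 * t)) * (X + k * e).
  move=> e0 e1; have hK := logk_mollifier e0 (ltW e1).
  have md := mollified_decay hK hH j1 j2 mA j3 j4 j5 wM1 sgE hdl lL hlam t0 hL0 hkappa hsob e0 e1
    t0 (lexx t).
  rewrite -/w' w't w'0 in md.
  have Ee : real_energy H (mfl (logk e) rho0) <=
      real_energy H rho0 + (2 * C * (16 * e) * (1 + mom2 rho0) + C * (128 * e ^+ 2)).
    have h1 := mfl_H_le hK hH Pr0; have h2 := mfl_jensen hK Pr0 hi0.
    exact: sum_le h1 h2.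
  have r0 := rate_ge0 hH (l 0); set q := (1 - e) / (1 + e) in md *.
  have [b1 b2 b3] := error_bounds e0 (ltW e1) tau00 S0 C0; rewrite -/q in b1.
  have b4 := ler_wpM2r Y0 (lerD b1 b2).
  have ub : expR (q * tau0 * t) * (real_energy H (mfl (logk e) (w t)) - rate H (l t)) <= X + k * e.
    by apply: (le_trans md); exact: decay_algebra Ee b3 b4 r0.
  rewrite -lerBlDl expRN mulrC -ler_pdivrMr ?invr_gt0 ?expR_gt0// invrK mulrC; exact: ub.
(* Starting at 1/2 keeps the width strictly below 1, as [step] requires. *)
pose e (n : nat) : R := n.+2%:R^-1.
have e0 n : 0 < e n by rewrite invr_gt0.
have e1 n : e n < 1 by rewrite invf_lt1 ?ltr0n// ltr1n.
have elim : e n @[n --> \oo] --> (0 : R).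
  have := @cvg_harm R 1; rewrite -(@cvg_shiftS _ _ _) => h.
  by apply: cvg_trans h; apply: near_eq_cvg; near=> n; rewrite /= mul1r.
pose bn n := rate H (l t) + expR (- ((1 - e n) / (1 + e n) * tau0 * t)) * (X + k * e n).
have bl : bn n @[n --> \oo] --> rate H (l t) + expR (- (tau0 * t)) * X.
  rewrite -[X in _ --> X](_ : rate H (l t) + expR (- ((1 - 0) / (1 + 0) * tau0 * t)) * (X + k * 0) = _);
    last by rewrite subr0 addr0 divr1 mul1r mulr0 addr0.
  apply: cvgD; first exact: cvg_cst.
  apply: cvgM; last by apply: cvgD; [exact: cvg_cst|apply: cvgM; [exact: cvg_cst|exact: elim]].
  apply: continuous_cvg; first exact: continuous_expR.
  apply: cvgN; apply: cvgM; last exact: cvg_cst; apply: cvgM; last exact: cvg_cst.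
  apply: cvgM; first by apply: cvgB; [exact: cvg_cst|exact: elim].
  by apply: cvgV; [rewrite addr0 oner_neq0|apply: cvgD; [exact: cvg_cst|exact: elim]].
apply: (energy_lsc hH (Pw t)) => eta eta0.
have n1 : \forall n \near \oo, `|rate H (l t) + expR (- (tau0 * t)) * X - bn n| <= eta.
  by move/cvgrPdist_le : bl; apply.
have n2 : \forall n \near \oo, `|16 * 0 - 16 * e n| <= eta.
  have el2 : 16 * e n @[n --> \oo] --> 16 * (0 : R) by apply: cvgM; [exact: cvg_cst|exact: elim].
  by move/cvgrPdist_le : el2; apply.
have [m _ hm] := n1; have [m' _ hm'] := n2; pose n := maxn m m'.
have a1 := hm n (leq_maxl _ _); have a2 := hm' n (leq_maxr _ _).
exists (logk (e n)), (2 / e n ^+ 2), (16 * e n), (128 * e n ^+ 2); split.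
- exact: logk_mollifier (e0 n) (ltW (e1 n)).
- by move: a2; rewrite mulr0 sub0r normrN; apply: le_trans (ler_norm _).
- apply: (le_trans (step _ (e0 n) (e1 n))); move: a1; rewrite distrC ler_distl => /andP[_].
  by rewrite /bn.
Unshelve. all: by end_near. Qed.

End Decay.

Section GibbsEnergy.
Context {R : realType}.
Local Notation mu := (@lebesgue_measure R).
Implicit Types (x s m : R).
Variables (H : R -> R) (C c : R).
Hypothesis hH : confining H C c.

Lemma gibbs_cont s : continuous (gibbs H s).
Proof. by move=> x; apply: cvgM; [exact: expo_cont hH s x|exact: cvg_cst]. Qed.

Lemma gibbs_P2 s : P2 (gibbs H s).
Proof.
have Z0 := Z_gt0 hH s.
have im n : (n <= 2)%N -> intg mu setT (fun x => x ^+ n * gibbs H s x).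
  move=> n2; apply: intg_eq (intgZ (Z H s)^-1 measurableT (zmom_intg hH s n2)) => // x _.
  by rewrite /gibbs /expo mulrC -mulrA.
split.
- by apply: cont_meas; exact: gibbs_cont.
- by move=> x; rewrite divr_ge0 ?expR_ge0// ltW.
- have i0 : intg mu setT (gibbs H s) by apply: intg_eq (im 0 isT) => // x _; rewrite expr0 mul1r.
  rewrite Rint_EFin//; congr (_%:E).
  have i1 : intg mu setT (fun x => x ^+ 0 * expo H s x) := zmom_intg hH s (isT : (0 <= 2)%N).
  transitivity (\int[mu]_x ((Z H s)^-1 * (x ^+ 0 * expo H s x))).
    by apply: eq_Rintegral => x _; rewrite expr0 mul1r mulrC.
  by rewrite RintegralZl// -/(zmom H 0 s) -(ZE H s) mulVf// gt_eqF.
- by rewrite Rint_EFin ?ltry//; exact: im.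
Qed.

Lemma ln_gibbs s x : ln (gibbs H s x) = - H x + s * x - logZ H s.
Proof. by rewrite /gibbs ln_div ?posrE ?expR_gt0 ?(Z_gt0 hH)// expRK. Qed.

Lemma gibbs_xlnx_intg s : intg mu setT (fun x => gibbs H s x * ln (gibbs H s x)).
Proof.
have Pg := gibbs_P2 s; pose g x := - H x + s * x - logZ H s.
have mg : measurable_fun setT g.
  apply: measurable_funB => //; apply: measurable_funD.
    by apply: measurable_funN; exact: cont_meas (H_cont hH).
  by apply: measurable_funM => //; exact: measurable_id.
have h : intg mu setT (fun x => g x * gibbs H s x).
  have i1 := intgN measurableT (H_intg hH Pg); have i2 := intgZ s measurableT (id_intg Pg).
  have i3 := intgZ (logZ H s) measurableT (P2_intg1 Pg).
  apply: intg_eq (intgB measurableT (intgD measurableT i1 i2) i3) => // x _.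
  by rewrite /g; move: (logZ H s) => v; ring.
by apply: intg_eq h => // x _; rewrite ln_gibbs mulrC.
Qed.

(** A Gibbs density has zero entropy relative to itself, so [relative_entropyE] determines its
    energy without integrating [ln]. *)
Lemma gibbs_energy s : free_energy H (gibbs H s) = (s * mean H s - logZ H s + logZ H 0)%:E.
Proof.
have Pg := gibbs_P2 s; have ig := gibbs_xlnx_intg s.
rewrite (free_energyE hH Pg ig); congr (_%:E).
have := relative_entropyE hH Pg ig s; rewrite /relative_entropy.
under eq_integral => x _.
  have gx : gibbs H s x != 0 by rewrite gt_eqF// divr_gt0 ?expR_gt0// (Z_gt0 hH).
  rewrite divff// ln1 mulr0.
  over.
rewrite integral0 => -[]; rewrite -/(mean H s).
by move: (logZ H s) (logZ H 0) (s * _) (real_energy H _) => a b e g h; lra.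
Qed.

Lemma intg_ae (f g : R -> R) : measurable_fun setT f -> {ae mu, forall x, f x = g x} ->
  intg mu setT g -> intg mu setT f.
Proof.
move=> mf fg ig; have mg := intg_meas ig; have /integrableP[_ h] := ig.
apply/integrableP; split; first exact/measurable_EFinP.
apply: le_lt_trans h; rewrite (@ae_eq_integral _ _ _ mu setT (fun x => `|(EFin \o g) x|)%E)//.
- by apply: measurableT_comp => //; exact/measurable_EFinP.
- by apply: measurableT_comp => //; exact/measurable_EFinP.
- by apply: ae_mono fg => x e _; rewrite /= e.
Qed.

(** Carries the estimate from the modified path back to the solution, which may differ from it on a
    null set at time 0. *)
Lemma real_energy_ae (r1 r2 : R -> R) : P2 r1 -> P2 r2 -> {ae mu, forall x, r1 x = r2 x} ->
  intg mu setT (fun x => r2 x * ln (r2 x)) ->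
  intg mu setT (fun x => r1 x * ln (r1 x)) /\ real_energy H r1 = real_energy H r2.
Proof.
move=> P1 P2' e i2; have m1 := meas_xlnx P1; have m2 := meas_xlnx P2'.
have e1 : {ae mu, forall x, r1 x * ln (r1 x) = r2 x * ln (r2 x)}.
  by apply: ae_mono e => x ->.
split; first exact: intg_ae m1 e1 i2.
congr (_ + _ + _); apply: Rint_ae => //.
- by apply: ae_mono e1 => x ex _.
- exact: intg_meas (H_intg hH P1).
- exact: intg_meas (H_intg hH P2').
- by apply: ae_mono e => x ex _; rewrite ex.
Qed.

(** Monotonicity of [mean] confines [lambda H m] between the values at the ends of the interval. *)
Lemma lambda_bounded (M : R) : exists2 b, 0 <= b & forall m, `|m| <= M -> `|lambda H m| <= b.
Proof.
have mono s t : s <= t -> mean H s <= mean H t.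
  by rewrite le_eqVlt => /predU1P[->//|/(mean_incr hH)/ltW].
pose b := `|lambda H M| + `|lambda H (- M)|; exists b; first exact: addr_ge0.
move=> m; rewrite (lambda_bound hH) ler_norml => /andP[m1 m2]; apply/andP; split.
  apply: le_trans m1; rewrite -[leRHS](mean_lambda hH (- M)); apply: mono.
  rewrite lerNl; apply: (@le_trans _ _ `|lambda H (- M)|); last by rewrite lerDr.
  by rewrite -normrN ler_norm.
apply: (le_trans m2); rewrite -[leLHS](mean_lambda hH M); apply: mono.
by apply: (le_trans (ler_norm _)); rewrite lerDl.
Qed.

End GibbsEnergy.

Section EssentialBounds.
Context {R : realType}.
Local Notation mu := (@lebesgue_measure R).

Lemma Linfty_norm_ge0 (f : R -> R) : (0 <= Linfty_norm f)%E.
Proof. exact: Lnorm_ge0. Qed.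

Lemma lebesgueT_gt0 : (0 < mu [set: R])%E.
Proof.
apply: (@lt_le_trans _ _ (mu `[0, 1])); last by apply: le_measure; rewrite ?inE.
by rewrite mu_itvcc// subr0 lte_fin.
Qed.

Lemma Linfty_norm_ae (f : R -> R) (S : R) : Linfty_norm f = S%:E ->
  {ae mu, forall r, 0 <= r -> `|f r| <= S}.
Proof.
rewrite /Linfty_norm unlock lebesgueT_gt0 => e.
have := @ess_sup_ge _ _ _ mu (abse \o (EFin \o (f \_ `]0, +oo[))); rewrite e => h.
apply: (ae_mono2 _ h (ae_neq 0)) => r /= + r0 rge; rewrite patchE mem_set/=.
  by rewrite lee_fin.
by rewrite in_itv/= andbT lt_neqAle eq_sym r0.
Qed.

Lemma ae_itv (P : R -> Prop) (a b : R) : a < b -> {ae mu, forall x, P x} ->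
  exists2 x, a < x < b & P x.
Proof.
move=> ab [N [mN N0 PN]]; apply: contrapT => h.
have sub : `]a, b[ `<=` N.
  by move=> x /= xab; apply: PN => Px; apply: h; exists x => //; move: xab; rewrite in_itv.
have : (mu `]a, b[ <= mu N)%E by apply: le_measure; rewrite ?inE//; exact: measurable_itv.
by rewrite N0 lebesgue_measure_itv /= lte_fin ab -EFinB lee_fin subr_le0 leNgt ab.
Qed.

End EssentialBounds.

(** Up to a positive factor it is an increment of [growth], whose derivative is positive in both
    cases of the definition. Strict positivity matters when it multiplies an infinite norm. *)
Lemma exp_quotient_gt0 (R : realType) (tau kappa t : R) : 0 < t -> 0 < exp_quotient tau kappa t.
Proof.
move=> t0; have [z _ e] := mvt (dv_growth tau kappa) (ltW t0).
have : 0 < growth tau kappa t - growth tau kappa 0 by rewrite e subr0 mulr_gt0 ?expR_gt0.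
by rewrite growth0 subr0 /growth pmulr_rgt0 ?expR_gt0.
Qed.

Lemma exp_quotient0 (R : realType) (tau kappa : R) : exp_quotient tau kappa 0 = 0.
Proof. by have := growth0 tau kappa; rewrite /growth mulr0 expR0 mul1r. Qed.

Lemma growth_quotient (R : realType) (tau kappa t : R) :
  expR (- (tau * t)) * growth tau kappa t = exp_quotient tau kappa t.
Proof. by rewrite /growth mulrA -expRD addNr expR0 mul1r. Qed.

Section VarianceBound.
Context {R : realType}.
Variables (H : R -> R) (C c : R).
Hypothesis hH : confining H C c.

Lemma c_Var_fin : exists2 v, 0 <= v & c_Var H = v%:E /\ forall s, v <= Var (gibbs H s).
Proof.
have le s : (c_Var H <= (Var (gibbs H s))%:E)%E by apply: ereal_inf_lbound; exists s.
have ge : (0 <= c_Var H)%E.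
  by apply: le_ereal_inf_tmp => _ [s _ <-]; rewrite lee_fin; exact: ltW (var_gt0 hH s).
move: le ge; case: (c_Var H) => [v| |] // le; last by have := le 0.
by rewrite lee_fin => v0; exists v => //; split => // s; have := le s; rewrite lee_fin.
Qed.

Lemma C_Var_ge s : ((Var (gibbs H s))%:E <= C_Var H)%E.
Proof. by apply: ereal_sup_ubound; exists s. Qed.

(** [rate_bregman] with [k = c_Var] gives the sharper constant [1 / (2 c_Var)]; since
    [c_Var <= C_Var], it is at most the stated [C_Var / (2 c_Var ^+ 2)]. *)
Lemma variance_term (m n L0 kappa t : R) : 0 < L0 -> 0 < kappa ->
  `|m - n| <= L0 / kappa * expR (- (kappa * t)) ->
  ((rate H m - (lambda H n * m - logZ H (lambda H n) + logZ H 0))%:E <=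
   C_Var H * (L0 ^+ 2)%:E / (2%:E * c_Var H ^+ 2 * (kappa ^+ 2)%:E) *
   (expR (- (2 * kappa * t)))%:E)%E.
Proof.
move=> L00 k0 hmn; have [v v0 [-> hv]] := c_Var_fin.
have CV := C_Var_ge 0; have V0 := var_gt0 hH 0.
have CV0 : (0 < C_Var H)%E by apply: lt_le_trans CV; rewrite lte_fin.
have L2 : 0 < L0 ^+ 2 by rewrite exprn_gt0.
have ee := expR_gt0 (- (2 * kappa * t)).
rewrite -EFin_expe -!EFinM.
(* If [c_Var] were 0, the inverse in [\bar R] would be [+oo], and so would the right side. *)
have := v0; rewrite le_eqVlt => /predU1P[vz|vp].
  rewrite -vz expr0n mulr0 mul0r inve0 gt0_muley ?gt0_mulye ?leey ?lte_fin//.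
  by rewrite mule_gt0// lte_fin.
have D0 : 0 < 2 * v ^+ 2 * kappa ^+ 2 by rewrite !mulr_gt0// ?exprn_gt0.
rewrite inver (gt_eqF D0).
apply: (@le_trans _ _ (v%:E * (L0 ^+ 2)%:E * ((2 * v ^+ 2 * kappa ^+ 2)^-1)%:E *
    (expR (- (2 * kappa * t)))%:E)%E); last first.
  apply: lee_wpmul2r; first by rewrite lee_fin ltW.
  apply: lee_wpmul2r; first by rewrite lee_fin invr_ge0 ltW.
  apply: lee_wpmul2r; first by rewrite lee_fin ltW.
  by apply: le_trans CV; rewrite lee_fin.
rewrite -!EFinM lee_fin; apply: (le_trans (rate_bregman hH m n vp hv)).
have h2 : (m - n) ^+ 2 <= (L0 / kappa * expR (- (kappa * t))) ^+ 2.
  rewrite -(real_normK (num_real (m - n))) !expr2; exact: ler_pM.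
have e2 : expR (- (kappa * t)) ^+ 2 = expR (- (2 * kappa * t)).
  by rewrite expr2 -expRD; congr expR; ring.
rewrite exprMn e2 in h2; rewrite ler_pdivrMr ?mulr_gt0//; apply: (le_trans h2).
rewrite le_eqVlt; apply/orP; left; apply/eqP; move: (expR _) => y; field.
by rewrite !gt_eqF.
Qed.

End VarianceBound.

(** An essential bound holds at times arbitrarily close to [r] on its right. Since [l] is Lipschitz
    and [lambda_bound] is a closed condition on [l], it extends to every [r]. *)
Lemma lambda_essential_bound (R : realType) (H l dl : R -> R) (C c lstar kappa L0 B : R) :
  confining H C c -> constraint l dl lstar -> 0 < kappa -> 0 < L0 ->
  {ae lebesgue_measure, forall t : R, 0 <= t -> `|dl t| <= L0 * expR (- (kappa * t))} ->
  Linfty_norm (lambda H \o l) = B%:E -> forall r, 0 <= r -> `|lambda H (l r)| <= B.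
Proof.
move=> hc hl k0 L00 hdl e r r0; have good := Linfty_norm_ae e.
have close eta : 0 < eta -> exists2 x, `|l x - l r| <= eta & mean H (- B) <= l x <= mean H B.
  move=> eta0; have lt : r < r + eta / L0 by rewrite ltrDl divr_gt0.
  have [x /andP[rx xr] gx] := ae_itv lt good; have x0 := le_trans r0 (ltW rx).
  exists x; last by rewrite -(lambda_bound hc); exact: gx.
  apply: (le_trans (constraint_lip hl k0 L00 hdl r0 (ltW rx))).
  have h1 : L0 * expR (- (kappa * r)) <= L0.
    by rewrite -[leRHS]mulr1 ler_wpM2l ?(ltW L00)// -expR0 ler_expR oppr_le0 mulr_ge0// ltW.
  have h2 : x - r <= eta / L0 by rewrite lerBlDl ltW.
  have h3 : 0 <= x - r by rewrite subr_ge0 ltW.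
  apply: (@le_trans _ _ (L0 * (eta / L0))).
    by apply: ler_pM => //; rewrite mulr_ge0 ?expR_ge0// ltW.
  by rewrite mulrC divfK// gt_eqF.
rewrite (lambda_bound hc); apply/andP; split; apply/ler_addgt0Pr => eta eta0;
  have [x + /andP[x3 x4]] := close _ eta0; rewrite ler_norml => /andP[x1 x2].
  by apply: (le_trans x3); rewrite -lerBlDl.
apply: (@le_trans _ _ (l x + eta)); last by rewrite lerD2r.
by rewrite -lerBlDl -opprB lerNl.
Qed.

Theorem corollary4p10 (R : realType) (H l dl rho0 : R -> R)
  (rho : R -> R -> R) (lstar kappa L0 C_LSI : R)
  (hH : potential H) (hl : constraint l dl lstar)
  (hrho0 : constrained_P2 (l 0) rho0) (hF0 : (free_energy H rho0 < +oo)%E)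
  (hkappa : 0 < kappa) (hL0 : 0 < L0)
  (hdl : {ae lebesgue_measure, forall t : R, 0 <= t ->
    `|dl t| <= L0 * expR (- (kappa * t))})
  (hrho : solution H l dl rho0 rho)
  (hC_LSI : 0 < C_LSI)
  (hLSI : log_Sobolev H (Linfty_norm (multiplier H dl rho)) C_LSI) :
  let sigma := multiplier H dl rho in
  let sigma_star := lambda H lstar in
  let tau := C_LSI^-1 in
  let C_l_sigma := (Linfty_norm (lambda H \o l) + Linfty_norm sigma)%E in
  forall t : R, 0 <= t ->
    (relative_entropy (rho t) (gibbs H sigma_star) <=
       (expR (- (tau * t)))%:E * free_energy H rho0
       + L0%:E * C_l_sigma * (exp_quotient tau kappa t)%:E
       + C_Var H * (L0 ^+ 2)%:E / (2%:E * c_Var H ^+ 2 * (kappa ^+ 2)%:E)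
         * (expR (- (2 * kappa * t)))%:E)%E
    /\
    (`| free_energy H (rho t) - free_energy H (gibbs H sigma_star)
        - relative_entropy (rho t) (gibbs H sigma_star) | <=
       (`|sigma_star| * L0 / kappa * expR (- (kappa * t)))%:E)%E.

Proof.
move=> sigma sigma_star tau C_l_sigma t t0.
have [C [c hc]] := potential_confining hH; have [Pr0 _] := hrho0.
have hi0 := free_energy_fin hc Pr0 hF0; have F0 := free_energyE hc Pr0 hi0.
have Pw := dpath_P2 hrho0 hrho.
have [_ hP _ _ _] := hrho; have [Pt Mt] := hP t t0.
have lim := constraint_limit hl hkappa hL0 hdl; have C0 := conf_C hc.
have e1 r : 0 <= r -> expR (- (kappa * r)) <= 1.
  by move=> r0; rewrite -expR0 ler_expR oppr_le0 mulr_ge0// ltW.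
have LK : 0 <= L0 / kappa by rewrite divr_ge0// ltW.
have [b b0 hb] := lambda_bounded hc (`|lstar| + L0 / kappa).
have hlam r : 0 <= r -> `|lambda H (l r)| <= b.
  move=> r0; apply: hb; rewrite -(subrK lstar (l r)) addrC.
  apply: (le_trans (ler_normD _ _)); rewrite lerD2l; apply: (le_trans (lim r r0)).
  by rewrite -[leRHS]mulr1 ler_wpM2l// e1.
have [A A0 hA] := path_moment hc hrho0 hrho t0.
(* A bound of sigma on [[0, t]] alone, from the second moment; it is finite even if the norm over
   the half-line is not. *)
pose S0 := 2 * C * (1 + A) + L0.
have S00 : 0 <= S0 by apply: addr_ge0; [rewrite !mulr_ge0// addr_ge0|exact: ltW].
have hS0 : {ae lebesgue_measure, forall r : R, 0 <= r <= t -> `|sigma r| <= S0}.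
  apply: ae_mono hdl => r hd rt; have /andP[r0 _] := rt.
  rewrite /sigma (multiplierE hc hrho0 hrho r0); apply: (le_trans (ler_normD _ _)); apply: lerD.
    have hq x : `|derive1 H x| <= 2 * C * (1 + x ^+ 2) by apply: lin_quad; exact: conf_lin hc x.
    apply: (le_trans (P2_le (Pw r) (cont_meas (conf_cont hc)) hq)).
    by apply: ler_wpM2l; [exact: mulr_ge0|rewrite lerD2l; exact: hA].
  by apply: (le_trans (hd r0)); rewrite -[leRHS]mulr1 ler_wpM2l ?(ltW hL0)// e1.
(* Rate 0 already shows that the entropy at time [t] is integrable, so that all energies below are
   real numbers. *)
have [iw Ew0] := energy_decay hc hrho0 hrho hl hkappa hL0 hdl hi0 t0 S00 hS0 hlam
  (or_introl erefl : sobolev_rate H S0%:E 0).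
have [it Et] := real_energy_ae hc Pt (Pw t) (dpath_ae hrho t0) iw.
(* The relative entropy splits into the excess of the energy over its minimum at the current mean
   and this Bregman distance, which produces the last term of the bound. *)
pose RB := rate H (l t) - (lambda H lstar * l t - logZ H (lambda H lstar) + logZ H 0).
have rel : relative_entropy (rho t) (gibbs H sigma_star) =
    ((real_energy H (rho t) - rate H (l t)) + RB)%:E.
  rewrite (relative_entropyE hc Pt it) Mt /RB; congr (_%:E).
  rewrite -/sigma_star; move: (real_energy H (rho t)) (rate H (l t)) (logZ H sigma_star) (logZ H 0) => u v w z.
  by ring.
have free := free_energyE hc Pt it.
split; last first.
  rewrite free rel (gibbs_energy hc) (mean_lambda hc) -!EFinB abse_EFin lee_fin /RB -/sigma_star.
  have -> : real_energy H (rho t) - (sigma_star * lstar - logZ H sigma_star + logZ H 0) -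
      (real_energy H (rho t) - rate H (l t) + (rate H (l t) - (sigma_star * l t - logZ H sigma_star + logZ H 0)))
      = sigma_star * (l t - lstar).
    move: (real_energy H (rho t)) (rate H (l t)) (logZ H sigma_star) (logZ H 0) => u v w z.
    by ring.
  by rewrite normrM -!mulrA ler_wpM2l// mulrA; exact: lim.
rewrite rel EFinD; apply: leeD; last by have := variance_term hc hL0 hkappa (lim t t0).
rewrite F0 -EFinM.
(* At [t = 0] the quotient vanishes and annihilates even an infinite norm, so the bound must come
   from the rate 0 estimate. For [t > 0] an infinite norm makes the right side [+oo]. *)
have := t0; rewrite le_eqVlt => /predU1P[tz|tp].
  have -> : exp_quotient tau kappa t = 0 by rewrite -tz exp_quotient0.
  have -> : expR (- (tau * t)) = 1 by rewrite -tz mulr0 oppr0 expR0.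
  have g0 : growth 0 kappa t = 0 by rewrite -tz growth0.
  rewrite mule0 adde0 mul1r lee_fin Et lerBlDl.
  by move: Ew0; rewrite g0 mulr0 addr0 mul0r oppr0 expR0 mul1r.
have q0 := exp_quotient_gt0 tau kappa tp.
have infinite : C_l_sigma = +oo%E -> ((real_energy H (rho t) - rate H (l t))%:E <=
    (expR (- (tau * t)) * real_energy H rho0)%:E + L0%:E * C_l_sigma * (exp_quotient tau kappa t)%:E)%E.
  by move=> ->; rewrite gt0_muley ?lte_fin// gt0_mulye ?lte_fin// addey// leey.
have Sge := Linfty_norm_ge0 sigma; have Lge := Linfty_norm_ge0 (lambda H \o l).
case E1 : (Linfty_norm sigma) => [S| |]; last by rewrite E1 in Sge.
  case E2 : (Linfty_norm (lambda H \o l)) => [B| |]; last by rewrite E2 in Lge.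
    have -> : (L0%:E * C_l_sigma * (exp_quotient tau kappa t)%:E)%E =
        (L0 * (B + S) * exp_quotient tau kappa t)%:E by rewrite /C_l_sigma E1 E2.
    rewrite -EFinD lee_fin.
    have S1 : 0 <= S by rewrite E1 lee_fin in Sge.
    have hS : {ae lebesgue_measure, forall r : R, 0 <= r <= t -> `|sigma r| <= S}.
      by apply: ae_mono (Linfty_norm_ae E1) => r hr /andP[r0 _]; exact: hr.
    have hB := lambda_essential_bound hc hl hkappa hL0 hdl E2.
    have hsob : sobolev_rate H S%:E tau.
      by right; exists C_LSI; split => //; rewrite -E1.
    have [_] := energy_decay hc hrho0 hrho hl hkappa hL0 hdl hi0 t0 S1 hS hB hsob.
    rewrite -Et -lerBlDl => /le_trans; apply; rewrite mulrDr lerD2l mulrCA growth_quotient.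
    by rewrite (addrC B S).
  by apply: infinite; rewrite /C_l_sigma E1 E2.
apply: infinite; rewrite /C_l_sigma E1 addey//; apply/eqP => e.
by rewrite e in Lge.
Qed.
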